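(* Let $\mathbb D$ be a framed bicategory with $\mathbb 2$-glueing and with lax colimits indexed by finite posets. Then $\mathbb D$ has $B$-glueing for every finite poset $B$.
   Context: **Double categories.** A (pseudo) double category $\mathbb D$ (a pseudo category object in CAT) has objects and horizontal morphisms $f\colon X\to Y$ (forming a category $\mathbb D_0$), vertical morphisms $m\colon X\nrightarrow X'$, and cells $\varphi\colon m\to^{f}_{f'}n$, where $m\colon X\nrightarrow X'$ is the left side, $n\colon Y\nrightarrow Y'$ the right side, $f\colon X\to Y$ the top and $f'\colon X'\to Y'$ the bottom (vertical morphisms and cells form a category $\mathbb D_1$). Horizontal composition is written $\circ$ and is strict; vertical composition of vertical morphisms and of cells is written $\bullet$ (with $m'\bullet m$ meaning first $m$, then $m'$) and is associative and unital up to coherent isomorphism. $\mathrm{id}^\bullet_X\colon X\nrightarrow X$ is the vertical identity. A cell is special if both its vertical or both its horizontal sides are identities. $\mathrm H\mathbb D$ is the 2-category of objects, horizontal morphisms, and 2-cells $f\Rightarrow g$ given by the special cells $\mathrm{id}^\bullet_X\to^f_g\mathrm{id}^\bullet_Y$. A companion of $f\colon X\to Y$ is $f_*\colon X\nrightarrow Y$ with cells $\eta\colon \mathrm{id}^\bullet_X\to^{\mathrm{id}_X}_{f} f_*$ and $\varepsilon\colon f_*\to^{f}_{\mathrm{id}_Y}\mathrm{id}^\bullet_Y$ such that $\varepsilon\circ\eta$ is the vertical identity cell on $f$ and the vertical composite $\varepsilon\bullet\eta$ is, modulo the identity isomorphisms, the identity cell on $f_*$. A conjoint of $f$ is $f^*\colon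 Y\nrightarrow X$ with cells $\alpha\colon\mathrm{id}^\bullet_X\to^{f}_{\mathrm{id}_X}f^*$ and $\beta\colon f^*\to^{\mathrm{id}_Y}_{f}\mathrm{id}^\bullet_Y$ satisfying the analogous two equations. $\mathbb D$ is a framed bicategory if every horizontal morphism has a companion and a conjoint. **Lax functors.** For a small category $B$, a vertical normal lax functor $F\colon B\to\mathbb D$ consists of objects $Fb$, vertical morphisms $F_\beta\colon Fb\nrightarrow Fb'$ for $\beta\colon b\to b'$ with $F_{\mathrm{id}_b}=\mathrm{id}^\bullet_{Fb}$, and special comparison cells $F_{\beta'}\bullet F_\beta\to F_{\beta'\beta}$ satisfying the usual coherence conditions. A horizontal lax transformation $f\colon F\to G$ consists of horizontal morphisms $f_b\colon Fb\to Gb$ and cells $f_\beta\colon F_\beta\to^{f_b}_{f_{b'}}G_\beta$ compatible with the comparison cells. A modification $\theta\colon f\to g$ consists of special cells $\theta_b\colon\mathrm{id}^\bullet_{Fb}\to^{f_b}_{g_b}\mathrm{id}^\bullet_{Gb}$ compatible with $f_\beta$ and $g_\beta$. These form the 2-category $\mathrm{Lax}_{\mathrm N}(B,\mathbb D)$. $\mathbb D$ has $B$-indexed lax colimits if the constant functor $\Delta\colon\mathrm H\mathbb D\to\mathrm{Lax}_{\mathrm N}(B,\mathbb D)$ has a left adjoint $\Gamma_B=\Gamma$. Then $\Gamma F$ comes with $i_b\colon Fb\to\Gamma F$ and cells $i_\beta\colon F_\beta\to^{i_b}_{i_{b'}}\mathrm{id}^\bullet_{\Gamma F}$ that are universal among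 such data compatible with the comparison cells. $\Gamma/F\colon\mathrm{Lax}_{\mathrm N}(B,\mathbb D)/F\to\mathrm H\mathbb D/\Gamma F$ is the 2-functor induced by $\Gamma$ on slices. $\mathbb 2$ is the poset $\{0<1\}$; an object of $\mathrm{Lax}_{\mathrm N}(\mathbb 2,\mathbb D)$ is a vertical morphism of $\mathbb D$. A poset is regarded as a category. **Glueing.** A framed bicategory $\mathbb D$ with $B$-indexed lax colimits has $B$-glueing over $F$ if $\Gamma/F$ is an equivalence of 2-categories with pseudo-inverse taking $p\colon X\to\Gamma_BF$ to the lax functor over $F$ given by $b\mapsto X_b$ and $\beta\mapsto (i_{b'})^*\bullet(i_b)_*\colon X_b\nrightarrow X_\beta\nrightarrow X_{b'}$. Here $X_b$ is the pullback in $\mathrm H\mathbb D$ of $p$ along $i_b\colon Fb\to\Gamma_BF$, $X_\beta$ is the pullback of $p$ along the induced morphism $\Gamma_{\mathbb 2}F_\beta\to\Gamma_BF$, and $X_b\to X_\beta\leftarrow X_{b'}$ (here also denoted $i_b,i_{b'}$) are the induced morphisms. $\mathbb D$ has $B$-glueing if it has $B$-glueing over every $F\colon B\to\mathbb D$. *)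

(* Defs.v *)
From mathcomp Require Import all_boot all_order.
From Stdlib Require Import FunctionalExtensionality ProofIrrelevance.

Set Implicit Arguments.
Unset Strict Implicit.
Unset Printing Implicit Defensive.
Local Obligation Tactic := idtac.

Record Cat := MkCat {
  Ob :> Type;
  Hom : Ob -> Ob -> Type;
  idm : forall x, Hom x x;
  comp : forall x y z, Hom y z -> Hom x y -> Hom x z;
  comp_idl : forall x y (f : Hom x y), comp (idm y) f = f;
  comp_idr : forall x y (f : Hom x y), comp f (idm x) = f;
  comp_assoc : forall x y z w (h : Hom z w) (g : Hom y z) (f : Hom x y),
    comp h (comp g f) = comp (comp h g) f }.

Arguments idm {c} x.

Notation "g ∘ f" := (comp g f) (at level 40, left associativity).

Definition is_iso (C : Cat) (x y : C) (f : Hom x y) : Prop :=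
  exists g : Hom y x, g ∘ f = idm x /\ f ∘ g = idm y.

Definition poset_cat (d : Order.disp_t) (P : porderType d) : Cat.
Proof.
refine (@MkCat P (fun x y : P => (x <= y)%O) (fun x => Order.POrderTheory.le_refl x)
  (fun x y z g f => Order.POrderTheory.le_trans f g) _ _ _).
all: intros; apply: bool_irrelevance.
Defined.

Definition cat2 : Cat := poset_cat bool.
Definition arr2 : @Hom cat2 false true := isT.

(** [Two x y] is the type of all 2-cells between parallel morphisms
    [x -> y], with their domain and codomain recorded by [dom2] and [cod2]
    (not by the type).  All laws are then plain equations, and only vertical
    composition [vc b a] ([a] first) needs a proof of composability.  In laws
    such proofs are universally quantified; those on composites always follow
    from the others. *)
Unset Implicit Arguments.
Record TwoCat := MkTwoCat {
  tc_cat :> Cat;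
  Two : tc_cat -> tc_cat -> Type;
  dom2 : forall {x y}, Two x y -> Hom x y;
  cod2 : forall {x y}, Two x y -> Hom x y;
  id2 : forall {x y}, Hom x y -> Two x y;
  vc : forall {x y} (b a : Two x y), cod2 a = dom2 b -> Two x y;
  hc : forall {x y z}, Two y z -> Two x y -> Two x z;
  dom2_id2 : forall {x y} (f : Hom x y), dom2 (id2 f) = f;
  cod2_id2 : forall {x y} (f : Hom x y), cod2 (id2 f) = f;
  dom2_vc : forall {x y} (b a : Two x y) e, dom2 (vc b a e) = dom2 a;
  cod2_vc : forall {x y} (b a : Two x y) e, cod2 (vc b a e) = cod2 b;
  dom2_hc : forall {x y z} (b : Two y z) (a : Two x y),
    dom2 (hc b a) = dom2 b ∘ dom2 a;
  cod2_hc : forall {x y z} (b : Two y z) (a : Two x y),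
    cod2 (hc b a) = cod2 b ∘ cod2 a;
  vc_idl : forall {x y} (a : Two x y) e, vc (id2 (cod2 a)) a e = a;
  vc_idr : forall {x y} (a : Two x y) e, vc a (id2 (dom2 a)) e = a;
  vc_assoc : forall {x y} (c b a : Two x y) e1 e2 e3 e4,
    vc c (vc b a e1) e2 = vc (vc c b e3) a e4;
  hc_idl : forall {x y} (a : Two x y), hc (id2 (idm y)) a = a;
  hc_idr : forall {x y} (a : Two x y), hc a (id2 (idm x)) = a;
  hc_assoc : forall {x y z w} (c : Two z w) (b : Two y z) (a : Two x y),
    hc c (hc b a) = hc (hc c b) a;
  hc_id2 : forall {x y z} (g : Hom y z) (f : Hom x y),
    hc (id2 g) (id2 f) = id2 (g ∘ f);
  hc_vc : forall {x y z} (d c : Two y z) (b a : Two x y) e1 e2 e3,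
    hc (vc d c e1) (vc b a e2) = vc (hc d b) (hc c a) e3 }.
Set Implicit Arguments.
Arguments Two {t} x y.
Arguments dom2 {t x y} _.
Arguments cod2 {t x y} _.
Arguments id2 {t x y} _.
Arguments vc {t x y} b a _.
Arguments hc {t x y z} _ _.
Arguments hc_vc {t x y z d c b a} _ _ _.
Arguments vc_idl {t x y a} e.

Record TwoFunctor (C D : TwoCat) := MkTwoFunctor {
  fob :> C -> D;
  fhom : forall x y, Hom x y -> Hom (fob x) (fob y);
  ftwo : forall x y, Two x y -> Two (fob x) (fob y);
  fhom_id : forall x, fhom (idm x) = idm (fob x);
  fhom_comp : forall x y z (g : Hom y z) (f : Hom x y),
    fhom (g ∘ f) = fhom g ∘ fhom f;
  dom2_ftwo : forall x y (a : Two x y), dom2 (ftwo a) = fhom (dom2 a);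
  cod2_ftwo : forall x y (a : Two x y), cod2 (ftwo a) = fhom (cod2 a);
  ftwo_id2 : forall x y (f : Hom x y), ftwo (id2 f) = id2 (fhom f);
  ftwo_vc : forall x y (b a : Two x y) e e',
    ftwo (vc b a e) = vc (ftwo b) (ftwo a) e';
  ftwo_hc : forall x y z (b : Two y z) (a : Two x y),
    ftwo (hc b a) = hc (ftwo b) (ftwo a) }.

Program Definition idF (C : TwoCat) : TwoFunctor C C :=
  @MkTwoFunctor C C (fun x => x) (fun _ _ f => f) (fun _ _ a => a)
    _ _ _ _ _ _ _.
Solve All Obligations with (try by []).
Next Obligation. move=> * /=; congr vc; exact: proof_irrelevance. Qed.

Program Definition compF (C D E : TwoCat) (G : TwoFunctor D E)
    (F : TwoFunctor C D) : TwoFunctor C E :=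
  @MkTwoFunctor C E (fun x => G (F x)) (fun _ _ f => fhom G (fhom F f))
    (fun _ _ a => ftwo G (ftwo F a)) _ _ _ _ _ _ _.
Next Obligation. move=> * /=; by rewrite !fhom_id. Qed.
Next Obligation. move=> * /=; by rewrite !fhom_comp. Qed.
Next Obligation. move=> * /=; by rewrite !dom2_ftwo. Qed.
Next Obligation. move=> * /=; by rewrite !cod2_ftwo. Qed.
Next Obligation. move=> * /=; by rewrite !ftwo_id2. Qed.
Next Obligation.
move=> C D E G F x y b a e e' /=.
have e1 : cod2 (ftwo F a) = dom2 (ftwo F b) by rewrite cod2_ftwo dom2_ftwo e.
by rewrite (ftwo_vc e e1) (ftwo_vc e1 e').
Qed.
Next Obligation. move=> * /=; by rewrite !ftwo_hc. Qed.

Record TwoNat (C D : TwoCat) (F G : TwoFunctor C D) := MkTwoNat {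
  nat_ob :> forall x, Hom (F x) (G x);
  nat_hom : forall x y (f : Hom x y), nat_ob y ∘ fhom F f = fhom G f ∘ nat_ob x;
  nat_two : forall x y (a : Two x y),
    hc (id2 (nat_ob y)) (ftwo F a) = hc (ftwo G a) (id2 (nat_ob x)) }.

Record LeftAdjoint (C D : TwoCat) (R : TwoFunctor C D) := MkLeftAdjoint {
  ladj :> TwoFunctor D C;
  unit : TwoNat (idF D) (compF R ladj);
  counit : TwoNat (compF ladj R) (idF C);
  triangle_l : forall x, counit (ladj x) ∘ fhom ladj (unit x) = idm (ladj x);
  triangle_r : forall y, fhom R (counit y) ∘ unit (R y) = idm (R y) }.

(** Equivalences of 2-categories are taken in the strict sense: the
    pseudo-inverse is a 2-functor, and the unit and counit are 2-natural
    isomorphisms. *)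
Record PseudoInverse (C D : TwoCat) (E : TwoFunctor C D) := MkPseudoInverse {
  pinv :> TwoFunctor D C;
  pi_unit : TwoNat (idF C) (compF pinv E);
  pi_counit : TwoNat (compF E pinv) (idF D);
  pi_unit_iso : forall x, is_iso (pi_unit x);
  pi_counit_iso : forall y, is_iso (pi_counit y) }.

(** Pullbacks in a 2-category have the universal property for 2-cells too. *)
Record is_pullback (K : TwoCat) (A B C P : K) (p : Hom A C) (q : Hom B C)
    (u : Hom P A) (v : Hom P B) : Prop := MkIsPullback {
  pb_comm : p ∘ u = q ∘ v;
  pb_hom : forall (Z : K) (a : Hom Z A) (b : Hom Z B), p ∘ a = q ∘ b ->
    exists! w : Hom Z P, u ∘ w = a /\ v ∘ w = b;
  pb_two : forall (Z : K) (a : Two Z A) (b : Two Z B),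
    hc (id2 p) a = hc (id2 q) b ->
    exists! w : Two Z P, hc (id2 u) w = a /\ hc (id2 v) w = b }.

Lemma vc_congr (C : TwoCat) (x y : C) (b b' a a' : Two x y) e e' :
  b = b' -> a = a' -> vc b a e = vc b' a' e'.
Proof. by move=> hb ha; subst; rewrite (proof_irrelevance _ e e'). Qed.

Lemma sig_eq (T : Type) (P : T -> Prop) (a b : {x | P x}) :
  proj1_sig a = proj1_sig b -> a = b.
Proof. exact: eq_sig_hprop (fun _ => @proof_irrelevance _) a b. Qed.

(** The strict slice: morphisms are commuting triangles, and 2-cells are
    those that become identities after composition with the projection. *)
Section Slice.
Variables (C : TwoCat) (c : C).

Definition slice_ob := {x : C & Hom x c}.
Definition slice_hom (p q : slice_ob) :=
  {f : Hom (projT1 p) (projT1 q) | projT2 q ∘ f = projT2 p}.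
Definition slice_two (p q : slice_ob) :=
  {a : Two (projT1 p) (projT1 q) | hc (id2 (projT2 q)) a = id2 (projT2 p)}.

Program Definition slice_cat : Cat :=
  @MkCat slice_ob slice_hom (fun p => idm (projT1 p))
    (fun p q r g f => proj1_sig g ∘ proj1_sig f) _ _ _.
Next Obligation. move=> *; exact: comp_idr. Qed.
Next Obligation.
by move=> p q r [g eg] [f ef] /=; rewrite comp_assoc eg.
Qed.
Next Obligation. move=> *; apply: sig_eq => /=; exact: comp_idl. Qed.
Next Obligation. move=> *; apply: sig_eq => /=; exact: comp_idr. Qed.
Next Obligation. move=> *; apply: sig_eq => /=; exact: comp_assoc. Qed.

Program Definition slice : TwoCat :=
  @MkTwoCat slice_cat slice_two
    (fun p q a => dom2 (proj1_sig a)) (fun p q a => cod2 (proj1_sig a))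
    (fun p q f => id2 (proj1_sig f))
    (fun p q b a e => vc (proj1_sig b) (proj1_sig a) (f_equal (@proj1_sig _ _) e))
    (fun p q r b a => hc (proj1_sig b) (proj1_sig a)) _ _ _ _ _ _ _ _ _ _ _ _ _ _.
Next Obligation.
move=> p q [a ea] /=; move: (f_equal (@dom2 C _ _) ea).
by rewrite dom2_hc !dom2_id2.
Qed.
Next Obligation.
move=> p q [a ea] /=; move: (f_equal (@cod2 C _ _) ea).
by rewrite cod2_hc !cod2_id2.
Qed.
Next Obligation. by move=> p q [f ef] /=; rewrite hc_id2 ef. Qed.
Next Obligation.
move=> p q b a e; move: (f_equal _ e) => /= {}e; move: b a e => [b eb] [a ea] /= e.
have e1 : cod2 (id2 (projT2 q)) = dom2 (id2 (projT2 q))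
  by rewrite dom2_id2 cod2_id2.
have -> : id2 (projT2 q) = vc _ _ e1.
  rewrite -{1}[LHS](vc_idl (a := id2 (projT2 q))).
    by rewrite !dom2_id2 !cod2_id2.
  by move=> h; apply: vc_congr => //; rewrite cod2_id2.
have e2 : cod2 (hc (id2 (projT2 q)) a) = dom2 (hc (id2 (projT2 q)) b).
  by rewrite cod2_hc dom2_hc e cod2_id2 dom2_id2.
rewrite (hc_vc e1 e e2).
have e3 : cod2 (id2 (projT2 p)) = dom2 (id2 (cod2 (id2 (projT2 p))))
  by rewrite dom2_id2 cod2_id2.
rewrite -[RHS](vc_idl e3); apply: vc_congr => //.
by rewrite cod2_id2.
Qed.
Next Obligation.
by move=> p q r [b eb] [a ea] /=; rewrite hc_assoc eb.
Qed.
Next Obligation. move=> *; apply: sig_eq => /=; exact: dom2_id2. Qed.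
Next Obligation. move=> *; apply: sig_eq => /=; exact: cod2_id2. Qed.
Next Obligation. move=> *; apply: sig_eq => /=; exact: dom2_vc. Qed.
Next Obligation. move=> *; apply: sig_eq => /=; exact: cod2_vc. Qed.
Next Obligation. move=> *; apply: sig_eq => /=; exact: dom2_hc. Qed.
Next Obligation. move=> *; apply: sig_eq => /=; exact: cod2_hc. Qed.
Next Obligation. move=> *; apply: sig_eq => /=; exact: vc_idl. Qed.
Next Obligation. move=> *; apply: sig_eq => /=; exact: vc_idr. Qed.
Next Obligation. move=> *; apply: sig_eq => /=; exact: vc_assoc. Qed.
Next Obligation. move=> *; apply: sig_eq => /=; exact: hc_idl. Qed.
Next Obligation. move=> *; apply: sig_eq => /=; exact: hc_idr. Qed.
Next Obligation. move=> *; apply: sig_eq => /=; exact: hc_assoc. Qed.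
Next Obligation. move=> *; apply: sig_eq => /=; exact: hc_id2. Qed.
Next Obligation. move=> *; apply: sig_eq => /=; exact: hc_vc. Qed.

End Slice.

(** The 2-functor [C/c -> D/(L c)] induced by [L : C -> D]. *)
Program Definition slice_functor (C D : TwoCat) (L : TwoFunctor C D) (c : C) :
    TwoFunctor (slice c) (slice (L c)) :=
  @MkTwoFunctor (slice c) (slice (L c))
    (fun p => existT _ (L (projT1 p)) (fhom L (projT2 p)))
    (fun p q f => fhom L (proj1_sig f)) (fun p q a => ftwo L (proj1_sig a))
    _ _ _ _ _ _ _.
Next Obligation. move=> C D L c p q [f ef] /=; by rewrite -fhom_comp ef. Qed.
Next Obligation.
move=> C D L c p q [a ea] /=; by rewrite -ftwo_id2 -ftwo_hc ea ftwo_id2.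
Qed.
Next Obligation. move=> *; apply: sig_eq => /=; exact: fhom_id. Qed.
Next Obligation. move=> *; apply: sig_eq => /=; exact: fhom_comp. Qed.
Next Obligation. move=> *; apply: sig_eq => /=; exact: dom2_ftwo. Qed.
Next Obligation. move=> *; apply: sig_eq => /=; exact: cod2_ftwo. Qed.
Next Obligation. move=> *; apply: sig_eq => /=; exact: ftwo_id2. Qed.
Next Obligation. move=> *; apply: sig_eq => /=; exact: ftwo_vc. Qed.
Next Obligation. move=> *; apply: sig_eq => /=; exact: ftwo_hc. Qed.

(** The categories [D_0] (objects and horizontal morphisms) and [D_1]
    (vertical morphisms and cells) with the functors top and bottom
    [D_1 -> D_0].  A cell [φ : Cell m n] is a cell [m -> n] with top [top φ]
    and bottom [bot φ], so that both categories satisfy plain equations. *)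
Unset Implicit Arguments.
Record DoubleBase := MkDoubleBase {
  d0 :> Cat;
  Ver : d0 -> d0 -> Type;
  Cell : forall {X X' Y Y'}, Ver X X' -> Ver Y Y' -> Type;
  top : forall {X X' Y Y'} {m : Ver X X'} {n : Ver Y Y'}, Cell m n -> Hom X Y;
  bot : forall {X X' Y Y'} {m : Ver X X'} {n : Ver Y Y'}, Cell m n -> Hom X' Y';
  cid : forall {X X'} (m : Ver X X'), Cell m m;
  ccomp : forall {X X' Y Y' Z Z'} {m : Ver X X'} {n : Ver Y Y'} {k : Ver Z Z'},
    Cell n k -> Cell m n -> Cell m k;
  ccomp_idl : forall {X X' Y Y'} {m : Ver X X'} {n : Ver Y Y'} (φ : Cell m n),
    ccomp (cid n) φ = φ;
  ccomp_idr : forall {X X' Y Y'} {m : Ver X X'} {n : Ver Y Y'} (φ : Cell m n),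
    ccomp φ (cid m) = φ;
  ccomp_assoc : forall {X X' Y Y' Z Z' W W'} {m : Ver X X'} {n : Ver Y Y'}
      {k : Ver Z Z'} {l : Ver W W'} (χ : Cell k l) (ψ : Cell n k) (φ : Cell m n),
    ccomp χ (ccomp ψ φ) = ccomp (ccomp χ ψ) φ;
  top_cid : forall {X X'} (m : Ver X X'), top (cid m) = idm X;
  bot_cid : forall {X X'} (m : Ver X X'), bot (cid m) = idm X';
  top_ccomp : forall {X X' Y Y' Z Z'} {m : Ver X X'} {n : Ver Y Y'}
      {k : Ver Z Z'} (ψ : Cell n k) (φ : Cell m n),
    top (ccomp ψ φ) = top ψ ∘ top φ;
  bot_ccomp : forall {X X' Y Y' Z Z'} {m : Ver X X'} {n : Ver Y Y'}
      {k : Ver Z Z'} (ψ : Cell n k) (φ : Cell m n),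
    bot (ccomp ψ φ) = bot ψ ∘ bot φ }.
Set Implicit Arguments.

Arguments Ver {d} _ _.
Arguments Cell {d X X' Y Y'} _ _.
Arguments top {d X X' Y Y' m n} _.
Arguments bot {d X X' Y Y' m n} _.
Arguments cid {d X X'} m.
Arguments ccomp {d X X' Y Y' Z Z' m n k} _ _.
Arguments ccomp_assoc {d X X' Y Y' Z Z' W W' m n k l} χ ψ φ.

Notation "ψ ⊙ φ" := (ccomp ψ φ) (at level 40, left associativity).

Record SpecialIso (D : DoubleBase) (X X' : D) (m n : Ver X X') := MkSpecialIso {
  iso_cell :> Cell m n;
  iso_inv : Cell n m;
  top_iso : top iso_cell = idm X;
  bot_iso : bot iso_cell = idm X';
  top_inv : top iso_inv = idm X;
  bot_inv : bot iso_inv = idm X';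
  iso_K : iso_inv ⊙ iso_cell = cid m;
  iso_VK : iso_cell ⊙ iso_inv = cid n }.

(** [vcc ψ φ e] is the vertical composite [ψ • φ], with [φ] above [ψ]; it
    needs the proof [e] that the bottom of [φ] is the top of [ψ].  As for
    [TwoCat], such proofs are universally quantified in equations, here and in
    the structures below. *)
Unset Implicit Arguments.
Record DoubleCat := MkDoubleCat {
  dbase :> DoubleBase;
  vid : forall X : dbase, Ver X X;
  vcomp : forall {X X' X'' : dbase}, Ver X' X'' -> Ver X X' -> Ver X X'';
  idc : forall {X Y : dbase}, Hom X Y -> Cell (vid X) (vid Y);
  top_idc : forall {X Y : dbase} (f : Hom X Y), top (idc f) = f;
  bot_idc : forall {X Y : dbase} (f : Hom X Y), bot (idc f) = f;
  idc_id : forall X : dbase, idc (idm X) = cid (vid X);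
  idc_comp : forall {X Y Z : dbase} (g : Hom Y Z) (f : Hom X Y),
    idc (g ∘ f) = idc g ⊙ idc f;
  vcc : forall {X X' X'' Y Y' Y'' : dbase} {m : Ver X X'} {m' : Ver X' X''}
      {n : Ver Y Y'} {n' : Ver Y' Y''} (ψ : Cell m' n') (φ : Cell m n),
    bot φ = top ψ -> Cell (vcomp m' m) (vcomp n' n);
  top_vcc : forall {X X' X'' Y Y' Y'' : dbase} {m : Ver X X'} {m' : Ver X' X''}
      {n : Ver Y Y'} {n' : Ver Y' Y''} (ψ : Cell m' n') (φ : Cell m n) e,
    top (vcc ψ φ e) = top φ;
  bot_vcc : forall {X X' X'' Y Y' Y'' : dbase} {m : Ver X X'} {m' : Ver X' X''}
      {n : Ver Y Y'} {n' : Ver Y' Y''} (ψ : Cell m' n') (φ : Cell m n) e,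
    bot (vcc ψ φ e) = bot ψ;
  vcc_cid : forall {X X' X'' : dbase} (m : Ver X X') (m' : Ver X' X'') e,
    vcc (cid m') (cid m) e = cid (vcomp m' m);
  vcc_ccomp : forall {X X' X'' Y Y' Y'' Z Z' Z'' : dbase}
      {m : Ver X X'} {m' : Ver X' X''} {n : Ver Y Y'} {n' : Ver Y' Y''}
      {k : Ver Z Z'} {k' : Ver Z' Z''} (ψ' : Cell n' k') (ψ : Cell m' n')
      (φ' : Cell n k) (φ : Cell m n) e e1 e2,
    vcc (ψ' ⊙ ψ) (φ' ⊙ φ) e = vcc ψ' φ' e1 ⊙ vcc ψ φ e2;
  assoc : forall {X X' X'' X''' : dbase} (m'' : Ver X'' X''') (m' : Ver X' X'')
      (m : Ver X X'),
    SpecialIso (vcomp (vcomp m'' m') m) (vcomp m'' (vcomp m' m));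
  luni : forall {X X' : dbase} (m : Ver X X'),
    SpecialIso (vcomp (vid X') m) m;
  runi : forall {X X' : dbase} (m : Ver X X'),
    SpecialIso (vcomp m (vid X)) m;
  assoc_nat : forall {X X' X'' X''' Y Y' Y'' Y''' : dbase}
      {m : Ver X X'} {m' : Ver X' X''} {m'' : Ver X'' X'''}
      {n : Ver Y Y'} {n' : Ver Y' Y''} {n'' : Ver Y'' Y'''}
      (χ : Cell m'' n'') (ψ : Cell m' n') (φ : Cell m n) e1 e2 e3 e4,
    assoc n'' n' n ⊙ vcc (vcc χ ψ e1) φ e2 =
    vcc χ (vcc ψ φ e3) e4 ⊙ assoc m'' m' m;
  luni_nat : forall {X X' Y Y' : dbase} {m : Ver X X'} {n : Ver Y Y'}
      (φ : Cell m n) e,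
    luni n ⊙ vcc (idc (bot φ)) φ e = φ ⊙ luni m;
  runi_nat : forall {X X' Y Y' : dbase} {m : Ver X X'} {n : Ver Y Y'}
      (φ : Cell m n) e,
    runi n ⊙ vcc φ (idc (top φ)) e = φ ⊙ runi m;
  pentagon : forall {X0 X1 X2 X3 X4 : dbase} (k : Ver X3 X4) (l : Ver X2 X3)
      (m : Ver X1 X2) (n : Ver X0 X1) e1 e2,
    vcc (cid k) (assoc l m n) e1 ⊙ assoc k (vcomp l m) n
      ⊙ vcc (assoc k l m) (cid n) e2
    = assoc k l (vcomp m n) ⊙ assoc (vcomp k l) m n;
  triangle : forall {X X' X'' : dbase} (n : Ver X' X'') (m : Ver X X') e1 e2,
    vcc (cid n) (luni m) e1 ⊙ assoc n (vid X') m = vcc (runi n) (cid m) e2 }.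
Set Implicit Arguments.

Arguments vid {d} X.
Arguments vcomp {d X X' X''} _ _.
Arguments idc {d X Y} _.
Arguments vcc {d X X' X'' Y Y' Y'' m m' n n'} ψ φ _.
Arguments assoc {d X X' X'' X'''} m'' m' m.
Arguments luni {d X X'} m.
Arguments runi {d X X'} m.
Arguments vcc_ccomp {d X X' X'' Y Y' Y'' Z Z' Z'' m m' n n' k k' ψ' ψ φ' φ} e e1 e2.
Arguments assoc_nat {d X X' X'' X''' Y Y' Y'' Y''' m m' m'' n n' n'' χ ψ φ} e1 e2 e3 e4.
Arguments vcc_cid {d X X' X'' m m'} e.
Arguments luni_nat {d X X' Y Y' m n φ} e.
Arguments runi_nat {d X X' Y Y' m n φ} e.
Arguments triangle {d X X' X''} n m e1 e2.
Arguments pentagon {d X0 X1 X2 X3 X4} k l m n e1 e2.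

Notation "n • m" := (vcomp n m) (at level 40, left associativity).

Section DoubleTheory.
Variable D : DoubleCat.

Lemma vcc_eq (X X' X'' Y Y' Y'' : D) (m : Ver X X') (m' : Ver X' X'')
    (n : Ver Y Y') (n' : Ver Y' Y'') (ψ ψ' : Cell m' n') (φ φ' : Cell m n) e e' :
  ψ = ψ' -> φ = φ' -> vcc ψ φ e = vcc ψ' φ' e'.
Proof. by move=> h h'; subst; rewrite (proof_irrelevance _ e e'). Qed.

Lemma iso_cancelR (X X' Y Y' : D) (m k : Ver X X') (n : Ver Y Y')
    (i : SpecialIso m k) (φ ψ : Cell k n) :
  φ ⊙ i = ψ ⊙ i -> φ = ψ.
Proof.
move=> /(f_equal (fun x => x ⊙ iso_inv i)).
by rewrite -!ccomp_assoc iso_VK !ccomp_idr.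
Qed.

Lemma iso_cancelL (X X' Y Y' : D) (m : Ver X X') (n k : Ver Y Y')
    (i : SpecialIso n k) (φ ψ : Cell m n) :
  i ⊙ φ = i ⊙ ψ -> φ = ψ.
Proof.
move=> /(f_equal (fun x => iso_inv i ⊙ x)).
by rewrite !ccomp_assoc iso_K !ccomp_idl.
Qed.

Lemma luniE (X X' Y Y' : D) (m : Ver X X') (n : Ver Y Y') (φ : Cell m n) f e :
  luni n ⊙ vcc (idc f) φ e = φ ⊙ luni m.
Proof.
have h : bot φ = f by rewrite e top_idc.
by subst; exact: luni_nat.
Qed.

Lemma runiE (X X' Y Y' : D) (m : Ver X X') (n : Ver Y Y') (φ : Cell m n) f e :
  runi n ⊙ vcc φ (idc f) e = φ ⊙ runi m.
Proof.
have h : top φ = f by rewrite -e bot_idc.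
by subst; exact: runi_nat.
Qed.

Program Definition iso_id (X X' : D) (m : Ver X X') : SpecialIso m m :=
  @MkSpecialIso _ _ _ _ _ (cid m) (cid m) _ _ _ _ _ _.
Solve All Obligations with
  by move=> *; rewrite ?(ccomp_idl, top_cid, bot_cid).

Program Definition vcc_iso (X X' X'' : D) (n n' : Ver X' X'') (m m' : Ver X X')
    (i : SpecialIso n n') (j : SpecialIso m m') (e : bot j = top i) :
    SpecialIso (n • m) (n' • m') :=
  @MkSpecialIso _ _ _ _ _ (vcc i j e) (vcc (iso_inv i) (iso_inv j) _)
    _ _ _ _ _ _.
Next Obligation. by move=> *; rewrite bot_inv top_inv. Qed.
Next Obligation. by move=> *; rewrite top_vcc top_iso. Qed.
Next Obligation. by move=> *; rewrite bot_vcc bot_iso. Qed.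
Next Obligation. by move=> *; rewrite top_vcc top_inv. Qed.
Next Obligation. by move=> *; rewrite bot_vcc bot_inv. Qed.
Next Obligation.
move=> X X' X'' n n' m m' i j e.
have ej : bot (iso_inv j ⊙ j) = top (iso_inv i ⊙ i).
  by rewrite !iso_K bot_cid top_cid.
rewrite -(vcc_ccomp ej).
have ek : bot (cid m) = top (cid n) by rewrite bot_cid top_cid.
by rewrite -(vcc_cid ek); apply: vcc_eq; rewrite iso_K.
Qed.
Next Obligation.
move=> X X' X'' n n' m m' i j e.
have ej : bot (j ⊙ iso_inv j) = top (i ⊙ iso_inv i).
  by rewrite !iso_VK bot_cid top_cid.
rewrite -(vcc_ccomp ej).
have ek : bot (cid m') = top (cid n') by rewrite bot_cid top_cid.
by rewrite -(vcc_cid ek); apply: vcc_eq; rewrite iso_VK.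
Qed.

Lemma luni_assoc (X X' X'' : D) (n : Ver X' X'') (m : Ver X X') e :
  luni (n • m) ⊙ assoc (vid X'') n m = vcc (luni n) (cid m) e.
Proof.
set I := vid X''.
have f0 : (forall (Y : D) (p q : Ver X Y) (a b : Cell p q) ea eb,
    vcc (idc (idm Y)) a ea = vcc (idc (idm Y)) b eb -> a = b).
  move=> Y p q a b ea eb /(f_equal (fun x => luni q ⊙ x)); rewrite !luniE.
  exact: iso_cancelR.
have e3 : bot (luni (n • m) ⊙ assoc I n m) = top (idc (idm X'')).
  by rewrite bot_ccomp !bot_iso comp_idl top_idc.
have e4 : bot (vcc (luni n) (cid m) e) = top (idc (idm X'')).
  by rewrite bot_vcc bot_iso top_idc.
apply: (f0 _ _ _ _ _ e3 e4).
have e5 : bot (assoc I n m) = top (cid I) by rewrite bot_iso top_cid.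
have e6 : bot (luni (n • m)) = top (cid I) by rewrite bot_iso top_cid.
have e7 : bot (luni n) = top (cid I) by rewrite bot_iso top_cid.
have e8 : bot (cid m) = top (vcc (cid I) (luni n) e7)
  by rewrite top_vcc top_iso bot_cid.
have e9 : bot (cid m) = top (assoc I I n) by rewrite top_iso bot_cid.
have e10 : bot (cid (n • m)) = top (runi I) by rewrite top_iso bot_cid.
have e11 : bot (cid n) = top (runi I) by rewrite top_iso bot_cid.
have e12 : bot (cid m) = top (vcc (runi I) (cid n) e11)
  by rewrite top_vcc top_cid bot_cid.
have e13 : bot (cid m) = top (cid n) by rewrite top_cid bot_cid.
have e14 : bot (vcc (cid n) (cid m) e13) = top (runi I)
  by rewrite bot_vcc bot_cid top_iso.
have e15 : bot (vcc (luni n) (cid m) e) = top (cid I)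
  by rewrite bot_vcc bot_iso top_cid.
have e16 : bot (cid m) = top (vcc (cid I) (luni n) e7 ⊙ assoc I I n).
  by rewrite top_ccomp top_vcc !top_iso comp_idl bot_cid.
have e17 : bot (luni (n • m) ⊙ assoc I n m) = top (cid I ⊙ cid I).
  by rewrite bot_ccomp !bot_iso top_ccomp !top_cid.
have P := pentagon I I n m e5 e9.
transitivity (vcc (cid I ⊙ cid I) (luni (n • m) ⊙ assoc I n m) e17).
  by apply: vcc_eq => //; rewrite ccomp_idl idc_id.
rewrite (vcc_ccomp _ e6 e5).
transitivity (vcc (cid I) (vcc (luni n) (cid m) e) e15); last first.
  by apply: vcc_eq; rewrite ?idc_id.
apply: (iso_cancelR (i := (assoc I (I • n) m))).
pose J := vcc_iso (i := assoc I I n) (j := iso_id m) e9.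
apply: (iso_cancelR (i := J)).
transitivity (vcc (cid I) (luni (n • m)) e6 ⊙ (vcc (cid I) (assoc I n m) e5
    ⊙ assoc I (I • n) m ⊙ vcc (assoc I I n) (cid m) e9)).
  by rewrite !ccomp_assoc.
rewrite P ccomp_assoc (triangle _ _ _ e10).
have -> : vcc (runi I) (cid (n • m)) e10 = vcc (runi I) (vcc (cid n) (cid m) e13) e14.
  by apply: vcc_eq => //; rewrite vcc_cid.
rewrite -(assoc_nat e11 e12).
have -> : vcc (vcc (runi I) (cid n) e11) (cid m) e12
   = vcc (vcc (cid I) (luni n) e7 ⊙ assoc I I n) (cid m ⊙ cid m)
       (etrans (f_equal _ (ccomp_idl _ (cid m))) e16).
  by apply: vcc_eq; rewrite ?ccomp_idl // (triangle _ _ _ e11).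
rewrite (vcc_ccomp _ e8 e9) ccomp_assoc (assoc_nat e7 e8 e e15).
done.
Qed.

Lemma luni_runi (X : D) : iso_cell (luni (vid X)) = runi (vid X).
Proof.
set I := vid X.
have e : bot (cid I) = top (luni I) by rewrite bot_cid top_iso.
have e' : bot (cid I) = top (runi I) by rewrite bot_cid top_iso.
have e1 : bot (luni I) = top (cid I) by rewrite bot_iso top_cid.
have e2 : bot (luni I) = top (idc (idm X)) by rewrite bot_iso top_idc.
suff : vcc (luni I) (cid I) e = vcc (runi I) (cid I) e'.
  have e3 : bot (idc (idm X)) = top (luni I) by rewrite bot_idc top_iso.
  have e4 : bot (idc (idm X)) = top (runi I) by rewrite bot_idc top_iso.
  move=> h; have : vcc (luni I) (idc (idm X)) e3 = vcc (runi I) (idc (idm X)) e4.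
    by rewrite -(@vcc_eq _ _ _ _ _ _ _ _ _ _ _ _ _ _ e e3 erefl (esym (idc_id D X)))
      -(@vcc_eq _ _ _ _ _ _ _ _ _ _ _ _ _ _ e' e4 erefl (esym (idc_id D X))).
  move=> /(f_equal (fun x => runi I ⊙ x)); rewrite !runiE.
  exact: iso_cancelR.
rewrite -luni_assoc -(triangle _ _ e1); congr (_ ⊙ _).
apply: (iso_cancelL (i := (luni I))).
rewrite -(luniE e2); congr (_ ⊙ _); apply: vcc_eq => //; exact: idc_id.
Qed.

End DoubleTheory.

(** Pasting with special cells between vertical identities: [under b φ] is
    [b • φ] and [over φ a] is [φ • a], modulo the unit isomorphisms. *)
Section Pasting.
Variable D : DoubleCat.

Definition under (X X' Y Y' : D) (m : Ver X X') (n : Ver Y Y')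
    (b : Cell (vid X') (vid Y')) (φ : Cell m n) (e : bot φ = top b) : Cell m n :=
  luni n ⊙ vcc b φ e ⊙ iso_inv (luni m).

Definition over (X X' Y Y' : D) (m : Ver X X') (n : Ver Y Y')
    (φ : Cell m n) (a : Cell (vid X) (vid Y)) (e : bot a = top φ) : Cell m n :=
  runi n ⊙ vcc φ a e ⊙ iso_inv (runi m).

Arguments under {X X' Y Y' m n} b φ e.
Arguments over {X X' Y Y' m n} φ a e.

Lemma underE (X X' Y Y' : D) (m : Ver X X') (n : Ver Y Y')
    (b : Cell (vid X') (vid Y')) (φ : Cell m n) e :
  under b φ e ⊙ luni m = luni n ⊙ vcc b φ e.
Proof. by rewrite /under -ccomp_assoc iso_K ccomp_idr. Qed.

Lemma overE (X X' Y Y' : D) (m : Ver X X') (n : Ver Y Y')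
    (φ : Cell m n) (a : Cell (vid X) (vid Y)) e :
  over φ a e ⊙ runi m = runi n ⊙ vcc φ a e.
Proof. by rewrite /over -ccomp_assoc iso_K ccomp_idr. Qed.

Lemma top_under (X X' Y Y' : D) (m : Ver X X') (n : Ver Y Y')
    (b : Cell (vid X') (vid Y')) (φ : Cell m n) e : top (under b φ e) = top φ.
Proof. by rewrite !top_ccomp top_vcc top_iso top_inv comp_idl comp_idr. Qed.

Lemma bot_under (X X' Y Y' : D) (m : Ver X X') (n : Ver Y Y')
    (b : Cell (vid X') (vid Y')) (φ : Cell m n) e : bot (under b φ e) = bot b.
Proof. by rewrite !bot_ccomp bot_vcc bot_iso bot_inv comp_idl comp_idr. Qed.

Lemma top_over (X X' Y Y' : D) (m : Ver X X') (n : Ver Y Y')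
    (φ : Cell m n) (a : Cell (vid X) (vid Y)) e : top (over φ a e) = top a.
Proof. by rewrite !top_ccomp top_vcc top_iso top_inv comp_idl comp_idr. Qed.

Lemma bot_over (X X' Y Y' : D) (m : Ver X X') (n : Ver Y Y')
    (φ : Cell m n) (a : Cell (vid X) (vid Y)) e : bot (over φ a e) = bot φ.
Proof. by rewrite !bot_ccomp bot_vcc bot_iso bot_inv comp_idl comp_idr. Qed.

Lemma under_eq (X X' Y Y' : D) (m : Ver X X') (n : Ver Y Y')
    (b b' : Cell (vid X') (vid Y')) (φ φ' : Cell m n) e e' :
  b = b' -> φ = φ' -> under b φ e = under b' φ' e'.
Proof. by move=> h h'; subst; rewrite (proof_irrelevance _ e e'). Qed.

Lemma over_eq (X X' Y Y' : D) (m : Ver X X') (n : Ver Y Y')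
    (φ φ' : Cell m n) (a a' : Cell (vid X) (vid Y)) e e' :
  φ = φ' -> a = a' -> over φ a e = over φ' a' e'.
Proof. by move=> h h'; subst; rewrite (proof_irrelevance _ e e'). Qed.

Lemma under_idc (X X' Y Y' : D) (m : Ver X X') (n : Ver Y Y')
    (f : Hom X' Y') (φ : Cell m n) e : under (idc f) φ e = φ.
Proof. by apply: (iso_cancelR (i := (luni m))); rewrite underE luniE. Qed.

Lemma over_idc (X X' Y Y' : D) (m : Ver X X') (n : Ver Y Y')
    (f : Hom X Y) (φ : Cell m n) e : over φ (idc f) e = φ.
Proof. by apply: (iso_cancelR (i := (runi m))); rewrite overE runiE. Qed.

Lemma under_ccomp (X X' Y Y' Z Z' : D) (m : Ver X X') (n : Ver Y Y')
    (k : Ver Z Z') (d : Cell (vid Y') (vid Z')) (c : Cell (vid X') (vid Y'))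
    (ψ : Cell n k) (φ : Cell m n) e e1 e2 :
  under (d ⊙ c) (ψ ⊙ φ) e = under d ψ e1 ⊙ under c φ e2.
Proof.
apply: (iso_cancelR (i := (luni m))).
by rewrite underE (vcc_ccomp e e1 e2) -ccomp_assoc underE !ccomp_assoc underE.
Qed.

Lemma over_ccomp (X X' Y Y' Z Z' : D) (m : Ver X X') (n : Ver Y Y')
    (k : Ver Z Z') (ψ : Cell n k) (φ : Cell m n)
    (d : Cell (vid Y) (vid Z)) (c : Cell (vid X) (vid Y)) e e1 e2 :
  over (ψ ⊙ φ) (d ⊙ c) e = over ψ d e1 ⊙ over φ c e2.
Proof.
apply: (iso_cancelR (i := (runi m))).
by rewrite overE (vcc_ccomp e e1 e2) -ccomp_assoc overE !ccomp_assoc overE.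
Qed.

Lemma under_over (X Y : D) (b a : Cell (vid X) (vid Y)) e :
  under b a e = over b a e.
Proof.
apply: (iso_cancelR (i := (luni (vid X)))).
by rewrite underE !luni_runi overE.
Qed.

Lemma vccR (X X' X'' Y Y' Y'' Z Z' Z'' : D)
    (m : Ver X X') (m' : Ver X' X'') (n : Ver Y Y') (n' : Ver Y' Y'')
    (k : Ver Z Z') (k' : Ver Z' Z'') (χ : Cell m' k') (χ' : Cell m k)
    (ψ' : Cell n' k') (ψ : Cell m' n') (φ' : Cell n k) (φ : Cell m n) e e1 e2 :
  χ = ψ' ⊙ ψ -> χ' = φ' ⊙ φ -> vcc ψ' φ' e1 ⊙ vcc ψ φ e2 = vcc χ χ' e.
Proof. by move=> h h'; subst; rewrite (vcc_ccomp e e1 e2). Qed.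

Lemma under_under (X X' Y Y' : D) (m : Ver X X') (n : Ver Y Y')
    (c b : Cell (vid X') (vid Y')) (φ : Cell m n) e1 e2 e3 e4 :
  under c (under b φ e1) e2 = under (under c b e3) φ e4.
Proof.
have f1 : bot (luni m) = top (cid (vid X')) by rewrite bot_iso top_cid.
have f2 : bot (luni n) = top (cid (vid Y')) by rewrite bot_iso top_cid.
have f3 : bot (cid m) = top (runi (vid X')) by rewrite bot_cid top_iso.
have f4 : bot (cid n) = top (runi (vid Y')) by rewrite bot_cid top_iso.
have f5 : bot φ = top (vcc c b e3) by rewrite top_vcc.
have f6 : bot (vcc b φ e1) = top c by rewrite bot_vcc.
have f7 : bot (under b φ e1 ⊙ luni m) = top c
  by rewrite bot_ccomp bot_iso comp_idr.
have f8 : bot φ = top (under c b e3 ⊙ luni (vid X'))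
  by rewrite top_ccomp top_under top_iso comp_idr.
apply: (iso_cancelR (i := (luni m))); rewrite !underE.
apply: (iso_cancelR (i := (vcc_iso (i := iso_id (vid X')) (j := luni m) f1))).
apply: (iso_cancelR (i := (assoc (vid X') (vid X') m))) => /=.
rewrite -!ccomp_assoc [in RHS](triangle _ _ _ f3).
rewrite [in RHS](vccR f8) ?ccomp_idr -?luni_runi //.
have -> : vcc (under c b e3 ⊙ luni (vid X')) φ f8 =
    vcc (runi (vid Y')) (cid n) f4 ⊙ vcc (vcc c b e3) φ f5.
  by apply/esym/vccR; rewrite -?luni_runi ?underE ?ccomp_idl.
rewrite -(triangle _ _ f2) -[X in _ = _ ⊙ X]ccomp_assoc (assoc_nat e3 f5 e1 f6).
congr (_ ⊙ _); rewrite !ccomp_assoc; congr (_ ⊙ _).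
rewrite (vccR f7) ?ccomp_idr // (vccR f7) // ?ccomp_idl ?underE //.
Qed.

Lemma over_over (X X' Y Y' : D) (m : Ver X X') (n : Ver Y Y')
    (φ : Cell m n) (b a : Cell (vid X) (vid Y)) e1 e2 e3 e4 :
  over (over φ b e1) a e2 = over φ (under b a e3) e4.
Proof.
have f1 : bot (cid (vid X)) = top (runi m) by rewrite bot_cid top_iso.
have f1' : bot (luni (vid X)) = top (cid m) by rewrite bot_iso top_cid.
have f2 : bot (cid (vid Y)) = top (runi n) by rewrite bot_cid top_iso.
have f2' : bot (luni (vid Y)) = top (cid n) by rewrite bot_iso top_cid.
have f5 : bot a = top (vcc φ b e1) by rewrite top_vcc.
have f6 : bot (vcc b a e3) = top φ by rewrite bot_vcc.
have f7 : bot a = top (over φ b e1 ⊙ runi m)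
  by rewrite top_ccomp top_iso comp_idr.
have f8 : bot (under b a e3 ⊙ luni (vid X)) = top φ
  by rewrite bot_ccomp bot_iso comp_idr.
apply: (iso_cancelR (i := (runi m))); rewrite !overE.
apply: (iso_cancelR (i := (vcc_iso (i := runi m) (j := iso_id (vid X)) f1))) => /=.
rewrite -[in RHS](triangle _ _ f1') -!ccomp_assoc.
rewrite (vccR f7) ?ccomp_idr //.
have -> : vcc (over φ b e1 ⊙ runi m) a f7 =
    vcc (runi n) (cid (vid Y)) f2 ⊙ vcc (vcc φ b e1) a f5.
  by apply/esym/vccR; rewrite ?overE ?ccomp_idl.
rewrite -(triangle _ _ f2') -ccomp_assoc (assoc_nat e1 f5 e3 f6).
congr (_ ⊙ _); rewrite !ccomp_assoc; congr (_ ⊙ _).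
rewrite (vccR f8) // ?ccomp_idl ?underE // (vccR f8) ?ccomp_idr ?underE //.
Qed.

Lemma over_under (X X' Y Y' : D) (m : Ver X X') (n : Ver Y Y')
    (b : Cell (vid X') (vid Y')) (φ : Cell m n) (a : Cell (vid X) (vid Y))
    e1 e2 e3 e4 :
  over (under b φ e1) a e2 = under b (over φ a e3) e4.
Proof.
have f1 : bot (cid (vid X)) = top (luni m) by rewrite bot_cid top_iso.
have f2 : bot (cid (vid Y)) = top (luni n) by rewrite bot_cid top_iso.
have f3 : bot (runi m) = top (idc (idm X')) by rewrite bot_iso top_idc.
have f4 : bot (runi n) = top (idc (idm Y')) by rewrite bot_iso top_idc.
have f5 : bot a = top (vcc b φ e1) by rewrite top_vcc e2 top_under.
have f6 : bot (vcc φ a e3) = top b by rewrite bot_vcc.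
have f7 : bot a = top (under b φ e1 ⊙ luni m)
  by rewrite top_ccomp top_iso comp_idr.
have f8 : bot (over φ a e3 ⊙ runi m) = top b
  by rewrite bot_ccomp bot_iso comp_idr bot_over.
apply: (iso_cancelR (i := (runi m))); rewrite overE.
apply: (iso_cancelR (i := (vcc_iso (i := luni m) (j := iso_id (vid X)) f1))) => /=.
rewrite -!ccomp_assoc (vccR f7) ?ccomp_idr //.
have -> : vcc (under b φ e1 ⊙ luni m) a f7 =
    vcc (luni n) (cid (vid Y)) f2 ⊙ vcc (vcc b φ e1) a f5.
  by apply/esym/vccR; rewrite ?underE ?ccomp_idl.
rewrite -!luni_assoc.
transitivity (luni n ⊙ vcc (idc (idm Y')) (runi n) f4 ⊙
    (vcc b (vcc φ a e3) f6 ⊙ assoc (vid X') m (vid X))).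
  by rewrite luniE -(assoc_nat e1 f5 e3 f6) !ccomp_assoc.
have -> : runi m ⊙ (luni (m • vid X) ⊙ assoc (vid X') m (vid X)) =
    luni m ⊙ (vcc (idc (idm X')) (runi m) f3 ⊙ assoc (vid X') m (vid X)).
  by rewrite !ccomp_assoc luniE.
rewrite (ccomp_assoc (iso_inv (luni m))) iso_K ccomp_idl.
rewrite -!ccomp_assoc; congr (_ ⊙ _).
rewrite !ccomp_assoc; congr (_ ⊙ _).
by rewrite (vccR f8) ?idc_id ?ccomp_idl ?overE // (vccR f8) ?idc_id ?ccomp_idr ?overE.
Qed.

End Pasting.
Arguments under {D X X' Y Y' m n} b φ e.
Arguments over {D X X' Y Y' m n} φ a e.

(** The 2-category [H D]; its 2-cells [f ⇒ g] are the cells between vertical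
    identities with top [f] and bottom [g]. *)
Program Definition HD (D : DoubleCat) : TwoCat :=
  @MkTwoCat D (fun X Y => Cell (vid X) (vid Y))
    (fun X Y a => top a) (fun X Y a => bot a) (fun X Y f => idc f)
    (fun X Y b a e => under b a e) (fun X Y Z b a => b ⊙ a)
    _ _ _ _ _ _ _ _ _ _ _ _ _ _.
Next Obligation. by move=> * /=; rewrite top_idc. Qed.
Next Obligation. by move=> * /=; rewrite bot_idc. Qed.
Next Obligation. by move=> * /=; rewrite top_under. Qed.
Next Obligation. by move=> * /=; rewrite bot_under. Qed.
Next Obligation. by move=> * /=; rewrite top_ccomp. Qed.
Next Obligation. by move=> * /=; rewrite bot_ccomp. Qed.
Next Obligation. by move=> * /=; rewrite under_idc. Qed.
Next Obligation. by move=> * /=; rewrite under_over over_idc. Qed.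
Next Obligation. move=> *; exact: under_under. Qed.
Next Obligation. by move=> * /=; rewrite idc_id ccomp_idl. Qed.
Next Obligation. by move=> * /=; rewrite idc_id ccomp_idr. Qed.
Next Obligation. by move=> * /=; rewrite ccomp_assoc. Qed.
Next Obligation. by move=> * /=; rewrite idc_comp. Qed.
Next Obligation. by move=> * /=; rewrite -under_ccomp. Qed.

Record Companion (D : DoubleCat) (X Y : D) (f : Hom X Y) := MkCompanion {
  cpn : Ver X Y;
  cpn_eta : Cell (vid X) cpn;
  cpn_eps : Cell cpn (vid Y);
  top_eta : top cpn_eta = idm X;
  bot_eta : bot cpn_eta = f;
  top_eps : top cpn_eps = f;
  bot_eps : bot cpn_eps = idm Y;
  cpn_hor : cpn_eps ⊙ cpn_eta = idc f;
  cpn_ver : forall e, luni cpn ⊙ vcc cpn_eps cpn_eta e = runi cpn }.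

Record Conjoint (D : DoubleCat) (X Y : D) (f : Hom X Y) := MkConjoint {
  cjt : Ver Y X;
  cjt_alpha : Cell (vid X) cjt;
  cjt_beta : Cell cjt (vid Y);
  top_alpha : top cjt_alpha = f;
  bot_alpha : bot cjt_alpha = idm X;
  top_beta : top cjt_beta = idm Y;
  bot_beta : bot cjt_beta = f;
  cjt_hor : cjt_beta ⊙ cjt_alpha = idc f;
  cjt_ver : forall e, runi cjt ⊙ vcc cjt_alpha cjt_beta e = luni cjt }.

Record FramedBicategory := MkFramedBicategory {
  fb_dc :> DoubleCat;
  fb_cpn : forall (X Y : fb_dc) (f : Hom X Y), Companion f;
  fb_cjt : forall (X Y : fb_dc) (f : Hom X Y), Conjoint f }.

Arguments fb_cpn {f X Y} _ : rename.
Arguments fb_cjt {f X Y} _ : rename.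

Section Frames.
Variable D : FramedBicategory.

Definition companion (X Y : D) (f : Hom X Y) : Ver X Y := cpn (fb_cpn f).
Definition conjoint (X Y : D) (f : Hom X Y) : Ver Y X := cjt (fb_cjt f).

Lemma beta_eps (X X' Y : D) (s : Hom X Y) (s' : Hom X' Y) :
  bot (cpn_eps (fb_cpn s)) = top (cjt_beta (fb_cjt s')).
Proof. by rewrite bot_eps top_beta. Qed.

(** The canonical (cartesian) cell [s'^* • s_* -> id] with top [s] and
    bottom [s']. *)
Definition frame_cell (X X' Y : D) (s : Hom X Y) (s' : Hom X' Y) :
    Cell (conjoint s' • companion s) (vid Y) :=
  luni (vid Y) ⊙ vcc (cjt_beta (fb_cjt s')) (cpn_eps (fb_cpn s)) (beta_eps s s').

End Frames.

(** The identity cell on [m], retyped along an equality [m = n]. *)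
Definition vcast (D : DoubleBase) (X X' : D) (m n : Ver X X') (e : m = n) :
    Cell m n :=
  match e in _ = k return Cell m k with erefl => cid m end.

Lemma top_vcast (D : DoubleBase) (X X' : D) (m n : Ver X X') (e : m = n) :
  top (vcast e) = idm X.
Proof. by subst; exact: top_cid. Qed.

Lemma bot_vcast (D : DoubleBase) (X X' : D) (m n : Ver X X') (e : m = n) :
  bot (vcast e) = idm X'.
Proof. by subst; exact: bot_cid. Qed.

Lemma vcastE (D : DoubleBase) (X X' : D) (m : Ver X X') (e : m = m) :
  vcast e = cid m.
Proof. by rewrite (proof_irrelevance _ e erefl). Qed.

Record NLax (B : Cat) (D : DoubleCat) := MkNLax {
  lob :> B -> D;
  lver : forall b b' : B, Hom b b' -> Ver (lob b) (lob b');
  lver_id : forall b : B, lver (idm b) = vid (lob b);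
  lcomp : forall (b b' b'' : B) (β' : Hom b' b'') (β : Hom b b'),
    Cell (lver β' • lver β) (lver (β' ∘ β));
  top_lcomp : forall b b' b'' (β' : Hom b' b'') (β : Hom b b'),
    top (lcomp β' β) = idm (lob b);
  bot_lcomp : forall b b' b'' (β' : Hom b' b'') (β : Hom b b'),
    bot (lcomp β' β) = idm (lob b'');
  lcomp_idl : forall b b' (β : Hom b b') e,
    vcast (f_equal (@lver b b') (comp_idl β)) ⊙ lcomp (idm b') β
    = luni (lver β) ⊙ vcc (vcast (lver_id b')) (cid (lver β)) e;
  lcomp_idr : forall b b' (β : Hom b b') e,
    vcast (f_equal (@lver b b') (comp_idr β)) ⊙ lcomp β (idm b)
    = runi (lver β) ⊙ vcc (cid (lver β)) (vcast (lver_id b)) e;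
  lcomp_assoc : forall b b' b'' b''' (β'' : Hom b'' b''') (β' : Hom b' b'')
      (β : Hom b b') e1 e2,
    vcast (f_equal (@lver b b''') (comp_assoc β'' β' β)) ⊙ lcomp β'' (β' ∘ β)
      ⊙ vcc (cid (lver β'')) (lcomp β' β) e1
      ⊙ assoc (lver β'') (lver β') (lver β)
    = lcomp (β'' ∘ β') β ⊙ vcc (lcomp β'' β') (cid (lver β)) e2 }.

Arguments lver {B D} F {b b'} _ : rename.
Arguments lcomp {B D} F {b b' b''} _ _ : rename.
Arguments lver_id {B D} F b : rename.

Section Lax.
Variables (B : Cat) (D : DoubleCat).

Record Transf (F G : NLax B D) := MkTransf {
  tob :> forall b : B, Hom (F b) (G b);
  tcell : forall b b' (β : Hom b b'), Cell (lver F β) (lver G β);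
  top_tcell : forall b b' (β : Hom b b'), top (tcell β) = tob b;
  bot_tcell : forall b b' (β : Hom b b'), bot (tcell β) = tob b';
  tcell_id : forall b,
    vcast (lver_id G b) ⊙ tcell (idm b) = idc (tob b) ⊙ vcast (lver_id F b);
  tcell_comp : forall b b' b'' (β' : Hom b' b'') (β : Hom b b') e,
    tcell (β' ∘ β) ⊙ lcomp F β' β
    = lcomp G β' β ⊙ vcc (tcell β') (tcell β) e }.

Arguments tcell {F G} t {b b'} β.

Lemma Transf_eq (F G : NLax B D) (t t' : Transf F G) :
  (forall b, t b = t' b) ->
  (forall b b' (β : Hom b b'), tcell t β = tcell t' β) -> t = t'.
Proof.
case: t => o c h1 h2 h3 h4; case: t' => o' c' k1 k2 k3 k4 /= eo ec.
have {}eo : o = o' by apply: functional_extensionality_dep.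
have {}ec : c = c'.
  by do 3! (apply: functional_extensionality_dep => ?); exact: ec.
by subst; congr MkTransf; apply: proof_irrelevance.
Qed.

Program Definition idT (F : NLax B D) : Transf F F :=
  @MkTransf F F (fun b => idm (F b)) (fun b b' β => cid (lver F β)) _ _ _ _.
Next Obligation. by move=> * /=; rewrite top_cid. Qed.
Next Obligation. by move=> * /=; rewrite bot_cid. Qed.
Next Obligation. by move=> * /=; rewrite ccomp_idr idc_id ccomp_idl. Qed.
Next Obligation. by move=> * /=; rewrite vcc_cid ccomp_idl ccomp_idr. Qed.

Program Definition compT (F G H : NLax B D) (s : Transf G H) (t : Transf F G) :
    Transf F H :=
  @MkTransf F H (fun b => s b ∘ t b) (fun b b' β => tcell s β ⊙ tcell t β)
    _ _ _ _.
Next Obligation. by move=> * /=; rewrite top_ccomp !top_tcell. Qed.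
Next Obligation. by move=> * /=; rewrite bot_ccomp !bot_tcell. Qed.
Next Obligation.
move=> F G H s t b.
by rewrite ccomp_assoc tcell_id -ccomp_assoc tcell_id ccomp_assoc idc_comp.
Qed.
Next Obligation.
move=> F G H s t b b' b'' β' β e.
have e1 : bot (tcell s β) = top (tcell s β') by rewrite top_tcell bot_tcell.
have e2 : bot (tcell t β) = top (tcell t β') by rewrite top_tcell bot_tcell.
by rewrite -ccomp_assoc (tcell_comp e2) ccomp_assoc (tcell_comp e1) -ccomp_assoc
  -(vcc_ccomp e).
Qed.

Program Definition lax_cat : Cat := @MkCat (NLax B D) Transf idT compT _ _ _.
Next Obligation.
by move=> F G t; apply: Transf_eq => * /=; rewrite ?comp_idl ?ccomp_idl.
Qed.
Next Obligation.
by move=> F G t; apply: Transf_eq => * /=; rewrite ?comp_idr ?ccomp_idr.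
Qed.
Next Obligation.
by move=> *; apply: Transf_eq => * /=; rewrite ?comp_assoc ?ccomp_assoc.
Qed.

(** Modifications [msrc ⇒ mtgt]; compatibility says that
    [(mtgt β) • (θ b) = (θ b') • (msrc β)] modulo the unit isomorphisms. *)
Record Modif (F G : NLax B D) := MkModif {
  msrc : Transf F G;
  mtgt : Transf F G;
  mcell :> forall b : B, Cell (vid (F b)) (vid (G b));
  top_mcell : forall b, top (mcell b) = msrc b;
  bot_mcell : forall b, bot (mcell b) = mtgt b;
  mcell_nat : forall b b' (β : Hom b b') e1 e2,
    under (mcell b') (tcell msrc β) e1 = over (tcell mtgt β) (mcell b) e2 }.

Lemma Modif_eq (F G : NLax B D) (a a' : Modif F G) :
  msrc a = msrc a' -> mtgt a = mtgt a' -> (forall b, a b = a' b) -> a = a'.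
Proof.
case: a => s t c h1 h2 h3; case: a' => s' t' c' k1 k2 k3 /= es et ec.
have {}ec : c = c' by apply: functional_extensionality_dep.
by subst; congr MkModif; apply: proof_irrelevance.
Qed.

Program Definition idM (F G : NLax B D) (t : Transf F G) : Modif F G :=
  @MkModif F G t t (fun b => idc (t b)) _ _ _.
Next Obligation. by move=> * /=; rewrite top_idc. Qed.
Next Obligation. by move=> * /=; rewrite bot_idc. Qed.
Next Obligation. by move=> * /=; rewrite under_idc over_idc. Qed.

Lemma mcomposable (F G : NLax B D) (b a : Modif F G) :
  mtgt a = msrc b -> forall x, bot (a x) = top (b x).
Proof. by move=> e x; rewrite bot_mcell top_mcell e. Qed.

Program Definition vcM (F G : NLax B D) (b a : Modif F G)
    (e : mtgt a = msrc b) : Modif F G :=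
  @MkModif F G (msrc a) (mtgt b) (fun x => under (b x) (a x) (mcomposable e x))
    _ _ _.
Next Obligation. by move=> * /=; rewrite top_under top_mcell. Qed.
Next Obligation. by move=> * /=; rewrite bot_under bot_mcell. Qed.
Next Obligation.
move=> F G b a e x x' β e1 e2.
have f1 : bot (tcell (msrc a) β) = top (a x') by rewrite bot_tcell top_mcell.
have f2 : bot (a x) = top (tcell (mtgt a) β) by rewrite bot_mcell top_tcell.
have f2' : bot (a x) = top (tcell (msrc b) β) by rewrite -e.
have f3 : bot (under (a x') (tcell (msrc a) β) f1) = top (b x').
  by rewrite bot_under; exact: mcomposable.
rewrite -(under_under (e1:=f1) f3).
have f4 : bot (tcell (msrc b) β) = top (b x') by rewrite bot_tcell top_mcell.
have f5 : bot (b x) = top (tcell (mtgt b) β) by rewrite bot_mcell top_tcell.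
have f6 : bot (over (tcell (msrc b) β) (a x) f2') = top (b x').
  by rewrite bot_over f4.
have f7 : bot (a x) = top (under (b x') (tcell (msrc b) β) f4).
  by rewrite top_under.
have f8 : bot (a x) = top (over (tcell (mtgt b) β) (b x) f5).
  by rewrite top_over; exact: mcomposable.
transitivity (under (b x') (over (tcell (msrc b) β) (a x) f2') f6).
  by apply: under_eq => //; rewrite (mcell_nat f1 f2); apply: over_eq; rewrite ?e.
rewrite -(over_under (e1:=f4) f7).
transitivity (over (over (tcell (mtgt b) β) (b x) f5) (a x) f8).
  by apply: over_eq => //; exact: mcell_nat.
exact: over_over.
Qed.

Program Definition hcM (F G H : NLax B D) (b : Modif G H) (a : Modif F G) :
    Modif F H :=
  @MkModif F H (compT (msrc b) (msrc a)) (compT (mtgt b) (mtgt a))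
    (fun x => b x ⊙ a x) _ _ _.
Next Obligation. by move=> * /=; rewrite top_ccomp !top_mcell. Qed.
Next Obligation. by move=> * /=; rewrite bot_ccomp !bot_mcell. Qed.
Next Obligation.
move=> F G H b a x x' β e1 e2 /=.
have f1 : bot (tcell (msrc a) β) = top (a x') by rewrite bot_tcell top_mcell.
have f2 : bot (a x) = top (tcell (mtgt a) β) by rewrite bot_mcell top_tcell.
have f3 : bot (tcell (msrc b) β) = top (b x') by rewrite bot_tcell top_mcell.
have f4 : bot (b x) = top (tcell (mtgt b) β) by rewrite bot_mcell top_tcell.
rewrite (under_ccomp e1 f3 f1) (over_ccomp e2 f4 f2).
by rewrite (mcell_nat f1 f2) (mcell_nat f3 f4).
Qed.

Program Definition Lax : TwoCat :=
  @MkTwoCat lax_cat Modif (@msrc) (@mtgt) idM vcM hcM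
    _ _ _ _ _ _ _ _ _ _ _ _ _ _.
Solve All Obligations with (try by []).
Next Obligation.
by move=> *; apply: Modif_eq => //= b; rewrite under_idc.
Qed.
Next Obligation.
by move=> *; apply: Modif_eq => //= b; rewrite under_over over_idc.
Qed.
Next Obligation.
by move=> F G c b a e1 e2 e3 e4; apply: Modif_eq => //= x; exact: under_under.
Qed.
Next Obligation.
move=> F G a; apply: Modif_eq => [||b] /=; rewrite ?idc_id ?ccomp_idl //.
  exact: (@comp_idl lax_cat).
exact: (@comp_idl lax_cat).
Qed.
Next Obligation.
move=> F G a; apply: Modif_eq => [||b] /=; rewrite ?idc_id ?ccomp_idr //.
  exact: (@comp_idr lax_cat).
exact: (@comp_idr lax_cat).
Qed.
Next Obligation.
move=> F G H K c b a; apply: Modif_eq => [||x] /=; rewrite ?ccomp_assoc //.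
  exact: (@comp_assoc lax_cat).
exact: (@comp_assoc lax_cat).
Qed.
Next Obligation.
by move=> *; apply: Modif_eq => //= b; rewrite idc_comp.
Qed.
Next Obligation.
by move=> F G H d c b a e1 e2 e3; apply: Modif_eq => //= x; apply/esym; exact: under_ccomp.
Qed.

Program Definition constL (X : D) : NLax B D :=
  @MkNLax B D (fun _ => X) (fun _ _ _ => vid X) (fun _ => erefl)
    (fun _ _ _ _ _ => luni (vid X)) _ _ _ _ _.
Next Obligation. by move=> * /=; rewrite top_iso. Qed.
Next Obligation. by move=> * /=; rewrite bot_iso. Qed.
Next Obligation. by move=> * /=; rewrite vcastE ccomp_idl vcc_cid ccomp_idr. Qed.
Next Obligation.
by move=> * /=; rewrite vcastE ccomp_idl vcc_cid ccomp_idr luni_runi.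
Qed.
Next Obligation.
move=> X b0 b1 b2 b3 β2 β1 β0 e1 e2 /=.
have f : bot (cid (vid X)) = top (runi (vid X)) by rewrite bot_cid top_iso.
rewrite vcastE ccomp_idl -ccomp_assoc (triangle _ _ e1 f); congr (_ ⊙ _).
by apply: vcc_eq; rewrite ?luni_runi.
Qed.

Program Definition constT (X Y : D) (f : Hom X Y) :
    Transf (constL X) (constL Y) :=
  @MkTransf (constL X) (constL Y) (fun _ => f) (fun _ _ _ => idc f) _ _ _ _.
Next Obligation. by move=> * /=; rewrite top_idc. Qed.
Next Obligation. by move=> * /=; rewrite bot_idc. Qed.
Next Obligation. by move=> * /=; rewrite ccomp_idl ccomp_idr. Qed.
Next Obligation. by move=> * /=; rewrite luniE. Qed.

Program Definition constM (X Y : D) (a : Cell (vid X) (vid Y)) :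
    Modif (constL X) (constL Y) :=
  @MkModif (constL X) (constL Y) (constT (top a)) (constT (bot a)) (fun _ => a)
    _ _ _.
Solve All Obligations with (try by []).
Next Obligation.
move=> X Y a b b' β e1 e2.
transitivity a; first by rewrite [LHS](under_over e1) [LHS]over_idc.
by apply/esym; have := under_idc (f := bot a) e2; rewrite under_over.
Qed.

Program Definition Delta : TwoFunctor (HD D) Lax :=
  @MkTwoFunctor (HD D) Lax constL constT constM _ _ _ _ _ _ _.
Next Obligation. by move=> X; apply: Transf_eq => * //=; rewrite idc_id. Qed.
Next Obligation. by move=> *; apply: Transf_eq => * //=; rewrite idc_comp. Qed.
Solve All Obligations with (try by []).
Next Obligation.
by move=> *; apply: Modif_eq => //=; apply: Transf_eq => * //=;
  rewrite ?top_idc ?bot_idc.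
Qed.
Next Obligation.
move=> X Y b a e e'; apply: Modif_eq => //=; last by move=> x; exact: under_eq.
  by apply: Transf_eq => * /=; rewrite top_under.
by apply: Transf_eq => * /=; rewrite bot_under.
Qed.
Next Obligation.
by move=> *; apply: Modif_eq => //=; apply: Transf_eq => * //=;
  rewrite ?top_ccomp ?bot_ccomp ?idc_comp.
Qed.

Definition LaxColimits := LeftAdjoint Delta.

(** The components of [cocone Γ F] are the [i_b] and its cells the [i_β]. *)
Definition cocone (Γ : LaxColimits) (F : NLax B D) :
  Transf F (constL (Γ F)) := unit Γ F.

End Lax.

Arguments tcell {B D F G} t {b b'} β.
Arguments Delta B D : clear implicits.
Arguments cocone {B D} Γ F.

(** A vertical morphism as an object of [Lax_N(2, D)], where the poset
    [{0 < 1}] is [bool], with its order [false < true]. *)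
Section Arrow.
Variables (D : DoubleCat) (X X' : D) (m : Ver X X').

Definition arrow_ob (x : bool) : D := if x then X' else X.

Definition arrow_ver (x y : bool) :
    @Hom cat2 x y -> Ver (arrow_ob x) (arrow_ob y) :=
  match x, y return @Hom cat2 x y -> Ver (arrow_ob x) (arrow_ob y) with
  | false, false => fun _ => vid X
  | false, true => fun _ => m
  | true, false => fun h => False_rect _ (notF h)
  | true, true => fun _ => vid X'
  end.

Definition arrow_lcomp (x y z : bool) :
    forall (h' : @Hom cat2 y z) (h : @Hom cat2 x y),
    Cell (arrow_ver h' • arrow_ver h) (arrow_ver (h' ∘ h : @Hom cat2 x z)) :=
  match x, y, z return forall (h' : @Hom cat2 y z) (h : @Hom cat2 x y),
    Cell (arrow_ver h' • arrow_ver h) (arrow_ver (h' ∘ h : @Hom cat2 x z)) with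
  | false, false, false => fun _ _ => luni (vid X)
  | false, false, true => fun _ _ => runi m
  | false, true, true => fun _ _ => luni m
  | true, true, true => fun _ _ => luni (vid X')
  | true, false, _ => fun _ h => False_rect _ (notF h)
  | _, true, false => fun h _ => False_rect _ (notF h)
  end.

Definition arrow_ver_id (x : bool) :
    arrow_ver (idm (c := cat2) x) = vid (arrow_ob x) :=
  match x with true => erefl | false => erefl end.

Program Definition arrow : NLax cat2 D :=
  @MkNLax cat2 D arrow_ob arrow_ver arrow_ver_id arrow_lcomp _ _ _ _ _.
Next Obligation.
by move=> [] [] [] h h' //=; rewrite top_iso.
Qed.
Next Obligation.
by move=> [] [] [] h h' //=; rewrite bot_iso.
Qed.
Next Obligation.
by move=> [] [] h e //=; rewrite !vcastE ccomp_idl vcc_cid ccomp_idr.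
Qed.
Next Obligation.
by move=> [] [] h e //=; rewrite !vcastE ccomp_idl vcc_cid ccomp_idr ?luni_runi.
Qed.
Next Obligation.
have T : forall (Y Y' Z : D) (k : Ver Y' Z) (n : Ver Y Y')
    (i : Cell (k • vid Y') k) e1 e2, i = runi k ->
    vcc (cid k) (luni n) e1 ⊙ assoc k (vid Y') n = vcc i (cid n) e2.
  by move=> Y Y' Z k n i f1 f2 hi; subst; exact: triangle.
move=> [] [] [] [] h h' h'' e1 e2 //=; rewrite vcastE ccomp_idl -ccomp_assoc.
- by rewrite (T _ _ _ _ _ (luni (vid X'))) ?luni_runi.
- by rewrite (T _ _ _ _ _ (luni (vid X'))) ?luni_runi.
- have f : bot (runi m) = top (idc (idm X')) by rewrite bot_iso top_idc.
  rewrite -luni_assoc !ccomp_assoc -(luniE f); congr (_ ⊙ _ ⊙ _).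
  by apply: vcc_eq; rewrite ?idc_id.
- by rewrite (T _ _ _ _ _ (runi m)).
- by rewrite (T _ _ _ _ _ (luni (vid X))) ?luni_runi.
Qed.

End Arrow.

(** The morphism [Γ_2 m -> Z] corresponding to a cell [m -> id_Z] under the
    adjunction [Γ_2 ⊣ Δ]. *)
Section Desc.
Variables (D : DoubleCat) (X X' Z : D) (m : Ver X X') (φ : Cell m (vid Z)).

Definition arrow_leg (x : bool) : Hom (arrow_ob X X' x) Z :=
  match x with false => top φ | true => bot φ end.

Definition arrow_cell (x y : bool) : forall h : @Hom cat2 x y,
    Cell (arrow_ver m h) (vid Z) :=
  match x, y return forall h : @Hom cat2 x y, Cell (arrow_ver m h) (vid Z) with
  | false, false => fun _ => idc (top φ)
  | false, true => fun _ => φ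
  | true, false => fun h => False_rect _ (notF h)
  | true, true => fun _ => idc (bot φ)
  end.

Program Definition arrow_cocone : Transf (arrow m) (constL cat2 Z) :=
  @MkTransf cat2 D (arrow m) (constL cat2 Z) arrow_leg arrow_cell _ _ _ _.
Next Obligation. by move=> [] [] h //=; rewrite top_idc. Qed.
Next Obligation. by move=> [] [] h //=; rewrite bot_idc. Qed.
Next Obligation. by move=> [] /=; rewrite ccomp_idl ccomp_idr. Qed.
Next Obligation.
by move=> [] [] [] h h' e //=; rewrite ?luniE // luni_runi runiE.
Qed.

Definition desc (Γ2 : LaxColimits cat2 D) : Hom (Γ2 (arrow m)) Z :=
  counit Γ2 Z ∘ fhom Γ2 arrow_cocone.

End Desc.

Section Glueing.
Variables (B : Cat) (D : FramedBicategory).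
Variables (Γ : LaxColimits B D) (Γ2 : LaxColimits cat2 D).
Variable F : NLax B D.

(** [(G, t)] is the lax functor over [F] given by [p : X -> Γ F], as witnessed
    by the cocone [j] on [G] with vertex [X]:
    - [G b] is the pullback [X_b] of [p] along [i_b], with projections [j b]
      and [t b];
    - [lver G β] is [(i_b')^* • (i_b)_*], where [s : X_b -> X_β] and
      [s' : X_b' -> X_β] are the morphisms into the pullback [X_β] of [p] along
      [Γ_2 F_β -> Γ F] induced by the [j]'s, the [t]'s and the two legs of the
      cocone on [F_β].  The last two equations say that the cells [j_β] and
      [t_β] are the canonical ones: the cell from [(i_b')^* • (i_b)_*] to the
      vertical identity on [X_β], followed by the projections of [X_β]. *)
Definition restricts_to (X : D) (p : Hom X (Γ F)) (G : NLax B D)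
    (t : Transf G F) (j : Transf G (constL B X)) : Prop :=
  (forall b, @is_pullback (HD D) X (F b) (Γ F) (G b)
     p (cocone Γ F b) (j b) (t b)) /\
  (forall (b b' : B) (β : Hom b b'),
    let c := cocone Γ2 (arrow (lver F β)) in
    exists (Xβ : D) (u : Hom Xβ X) (v : Hom Xβ (Γ2 (arrow (lver F β))))
      (s : Hom (G b) Xβ) (s' : Hom (G b') Xβ)
      (σ : SpecialIso (lver G β) (conjoint s' • companion s)),
      @is_pullback (HD D) X (Γ2 (arrow (lver F β))) (Γ F) Xβ
        p (desc (tcell (cocone Γ F) β) Γ2) u v /\
      (u ∘ s = j b /\ v ∘ s = c false ∘ t b) /\
      (u ∘ s' = j b' /\ v ∘ s' = c true ∘ t b') /\
      idc u ⊙ (frame_cell s s' ⊙ σ) = tcell j β /\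
      idc v ⊙ (frame_cell s s' ⊙ σ) = tcell c arr2 ⊙ tcell t β).

(** [D] has [B]-glueing over [F].  The cocone on the value [G] of the
    pseudo-inverse at [p] is the transpose of the counit [Γ G -> X] at [p]. *)
Definition has_glueing_over : Prop :=
  exists Ψ : PseudoInverse (slice_functor Γ F),
  forall (X : D) (p : Hom X (Γ F)),
    let P : slice (Γ F) := existT _ X p in
    let G := projT1 (Ψ P) in
    restricts_to p (projT2 (Ψ P))
      (compT (constT B (proj1_sig (pi_counit Ψ P))) (cocone Γ G)).

End Glueing.

Definition has_glueing (B : Cat) (D : FramedBicategory)
    (Γ : LaxColimits B D) (Γ2 : LaxColimits cat2 D) : Prop :=
  forall F : NLax B D, has_glueing_over Γ Γ2 F.

(* Main.v *)
Require Import Defs.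
From mathcomp Require Import all_boot all_order.
From Stdlib Require Import FunctionalExtensionality ProofIrrelevance.
From Stdlib Require Import Classical ClassicalEpsilon.
Require Import Defs.

Set Implicit Arguments.
Unset Strict Implicit.
Unset Printing Implicit Defensive.

(** Let [b] be a minimal element of [B].  The lax colimit of [F] is the collage [Γ_2 n] of a
    vertical morphism [n : F b -> T'], where [T'] is the lax colimit of [F] over the other
    elements and the restriction of [n] to [F c] is [F_bc] if [b <= c], and void otherwise.  That
    such an [n] exists and is determined by these restrictions follows from the main point: a
    vertical morphism into a collage [N = Γ_2 (C -> B)] amounts to its restrictions to [C] and [B]
    and the action of [C -> B] between them.  The vertical identity of [N] is a retract of
    [t_* • z], for a map [t : V -> N] folding a zigzag [V] of collages, each part of which sees
    only [C] or only [B]; this reduces the claim to collages of simpler vertical morphisms.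

    By induction on [B], [2]-glueing then gives for every universal cocone [i] on [F] that the
    cells [i_β] are cartesian and the legs full monomorphisms with pullbacks along them, that
    restricting along [p : X -> Γ F] gives a universal cocone, and that the squares of
    [Γ t : Γ G -> Γ F] over the legs are pullbacks.  Hence [Γ/F] is fully faithful and
    essentially surjective.  Two-dimensional universal properties reduce to one-dimensional ones,
    as 2-cells out of [Z] are maps out of the collage of the vertical identity of [Z]. *)

(** * Cartesian cells, restrictions and extensions *)

(** Nothing is assumed about colimits of vertical morphisms between fixed objects, so every
    extension of cells has to be extracted from collages. The device is always the same. The collage
    cell of [w] is cartesian, so cells into and out of [w] can be traded for morphisms between
    objects; a morphism from [X] to a collage decomposes [X] in turn, and a good choice of target
    (the collage of the identity of [X], or another cylinder) produces the decomposition that is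
    wanted. The zigzag turns compatibility with an action, a condition on a composite [n • y1], into
    agreement of two cells on a common restriction to [B0]. Void morphisms are extensions of the
    identity of the initial object, which is the colimit over the empty poset; its strictness is
    what allows pieces of a decomposition to be discarded. The induction has to carry cells and
    modules over [T'] together: modules yield [n] from its column of restrictions, cells show that
    the collage of [n] is a colimit. *)

Section Calculus.
Variable D : FramedBicategory.

(** Cartesian with respect to the functor [(top, bot)] from vertical morphisms and cells to pairs of
    objects. Uniqueness is a field of its own because it is the standard way of proving an equation
    of cells below: compose with a cartesian cell. *)
Record cart (X X' Y Y' : D) (m : Ver X X') (n : Ver Y Y') (c : Cell m n) : Prop :=
  MkCart {
  cart_ex : forall (Z Z' : D) (w : Ver Z Z') (φ : Cell w n) a b,
    top φ = top c ∘ a -> bot φ = bot c ∘ b ->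
    exists ψ : Cell w m, [/\ top ψ = a, bot ψ = b & c ⊙ ψ = φ];
  cart_uq : forall (Z Z' : D) (w : Ver Z Z') (ψ ψ' : Cell w m),
    top ψ = top ψ' -> bot ψ = bot ψ' -> c ⊙ ψ = c ⊙ ψ' -> ψ = ψ' }.

Record opcart (X X' Y Y' : D) (m : Ver X X') (n : Ver Y Y') (o : Cell m n) : Prop :=
  MkOpcart {
  opcart_ex : forall (Z Z' : D) (w : Ver Z Z') (φ : Cell m w) f g,
    top φ = f ∘ top o -> bot φ = g ∘ bot o ->
    exists ψ : Cell n w, [/\ top ψ = f, bot ψ = g & ψ ⊙ o = φ];
  opcart_uq : forall (Z Z' : D) (w : Ver Z Z') (ψ ψ' : Cell n w),
    top ψ = top ψ' -> bot ψ = bot ψ' -> ψ ⊙ o = ψ' ⊙ o -> ψ = ψ' }.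

Definition tbE := (top_ccomp, bot_ccomp, top_vcc, bot_vcc, top_iso, bot_iso,
  top_inv, bot_inv, top_cid, bot_cid, top_idc, bot_idc, top_under, bot_under,
  top_over, bot_over, top_eta, bot_eta, top_eps, bot_eps, top_alpha, bot_alpha,
  top_beta, bot_beta, comp_idl, comp_idr).

Lemma cart_comp (X X' Y Y' Z Z' : D) (m : Ver X X') (n : Ver Y Y') (k : Ver Z Z')
    (c : Cell n k) (c' : Cell m n) : cart c -> cart c' -> cart (c ⊙ c').
Proof.
move=> [ex uq] [ex' uq']; split.
  move=> W W' w φ a b; rewrite !tbE -!comp_assoc => ht hb.
  have [ψ [h1 h2 h3]] := ex _ _ _ _ _ _ ht hb.
  have [ψ' [h1' h2' h3']] := ex' _ _ _ _ _ _ h1 h2.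
  by exists ψ'; split=> //; rewrite -ccomp_assoc h3'.
move=> W W' w ψ ψ' h1 h2; rewrite -!ccomp_assoc => h3.
by apply: uq' => //; apply: uq => //; rewrite !tbE ?h1 ?h2.
Qed.

Lemma cart_cancel (X X' Y Y' Z Z' : D) (m : Ver X X') (n : Ver Y Y') (k : Ver Z Z')
    (c : Cell n k) (c' : Cell m n) : cart c -> cart (c ⊙ c') -> cart c'.
Proof.
move=> [ex uq] [ex' uq']; split.
  move=> W W' w φ a b ht hb.
  have := ex' _ _ w (c ⊙ φ) a b; rewrite !tbE ht hb !comp_assoc.
  move=> /(_ erefl erefl) [ψ [h1 h2 h3]]; exists ψ; split=> //.
  by apply: uq; rewrite ?tbE ?h1 ?h2 ?ht ?hb // ccomp_assoc.
move=> W W' w ψ ψ' h1 h2 h3; apply: uq' => //.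
by rewrite -!ccomp_assoc h3.
Qed.

Lemma cart_iso (X X' : D) (m n : Ver X X') (i : SpecialIso m n) : cart i.
Proof.
split.
  move=> W W' w φ a b; rewrite !tbE => ht hb; exists (iso_inv i ⊙ φ); split.
  - by rewrite !tbE.
  - by rewrite !tbE.
  - by rewrite ccomp_assoc iso_VK ccomp_idl.
by move=> W W' w ψ ψ' _ _; exact: iso_cancelL.
Qed.

Lemma opcart_comp (X X' Y Y' Z Z' : D) (m : Ver X X') (n : Ver Y Y') (k : Ver Z Z')
    (c : Cell n k) (c' : Cell m n) : opcart c -> opcart c' -> opcart (c ⊙ c').
Proof.
move=> [ex uq] [ex' uq']; split.
  move=> W W' w φ a b; rewrite !tbE !comp_assoc => ht hb.
  have [ψ [h1 h2 h3]] := ex' _ _ _ _ _ _ ht hb.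
  have [ψ' [h1' h2' h3']] := ex _ _ _ _ _ _ h1 h2.
  by exists ψ'; split=> //; rewrite ccomp_assoc h3'.
move=> W W' w ψ ψ' h1 h2; rewrite !ccomp_assoc => h3.
by apply: uq => //; apply: uq' => //; rewrite !tbE ?h1 ?h2.
Qed.

Lemma opcart_iso (X X' : D) (m n : Ver X X') (i : SpecialIso m n) : opcart i.
Proof.
split.
  move=> W W' w φ a b; rewrite !tbE => ht hb; exists (φ ⊙ iso_inv i); split.
  - by rewrite !tbE.
  - by rewrite !tbE.
  - by rewrite -ccomp_assoc iso_K ccomp_idr.
by move=> W W' w ψ ψ' _ _; exact: iso_cancelR.
Qed.

Definition iso_sym (X X' : D) (m n : Ver X X') (i : SpecialIso m n) :
  SpecialIso n m := MkSpecialIso (top_inv i) (bot_inv i) (top_iso i) (bot_iso i)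
    (iso_VK i) (iso_K i).

Lemma cart_unique (X X' Y Y' : D) (m m' : Ver X X') (n : Ver Y Y')
    (c : Cell m n) (c' : Cell m' n) :
  cart c -> cart c' -> top c = top c' -> bot c = bot c' ->
  exists i : SpecialIso m m', c' ⊙ i = c.
Proof.
move=> C C' ht hb.
have [i [i1 i2 i3]] : exists i, [/\ top i = idm X, bot i = idm X' & c' ⊙ i = c].
  by apply: (cart_ex C'); rewrite comp_idr.
have [j [j1 j2 j3]] : exists i, [/\ top i = idm X, bot i = idm X' & c ⊙ i = c'].
  by apply: (cart_ex C); rewrite comp_idr.
have ji : j ⊙ i = cid m.
  apply: (cart_uq C); rewrite ?tbE ?i1 ?i2 ?j1 ?j2 ?comp_idl //.
  by rewrite ccomp_assoc j3 i3 ccomp_idr.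
have ij : i ⊙ j = cid m'.
  apply: (cart_uq C'); rewrite ?tbE ?i1 ?i2 ?j1 ?j2 ?comp_idl //.
  by rewrite ccomp_assoc i3 j3 ccomp_idr.
by exists (MkSpecialIso i1 i2 j1 j2 ji ij).
Qed.

Lemma opcart_unique (X X' Y Y' : D) (m : Ver X X') (n n' : Ver Y Y')
    (c : Cell m n) (c' : Cell m n') :
  opcart c -> opcart c' -> top c = top c' -> bot c = bot c' ->
  exists i : SpecialIso n n', i ⊙ c = c'.
Proof.
move=> C C' ht hb.
have [i [i1 i2 i3]] : exists i, [/\ top i = idm Y, bot i = idm Y' & i ⊙ c = c'].
  by apply: (opcart_ex C); rewrite comp_idl.
have [j [j1 j2 j3]] : exists i, [/\ top i = idm Y, bot i = idm Y' & i ⊙ c' = c].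
  by apply: (opcart_ex C'); rewrite comp_idl.
have ji : j ⊙ i = cid n.
  apply: (opcart_uq C); rewrite ?tbE ?i1 ?i2 ?j1 ?j2 ?comp_idl //.
  by rewrite -ccomp_assoc i3 j3 ccomp_idl.
have ij : i ⊙ j = cid n'.
  apply: (opcart_uq C'); rewrite ?tbE ?i1 ?i2 ?j1 ?j2 ?comp_idl //.
  by rewrite -ccomp_assoc j3 i3 ccomp_idl.
by exists (MkSpecialIso i1 i2 j1 j2 ji ij).
Qed.

Lemma cid_composable (X X' X'' : D) (n : Ver X' X'') (m : Ver X X') :
  bot (cid m) = top (cid n).
Proof. by rewrite !tbE. Qed.

(** Counterpart of [luni_assoc] for the right unit. Composition with an identity is faithful by
    naturality of [runi], so the equation is checked after it, where pentagon and triangle prove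
    it. *)
Lemma runi_assoc (X X' X'' : D) (n : Ver X' X'') (m : Ver X X') e :
  vcc (cid n) (runi m) e ⊙ assoc n m (vid X) = runi (n • m).
Proof.
set I := vid X.
have f0 : (forall (p q : Ver X X'') (a b : Cell p q) ea eb,
    vcc a (cid I) ea = vcc b (cid I) eb -> a = b).
  move=> p q a b ea eb h.
  have ea' : bot (idc (idm X)) = top a by rewrite idc_id.
  have eb' : bot (idc (idm X)) = top b by rewrite idc_id.
  have : vcc a (idc (idm X)) ea' = vcc b (idc (idm X)) eb'.
    transitivity (vcc a (cid I) ea); first by apply: vcc_eq; rewrite ?idc_id.
    by rewrite h; apply: vcc_eq; rewrite ?idc_id.
  by move=> /(f_equal (fun x => runi q ⊙ x)); rewrite !runiE; exact: iso_cancelR.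
have e1 : bot (cid I) = top (vcc (cid n) (runi m) e ⊙ assoc n m I) by rewrite !tbE.
have e2 : bot (cid I) = top (runi (n • m)) by rewrite !tbE.
apply: (f0 _ _ _ _ e1 e2).
apply: (iso_cancelL (i := assoc n m I)).
have e3 : bot (luni I) = top (cid (n • m)) by rewrite !tbE.
have e4 : bot (luni I) = top (cid m) by rewrite !tbE.
have e4' : bot (vcc (cid m) (luni I) e4) = top (cid n) by rewrite !tbE.
have e5 : bot (luni I) = top (vcc (cid n) (cid m) (cid_composable n m)).
  by rewrite !tbE.
have e6 : bot (assoc m I I) = top (cid n) by rewrite !tbE.
have e7 : bot (cid I) = top (assoc n m I) by rewrite !tbE.
have e8 : bot (cid I) = top (runi m) by rewrite !tbE.
have e9 : bot (vcc (runi m) (cid I) e8) = top (cid n) by rewrite !tbE.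
have e10 : bot (cid I) = top (vcc (cid n) (runi m) e) by rewrite !tbE.
have e11 : bot (vcc (cid m) (luni I) e4 ⊙ assoc m I I) = top (cid n ⊙ cid n).
  by rewrite !tbE.
have e12 : bot (cid I ⊙ cid I) = top (vcc (cid n) (runi m) e ⊙ assoc n m I).
  by rewrite !tbE.
rewrite -(triangle _ _ e3).
have -> : vcc (cid (n • m)) (luni I) e3
    = vcc (vcc (cid n) (cid m) (cid_composable n m)) (luni I) e5.
  by apply: vcc_eq => //; rewrite vcc_cid.
rewrite ccomp_assoc (assoc_nat _ _ e4 e4') -ccomp_assoc -(pentagon n m I I e6 e7).
rewrite !ccomp_assoc -(vcc_ccomp e11).
have -> : vcc (cid n ⊙ cid n) (vcc (cid m) (luni I) e4 ⊙ assoc m I I) e11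
    = vcc (cid n) (vcc (runi m) (cid I) e8) e9.
  by apply: vcc_eq; rewrite ?ccomp_idl // (triangle _ _ _ e8).
rewrite -(assoc_nat e e10) -ccomp_assoc -(vcc_ccomp e12); congr (_ ⊙ _).
by apply: vcc_eq; rewrite ?ccomp_idl.
Qed.

End Calculus.

(** * Restrictions and extensions along one side, from companions and conjoints *)

Section Restrictions.
Variable D : FramedBicategory.
Local Notation eps f := (cpn_eps (fb_cpn f)).
Local Notation eta f := (cpn_eta (fb_cpn f)).
Local Notation alpha f := (cjt_alpha (fb_cjt f)).
Local Notation beta f := (cjt_beta (fb_cjt f)).

Lemma rb_e (X Y Y' : D) (n : Ver X Y) (g : Hom Y' Y) : bot (cid n) = top (beta g).
Proof. by rewrite !tbE. Qed.
Definition rb (X Y Y' : D) (n : Ver X Y) (g : Hom Y' Y) : Cell (conjoint g • n) n :=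
  luni n ⊙ vcc (beta g) (cid n) (rb_e n g).

Lemma rt_e (X Y X' : D) (n : Ver X Y) (f : Hom X' X) : bot (eps f) = top (cid n).
Proof. by rewrite !tbE. Qed.
Definition rt (X Y X' : D) (n : Ver X Y) (f : Hom X' X) : Cell (n • companion f) n :=
  runi n ⊙ vcc (cid n) (eps f) (rt_e n f).

Lemma ob_e (X Y Y' : D) (m : Ver X Y) (g : Hom Y Y') : bot (cid m) = top (eta g).
Proof. by rewrite !tbE. Qed.
Definition ob (X Y Y' : D) (m : Ver X Y) (g : Hom Y Y') : Cell m (companion g • m) :=
  vcc (eta g) (cid m) (ob_e m g) ⊙ iso_inv (luni m).

Lemma ot_e (X Y X' : D) (m : Ver X Y) (h : Hom X X') : bot (alpha h) = top (cid m).
Proof. by rewrite !tbE. Qed.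
Definition ot (X Y X' : D) (m : Ver X Y) (h : Hom X X') : Cell m (m • conjoint h) :=
  vcc (cid m) (alpha h) (ot_e m h) ⊙ iso_inv (runi m).

Lemma top_rb (X Y Y' : D) (n : Ver X Y) (g : Hom Y' Y) : top (rb n g) = idm X.
Proof. by rewrite !tbE. Qed.
Lemma bot_rb (X Y Y' : D) (n : Ver X Y) (g : Hom Y' Y) : bot (rb n g) = g.
Proof. by rewrite !tbE. Qed.
Lemma top_rt (X Y X' : D) (n : Ver X Y) (f : Hom X' X) : top (rt n f) = f.
Proof. by rewrite !tbE. Qed.
Lemma bot_rt (X Y X' : D) (n : Ver X Y) (f : Hom X' X) : bot (rt n f) = idm Y.
Proof. by rewrite !tbE. Qed.
Lemma top_ob (X Y Y' : D) (m : Ver X Y) (g : Hom Y Y') : top (ob m g) = idm X.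
Proof. by rewrite !tbE. Qed.
Lemma bot_ob (X Y Y' : D) (m : Ver X Y) (g : Hom Y Y') : bot (ob m g) = g.
Proof. by rewrite !tbE. Qed.
Lemma top_ot (X Y X' : D) (m : Ver X Y) (h : Hom X X') : top (ot m h) = h.
Proof. by rewrite !tbE. Qed.
Lemma bot_ot (X Y X' : D) (m : Ver X Y) (h : Hom X X') : bot (ot m h) = idm Y.
Proof. by rewrite !tbE. Qed.

(** The second conjoint equation whiskered with [n]. It recovers a cell into [conjoint g • n] from
    its composite with [rb n g], which is the uniqueness half of [cart_rb]. The next three lemmas do
    the same for [rt], [ob] and [ot]. *)
Lemma rb_section (X Y Y' : D) (n : Ver X Y) (g : Hom Y' Y) e :
  vcc (alpha g) (rb n g) e = luni (conjoint g • n).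
Proof.
have e2 : bot (beta g) = top (alpha g) by rewrite !tbE.
have e3 : bot (cid n) = top (vcc (alpha g) (beta g) e2) by rewrite !tbE.
have e4 : bot (luni n) = top (cid (conjoint g)) by rewrite !tbE.
have e5 : bot (vcc (beta g) (cid n) (rb_e n g)) = top (alpha g) by rewrite !tbE.
have e6 : bot (cid n) = top (runi (conjoint g)) by rewrite !tbE.
have e7 : bot (cid n) = top (luni (conjoint g)) by rewrite !tbE.
have -> : vcc (alpha g) (rb n g) e
    = vcc (cid (conjoint g)) (luni n) e4 ⊙ vcc (alpha g) (vcc (beta g) (cid n) (rb_e n g)) e5.
  by rewrite (vccR (χ := alpha g) (χ' := rb n g) e) // ccomp_idl.
apply: (iso_cancelR (i := assoc _ _ n)).
rewrite -ccomp_assoc -(assoc_nat e2 e3) ccomp_assoc (triangle _ _ _ e6) (luni_assoc e7).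
rewrite (vccR (χ := luni (conjoint g)) (χ' := cid n) e7) ?ccomp_idl //.
by rewrite -(cjt_ver e2).
Qed.

Lemma rt_section (X Y X' : D) (n : Ver X Y) (f : Hom X' X) e :
  vcc (rt n f) (eta f) e = runi (n • companion f).
Proof.
have e2 : bot (eta f) = top (eps f) by rewrite !tbE.
have e3 : bot (vcc (eps f) (eta f) e2) = top (cid n) by rewrite !tbE.
have e4 : bot (cid (companion f)) = top (runi n) by rewrite !tbE.
have e5 : bot (eta f) = top (vcc (cid n) (eps f) (rt_e n f)) by rewrite !tbE.
have e6 : bot (luni (companion f)) = top (cid n) by rewrite !tbE.
have e7 : bot (runi (companion f)) = top (cid n) by rewrite !tbE.
have -> : vcc (rt n f) (eta f) e
    = vcc (runi n) (cid (companion f)) e4 ⊙ vcc (vcc (cid n) (eps f) (rt_e n f)) (eta f) e5.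
  by rewrite (vccR (χ := rt n f) (χ' := eta f) e) // ccomp_idl.
rewrite -(triangle _ _ e6) -ccomp_assoc (assoc_nat (rt_e n f) e5 e2 e3) ccomp_assoc.
rewrite (vccR (χ := cid n) (χ' := runi (companion f)) e7) ?ccomp_idl //.
  exact: runi_assoc.
by rewrite -(cpn_ver e2).
Qed.

Lemma ob_section (X Y Y' : D) (m : Ver X Y) (g : Hom Y Y') e :
  luni (companion g • m) ⊙ vcc (eps g) (ob m g) e = iso_cell (iso_id (companion g • m)).
Proof.
have e2 : bot (eta g) = top (eps g) by rewrite !tbE.
have e3 : bot (cid m) = top (vcc (eps g) (eta g) e2) by rewrite !tbE.
have e5 : bot (vcc (eta g) (cid m) (ob_e m g)) = top (eps g) by rewrite !tbE.
have e6 : bot (cid m) = top (luni (companion g)) by rewrite !tbE.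
have e7 : bot (luni m) = top (cid (companion g)) by rewrite !tbE.
have e8 : bot (cid m) = top (runi (companion g)) by rewrite !tbE.
have e9 : bot (ob m g ⊙ luni m) = top (eps g ⊙ cid (companion g)) by rewrite !tbE.
apply: (iso_cancelR (i := vcc_iso (i := iso_id (companion g)) (j := luni m) e7)) => /=.
rewrite -ccomp_assoc -(vcc_ccomp e9) ccomp_idl.
have -> : vcc (eps g ⊙ cid (companion g)) (ob m g ⊙ luni m) e9
   = vcc (eps g) (vcc (eta g) (cid m) (ob_e m g)) e5.
  by apply: vcc_eq; rewrite ?ccomp_idr // -ccomp_assoc iso_K ccomp_idr.
apply: (iso_cancelR (i := assoc _ _ m)).
rewrite -ccomp_assoc -(assoc_nat e2 e3) ccomp_assoc (luni_assoc e6) (triangle _ _ _ e8).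
rewrite (vccR (χ := runi (companion g)) (χ' := cid m) e8) ?ccomp_idl //.
by rewrite -(cpn_ver e2).
Qed.

Lemma ot_section (X Y X' : D) (m : Ver X Y) (h : Hom X X') e :
  runi (m • conjoint h) ⊙ vcc (ot m h) (beta h) e = iso_cell (iso_id (m • conjoint h)).
Proof.
have e2 : bot (beta h) = top (alpha h) by rewrite !tbE.
have e3 : bot (vcc (alpha h) (beta h) e2) = top (cid m) by rewrite !tbE.
have e5 : bot (beta h) = top (vcc (cid m) (alpha h) (ot_e m h)) by rewrite !tbE.
have e6 : bot (runi (conjoint h)) = top (cid m) by rewrite !tbE.
have e7 : bot (cid (conjoint h)) = top (runi m) by rewrite !tbE.
have e8 : bot (luni (conjoint h)) = top (cid m) by rewrite !tbE.
have e9 : bot (beta h ⊙ cid (conjoint h)) = top (ot m h ⊙ runi m) by rewrite !tbE.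
apply: (iso_cancelR (i := vcc_iso (i := runi m) (j := iso_id (conjoint h)) e7)) => /=.
rewrite -ccomp_assoc -(vcc_ccomp e9) ccomp_idl.
have -> : vcc (ot m h ⊙ runi m) (beta h ⊙ cid (conjoint h)) e9
   = vcc (vcc (cid m) (alpha h) (ot_e m h)) (beta h) e5.
  by apply: vcc_eq; rewrite ?ccomp_idr // -ccomp_assoc iso_K ccomp_idr.
rewrite -(triangle _ _ e8) -(runi_assoc e6) -ccomp_assoc (assoc_nat (ot_e m h) e5 e2 e3).
rewrite ccomp_assoc; congr (_ ⊙ _).
rewrite (vccR (χ := cid m) (χ' := luni (conjoint h)) e8) ?ccomp_idl //.
by rewrite -(cjt_ver e2).
Qed.

Lemma cart_rb (X Y Y' : D) (n : Ver X Y) (g : Hom Y' Y) : cart (rb n g).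
Proof.
split.
  move=> Z Z' w φ a b; rewrite top_rb bot_rb comp_idl => ht hb.
  have e : bot φ = top (alpha g ⊙ idc b) by rewrite !tbE.
  exists (vcc (alpha g ⊙ idc b) φ e ⊙ iso_inv (luni w)); split; rewrite ?tbE //.
  rewrite /rb; apply: (iso_cancelR (i := luni w)).
  rewrite -!ccomp_assoc iso_K ccomp_idr.
  have e' : bot φ = top (idc (g ∘ b)) by rewrite !tbE.
  rewrite (vccR (χ := idc (g ∘ b)) (χ' := φ) e') ?ccomp_idl //; first exact: luniE.
  by rewrite ccomp_assoc cjt_hor idc_comp.
move=> Z Z' w; suff E (ψ : Cell w (conjoint g • n)) e : ψ ⊙ luni w
    = vcc (alpha g ⊙ idc (bot ψ)) (rb n g ⊙ ψ) e.
  move=> ψ ψ' ht hb h; apply: (iso_cancelR (i := luni w)).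
  have e (x : Cell w (conjoint g • n)) : bot (rb n g ⊙ x) = top (alpha g ⊙ idc (bot x)).
    by rewrite !tbE.
  by rewrite !(E _ (e _)); apply: vcc_eq; rewrite ?hb.
have e1 : bot (rb n g) = top (alpha g) by rewrite !tbE.
have e2 : bot ψ = top (idc (bot ψ)) by rewrite !tbE.
by rewrite (vcc_ccomp e e1 e2) rb_section luni_nat.
Qed.

Lemma cart_rt (X Y X' : D) (n : Ver X Y) (f : Hom X' X) : cart (rt n f).
Proof.
split.
  move=> Z Z' w φ a b; rewrite top_rt bot_rt comp_idl => ht hb.
  have e : bot (eta f ⊙ idc a) = top φ by rewrite !tbE.
  exists (vcc φ (eta f ⊙ idc a) e ⊙ iso_inv (runi w)); split; rewrite ?tbE //.
  rewrite /rt; apply: (iso_cancelR (i := runi w)).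
  rewrite -!ccomp_assoc iso_K ccomp_idr.
  have e' : bot (idc (f ∘ a)) = top φ by rewrite !tbE.
  rewrite (vccR (χ' := idc (f ∘ a)) (χ := φ) e') ?ccomp_idl //; first exact: runiE.
  by rewrite ccomp_assoc cpn_hor idc_comp.
move=> Z Z' w; suff E (ψ : Cell w (n • companion f)) e : ψ ⊙ runi w
    = vcc (rt n f ⊙ ψ) (eta f ⊙ idc (top ψ)) e.
  move=> ψ ψ' ht hb h; apply: (iso_cancelR (i := runi w)).
  have e (x : Cell w (n • companion f)) : bot (eta f ⊙ idc (top x)) = top (rt n f ⊙ x).
    by rewrite !tbE.
  by rewrite !(E _ (e _)); apply: vcc_eq; rewrite ?ht.
have e1 : bot (eta f) = top (rt n f) by rewrite !tbE.
have e2 : bot (idc (top ψ)) = top ψ by rewrite !tbE.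
by rewrite (vcc_ccomp e e1 e2) rt_section runi_nat.
Qed.

Lemma opcart_ob (X Y Y' : D) (m : Ver X Y) (g : Hom Y Y') : opcart (ob m g).
Proof.
split.
  move=> Z Z' w φ f g'; rewrite top_ob bot_ob comp_idr => ht hb.
  have e : bot φ = top (idc g' ⊙ eps g) by rewrite !tbE.
  exists (luni w ⊙ vcc (idc g' ⊙ eps g) φ e); split; rewrite ?tbE //.
  rewrite /ob; apply: (iso_cancelR (i := luni m)).
  rewrite -!ccomp_assoc iso_K ccomp_idr.
  have e' : bot φ = top (idc (g' ∘ g)) by rewrite !tbE.
  rewrite (vccR (χ := idc (g' ∘ g)) (χ' := φ) e') ?ccomp_idr //; first exact: luniE.
  by rewrite -ccomp_assoc cpn_hor idc_comp.
move=> Z Z' w; suff E (ψ : Cell (companion g • m) w) e : ψ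
    = luni w ⊙ vcc (idc (bot ψ) ⊙ eps g) (ψ ⊙ ob m g) e.
  move=> ψ ψ' ht hb h.
  have e (x : Cell (companion g • m) w) : bot (x ⊙ ob m g) = top (idc (bot x) ⊙ eps g).
    by rewrite !tbE.
  apply: (etrans (E _ (e _))); apply: (etrans _ (esym (E _ (e _)))).
  by congr (_ ⊙ _); apply: vcc_eq; rewrite ?hb.
have e1 : bot (ob m g) = top (eps g) by rewrite !tbE.
have e2 : bot ψ = top (idc (bot ψ)) by rewrite !tbE.
rewrite (vcc_ccomp e e2 e1) ccomp_assoc luni_nat -ccomp_assoc ob_section /=.
by rewrite ccomp_idr.
Qed.

Lemma opcart_ot (X Y X' : D) (m : Ver X Y) (h : Hom X X') : opcart (ot m h).
Proof.
split.
  move=> Z Z' w φ f g'; rewrite top_ot bot_ot comp_idr => ht hb.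
  have e : bot (idc f ⊙ beta h) = top φ by rewrite !tbE.
  exists (runi w ⊙ vcc φ (idc f ⊙ beta h) e); split; rewrite ?tbE //.
  rewrite /ot; apply: (iso_cancelR (i := runi m)).
  rewrite -!ccomp_assoc iso_K ccomp_idr.
  have e' : bot (idc (f ∘ h)) = top φ by rewrite !tbE.
  rewrite (vccR (χ' := idc (f ∘ h)) (χ := φ) e') ?ccomp_idr //; first exact: runiE.
  by rewrite -ccomp_assoc cjt_hor idc_comp.
move=> Z Z' w; suff E (ψ : Cell (m • conjoint h) w) e : ψ
    = runi w ⊙ vcc (ψ ⊙ ot m h) (idc (top ψ) ⊙ beta h) e.
  move=> ψ ψ' ht hb H.
  have e (x : Cell (m • conjoint h) w) : bot (idc (top x) ⊙ beta h) = top (x ⊙ ot m h).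
    by rewrite !tbE.
  apply: (etrans (E _ (e _))); apply: (etrans _ (esym (E _ (e _)))).
  by congr (_ ⊙ _); apply: vcc_eq; rewrite ?ht.
have e1 : bot (beta h) = top (ot m h) by rewrite !tbE.
have e2 : bot (idc (top ψ)) = top ψ by rewrite !tbE.
rewrite (vcc_ccomp e e2 e1) ccomp_assoc runi_nat -ccomp_assoc ot_section /=.
by rewrite ccomp_idr.
Qed.

End Restrictions.

(** * Whiskering of (op)cartesian cells, and the action of cells into vertical identities *)

Section Actions.
Variable D : FramedBicategory.
Local Notation eps f := (cpn_eps (fb_cpn f)).
Local Notation eta f := (cpn_eta (fb_cpn f)).
Local Notation alpha f := (cjt_alpha (fb_cjt f)).
Local Notation beta f := (cjt_beta (fb_cjt f)).

(** Cartesian cells with given sides are unique up to isomorphism, so [c] may be replaced by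
    [rb n (bot c)]; associativity then identifies the whiskered cell with [rb (n • y) (bot c)]. The
    three variants that follow use [rt], [ob] and [ot]. *)
Lemma cart_vcc_cid (X Y Y' Z : D) (n' : Ver X Y') (n : Ver X Y) (c : Cell n' n)
    (y : Ver Z X) e :
  cart c -> top c = idm X -> cart (vcc c (cid y) e).
Proof.
move=> Cc tc.
have [i hi] := cart_unique Cc (cart_rb n (bot c)) (etrans tc (esym (top_rb n (bot c))))
  (esym (bot_rb n (bot c))).
have e1 : bot (cid y) = top i by rewrite !tbE.
have e2 : bot (cid y) = top (rb n (bot c)) by rewrite !tbE.
have -> : vcc c (cid y) e = vcc (rb n (bot c)) (cid y) e2 ⊙ vcc_iso (i := i) (j := iso_id y) e1.
  by apply/esym/vccR; rewrite ?hi ?ccomp_idl.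
apply: cart_comp; last exact: cart_iso.
suff -> : vcc (rb n (bot c)) (cid y) e2 = rb (n • y) (bot c) ⊙ assoc _ _ _.
  by apply: cart_comp; [exact: cart_rb | exact: cart_iso].
set g := bot c.
have e3 : bot (cid y) = top (luni n) by rewrite !tbE.
have e4 : bot (cid y) = top (vcc (beta g) (cid n) (rb_e n g)) by rewrite !tbE.
have e5 : bot (cid y) = top (cid n) by rewrite !tbE.
have e6 : bot (vcc (cid n) (cid y) e5) = top (beta g) by rewrite !tbE.
rewrite -(vccR (ψ' := luni n) (φ' := cid y) (ψ := vcc (beta g) (cid n) (rb_e n g)) (φ := cid y) _ e3 e4) ?ccomp_idl //.
rewrite -luni_assoc -ccomp_assoc (assoc_nat _ _ e5 e6) /rb !ccomp_assoc.
by congr (_ ⊙ _ ⊙ _); apply: vcc_eq; rewrite ?vcc_cid.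
Qed.

Lemma cart_cid_vcc (X X' Y Z : D) (n' : Ver X' Y) (n : Ver X Y) (c : Cell n' n)
    (y : Ver Y Z) e :
  cart c -> bot c = idm Y -> cart (vcc (cid y) c e).
Proof.
move=> Cc bc; set f := top c.
have [i hi] := cart_unique Cc (cart_rt n f) (esym (top_rt n f))
  (etrans bc (esym (bot_rt n f))).
have e1 : bot i = top (cid y) by rewrite !tbE.
have e2 : bot (rt n f) = top (cid y) by rewrite !tbE.
have -> : vcc (cid y) c e = vcc (cid y) (rt n f) e2 ⊙ vcc_iso (i := iso_id y) (j := i) e1.
  by apply/esym/vccR; rewrite ?hi ?ccomp_idl.
apply: cart_comp; last exact: cart_iso.
suff H : vcc (cid y) (rt n f) e2 ⊙ assoc _ _ _ = rt (y • n) f.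
  apply: (cart_cancel (n := y • n) (c' := vcc (cid y) (rt n f) e2) (cart_iso (iso_id _))) => /=.
  rewrite ccomp_idl.
  have -> : vcc (cid y) (rt n f) e2 = rt (y • n) f ⊙ iso_sym (assoc y n (companion f)).
    by rewrite -H -ccomp_assoc /= iso_VK ccomp_idr.
  by apply: cart_comp; [exact: cart_rt | exact: cart_iso].
have e3 : bot (runi n) = top (cid y) by rewrite !tbE.
have e4 : bot (vcc (cid n) (eps f) (rt_e n f)) = top (cid y) by rewrite !tbE.
have e5 : bot (cid n) = top (cid y) by rewrite !tbE.
have e6 : bot (eps f) = top (vcc (cid y) (cid n) e5) by rewrite !tbE.
rewrite -(vccR (φ' := runi n) (ψ' := cid y) (φ := vcc (cid n) (eps f) (rt_e n f)) (ψ := cid y) _ e3 e4) ?ccomp_idl //.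
rewrite -ccomp_assoc -(assoc_nat e5 e6) ccomp_assoc runi_assoc /rt.
by congr (_ ⊙ _); apply: vcc_eq; rewrite ?vcc_cid.
Qed.

Lemma opcart_vcc_cid (X Y Y' Z : D) (n' : Ver X Y') (n : Ver X Y) (c : Cell n n')
    (y : Ver Z X) e :
  opcart c -> top c = idm X -> opcart (vcc c (cid y) e).
Proof.
move=> Cc tc; set g := bot c.
have [i hi] := opcart_unique (opcart_ob n g) Cc (etrans (top_ob n g) (esym tc))
  (bot_ob n g).
have e1 : bot (cid y) = top i by rewrite !tbE.
have e2 : bot (cid y) = top (ob n g) by rewrite !tbE.
have -> : vcc c (cid y) e = vcc_iso (i := i) (j := iso_id y) e1 ⊙ vcc (ob n g) (cid y) e2.
  by apply/esym/vccR; rewrite ?hi ?ccomp_idl.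
apply: opcart_comp; first exact: opcart_iso.
suff H : ob (n • y) g = assoc _ _ _ ⊙ vcc (ob n g) (cid y) e2.
  have -> : vcc (ob n g) (cid y) e2 = iso_sym (assoc _ n y) ⊙ ob (n • y) g.
    by rewrite H ccomp_assoc iso_K ccomp_idl.
  by apply: opcart_comp; [exact: opcart_iso | exact: opcart_ob].
have e3 : bot (cid y) = top (luni n) by rewrite !tbE.
have e4 : bot (cid y) = top (vcc (eta g) (cid n) (ob_e n g)) by rewrite !tbE.
have e5 : bot (cid y) = top (cid n) by rewrite !tbE.
have e6 : bot (vcc (cid n) (cid y) e5) = top (eta g) by rewrite !tbE.
apply: (iso_cancelR (i := vcc_iso (i := luni n) (j := iso_id y) e3)) => /=.
rewrite -[RHS]ccomp_assoc (vccR (χ := vcc (eta g) (cid n) (ob_e n g)) (χ' := cid y) e4) ?ccomp_idl //; last first.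
  by rewrite /ob -ccomp_assoc iso_K ccomp_idr.
rewrite -luni_assoc (assoc_nat _ _ e5 e6) ccomp_assoc; congr (_ ⊙ _).
by rewrite /ob -ccomp_assoc iso_K ccomp_idr; apply: vcc_eq; rewrite ?vcc_cid.
Qed.

Lemma opcart_cid_vcc (X X' Y Z : D) (n' : Ver X' Y) (n : Ver X Y) (c : Cell n n')
    (y : Ver Y Z) e :
  opcart c -> bot c = idm Y -> opcart (vcc (cid y) c e).
Proof.
move=> Cc bc; set f := top c.
have [i hi] := opcart_unique (opcart_ot n f) Cc (top_ot n f)
  (etrans (bot_ot n f) (esym bc)).
have e1 : bot i = top (cid y) by rewrite !tbE.
have e2 : bot (ot n f) = top (cid y) by rewrite !tbE.
have -> : vcc (cid y) c e = vcc_iso (i := iso_id y) (j := i) e1 ⊙ vcc (cid y) (ot n f) e2.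
  by apply/esym/vccR; rewrite ?hi ?ccomp_idl.
apply: opcart_comp; first exact: opcart_iso.
suff H : vcc (cid y) (ot n f) e2 = assoc _ _ _ ⊙ ot (y • n) f.
  by rewrite H; apply: opcart_comp; [exact: opcart_iso | exact: opcart_ot].
have e3 : bot (runi n) = top (cid y) by rewrite !tbE.
have e4 : bot (vcc (cid n) (alpha f) (ot_e n f)) = top (cid y) by rewrite !tbE.
have e5 : bot (cid n) = top (cid y) by rewrite !tbE.
have e6 : bot (alpha f) = top (vcc (cid y) (cid n) e5) by rewrite !tbE.
apply: (iso_cancelR (i := vcc_iso (i := iso_id y) (j := runi n) e3)) => /=.
rewrite (vccR (χ := cid y) (χ' := vcc (cid n) (alpha f) (ot_e n f)) e4) ?ccomp_idl //; last first.
  by rewrite /ot -ccomp_assoc iso_K ccomp_idr.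
apply: (iso_cancelR (i := assoc y n (vid X))).
rewrite -ccomp_assoc -[X in _ = X]ccomp_assoc runi_assoc /ot -(assoc_nat e5 e6).
rewrite -ccomp_assoc; congr (_ ⊙ _).
by rewrite iso_K ccomp_idr; apply: vcc_eq; rewrite ?vcc_cid.
Qed.

Lemma cart_eps (X Y : D) (f : Hom X Y) : cart (eps f).
Proof.
have -> : eps f = rt (vid Y) f ⊙ iso_sym (luni (companion f)).
  apply: (iso_cancelR (i := luni (companion f))).
  rewrite -ccomp_assoc /= iso_K ccomp_idr /rt -luni_runi.
  have e : bot (eps f) = top (idc (idm Y)) by rewrite !tbE.
  by rewrite -(luniE e); congr (_ ⊙ _); apply: vcc_eq; rewrite ?idc_id.
by apply: cart_comp; [exact: cart_rt | exact: cart_iso].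
Qed.

Lemma cart_beta (X Y : D) (f : Hom X Y) : cart (beta f).
Proof.
have -> : beta f = rb (vid Y) f ⊙ iso_sym (runi (conjoint f)).
  apply: (iso_cancelR (i := runi (conjoint f))).
  rewrite -ccomp_assoc /= iso_K ccomp_idr /rb luni_runi.
  have e : bot (idc (idm Y)) = top (beta f) by rewrite !tbE.
  by rewrite -(runiE e); congr (_ ⊙ _); apply: vcc_eq; rewrite ?idc_id.
by apply: cart_comp; [exact: cart_rb | exact: cart_iso].
Qed.

Lemma opcart_eta (X Y : D) (f : Hom X Y) : opcart (eta f).
Proof.
have -> : eta f = runi (companion f) ⊙ ob (vid X) f.
  rewrite /ob ccomp_assoc.
  have e : bot (idc (idm X)) = top (eta f) by rewrite !tbE.
  have -> : vcc (eta f) (cid (vid X)) (ob_e (vid X) f) = vcc (eta f) (idc (idm X)) e.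
    by apply: vcc_eq; rewrite ?idc_id.
  by rewrite runiE -luni_runi -ccomp_assoc iso_VK ccomp_idr.
by apply: opcart_comp; [exact: opcart_iso | exact: opcart_ob].
Qed.

Lemma opcart_alpha (X Y : D) (f : Hom X Y) : opcart (alpha f).
Proof.
have -> : alpha f = luni (conjoint f) ⊙ ot (vid X) f.
  rewrite /ot ccomp_assoc.
  have e : bot (alpha f) = top (idc (idm X)) by rewrite !tbE.
  have -> : vcc (cid (vid X)) (alpha f) (ot_e (vid X) f) = vcc (idc (idm X)) (alpha f) e.
    by apply: vcc_eq; rewrite ?idc_id.
  by rewrite luniE luni_runi -ccomp_assoc iso_VK ccomp_idr.
by apply: opcart_comp; [exact: opcart_iso | exact: opcart_ot].
Qed.

Lemma cart_frame (X X' Y : D) (s : Hom X Y) (s' : Hom X' Y) : cart (frame_cell s s').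
Proof.
suff -> : frame_cell s s' = eps s ⊙ rb (companion s) s'.
  by apply: cart_comp; [exact: cart_eps | exact: cart_rb].
rewrite /rb ccomp_assoc -(luniE (f := idm Y)) ?tbE // => e.
rewrite -ccomp_assoc (vccR (χ := beta s') (χ' := eps s) (beta_eps s s')) ?ccomp_idr //.
by rewrite idc_id ccomp_idl.
Qed.

Lemma restriction_exists (A B X Y : D) (m : Ver X Y) (a : Hom A X) (b : Hom B Y) :
  exists w (c : Cell w m), [/\ cart c, top c = a & bot c = b].
Proof.
exists ((conjoint b • m) • companion a), (rb m b ⊙ rt (conjoint b • m) a).
by split; [apply: cart_comp; [exact: cart_rb | exact: cart_rt] | |]; rewrite !tbE.
Qed.

Lemma extension_exists (A B X Y : D) (m : Ver X Y) (a : Hom X A) (b : Hom Y B) :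
  exists w (c : Cell m w), [/\ opcart c, top c = a & bot c = b].
Proof.
exists (companion b • m • conjoint a), (ot (companion b • m) a ⊙ ob m b).
by split; [apply: opcart_comp; [exact: opcart_ot | exact: opcart_ob] | |]; rewrite !tbE.
Qed.

(** [u] is pasted below [φ] and the identity in the target is absorbed by the unit. For cells into a
    vertical identity this is their vertical composition, with the target unchanged. *)
Definition lact (X Y Z V W : D) (m : Ver X Y) (n : Ver Y Z) (w : Ver V W)
    (u : Cell n (vid W)) (φ : Cell m w) (e : bot φ = top u) : Cell (n • m) w :=
  luni w ⊙ vcc u φ e.
Definition ract (X Y Z V W : D) (m : Ver X Y) (n : Ver Y Z) (w : Ver V W)
    (φ : Cell n w) (u : Cell m (vid V)) (e : bot u = top φ) : Cell (n • m) w :=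
  runi w ⊙ vcc φ u e.

Arguments lact {X Y Z V W m n w} u φ e.
Arguments ract {X Y Z V W m n w} φ u e.

Lemma top_lact (X Y Z V W : D) (m : Ver X Y) (n : Ver Y Z) (w : Ver V W)
    (u : Cell n (vid W)) (φ : Cell m w) e : top (lact u φ e) = top φ.
Proof. by rewrite !tbE. Qed.
Lemma bot_lact (X Y Z V W : D) (m : Ver X Y) (n : Ver Y Z) (w : Ver V W)
    (u : Cell n (vid W)) (φ : Cell m w) e : bot (lact u φ e) = bot u.
Proof. by rewrite !tbE. Qed.
Lemma top_ract (X Y Z V W : D) (m : Ver X Y) (n : Ver Y Z) (w : Ver V W)
    (φ : Cell n w) (u : Cell m (vid V)) e : top (ract φ u e) = top u.
Proof. by rewrite !tbE. Qed.
Lemma bot_ract (X Y Z V W : D) (m : Ver X Y) (n : Ver Y Z) (w : Ver V W)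
    (φ : Cell n w) (u : Cell m (vid V)) e : bot (ract φ u e) = bot φ.
Proof. by rewrite !tbE. Qed.

Lemma lact_eq (X Y Z V W : D) (m : Ver X Y) (n : Ver Y Z) (w : Ver V W)
    (u u' : Cell n (vid W)) (φ φ' : Cell m w) e e' :
  u = u' -> φ = φ' -> lact u φ e = lact u' φ' e'.
Proof. by move=> h h'; rewrite /lact; congr (_ ⊙ _); exact: vcc_eq. Qed.
Lemma ract_eq (X Y Z V W : D) (m : Ver X Y) (n : Ver Y Z) (w : Ver V W)
    (φ φ' : Cell n w) (u u' : Cell m (vid V)) e e' :
  φ = φ' -> u = u' -> ract φ u e = ract φ' u' e'.
Proof. by move=> h h'; rewrite /ract; congr (_ ⊙ _); exact: vcc_eq. Qed.

Lemma lact_ract (X Y Z W : D) (m : Ver X Y) (n : Ver Y Z)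
    (u : Cell n (vid W)) (φ : Cell m (vid W)) e : lact u φ e = ract u φ e.
Proof. by rewrite /lact /ract luni_runi. Qed.

Lemma comp_lact (X Y Z V W V' W' : D) (m : Ver X Y) (n : Ver Y Z) (w : Ver V W)
    (w' : Ver V' W') (u : Cell n (vid W)) (φ : Cell m w) (ψ : Cell w w') e e' :
  ψ ⊙ lact u φ e = lact (idc (bot ψ) ⊙ u) (ψ ⊙ φ) e'.
Proof.
have e1 : bot ψ = top (idc (bot ψ)) by rewrite !tbE.
by rewrite /lact ccomp_assoc -(luniE e1) -ccomp_assoc -(vcc_ccomp e').
Qed.

Lemma comp_ract (X Y Z V W V' W' : D) (m : Ver X Y) (n : Ver Y Z) (w : Ver V W)
    (w' : Ver V' W') (φ : Cell n w) (u : Cell m (vid V)) (ψ : Cell w w') e e' :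
  ψ ⊙ ract φ u e = ract (ψ ⊙ φ) (idc (top ψ) ⊙ u) e'.
Proof.
have e1 : bot (idc (top ψ)) = top ψ by rewrite !tbE.
by rewrite /ract ccomp_assoc -(runiE e1) -ccomp_assoc -(vcc_ccomp e').
Qed.

Lemma lact_comp (X Y Z V W X' Y' Z' : D) (m : Ver X Y) (n : Ver Y Z) (w : Ver V W)
    (m' : Ver X' Y') (n' : Ver Y' Z')
    (u : Cell n (vid W)) (φ : Cell m w) (c : Cell n' n) (d : Cell m' m) e e1 e2 :
  lact u φ e ⊙ vcc c d e1 = lact (u ⊙ c) (φ ⊙ d) e2.
Proof. by rewrite /lact -ccomp_assoc -(vcc_ccomp e2). Qed.

Lemma ract_comp (X Y Z V W X' Y' Z' : D) (m : Ver X Y) (n : Ver Y Z) (w : Ver V W)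
    (m' : Ver X' Y') (n' : Ver Y' Z')
    (φ : Cell n w) (u : Cell m (vid V)) (c : Cell n' n) (d : Cell m' m) e e1 e2 :
  ract φ u e ⊙ vcc c d e1 = ract (φ ⊙ c) (u ⊙ d) e2.
Proof. by rewrite /ract -ccomp_assoc -(vcc_ccomp e2). Qed.

Lemma lact_lact (W0 X Y Z V W : D) (l : Ver W0 X) (m : Ver X Y) (n : Ver Y Z)
    (w : Ver V W) (u : Cell n (vid W)) (v : Cell m (vid W)) (φ : Cell l w) e1 e2 e3 e4 :
  lact u (lact v φ e1) e2 ⊙ assoc n m l = lact (lact u v e3) φ e4.
Proof.
have f1 : bot (luni w) = top (cid (vid W)) by rewrite !tbE.
have f2 : bot (vcc v φ e1) = top u by rewrite !tbE.
have f3 : bot (cid w) = top (runi (vid W)) by rewrite !tbE.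
have f4 : bot φ = top (vcc u v e3) by rewrite !tbE.
rewrite /lact -(vccR (ψ' := cid _) (ψ := u) (φ' := luni w) (φ := vcc v φ e1) _ f1 f2) ?ccomp_idl //.
rewrite -!ccomp_assoc -(assoc_nat e3 f4); congr (_ ⊙ _).
rewrite ccomp_assoc (triangle _ _ _ f3).
by apply: vccR; rewrite ?luni_runi ?ccomp_idl.
Qed.

Lemma lact_ract_assoc (W0 X Y Z V W : D) (l : Ver W0 X) (m : Ver X Y) (n : Ver Y Z)
    (w : Ver V W) (u : Cell n (vid W)) (φ : Cell m w) (v : Cell l (vid V)) e1 e2 e3 e4 :
  lact u (ract φ v e1) e2 ⊙ assoc n m l = ract (lact u φ e3) v e4.
Proof.
have f1 : bot (runi w) = top (idc (idm W)) by rewrite !tbE.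
have f2 : bot (vcc φ v e1) = top u by rewrite !tbE.
have f3 : bot (cid (vid V)) = top (luni w) by rewrite !tbE.
have f4 : bot v = top (vcc u φ e3) by rewrite !tbE.
rewrite /lact /ract -(vccR (ψ' := idc (idm W)) (ψ := u) (φ' := runi w) (φ := vcc φ v e1) _ f1 f2) ?idc_id ?ccomp_idl //.
rewrite -!ccomp_assoc -(assoc_nat e3 f4) [in LHS]ccomp_assoc luniE.
rewrite -ccomp_assoc (ccomp_assoc (luni _)) (luni_assoc f3); congr (_ ⊙ _).
by apply: vccR; rewrite ?ccomp_idl.
Qed.

Lemma underL (X X' Y Y' : D) (m : Ver X X') (n : Ver Y Y')
    (b : Cell (vid X') (vid Y')) (φ : Cell m n) e :
  under b φ e ⊙ luni m = lact b φ e.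
Proof. exact: underE. Qed.

Lemma overR (X X' Y Y' : D) (m : Ver X X') (n : Ver Y Y')
    (φ : Cell m n) (a : Cell (vid X) (vid Y)) e :
  over φ a e ⊙ runi m = ract φ a e.
Proof. exact: overE. Qed.

Lemma comp_under (X X' Y Y' Z Z' : D) (m : Ver X X') (n : Ver Y Y') (w : Ver Z Z')
    (b : Cell (vid X') (vid Y')) (φ : Cell m n) (ψ : Cell n w) e e' :
  ψ ⊙ under b φ e = under (idc (bot ψ) ⊙ b) (ψ ⊙ φ) e'.
Proof.
have f1 : bot ψ = top (idc (bot ψ)) by rewrite !tbE.
by rewrite (under_ccomp e' f1 e) under_idc.
Qed.

Lemma comp_over (X X' Y Y' Z Z' : D) (m : Ver X X') (n : Ver Y Y') (w : Ver Z Z')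
    (a : Cell (vid X) (vid Y)) (φ : Cell m n) (ψ : Cell n w) e e' :
  ψ ⊙ over φ a e = over (ψ ⊙ φ) (idc (top ψ) ⊙ a) e'.
Proof.
have f1 : bot (idc (top ψ)) = top ψ by rewrite !tbE.
by rewrite (over_ccomp e' f1 e) over_idc.
Qed.

Lemma under_comp (X X' Y Y' Z Z' : D) (m : Ver X X') (n : Ver Y Y') (w : Ver Z Z')
    (b : Cell (vid X') (vid Y')) (φ : Cell m n) (ψ : Cell w m) e e' :
  under b φ e ⊙ ψ = under (b ⊙ idc (bot ψ)) (φ ⊙ ψ) e'.
Proof.
have f1 : bot ψ = top (idc (bot ψ)) by rewrite !tbE.
by rewrite (under_ccomp e' e f1) under_idc.
Qed.

Lemma over_comp (X X' Y Y' Z Z' : D) (m : Ver X X') (n : Ver Y Y') (w : Ver Z Z')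
    (a : Cell (vid X) (vid Y)) (φ : Cell m n) (ψ : Cell w m) e e' :
  over φ a e ⊙ ψ = over (φ ⊙ ψ) (a ⊙ idc (top ψ)) e'.
Proof.
have f1 : bot (idc (top ψ)) = top ψ by rewrite !tbE.
by rewrite (over_ccomp e' e f1) over_idc.
Qed.

(** Fullness of [i] makes [alpha i] cartesian, by cancelling [beta i] in [beta i ⊙ alpha i = idc i].
    Thus extension along a full morphism is undone by restriction. *)
Lemma cart_ot_full (A N Z : D) (m : Ver A Z) (i : Hom A N) :
  cart (idc i) -> cart (ot m i).
Proof.
move=> Ci.
have Ca : cart (alpha i) by apply: (cart_cancel (cart_beta i)); rewrite cjt_hor.
by apply: cart_comp; [apply: cart_cid_vcc Ca _; rewrite !tbE | exact: (cart_iso (iso_sym _))].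
Qed.

End Actions.
Arguments lact {D X Y Z V W m n w} u φ e.
Arguments ract {D X Y Z V W m n w} φ u e.

(** * Collages *)

Section Glue.
Variable D : FramedBicategory.

(** [u] exhibits [X] as [Γ_2 m], the collage of [m]. *)
Definition glue (A B X : D) (m : Ver A B) (u : Cell m (vid X)) : Prop :=
  forall (Y : D) (φ : Cell m (vid Y)), exists! h : Hom X Y, idc h ⊙ u = φ.

Definition zero (Z : D) : Prop :=
  forall Y : D, (exists! h : Hom Z Y, True) /\ (forall θ θ' : Cell (vid Z) (vid Y), θ = θ').

(** The collage of a void vertical morphism is a coproduct. *)
Definition void (A B : D) (v : Ver A B) : Prop :=
  forall (Y : D) (f : Hom A Y) (g : Hom B Y),
    exists! φ : Cell v (vid Y), top φ = f /\ bot φ = g.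

Definition mono (A X : D) (e : Hom A X) : Prop :=
  forall (Z : D) (a b : Hom Z A), e ∘ a = e ∘ b -> a = b.

(** What the rest of the proof uses of [2]-glueing, in terms of individual collages. *)
Record glue_theory : Prop := MkGlueTheory {
  gt_glue : forall (A B : D) (m : Ver A B), exists (X : D) (u : Cell m (vid X)), glue u;
  gt_cart : forall (A B X : D) (m : Ver A B) (u : Cell m (vid X)), glue u -> cart u;
  gt_two : forall (A B X : D) (m : Ver A B) (u : Cell m (vid X)), glue u ->
    forall (Y : D) (h h' : Hom X Y) (θA : Cell (vid A) (vid Y)) (θB : Cell (vid B) (vid Y))
      e1 e2,
    top θA = h ∘ top u -> bot θB = h' ∘ bot u ->
    under θB (idc h ⊙ u) e1 = over (idc h' ⊙ u) θA e2 ->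
    exists! θ : Cell (vid X) (vid Y), [/\ top θ = h, bot θ = h',
      θ ⊙ idc (top u) = θA & θ ⊙ idc (bot u) = θB];
  gt_dec : forall (A B M X : D) (m : Ver A B) (u : Cell m (vid M)) (p : Hom X M), glue u ->
    exists (A' B' : D) (n : Ver A' B') (u' : Cell n (vid X)) (c : Cell n m),
      glue u' /\ idc p ⊙ u' = u ⊙ c;
  gt_pbt : forall (A B A' B' M N : D) (m : Ver A B) (u : Cell m (vid M)) (n : Ver A' B')
      (u' : Cell n (vid N)) (c : Cell n m) (p : Hom N M), glue u -> glue u' ->
    idc p ⊙ u' = u ⊙ c -> is_pullback (K := HD D) p (top u) (top u') (top c);
  gt_pbb : forall (A B A' B' M N : D) (m : Ver A B) (u : Cell m (vid M)) (n : Ver A' B')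
      (u' : Cell n (vid N)) (c : Cell n m) (p : Hom N M), glue u -> glue u' ->
    idc p ⊙ u' = u ⊙ c -> is_pullback (K := HD D) p (bot u) (bot u') (bot c);
  gt_zero : exists Z : D, zero Z }.

End Glue.

(** * Strict initial objects; legs of a collage are disjoint full monomorphisms *)

Section GlueTheory.
Variable D : FramedBicategory.
Local Notation eps f := (cpn_eps (fb_cpn f)).
Local Notation eta f := (cpn_eta (fb_cpn f)).
Local Notation alpha f := (cjt_alpha (fb_cjt f)).
Local Notation beta f := (cjt_beta (fb_cjt f)).

Lemma glue_ex (A B X Y : D) (m : Ver A B) (u : Cell m (vid X)) (φ : Cell m (vid Y)) :
  glue u -> exists h : Hom X Y, idc h ⊙ u = φ.
Proof. by move=> /(_ Y φ) [h [hh _]]; exists h. Qed.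

Lemma glue_uq (A B X Y : D) (m : Ver A B) (u : Cell m (vid X)) (h h' : Hom X Y) :
  glue u -> idc h ⊙ u = idc h' ⊙ u -> h = h'.
Proof.
move=> /(_ Y (idc h ⊙ u)) [k [_ K]] e.
by rewrite -(K h erefl); apply: K.
Qed.

Lemma idc_top (A B X Y : D) (m : Ver A B) (u : Cell m (vid X)) (φ : Cell m (vid Y)) (h : Hom X Y) :
  idc h ⊙ u = φ -> h ∘ top u = top φ.
Proof. by move=> <-; rewrite !tbE. Qed.
Lemma idc_bot (A B X Y : D) (m : Ver A B) (u : Cell m (vid X)) (φ : Cell m (vid Y)) (h : Hom X Y) :
  idc h ⊙ u = φ -> h ∘ bot u = bot φ.
Proof. by move=> <-; rewrite !tbE. Qed.

Lemma cart_invertible (A B A' B' : D) (m : Ver A B) (m' : Ver A' B') (c : Cell m' m) :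
  cart c -> is_iso (top c) -> is_iso (bot c) ->
  exists d : Cell m m', d ⊙ c = cid m' /\ c ⊙ d = cid m.
Proof.
move=> C [a' [a1 a2]] [b' [b1 b2]].
have [d [d1 d2 d3]] : exists d : Cell m m', [/\ top d = a', bot d = b' & c ⊙ d = cid m].
  by apply: (cart_ex C); rewrite !tbE.
exists d; split=> //; apply: (cart_uq C); rewrite ?tbE ?d1 ?d2 //.
by rewrite ccomp_assoc d3 ccomp_idl ccomp_idr.
Qed.

Lemma glue_comp_cart (A B A' B' X : D) (m : Ver A B) (m' : Ver A' B') (u : Cell m (vid X))
    (c : Cell m' m) :
  glue u -> cart c -> is_iso (top c) -> is_iso (bot c) -> glue (u ⊙ c).
Proof.
move=> U C ia ib Y φ; have [d [dc cd]] := cart_invertible C ia ib.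
have [h [h1 h2]] := U Y (φ ⊙ d); exists h; split.
  by rewrite ccomp_assoc h1 -ccomp_assoc dc ccomp_idr.
by move=> k; rewrite ccomp_assoc => hk; apply: h2; rewrite -hk -ccomp_assoc cd ccomp_idr.
Qed.

Lemma glue_releg (A B A' B' X : D) (m : Ver A B) (u : Cell m (vid X))
    (a : Hom A' A) (b : Hom B' B) :
  glue u -> is_iso a -> is_iso b ->
  exists (m' : Ver A' B') (u' : Cell m' (vid X)),
    [/\ glue u', top u' = top u ∘ a & bot u' = bot u ∘ b].
Proof.
move=> U ia ib; have [m' [c [C ca cb]]] := restriction_exists m a b.
exists m', (u ⊙ c); split; rewrite ?tbE ?ca ?cb //.
by apply: glue_comp_cart => //; rewrite ?ca ?cb.
Qed.

Lemma is_iso_id (A : D) : is_iso (idm A).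
Proof. by exists (idm A); rewrite !comp_idl. Qed.

Lemma is_iso_comp (A B C : D) (f : Hom A B) (g : Hom B C) :
  is_iso f -> is_iso g -> is_iso (g ∘ f).
Proof.
move=> [f' [f1 f2]] [g' [g1 g2]]; exists (f' ∘ g'); split.
  by rewrite comp_assoc -(comp_assoc f') g1 comp_idr f1.
by rewrite comp_assoc -(comp_assoc g) f2 comp_idr g2.
Qed.

Lemma iso_inverse (A B : D) (f : Hom A B) :
  is_iso f -> exists g, [/\ is_iso g, g ∘ f = idm A & f ∘ g = idm B].
Proof. by move=> [g [g1 g2]]; exists g; split=> //; exists f. Qed.

Lemma mono_comp (A B C : D) (f : Hom A B) (g : Hom B C) : mono f -> mono g -> mono (g ∘ f).
Proof. by move=> F G Z a b; rewrite -!comp_assoc => /G /F. Qed.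

Lemma mono_iso_both (A B X : D) (f : Hom A X) (g : Hom B X) (h : Hom A B) (k : Hom B A) :
  mono f -> mono g -> g ∘ h = f -> f ∘ k = g -> is_iso h.
Proof.
move=> F G h1 h2; exists k; split.
  by apply: F; rewrite comp_assoc h2 h1 comp_idr.
by apply: G; rewrite comp_assoc h1 h2 comp_idr.
Qed.

Lemma pb_lift (A B C P : D) (p : Hom A C) (q : Hom B C) (u : Hom P A) (v : Hom P B) :
  is_pullback (K := HD D) p q u v ->
  forall (Z : D) (a : Hom Z A) (b : Hom Z B), p ∘ a = q ∘ b ->
  exists w : Hom Z P, u ∘ w = a /\ v ∘ w = b.
Proof. by move=> H Z a b /(pb_hom H) [w [hw _]]; exists w. Qed.

Lemma pb_uniq (A B C P : D) (p : Hom A C) (q : Hom B C) (u : Hom P A) (v : Hom P B) :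
  is_pullback (K := HD D) p q u v ->
  forall (Z : D) (w w' : Hom Z P), u ∘ w = u ∘ w' -> v ∘ w = v ∘ w' -> w = w'.
Proof.
move=> H Z w w' h1 h2.
have e : p ∘ (u ∘ w) = q ∘ (v ∘ w).
  by have := pb_comm H => /= E; rewrite !comp_assoc; congr (_ ∘ _).
have [k [_ K]] := pb_hom H e.
by rewrite -(K w (conj erefl erefl)) (K w' (conj (esym h1) (esym h2))).
Qed.

Lemma zero_hom (Z Y : D) : zero Z -> exists h : Hom Z Y, True.
Proof. by move=> /(_ Y) [[h _] _]; exists h. Qed.

Lemma zero_uq (Z Y : D) (h h' : Hom Z Y) : zero Z -> h = h'.
Proof. by move=> /(_ Y) [[k [_ K]] _]; rewrite -(K h I) (K h' I). Qed.

Lemma zero_iso (Z Z' : D) (f : Hom Z' Z) : zero Z -> is_iso f -> zero Z'.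
Proof.
move=> Zz [g [g1 g2]] Y; have [[h _] Z2] := Zz Y; split.
  exists (h ∘ f); split=> // k _.
  by rewrite (zero_uq h (k ∘ g) Zz) -comp_assoc g1 comp_idr.
move=> θ θ'; have e := Z2 (θ ⊙ idc g) (θ' ⊙ idc g).
have := f_equal (fun x => x ⊙ idc f) e; rewrite -!ccomp_assoc -idc_comp g1 idc_id.
by rewrite !ccomp_idr.
Qed.

Variable GT : glue_theory D.

(** The initial object is strict. [O] is the collage of its own identity, with identity legs, so the
    pullback squares of the map from the collage [M] of [companion f] to [O] make both legs of [M]
    invertible, and [Z] is isomorphic to [O]. *)
Lemma zero_of_hom (Z O : D) : zero O -> Hom Z O -> zero Z.
Proof.
move=> Oz f.
have [M [u U]] := gt_glue GT (companion f).
have G0 : glue (cid (vid O)).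
  move=> Y φ; have [h _] := zero_hom Y Oz; exists h; split; first by case: (Oz Y).
  by move=> *; exact: zero_uq.
have [h hh] := glue_ex (eps f) U.
have E : idc h ⊙ u = cid (vid O) ⊙ eps f by rewrite hh ccomp_idl.
have Pb := gt_pbb GT G0 U E; have Pt := gt_pbt GT G0 U E.
rewrite !tbE in Pb Pt.
have ib : is_iso (bot u).
  have [w [w1 w2]] := pb_lift Pb (a := idm M) (b := h) (etrans (comp_idr _) (esym (comp_idl _))).
  by exists w; split=> //; apply: zero_uq.
have it : is_iso (top u).
  have [w [w1 w2]] := pb_lift Pt (a := idm M) (b := h) (etrans (comp_idr _) (esym (comp_idl _))).
  exists w; split=> //; apply: (pb_uniq Pt); first by rewrite comp_assoc w1 comp_idl comp_idr.
  by rewrite comp_assoc w2 (idc_top hh) !tbE.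
have [g [gi _ _]] := iso_inverse ib.
by apply: (zero_iso Oz (f := g ∘ top u)); exact: is_iso_comp.
Qed.

(** A cell out of [conjoint f] is determined by its sides and its composite with [alpha f]. When [Z]
    is zero that composite carries no information, and only a morphism out of [A] remains. *)
Lemma glue_beta_zero (Z A : D) (f : Hom Z A) : zero Z -> glue (beta f).
Proof.
move=> Zz Y φ; exists (top φ); split; last by move=> h <-; rewrite !tbE.
apply: (opcart_uq (opcart_alpha f)); rewrite ?tbE //; first exact: zero_uq.
by case: (Zz Y).
Qed.

Arguments glue_beta_zero [Z A] f _.

Lemma glue_eps_zero (Z A : D) (f : Hom Z A) : zero Z -> glue (eps f).
Proof.
move=> Zz Y φ; exists (bot φ); split; last by move=> h <-; rewrite !tbE.
apply: (opcart_uq (opcart_eta f)); rewrite ?tbE //; first exact: zero_uq.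
by case: (Zz Y).
Qed.

Arguments glue_eps_zero [Z A] f _.

(** [u] factors through [beta (bot u)], whose collage is again [M] and whose top leg is the
    identity. The pullback square of the identity of [M] over this leg has [top u] as both
    projections. *)
Lemma zero_bot_iso (A Z M : D) (y : Ver A Z) (u : Cell y (vid M)) :
  zero Z -> glue u -> is_iso (top u).
Proof.
move=> Zz U.
have [c [ct cb cc]] : exists c, [/\ top c = top u, bot c = idm Z & beta (bot u) ⊙ c = u].
  by apply: (cart_ex (cart_beta (bot u))); rewrite !tbE.
have E : idc (idm M) ⊙ u = beta (bot u) ⊙ c by rewrite cc idc_id ccomp_idl.
have P := gt_pbt GT (glue_beta_zero _ Zz) U E; rewrite !tbE ct in P.
have [w [w1 w2]] := pb_lift P (a := idm M) (b := idm M) erefl.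
exists w; split=> //; apply: (pb_uniq P);
by rewrite comp_assoc w1 comp_idl comp_idr.
Qed.

Lemma zero_top_iso (Z B M : D) (y : Ver Z B) (u : Cell y (vid M)) :
  zero Z -> glue u -> is_iso (bot u).
Proof.
move=> Zz U.
have [c [ct cb cc]] : exists c, [/\ top c = idm Z, bot c = bot u & eps (top u) ⊙ c = u].
  by apply: (cart_ex (cart_eps (top u))); rewrite !tbE.
have E : idc (idm M) ⊙ u = eps (top u) ⊙ c by rewrite cc idc_id ccomp_idl.
have P := gt_pbb GT (glue_eps_zero _ Zz) U E; rewrite !tbE cb in P.
have [w [w1 w2]] := pb_lift P (a := idm M) (b := idm M) erefl.
exists w; split=> //; apply: (pb_uniq P);
by rewrite comp_assoc w1 comp_idl comp_idr.
Qed.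

Section Legs.
Variables (A B M : D) (m : Ver A B) (u : Cell m (vid M)).
Hypothesis U : glue u.

(** The conjoint of [oA] has collage [A], the companion of [oB] has collage [B], and these map to
    the collage of [m] by [top u] and [bot u]. Their pullback squares show that the kernel pairs of
    the legs are trivial and that the legs meet in the zero object. *)
Lemma legs_mono_disjoint :
  [/\ mono (top u), mono (bot u) &
      forall (Z : D) (a : Hom Z A) (b : Hom Z B), top u ∘ a = bot u ∘ b -> zero Z].
Proof.
have [O Oz] := gt_zero GT.
have [oA _] := zero_hom A Oz; have [oB _] := zero_hom B Oz.
have [w [wt wb wu]] : exists w : Cell (vid O) m, [/\ top w = oA, bot w = oB &
    u ⊙ w = idc (top u ∘ oA)].
  by apply: (cart_ex (gt_cart GT U)); rewrite ?tbE //; exact: zero_uq.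
have [c [ct cb co]] : exists c : Cell (conjoint oA) m, [/\ top c = idm A, bot c = oB & c ⊙ alpha oA = w].
  by apply: (opcart_ex (opcart_alpha oA)); rewrite ?tbE.
have [d [dt db _]] : exists c : Cell (companion oB) m, [/\ top c = oA, bot c = idm B & c ⊙ eta oB = w].
  by apply: (opcart_ex (opcart_eta oB)); rewrite ?tbE.
have [h hh] := glue_ex (u ⊙ c) (glue_beta_zero oA Oz).
have [k kk] := glue_ex (u ⊙ d) (glue_eps_zero oB Oz).
have ht : h = top u by have := idc_top hh; rewrite !tbE ct comp_idr.
have kb : k = bot u by have := idc_bot kk; rewrite !tbE db comp_idr.
subst h k.
have P1 := gt_pbt GT U (glue_beta_zero oA Oz) hh; rewrite !tbE ct in P1.
have P2 := gt_pbb GT U (glue_eps_zero oB Oz) kk; rewrite !tbE db in P2.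
have P3 := gt_pbb GT U (glue_beta_zero oA Oz) hh; rewrite !tbE cb in P3.
split.
- move=> Z a b /(pb_lift P1) [w1 [h1 h2]]; by rewrite -h1 -h2.
- move=> Z a b /(pb_lift P2) [w1 [h1 h2]]; by rewrite -h1 -h2.
- move=> Z a b /(pb_lift P3) [w1 _]; exact: zero_of_hom Oz w1.
Qed.

Lemma top_mono : mono (top u). Proof. by case: legs_mono_disjoint. Qed.
Lemma bot_mono : mono (bot u). Proof. by case: legs_mono_disjoint. Qed.
Lemma legs_disjoint (Z : D) (a : Hom Z A) (b : Hom Z B) :
  top u ∘ a = bot u ∘ b -> zero Z.
Proof. by case: legs_mono_disjoint => _ _; apply. Qed.

End Legs.

Lemma split (A B M X : D) (m : Ver A B) (u : Cell m (vid M)) (p : Hom X M) : glue u ->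
  exists (A' B' : D) (n : Ver A' B') (u' : Cell n (vid X)) (c : Cell n m),
    [/\ glue u', idc p ⊙ u' = u ⊙ c, is_pullback (K := HD D) p (top u) (top u') (top c)
      & is_pullback (K := HD D) p (bot u) (bot u') (bot c)].
Proof.
move=> U; have [A' [B' [n [u' [c [U' e]]]]]] := gt_dec GT p U.
exists A', B', n, u', c; split=> //; [exact: gt_pbt e | exact: gt_pbb e].
Qed.

Lemma zero_glue (A B M : D) (m : Ver A B) (u : Cell m (vid M)) :
  glue u -> zero A -> zero B -> zero M.
Proof.
move=> U Az Bz; have [g [gi _ _]] := iso_inverse (zero_bot_iso Bz U).
exact: zero_iso Az gi.
Qed.

(** Let [h : X -> M] correspond to [φ] on the collage [X] of [w]. Both legs of [X] land in the part
    of [X] over [A]. So the part over [B] meets each leg in zero and is itself zero; then [X] is its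
    own part over [A], and [h] factors through [top u]. *)
Lemma full_top (A B M : D) (m : Ver A B) (u : Cell m (vid M)) :
  glue u -> cart (idc (top u)).
Proof.
move=> U; split.
  move=> Z Z' w φ a b; rewrite !tbE => ta tb.
  have [X [v V]] := gt_glue GT w.
  have [h hh] := glue_ex φ V.
  have [X0 [X1 [n [u' [c [U' e P0 P1]]]]]] := split h U.
  have [a0 [a1 _]] := pb_lift P0 (etrans (idc_top hh) ta).
  have [b0 [b1 _]] := pb_lift P0 (etrans (idc_bot hh) tb).
  have [E0 [E1 [k [x [d [Xg e' _ _]]]]]] := split (bot u') V.
  have z0 : zero E0.
    apply: (legs_disjoint U' (a := a0 ∘ top d) (b := top x)).
    by rewrite comp_assoc a1; have := f_equal top e'; rewrite !tbE.
  have z1 : zero E1.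
    apply: (legs_disjoint U' (a := b0 ∘ bot d) (b := bot x)).
    by rewrite comp_assoc b1; have := f_equal bot e'; rewrite !tbE.
  have z := zero_glue Xg z0 z1.
  have [g [g1 g2]] := zero_bot_iso z U'.
  exists (idc (top c ∘ g) ⊙ v).
  have K : top u ∘ (top c ∘ g) = h.
    have /= := pb_comm P0; rewrite comp_assoc => <-.
    by rewrite -comp_assoc g2 comp_idr.
  split; rewrite ?tbE.
  - by apply: (top_mono U); rewrite comp_assoc K (idc_top hh).
  - by apply: (top_mono U); rewrite comp_assoc K (idc_bot hh).
  - by rewrite ccomp_assoc -idc_comp K.
move=> Z Z' w ψ ψ' _ _ e.
have [X [v V]] := gt_glue GT w.
have [h hh] := glue_ex ψ V; have [h' hh'] := glue_ex ψ' V.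
suff E : h = h' by rewrite -hh -hh' E.
apply: (top_mono U); apply: (glue_uq V).
by rewrite !idc_comp -!ccomp_assoc hh hh'.
Qed.

Lemma full_bot (A B M : D) (m : Ver A B) (u : Cell m (vid M)) :
  glue u -> cart (idc (bot u)).
Proof.
move=> U; split.
  move=> Z Z' w φ a b; rewrite !tbE => ta tb.
  have [X [v V]] := gt_glue GT w.
  have [h hh] := glue_ex φ V.
  have [X0 [X1 [n [u' [c [U' e P0 P1]]]]]] := split h U.
  have [a0 [a1 _]] := pb_lift P1 (etrans (idc_top hh) ta).
  have [b0 [b1 _]] := pb_lift P1 (etrans (idc_bot hh) tb).
  have [E0 [E1 [k [x [d [Xg e' _ _]]]]]] := split (top u') V.
  have z0 : zero E0.
    apply: (legs_disjoint U' (b := a0 ∘ top d) (a := top x)).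
    by rewrite comp_assoc a1; have := f_equal top e'; rewrite !tbE.
  have z1 : zero E1.
    apply: (legs_disjoint U' (b := b0 ∘ bot d) (a := bot x)).
    by rewrite comp_assoc b1; have := f_equal bot e'; rewrite !tbE.
  have z := zero_glue Xg z0 z1.
  have [g [g1 g2]] := zero_top_iso z U'.
  exists (idc (bot c ∘ g) ⊙ v).
  have K : bot u ∘ (bot c ∘ g) = h.
    have /= := pb_comm P1; rewrite comp_assoc => <-.
    by rewrite -comp_assoc g2 comp_idr.
  split; rewrite ?tbE.
  - by apply: (bot_mono U); rewrite comp_assoc K (idc_top hh).
  - by apply: (bot_mono U); rewrite comp_assoc K (idc_bot hh).
  - by rewrite ccomp_assoc -idc_comp K.
move=> Z Z' w ψ ψ' _ _ e.
have [X [v V]] := gt_glue GT w.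
have [h hh] := glue_ex ψ V; have [h' hh'] := glue_ex ψ' V.
suff E : h = h' by rewrite -hh -hh' E.
apply: (bot_mono U); apply: (glue_uq V).
by rewrite !idc_comp -!ccomp_assoc hh hh'.
Qed.

End GlueTheory.
Arguments glue_beta_zero {D} [Z A] f _.
Arguments glue_eps_zero {D} [Z A] f _.

(** * Void vertical morphisms *)

Section Void.
Variable D : FramedBicategory.
Local Notation eps f := (cpn_eps (fb_cpn f)).
Local Notation eta f := (cpn_eta (fb_cpn f)).
Local Notation alpha f := (cjt_alpha (fb_cjt f)).
Local Notation beta f := (cjt_beta (fb_cjt f)).
Variable GT : glue_theory D.

Lemma void_ex (A B Y : D) (v : Ver A B) (f : Hom A Y) (g : Hom B Y) :
  void v -> exists φ : Cell v (vid Y), top φ = f /\ bot φ = g.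
Proof. by move=> /(_ Y f g) [φ [h _]]; exists φ. Qed.

Lemma void_uq (A B Y : D) (v : Ver A B) (φ φ' : Cell v (vid Y)) :
  void v -> top φ = top φ' -> bot φ = bot φ' -> φ = φ'.
Proof.
move=> /(_ Y (top φ) (bot φ)) [ψ [_ K]] h1 h2.
by rewrite -(K φ (conj erefl erefl)); apply: K; split.
Qed.

(** The extension of the identity of the initial object along its maps to [A] and [B]: a cell out of
    it is given by its sides alone. *)
Lemma void_exists (A B : D) : exists v : Ver A B, void v.
Proof.
have [O Oz] := gt_zero GT.
have [a _] := zero_hom A Oz; have [b _] := zero_hom B Oz.
have [v [o [Oo ta tb]]] := extension_exists (vid O) a b.
exists v => Y f g.
have [φ [h1 h2 h3]] : exists φ : Cell v (vid Y), [/\ top φ = f, bot φ = g & φ ⊙ o = idc (f ∘ a)].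
  by apply: (opcart_ex Oo); rewrite !tbE ?ta // tb; exact: zero_uq.
exists φ; split=> // ψ [k1 k2]; apply: (opcart_uq Oo); rewrite ?h1 ?h2 //.
by case: (Oz Y).
Qed.

Lemma void_zero_top (A B : D) (v : Ver A B) : zero A -> void v.
Proof.
move=> Az Y f g.
have [M [u U]] := gt_glue GT v.
have [k [ki k1 k2]] := iso_inverse (zero_top_iso GT Az U).
exists (idc (g ∘ k) ⊙ u); split.
  by split; rewrite !tbE; [exact: zero_uq | rewrite -comp_assoc k1 comp_idr].
move=> φ [h1 h2]; have [F hF] := glue_ex φ U; rewrite -hF.
by have := idc_bot hF; rewrite h2 => <-; rewrite -comp_assoc k2 comp_idr.
Qed.

Lemma coproduct_exists (A B : D) : exists (S : D) (s0 : Hom A S) (s1 : Hom B S) (v : Ver A B)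
  (u : Cell v (vid S)), [/\ void v, glue u, top u = s0 & bot u = s1].
Proof.
have [v V] := void_exists A B; have [S [u U]] := gt_glue GT v.
by exists S, (top u), (bot u), v, u.
Qed.

Lemma void_glue_ex (A B S Y : D) (v : Ver A B) (u : Cell v (vid S)) (f : Hom A Y) (g : Hom B Y) :
  void v -> glue u -> exists h : Hom S Y, h ∘ top u = f /\ h ∘ bot u = g.
Proof.
move=> V U; have [φ [<- <-]] := void_ex f g V.
by have [h hh] := glue_ex φ U; exists h; rewrite (idc_top hh) (idc_bot hh).
Qed.

Lemma void_glue_uq (A B S Y : D) (v : Ver A B) (u : Cell v (vid S)) (h h' : Hom S Y) :
  void v -> glue u -> h ∘ top u = h' ∘ top u -> h ∘ bot u = h' ∘ bot u -> h = h'.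
Proof.
by move=> V U e1 e2; apply: (glue_uq U); apply: void_uq => //; rewrite !tbE.
Qed.

Lemma void_glue_swap (A B S : D) (v : Ver A B) (u : Cell v (vid S)) (v' : Ver B A)
    (u' : Cell v' (vid S)) :
  void v -> glue u -> void v' -> top u' = bot u -> bot u' = top u -> glue u'.
Proof.
move=> V U V' t b Y φ; have [h [h1 h2]] := void_glue_ex (bot φ) (top φ) V U.
exists h; split; first by apply: (void_uq V'); rewrite !tbE ?t ?b.
move=> k hk; apply: (void_glue_uq V U); rewrite ?h1 ?h2 -?t -?b.
  by rewrite (idc_bot hk).
by rewrite (idc_top hk).
Qed.

(** Cells of a collage run from [A] to [B], while [w] runs backwards. The collage [X] of [v]
    therefore decomposes over [M] in the opposite order, [V'] before [V]. This second collage
    structure is used to factor [uv] through the coproduct [S] of [V'] and [V]. *)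
Lemma void_of_disjoint (A B M V V' : D) (m : Ver A B) (u : Cell m (vid M)) (v : Ver V V')
    (w : Cell v (vid M)) (f : Hom V B) (g : Hom V' A) :
  glue u -> top w = bot u ∘ f -> bot w = top u ∘ g -> void v.
Proof.
move=> U tw bw.
have [X [uv UV]] := gt_glue GT v; have [h hh] := glue_ex w UV.
have [X0 [X1 [n [u' [c [U' _ P0 P1]]]]]] := split GT h U.
have [a1 [ha1 _]] := pb_lift P1 (etrans (idc_top hh) tw).
have [b0 [hb0 _]] := pb_lift P0 (etrans (idc_bot hh) bw).
(* The part of [X] over [A] is the leg [V']: it meets the leg [V] in zero, as [V] lies over [B].
   Likewise the part over [B] is [V]. *)
have ib0 : is_iso b0.
  have [E0 [E1 [k [x [d [Ug e _ _]]]]]] := split GT (top u') UV.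
  have z0 : zero E0.
    apply: (legs_disjoint GT U' (a := top x) (b := a1 ∘ top d)).
    by rewrite comp_assoc ha1; have := f_equal top e; rewrite !tbE.
  have [r [_ r1 r2]] := iso_inverse (zero_top_iso GT z0 Ug).
  apply: (mono_iso_both (bot_mono GT UV) (top_mono GT U') hb0 (k := bot d ∘ r)).
  rewrite comp_assoc; have := f_equal bot e; rewrite !tbE => <-.
  by rewrite -comp_assoc r2 comp_idr.
have ia1 : is_iso a1.
  have [E0 [E1 [k [x [d [Ug e _ _]]]]]] := split GT (bot u') UV.
  have z1 : zero E1.
    apply: (legs_disjoint GT U' (a := b0 ∘ bot d) (b := bot x)).
    by rewrite comp_assoc hb0; have := f_equal bot e; rewrite !tbE.
  have [r [_ r1 r2]] := iso_inverse (zero_bot_iso GT z1 Ug).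
  apply: (mono_iso_both (top_mono GT UV) (bot_mono GT U') ha1 (k := top d ∘ r)).
  rewrite comp_assoc; have := f_equal top e; rewrite !tbE => <-.
  by rewrite -comp_assoc r2 comp_idr.
have [n2 [u2 [U2 t2 b2]]] := glue_releg U' ib0 ia1.
rewrite hb0 in t2; rewrite ha1 in b2; clear h hh ib0 ia1 hb0 ha1 P0 P1 c U'.
have [S [s0 [s1 [s [us [Vs Us ts bs]]]]]] := coproduct_exists V' V.
have [p [hp0 hp1]] := void_glue_ex (bot uv) (top uv) Vs Us; rewrite ts bs in hp0 hp1.
(* [O] is [S] followed by a second copy of [V], with all cells that exist in [X]. The collapse [cO]
   has a section [ξ], which keeps [V'] in [S] and sends [V] to the second copy. The image of [uv]
   under [ξ], preceded by the 2-cell [uo ⊙ δ] between the two copies of [V], has both sides in [S]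
   and descends to [S] by fullness. *)
have [o [co [Co tco bco]]] := restriction_exists (vid X) p (top uv).
have [O [uo UO]] := gt_glue GT o.
have [cO hcO] := glue_ex co UO.
have [κ [κt κb κe]] : exists κ, [/\ top κ = s0, bot κ = idm V & co ⊙ κ = u2].
  by apply: (cart_ex Co); rewrite ?tbE ?tco ?bco ?hp0.
have [ξ hξ] := glue_ex (uo ⊙ κ) U2.
have cξ : cO ∘ ξ = idm X.
  apply: (glue_uq U2); rewrite idc_comp -ccomp_assoc hξ ccomp_assoc hcO κe.
  by rewrite idc_id ccomp_idl.
have [δ [δt δb δe]] : exists δ, [/\ top δ = s1, bot δ = idm V & co ⊙ δ = idc (top uv)].
  by apply: (cart_ex Co); rewrite ?tbE ?tco ?bco ?hp1.
have e1 : bot (uo ⊙ δ) = top (idc ξ ⊙ uv).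
  by rewrite !tbE δb comp_idr -b2 (idc_bot hξ) !tbE κb comp_idr.
have [cS [cSt cSb cSe]] : exists cS : Cell v (vid S), [/\ top cS = s1, bot cS = s0 &
    idc (top uo) ⊙ cS = over (idc ξ ⊙ uv) (uo ⊙ δ) e1].
  apply: (cart_ex (full_top GT UO)); rewrite ?tbE ?δt //.
  by rewrite -t2 (idc_top hξ) !tbE κt.
have e2 : bot (idc (top uv)) = top uv by rewrite !tbE.
have pS : idc p ⊙ cS = uv.
  have -> : idc p = idc cO ⊙ idc (top uo) by rewrite -idc_comp (idc_top hcO) tco.
  rewrite -ccomp_assoc cSe; have e3 : bot (idc cO ⊙ (uo ⊙ δ)) = top (idc cO ⊙ (idc ξ ⊙ uv)).
    by rewrite tbE e1 [RHS]tbE !tbE.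
  have e4 : bot (idc (top (idc cO)) ⊙ (uo ⊙ δ)) = top (idc cO ⊙ (idc ξ ⊙ uv)).
    by rewrite -e3 !tbE.
  rewrite (comp_over _ e4); apply: (etrans _ (over_idc (φ := uv) e2)); apply: over_eq.
    by rewrite ccomp_assoc -idc_comp cξ idc_id ccomp_idl.
  by rewrite ccomp_assoc [top (idc cO)]top_idc hcO δe.
move=> Y fY gY; have [q [q0 q1]] := void_glue_ex gY fY Vs Us.
rewrite ts bs in q0 q1; exists (idc q ⊙ cS); split; first by rewrite !tbE cSt cSb.
move=> φ [φt φb]; have [F hF] := glue_ex φ UV.
rewrite -hF -pS ccomp_assoc -idc_comp; congr (idc _ ⊙ _).
apply: (void_glue_uq Vs Us); rewrite ?ts ?bs ?q0 ?q1 -comp_assoc ?hp0 ?hp1.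
  by rewrite (idc_bot hF).
by rewrite (idc_top hF).
Qed.

(** The collage of [v] is a coproduct, hence also the collage of a void morphism from [B] to [A].
    There [c] runs backwards, and [void_of_disjoint] applies. *)
Lemma void_of_cell (A B V V' : D) (v : Ver A B) (w : Ver V V') (c : Cell w v) :
  void v -> void w.
Proof.
move=> Vv; have [S [u U]] := gt_glue GT v.
have [v' V'v] := void_exists B A.
have [u' [t b]] := void_ex (bot u) (top u) V'v.
have U' := void_glue_swap Vv U V'v t b.
by apply: (void_of_disjoint (w := u ⊙ c) (f := top c) (g := bot c) U'); rewrite !tbE ?t ?b.
Qed.

End Void.

(** * Associativity of collages *)

Section Regroup.
Variable D : FramedBicategory.
Variable GT : glue_theory D.

(** Interchange. Together with [two_over] it says that a 2-cell out of a collage satisfies the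
    compatibility asked for in [gt_two]. *)
Lemma two_under (X Y A B : D) (σ : Cell (vid X) (vid Y)) (m : Ver A B) (ψ : Cell m (vid X)) e :
  under (σ ⊙ idc (bot ψ)) (idc (top σ) ⊙ ψ) e = σ ⊙ ψ.
Proof.
have e1 : bot (idc (top σ)) = top σ by rewrite !tbE.
by rewrite -(under_comp e1) under_over over_idc.
Qed.

Lemma two_over (X Y A B : D) (σ : Cell (vid X) (vid Y)) (m : Ver A B) (ψ : Cell m (vid X)) e :
  over (idc (bot σ) ⊙ ψ) (σ ⊙ idc (top ψ)) e = σ ⊙ ψ.
Proof.
have e1 : bot σ = top (idc (bot σ)) by rewrite !tbE.
by rewrite -(over_comp e1) -under_over under_idc.
Qed.

Lemma pb_mono_iso (A B C P : D) (p : Hom A C) (q : Hom B C) (u : Hom P A) (v : Hom P B)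
    (q0 : Hom B A) :
  is_pullback (K := HD D) p q u v -> mono p -> p ∘ q0 = q ->
  exists r : Hom B P, [/\ is_iso r, u ∘ r = q0 & v ∘ r = idm B].
Proof.
move=> H Mp e; have [r [r1 r2]] := pb_lift H (a := q0) (b := idm B) (etrans e (esym (comp_idr _))).
exists r; split=> //; exists v; split=> //.
apply: (pb_uniq H); last by rewrite comp_assoc r2 comp_idl comp_idr.
apply: Mp; have /= E := pb_comm H.
by rewrite (comp_assoc u) r1 comp_idr comp_assoc e E.
Qed.

Lemma pb_mono (A B C P : D) (p : Hom A C) (q : Hom B C) (u : Hom P A) (v : Hom P B) :
  is_pullback (K := HD D) p q u v -> mono p -> mono v.
Proof.
move=> H Mp Z a b e; apply: (pb_uniq H) => //; apply: Mp.
by have /= E := pb_comm H; rewrite !comp_assoc E -!comp_assoc e.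
Qed.

(** From [A -> {C -> B}] to [{A -> C} -> B]. The new decomposition is pulled back from the collage
    [X2] of the identity of [X] along a map [χ] sending [A] and [C] to the first copy of [X] and [B]
    to the second. *)
Lemma regroup_left (A B C N X : D) (n : Ver C B) (un : Cell n (vid N)) (x : Ver A N)
    (ux : Cell x (vid X)) :
  glue un -> glue ux ->
  exists (N' : D) (y : Ver A C) (uy : Cell y (vid N')) (v : Ver N' B) (uv : Cell v (vid X)),
    [/\ glue uy, glue uv & [/\ top uv ∘ top uy = top ux,
        top uv ∘ bot uy = bot ux ∘ top un & bot uv = bot ux ∘ bot un]].
Proof.
move=> Un Ux.
have [X2 [us Us]] := gt_glue GT (vid X).
have e1 : bot (idc (top us ∘ bot ux) ⊙ un) = top (us ⊙ idc (bot ux ∘ bot un)).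
  by rewrite !tbE comp_assoc.
have [m hm] := glue_ex (under _ _ e1) Un.
have e2 : bot (idc (top us ∘ bot ux ∘ top un)) = top (idc m ⊙ un).
  by rewrite [RHS]tbE !tbE (idc_top hm) !tbE.
(* [m] keeps [C] in the first copy and moves [B] to the second. [τ] is the 2-cell to [m] from the
   inclusion of [N] in the first copy, and pasting it below [ux] defines [χ]. *)
have [τ [[τt τb _ _] _]] : exists! θ : Cell (vid N) (vid X2),
   [/\ top θ = top us ∘ bot ux, bot θ = m, θ ⊙ idc (top un) = idc (top us ∘ bot ux ∘ top un)
     & θ ⊙ idc (bot un) = us ⊙ idc (bot ux ∘ bot un)].
  apply: (gt_two GT Un (e1 := e1) (e2 := e2)); rewrite ?tbE // ?(idc_bot hm) ?tbE //.
  by rewrite -hm over_idc.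
have e3 : bot (idc (top us) ⊙ ux) = top τ by rewrite !tbE.
have [χ hχ] := glue_ex (under _ _ e3) Ux.
have χA : χ ∘ top ux = top us ∘ top ux by rewrite (idc_top hχ) !tbE.
have χN : χ ∘ bot ux = m by rewrite (idc_bot hχ) !tbE.
have χC : χ ∘ (bot ux ∘ top un) = top us ∘ (bot ux ∘ top un).
  by rewrite comp_assoc χN (idc_top hm) !tbE comp_assoc.
have χB : χ ∘ (bot ux ∘ bot un) = bot us ∘ (bot ux ∘ bot un).
  by rewrite comp_assoc χN (idc_bot hm) !tbE.
have [X0 [X1 [v [uv [c [Uv _ P0 P1]]]]]] := split GT χ Us.
have [a0 [ha0 _]] := pb_lift P0 χA.
have [c0 [hc0 _]] := pb_lift P0 χC.
have [b1 [hb1 _]] := pb_lift P1 χB.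
have Mι := bot_mono GT Ux.
(* The part of [X] over the second copy meets neither [A] nor [C], so nothing but [B] is left of it.
   In the same way the part over the first copy misses [B]. *)
have ib1 : is_iso b1.
  have [A1 [N1 [k [w [d [W dE Q0 Q1]]]]]] := split GT (bot uv) Ux.
  have [C1 [B1 [k' [w' [d' [W' dE' Q0' Q1']]]]]] := split GT (bot d) Un.
  have /= q1 := pb_comm Q1; have /= q1' := pb_comm Q1'; have /= q0' := pb_comm Q0'.
  have zA : zero A1.
    apply: (legs_disjoint GT Uv (a := a0 ∘ top d) (b := top w)).
    by rewrite comp_assoc ha0; have /= := pb_comm Q0.
  have zC : zero C1.
    apply: (legs_disjoint GT Uv (a := c0 ∘ top d') (b := bot w ∘ top w')).
    by rewrite comp_assoc hc0 comp_assoc q1 -!comp_assoc q0'.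
  have [r [_ r1 r2]] := iso_inverse (zero_top_iso GT zA W).
  have [r' [_ r1' r2']] := iso_inverse (zero_top_iso GT zC W').
  apply: (mono_iso_both (mono_comp (bot_mono GT Un) Mι) (bot_mono GT Uv) hb1 (k := bot d' ∘ r' ∘ r)).
  rewrite 2!comp_assoc -(comp_assoc (bot ux)) -q1' -!comp_assoc (comp_assoc (bot w')) r2' comp_idl.
  by rewrite comp_assoc -q1 -comp_assoc r2 comp_idr.
have [y [uy [Uy ty by_]]] : exists (y : Ver A C) (uy : Cell y (vid X0)),
    [/\ glue uy, top uy = a0 & top uv ∘ bot uy = bot ux ∘ top un].
  have [A0 [N0 [k [w [d [W dE Q0 Q1]]]]]] := split GT (top uv) Ux.
  have [C0 [B0 [k' [w' [d' [W' dE' Q0' Q1']]]]]] := split GT (bot d) Un.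
  have /= q1 := pb_comm Q1; have /= q1' := pb_comm Q1'; have /= q0' := pb_comm Q0'.
  have [rA [irA rA1 _]] := pb_mono_iso Q0 (top_mono GT Uv) ha0.
  have zB : zero B0.
    apply: (legs_disjoint GT Uv (a := bot w ∘ bot w') (b := b1 ∘ bot d')).
    by rewrite [RHS]comp_assoc hb1 comp_assoc q1 -!comp_assoc q1'.
  have [q [_ q2]] := pb_lift Q1 hc0.
  have [rC [irC rC1 rC2]] := pb_mono_iso Q0' (pb_mono Q1 (top_mono GT Uv)) q2.
  have i2 := zero_bot_iso GT zB W'.
  have [y [uy [Uy ty by_]]] := glue_releg W irA (is_iso_comp irC i2).
  exists y, uy; split; rewrite ?ty ?rA1 // by_ comp_assoc q1 -comp_assoc (comp_assoc (bot d)) q0'.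
  by rewrite -comp_assoc rC2 comp_idr.
have [v2 [uv2 [Uv2 tv bv]]] := glue_releg Uv (is_iso_id X0) ib1.
exists X0, y, uy, v2, uv2; split=> //.
by rewrite tv bv !comp_idr ty ha0 by_ hb1.
Qed.

(** Mirror image of [regroup_left]: here [χ] keeps only [A] in the first copy of [X] and sends [C]
    and [B] to the second. *)
Lemma regroup_right (A B C N X : D) (y : Ver A C) (uy : Cell y (vid N)) (v : Ver N B)
    (uv : Cell v (vid X)) :
  glue uy -> glue uv ->
  exists (N' : D) (n : Ver C B) (un : Cell n (vid N')) (x : Ver A N') (ux : Cell x (vid X)),
    [/\ glue un, glue ux & [/\ top ux = top uv ∘ top uy,
        bot ux ∘ top un = top uv ∘ bot uy & bot ux ∘ bot un = bot uv]].
Proof.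
move=> Uy Uv.
have [X2 [us Us]] := gt_glue GT (vid X).
have e1 : bot (idc (top us ∘ top uv) ⊙ uy) = top (us ⊙ idc (top uv ∘ bot uy)).
  by rewrite !tbE comp_assoc.
have [m hm] := glue_ex (under _ _ e1) Uy.
have mt : m ∘ top uy = top us ∘ (top uv ∘ top uy) by rewrite (idc_top hm) !tbE comp_assoc.
have mb : m ∘ bot uy = bot us ∘ (top uv ∘ bot uy) by rewrite (idc_bot hm) !tbE.
have e2 : bot (us ⊙ idc (top uv ∘ top uy)) = top (idc (bot us ∘ top uv) ⊙ uy).
  by rewrite !tbE comp_assoc.
have e3 : bot (idc m ⊙ uy) = top (idc (bot us ∘ (top uv ∘ bot uy))) by rewrite !tbE.
have [τ [[τt τb _ _] _]] : exists! θ : Cell (vid N) (vid X2),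
   [/\ top θ = m, bot θ = bot us ∘ top uv, θ ⊙ idc (top uy) = us ⊙ idc (top uv ∘ top uy)
     & θ ⊙ idc (bot uy) = idc (bot us ∘ (top uv ∘ bot uy))].
  apply: (gt_two GT Uy (e1 := e3) (e2 := e2)); rewrite ?tbE // ?comp_assoc //.
  rewrite under_idc hm.
  have f1 : bot (idc (top us) ⊙ (idc (top uv) ⊙ uy)) = top (us ⊙ idc (bot (idc (top uv) ⊙ uy))).
    by rewrite !tbE.
  have f2 : bot (us ⊙ idc (top (idc (top uv) ⊙ uy))) = top (idc (bot us) ⊙ (idc (top uv) ⊙ uy)).
    by rewrite !tbE.
  have := etrans (two_under f1) (esym (two_over f2)) => E.
  apply: (etrans _ (etrans E _)).
    by apply: under_eq; rewrite ?tbE // ccomp_assoc -idc_comp.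
  by apply: over_eq; rewrite ?tbE // ccomp_assoc -idc_comp.
have e4 : bot τ = top (idc (bot us) ⊙ uv) by rewrite !tbE.
have [χ hχ] := glue_ex (over _ _ e4) Uv.
have χN : χ ∘ top uv = m by rewrite (idc_top hχ) !tbE.
have χA : χ ∘ (top uv ∘ top uy) = top us ∘ (top uv ∘ top uy).
  by rewrite comp_assoc χN.
have χC : χ ∘ (top uv ∘ bot uy) = bot us ∘ (top uv ∘ bot uy).
  by rewrite comp_assoc χN.
have χB : χ ∘ bot uv = bot us ∘ bot uv by rewrite (idc_bot hχ) !tbE.
have [X0 [X1 [x [ux [c [Ux _ P0 P1]]]]]] := split GT χ Us.
have [a0 [ha0 _]] := pb_lift P0 χA.
have [c1 [hc1 _]] := pb_lift P1 χC.
have [b1 [hb1 _]] := pb_lift P1 χB.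
have Mι := top_mono GT Uv.
have ia0 : is_iso a0.
  have [N1 [B1 [k [w [d [W dE Q0 Q1]]]]]] := split GT (top ux) Uv.
  have [A1 [C1 [k' [w' [d' [W' dE' Q0' Q1']]]]]] := split GT (top d) Uy.
  have /= q0 := pb_comm Q0; have /= q1' := pb_comm Q1'; have /= q0' := pb_comm Q0'.
  have zB : zero B1.
    apply: (legs_disjoint GT Ux (a := bot w) (b := b1 ∘ bot d)).
    by rewrite comp_assoc hb1; have /= := pb_comm Q1.
  have zC : zero C1.
    apply: (legs_disjoint GT Ux (a := top w ∘ bot w') (b := c1 ∘ bot d')).
    by rewrite [RHS]comp_assoc hc1 comp_assoc q0 -!comp_assoc q1'.
  have [r [_ r1 r2]] := iso_inverse (zero_bot_iso GT zB W).
  have [r' [_ r1' r2']] := iso_inverse (zero_bot_iso GT zC W').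
  apply: (mono_iso_both (mono_comp (top_mono GT Uy) Mι) (top_mono GT Ux) ha0 (k := top d' ∘ r' ∘ r)).
  rewrite 2!comp_assoc -(comp_assoc (top uv)) -q0' -!comp_assoc (comp_assoc (top w')) r2' comp_idl.
  by rewrite comp_assoc -q0 -comp_assoc r2 comp_idr.
have [n [un [Un tn bn]]] : exists (n : Ver C B) (un : Cell n (vid X1)),
    [/\ glue un, bot ux ∘ top un = top uv ∘ bot uy & bot un = b1].
  have [N1 [B1 [k [w [d [W dE Q0 Q1]]]]]] := split GT (bot ux) Uv.
  have [A1 [C1 [k' [w' [d' [W' dE' Q0' Q1']]]]]] := split GT (top d) Uy.
  have /= q0 := pb_comm Q0; have /= q1' := pb_comm Q1'; have /= q0' := pb_comm Q0'.
  have [rB [irB rB1 _]] := pb_mono_iso Q1 (bot_mono GT Ux) hb1.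
  have zA : zero A1.
    apply: (legs_disjoint GT Ux (a := a0 ∘ top d') (b := top w ∘ top w')).
    by rewrite comp_assoc ha0 comp_assoc q0 -!comp_assoc q0'.
  have [q [_ q2]] := pb_lift Q0 hc1.
  have [rC [irC rC1 rC2]] := pb_mono_iso Q1' (pb_mono Q0 (bot_mono GT Ux)) q2.
  have i2 := zero_top_iso GT zA W'.
  have [n [un [Un tn bn]]] := glue_releg W (is_iso_comp irC i2) irB.
  exists n, un; split; rewrite ?bn ?rB1 // tn comp_assoc q0 -comp_assoc (comp_assoc (top d)) q1'.
  by rewrite -comp_assoc rC2 comp_idr.
have [x2 [ux2 [Ux2 tx bx]]] := glue_releg Ux ia0 (is_iso_id X1).
exists X1, n, un, x2, ux2; split=> //.
by rewrite tx bx !comp_idr ha0 tn bn hb1.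
Qed.

End Regroup.

(** * Reflections, mapping cylinders and the collage of a conjoint *)

Section Cylinders.
Variable D : FramedBicategory.
Local Notation eps f := (cpn_eps (fb_cpn f)).
Local Notation eta f := (cpn_eta (fb_cpn f)).
Local Notation alpha f := (cjt_alpha (fb_cjt f)).
Local Notation beta f := (cjt_beta (fb_cjt f)).
Variable GT : glue_theory D.

Lemma two_ex (A B X Y : D) (m : Ver A B) (u : Cell m (vid X)) (h h' : Hom X Y)
    (θA : Cell (vid A) (vid Y)) (θB : Cell (vid B) (vid Y)) e1 e2 : glue u ->
  top θA = h ∘ top u -> bot θB = h' ∘ bot u ->
  under θB (idc h ⊙ u) e1 = over (idc h' ⊙ u) θA e2 ->
  exists θ : Cell (vid X) (vid Y), [/\ top θ = h, bot θ = h',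
    θ ⊙ idc (top u) = θA & θ ⊙ idc (bot u) = θB].
Proof. by move=> U h1 h2 h3; have [θ [hθ _]] := gt_two GT U h1 h2 h3; exists θ. Qed.

Lemma two_ext (A B X Y : D) (m : Ver A B) (u : Cell m (vid X)) (θ θ' : Cell (vid X) (vid Y)) :
  glue u -> top θ = top θ' -> bot θ = bot θ' -> θ ⊙ idc (top u) = θ' ⊙ idc (top u) ->
  θ ⊙ idc (bot u) = θ' ⊙ idc (bot u) -> θ = θ'.
Proof.
move=> U ht hb hA hB.
have e1 : bot (idc (top θ) ⊙ u) = top (θ ⊙ idc (bot u)) by rewrite !tbE.
have e2 : bot (θ ⊙ idc (top u)) = top (idc (bot θ) ⊙ u) by rewrite !tbE.
have := gt_two GT U (e1 := e1) (e2 := e2); rewrite !tbE => /(_ erefl erefl).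
rewrite two_under two_over => /(_ erefl) [k [_ K]].
by rewrite -(K θ) ?(K θ').
Qed.

(** [t] is left adjoint to [s] with unit [σ] and identity counit. A cell whose bottom factors
    through [t] sends [σ] to an identity, so it is determined by its restriction along [s]. Its
    inverse construction is composition with [ρ], the factorisation through [κ] of the action of [σ]
    on [w]. *)
Lemma reflection_desc (A V N Y : D) (t : Hom V N) (s : Hom N V) (σ : Cell (vid V) (vid V))
    (w : Ver A V) (w1 : Ver A N) (κ : Cell w1 w) (φ : Cell w1 (vid Y)) :
  t ∘ s = idm N -> top σ = idm V -> bot σ = s ∘ t -> idc t ⊙ σ = idc t -> σ ⊙ idc s = idc s ->
  cart κ -> top κ = idm A -> bot κ = s ->
  exists ψ : Cell w (vid Y), [/\ bot ψ = bot φ ∘ t, ψ ⊙ κ = φ &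
    forall (ψ' : Cell w (vid Y)) (g : Hom N Y), bot ψ' = g ∘ t -> ψ' ⊙ κ = φ -> ψ' = ψ].
Proof.
move=> ts σt σb tσ σs Cκ κt κb.
have e1 : bot (cid w) = top σ by rewrite !tbE.
have [ρ [ρt ρb ρe]] : exists ρ, [/\ top ρ = idm A, bot ρ = t & κ ⊙ ρ = under σ (cid w) e1].
  by apply: (cart_ex Cκ); rewrite !tbE ?κt ?κb ?comp_idl.
have ρκ : ρ ⊙ κ = cid w1.
  apply: (cart_uq Cκ); rewrite ?tbE ?ρt ?ρb ?κt ?κb ?comp_idl //.
  rewrite ccomp_assoc ρe ccomp_idr.
  have e2 : bot (cid w ⊙ κ) = top (σ ⊙ idc (bot κ)) by rewrite !tbE σt comp_idl.
  rewrite (under_comp _ e2); have e3 : bot κ = top (idc s) by rewrite !tbE.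
  apply: (etrans _ (under_idc e3)); apply: under_eq; rewrite ?ccomp_idl ?κb //.
exists (φ ⊙ ρ); split; rewrite ?tbE ?ρb //; first by rewrite -ccomp_assoc ρκ ccomp_idr.
move=> ψ' g hb h; rewrite -h -ccomp_assoc ρe.
have e4 : bot (ψ' ⊙ cid w) = top (idc (bot ψ') ⊙ σ) by rewrite !tbE σt comp_idr.
rewrite (comp_under _ e4); apply/esym.
have e3 : bot ψ' = top (idc (g ∘ t)) by rewrite !tbE.
apply: (etrans _ (under_idc e3)); apply: under_eq; rewrite ?ccomp_idr // hb.
by rewrite idc_comp -ccomp_assoc tσ.
Qed.

(** The collage of the companion of [l] is its mapping cylinder and reflects onto the copy of [N].
    Any opcartesian [η] is allowed, so that the lemma also applies when [m] is merely isomorphic to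
    an identity. *)
Lemma cylinder (B N V : D) (l : Hom B N) (m : Ver B N) (η : Cell (vid B) m) (u : Cell m (vid V)) :
  glue u -> opcart η -> top η = idm B -> bot η = l ->
  exists (t : Hom V N) (σ : Cell (vid V) (vid V)),
    [/\ t ∘ top u = l, t ∘ bot u = idm N, idc t ⊙ u ⊙ η = idc l &
     [/\ top σ = idm V, bot σ = bot u ∘ t, idc t ⊙ σ = idc t, σ ⊙ idc (bot u) = idc (bot u)
     & σ ⊙ idc (top u) = u ⊙ η]].
Proof.
move=> U O ηt ηb.
have [ε [εt εb εe]] : exists ε : Cell m (vid N), [/\ top ε = l, bot ε = idm N & ε ⊙ η = idc l].
  by apply: (opcart_ex O); rewrite !tbE ?ηt ?ηb ?comp_idl ?comp_idr.
have [t ht] := glue_ex ε U.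
have tt : t ∘ top u = l by rewrite (idc_top ht).
have tb : t ∘ bot u = idm N by rewrite (idc_bot ht).
have e1 : bot (idc (idm V) ⊙ u) = top (idc (bot u)) by rewrite !tbE.
have e2 : bot (u ⊙ η) = top (idc (bot u ∘ t) ⊙ u) by rewrite !tbE ηb -comp_assoc tt.
have [|||σ [σt σb σA σB]] := two_ex (h := idm V) (h' := bot u ∘ t) (e1 := e1) (e2 := e2) U.
- by rewrite !tbE ηt comp_idr.
- by rewrite !tbE -comp_assoc tb comp_idr.
- rewrite under_idc idc_id ccomp_idl; apply: (opcart_uq O); rewrite ?tbE ?ηt ?comp_idr //.
    by rewrite -comp_assoc tb comp_idr.
  have e3 : bot (u ⊙ η ⊙ idc (top η)) = top (idc (bot u ∘ t) ⊙ u ⊙ η).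
    by rewrite !tbE ηt ηb !comp_idr -comp_assoc tt.
  rewrite (over_comp _ e3).
  have e4 : bot (u ⊙ η) = top (idc (bot u ∘ l)) by rewrite !tbE ηb.
  apply: (etrans (y := over (idc (bot u ∘ l)) (u ⊙ η) e4)).
    by rewrite -under_over under_idc.
  apply: over_eq; last by rewrite ηt idc_id ccomp_idr.
  by rewrite [idc (bot u ∘ t)]idc_comp -!ccomp_assoc (ccomp_assoc (idc t)) ht εe -idc_comp.
exists t, σ; split=> //; first by rewrite ht εe.
split=> //; apply: (two_ext U); rewrite ?tbE ?σt ?σb ?comp_idr //.
- by rewrite comp_assoc tb comp_idl.
- by rewrite -ccomp_assoc σA ccomp_assoc ht εe -idc_comp tt.
- by rewrite -ccomp_assoc σB.
Qed.

(** Cells from the [M] part to the [B] part of [X] are cells into [r], and [r] is already a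
    restriction of the identity of [N], so [p] loses nothing on them. *)
Lemma collapse_faithful (B M N X V W : D) (r : Ver M B) (cr : Cell r (vid N))
    (u : Cell r (vid X)) (p : Hom X N) (v : Ver V W) (a : Hom V M) (b : Hom W B)
    (ψ ψ' : Cell v (vid X)) :
  glue u -> cart cr -> idc p ⊙ u = cr -> top ψ = top u ∘ a -> bot ψ = bot u ∘ b ->
  top ψ' = top u ∘ a -> bot ψ' = bot u ∘ b -> idc p ⊙ ψ = idc p ⊙ ψ' -> ψ = ψ'.
Proof.
move=> U C hp t b1 t' b1' e.
have [c [ct cb ce]] := cart_ex (gt_cart GT U) t b1.
have [c' [ct' cb' ce']] := cart_ex (gt_cart GT U) t' b1'.
suff -> : ψ = ψ' by [].
rewrite -ce -ce'; congr (_ ⊙ _); apply: (cart_uq C); rewrite ?ct ?cb //.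
by rewrite -hp -!ccomp_assoc ce ce'.
Qed.

(** In the collage [N+] of [j^*] the full image of [{A, ĉ}] is again a copy [e] of [N'], and
    the cells from [e] to the copy [e1 = top ug] of [N'] factor through [A]. *)
Lemma collage_conjoint_split (A C N N2 : D) (y : Ver A C) (uy : Cell y (vid N))
    (ug : Cell (conjoint (bot uy)) (vid N2)) :
  glue uy -> glue ug ->
  exists (e : Hom N N2) (π : Hom N2 N),
    [/\ e ∘ top uy = top ug ∘ top uy, e ∘ bot uy = bot ug,
        (forall e1, idc e ⊙ uy = under (ug ⊙ alpha (bot uy)) (idc (top ug) ⊙ uy) e1),
        idc π ⊙ ug = beta (bot uy) /\ π ∘ e = idm N &
     forall (w h : Ver N N) (o : Cell (vid A) w) (ε : Cell w (vid N)) (κ : Cell h (vid N2)),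
       opcart o -> top o = top uy -> bot o = top uy -> top ε = idm N -> bot ε = idm N ->
       ε ⊙ o = idc (top uy) -> top κ = e -> bot κ = top ug ->
       exists η : Cell h w, [/\ top η = idm N, bot η = idm N & ε ⊙ η = idc π ⊙ κ]].
Proof.
move=> Uy Ug; set i := top uy; set j := bot uy; set e1 := top ug; set cc := bot ug.
pose γ := ug ⊙ alpha j.
have γt : top γ = e1 ∘ j by rewrite !tbE.
have γb : bot γ = cc by rewrite !tbE.
have f0 : bot (idc e1 ⊙ uy) = top γ by rewrite γt !tbE.
have [e he] := glue_ex (under γ (idc e1 ⊙ uy) f0) Uy.
have [π hπ] := glue_ex (beta j) Ug.
have ei : e ∘ i = e1 ∘ i by rewrite (idc_top he) !tbE.
have ej : e ∘ j = cc by rewrite (idc_bot he) bot_under γb.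
have πe1 : π ∘ e1 = idm N by rewrite (idc_top hπ) !tbE.
have πc : π ∘ cc = j by rewrite (idc_bot hπ) !tbE.
have πγ : idc π ⊙ γ = idc j by rewrite /γ ccomp_assoc hπ cjt_hor.
have πe : π ∘ e = idm N.
  apply: (glue_uq Uy); rewrite idc_comp -ccomp_assoc he.
  have f1 : bot (idc π ⊙ (idc e1 ⊙ uy)) = top (idc (bot (idc π)) ⊙ γ).
    by rewrite tbE f0 [RHS]tbE !tbE.
  rewrite (comp_under _ f1).
  have f2 : bot uy = top (idc j) by rewrite !tbE.
  rewrite idc_id ccomp_idl; apply: (etrans _ (under_idc f2)).
  apply: under_eq; first by rewrite [bot (idc π)]bot_idc.
  by rewrite ccomp_assoc -idc_comp πe1 idc_id ccomp_idl.
exists e, π; split=> //; first by move=> f1; rewrite he; exact: under_eq.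
move=> w h o ε κ Oo ot ob εt εb εo κt κb.
(* [w] is the extension of the identity of [A] to [N] on both sides, so [Dd] is two copies of [N]
   joined through [A] only. The collage [Dh] adds a copy of [C] that receives every cell of [N]
   ending at [j]. *)
have [Dd [ud Ud]] := gt_glue GT w.
pose θ := ud ⊙ o.
have θt : top θ = top ud ∘ i by rewrite !tbE ot.
have θb : bot θ = bot ud ∘ i by rewrite !tbE ob.
have [d hd] := glue_ex ε Ud.
have d0 : d ∘ top ud = idm N by rewrite (idc_top hd).
have d1 : d ∘ bot ud = idm N by rewrite (idc_bot hd).
have [r [cr [Cr crt crb]]] := restriction_exists (vid N) d j.
have [Dh [uh Uh]] := gt_glue GT r.
have [dd hdd] := glue_ex cr Uh.
have dl : dd ∘ top uh = d by rewrite (idc_top hdd).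
have dc : dd ∘ bot uh = j by rewrite (idc_bot hdd).
set λ := top uh in dl *.
have g1 : bot (idc λ ⊙ θ) = top (idc (λ ∘ bot ud) ⊙ uy) by rewrite !tbE ob comp_assoc.
(* [h1] puts [A] in the first copy of [N] and [C] in the second, with [θ] as the connection between
   the copies. *)
have [h1 hh1] := glue_ex (over _ _ g1) Uy.
have h1i : h1 ∘ i = λ ∘ (top ud ∘ i) by rewrite (idc_top hh1) !tbE ot.
have h1j : h1 ∘ j = λ ∘ (bot ud ∘ j) by rewrite (idc_bot hh1) !tbE comp_assoc.
have mu_ex (k : Hom N Dd) : d ∘ k = idm N -> exists μ : Cell (vid C) (vid Dh),
    [/\ top μ = λ ∘ (k ∘ j), bot μ = bot uh & idc dd ⊙ μ = idc j].
  move=> dk; have [μ [m1 m2 m3]] : exists μ : Cell (vid C) r, [/\ top μ = k ∘ j, bot μ = idm C & cr ⊙ μ = idc j].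
    by apply: (cart_ex Cr); rewrite !tbE ?crt ?crb ?comp_assoc ?dk ?comp_idl ?comp_idr.
  by exists (uh ⊙ μ); split; rewrite ?tbE ?m1 ?m2 ?comp_idr // ccomp_assoc hdd.
have [μ [μt μb μe]] := mu_ex _ d1.
have [μ' [μt' μb' μe']] := mu_ex _ d0.
have [φ [φt φb φe]] : exists φ : Cell (conjoint j) (vid Dh), [/\ top φ = h1, bot φ = bot uh & φ ⊙ alpha j = μ].
  by apply: (opcart_ex (opcart_alpha j)); rewrite !tbE ?h1j.
(* [H] is [h1] on [e1] and sends [ĉ] to the added copy of [C]. Hence there are 2-cells [τ0] from the
   first copy of [N] to [H ∘ e] and [τ1] from [h1] to the second copy. *)
have [H hH] := glue_ex φ Ug.
have He1 : H ∘ e1 = h1 by rewrite (idc_top hH).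
have Hc : H ∘ cc = bot uh by rewrite (idc_bot hH).
have dh1 : dd ∘ h1 = idm N.
  apply: (glue_uq Uy); rewrite idc_comp -ccomp_assoc hh1.
  have g2 : bot (idc (top (idc dd)) ⊙ (idc λ ⊙ θ)) = top (idc dd ⊙ (idc (λ ∘ bot ud) ⊙ uy)).
    by rewrite [LHS]bot_ccomp g1 [RHS]top_ccomp !tbE.
  rewrite (comp_over _ g2) idc_id ccomp_idl.
  have g3 : bot (idc i) = top uy by rewrite !tbE.
  apply: (etrans _ (over_idc g3)); apply: over_eq.
    by rewrite ccomp_assoc -idc_comp comp_assoc dl d1 idc_id ccomp_idl.
  by rewrite top_idc ccomp_assoc -idc_comp dl /θ ccomp_assoc hd.
have dH : dd ∘ H = π.
  apply: (glue_uq Ug); rewrite idc_comp -ccomp_assoc hH hπ.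
  apply: (opcart_uq (opcart_alpha j)); rewrite ?tbE ?φt ?φb ?dc //.
  by rewrite -ccomp_assoc φe μe cjt_hor.
have g4 : bot (idc λ ⊙ (idc (top ud) ⊙ uy)) = top μ' by rewrite !tbE.
have g5 : bot (idc (λ ∘ (top ud ∘ i))) = top (idc (H ∘ e) ⊙ uy).
  by rewrite !tbE -comp_assoc ei (comp_assoc H) He1.
have Nat0 : under μ' (idc λ ⊙ (idc (top ud) ⊙ uy)) g4 = idc (H ∘ e) ⊙ uy.
  apply: (collapse_faithful (a := top ud ∘ i) (b := idm C) Uh Cr hdd); rewrite ?tbE ?μb' ?comp_idr //.
  - by rewrite -comp_assoc ei (comp_assoc H) He1.
  - by rewrite -comp_assoc ej Hc.
  have g6 : bot (idc dd ⊙ (idc λ ⊙ (idc (top ud) ⊙ uy))) = top (idc (bot (idc dd)) ⊙ μ').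
    by rewrite [LHS]bot_ccomp g4 [RHS]top_ccomp !tbE.
  rewrite (comp_under _ g6) [RHS]ccomp_assoc -idc_comp comp_assoc dH πe idc_id ccomp_idl.
  have g7 : bot uy = top (idc j) by rewrite !tbE.
  apply: (etrans _ (under_idc g7)); apply: under_eq; first by rewrite bot_idc.
  by rewrite !ccomp_assoc -!idc_comp dl d0 idc_id ccomp_idl.
have g4' : bot (idc (λ ∘ top ud) ⊙ uy) = top μ' by rewrite !tbE μt' comp_assoc.
have [|||τ0 [τ0t τ0b τ0A τ0B]] := two_ex (h := λ ∘ top ud) (h' := H ∘ e) (e1 := g4') (e2 := g5) Uy.
- by rewrite !tbE comp_assoc.
- by rewrite μb' -comp_assoc ej Hc.
- rewrite over_idc -Nat0; apply: under_eq => //.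
  by rewrite idc_comp ccomp_assoc.
have g8 : bot (idc h1 ⊙ uy) = top (idc (λ ∘ (bot ud ∘ j))) by rewrite !tbE.
have [|||τ1 [τ1t τ1b τ1A τ1B]] := two_ex (h := h1) (h' := λ ∘ bot ud) (e1 := g8) (e2 := g1) Uy.
- by rewrite !tbE ot.
- by rewrite !tbE comp_assoc.
- by rewrite under_idc hh1.
have g9 : bot τ0 = top (idc H ⊙ κ) by rewrite τ0b !tbE κt.
have g10 : bot (over (idc H ⊙ κ) τ0 g9) = top τ1 by rewrite !tbE κb He1 τ1t.
(* Under [H] the cell [κ] runs from [H ∘ e] to [h1]. Prolonged by [τ0] and [τ1] it connects the two
   copies of [N]; fullness of [λ] brings it back to [Dd], where such cells are cells into [w]. The
   collapse to [N] sends [τ0] and [τ1] to identities, whence the equation for [η]. *)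
have [ζ [ζt ζb ζe]] : exists ζ : Cell h (vid Dd), [/\ top ζ = top ud, bot ζ = bot ud &
    idc λ ⊙ ζ = under τ1 (over (idc H ⊙ κ) τ0 g9) g10].
  by apply: (cart_ex (full_top GT Uh)); rewrite !tbE ?τ0t ?τ1b.
have [η [ηt ηb ηe]] : exists η : Cell h w, [/\ top η = idm N, bot η = idm N & ud ⊙ η = ζ].
  by apply: (cart_ex (gt_cart GT Ud)); rewrite ?comp_idr.
exists η; split=> //; rewrite -hd -ccomp_assoc ηe -dl idc_comp -ccomp_assoc ζe.
have dτ0 : idc dd ⊙ τ0 = idc (idm N).
  apply: (two_ext Uy); rewrite ?tbE ?τ0t ?τ0b ?comp_assoc ?dl ?d0 ?dH ?πe //.
  - by rewrite -ccomp_assoc τ0A -!idc_comp comp_idl !comp_assoc dl d0 comp_idl.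
  - by rewrite -ccomp_assoc τ0B μe' -idc_comp comp_idl.
have dτ1 : idc dd ⊙ τ1 = idc (idm N).
  apply: (two_ext Uy); rewrite ?tbE ?τ1t ?τ1b ?comp_assoc ?dl ?d1 ?dh1 //.
  - by rewrite -ccomp_assoc τ1A ccomp_assoc -idc_comp dl /θ ccomp_assoc hd εo -idc_comp comp_idl.
  - by rewrite -ccomp_assoc τ1B -!idc_comp comp_idl !comp_assoc dl d1 comp_idl.
have k1 : bot (idc dd ⊙ over (idc H ⊙ κ) τ0 g9) = top (idc (bot (idc dd)) ⊙ τ1).
  by rewrite [LHS]bot_ccomp g10 [RHS]top_ccomp !tbE.
rewrite (comp_under _ k1).
have k2 : bot (idc π ⊙ κ) = top (idc (idm N)) by rewrite !tbE κb.
apply: (etrans _ (under_idc k2)); apply: under_eq; first by rewrite bot_idc.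
have k3 : bot (idc (top (idc dd)) ⊙ τ0) = top (idc dd ⊙ (idc H ⊙ κ)).
  by rewrite [LHS]bot_ccomp g9 [RHS]top_ccomp !tbE.
rewrite (comp_over _ k3).
have k4 : bot (idc (idm N)) = top (idc π ⊙ κ) by rewrite !tbE κt.
apply: (etrans _ (over_idc k4)); apply: over_eq; last by rewrite top_idc.
by rewrite ccomp_assoc -idc_comp dH.
Qed.

End Cylinders.

(** * Vertical morphisms out of a collage that vanish on its second part *)

Section VoidExtension.
Variable D : FramedBicategory.
Local Notation eps f := (cpn_eps (fb_cpn f)).
Local Notation eta f := (cpn_eta (fb_cpn f)).
Local Notation alpha f := (cjt_alpha (fb_cjt f)).
Local Notation beta f := (cjt_beta (fb_cjt f)).

(** With [h] written as [v • companion i] and [w] as [companion i • conjoint i], the composite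
    [v • w] is the extension along [i] of the restriction [h], and [vcc κ o e] is the extension
    cell, up to isomorphism. *)
Lemma restrict_extend (A N B : D) (i : Hom A N) (v : Ver N B) (h : Ver A B) (κ : Cell h v)
    (w : Ver N N) (o : Cell (vid A) w) e :
  cart κ -> top κ = i -> bot κ = idm B -> opcart o -> top o = i -> bot o = i ->
  opcart (vcc κ o e) /\ (cart (idc i) -> cart (vcc κ o e)).
Proof.
move=> Cκ κt κb Oo ot_ ob_.
have O0 := opcart_comp (opcart_ot (companion i) i) (opcart_eta i).
have [iw hw] : exists iw : SpecialIso (companion i • conjoint i) w, iw ⊙ (ot (companion i) i ⊙ eta i) = o.
  by apply: (opcart_unique O0 Oo); rewrite !tbE ?ot_ ?ob_.
have [ih hh] : exists ih : SpecialIso h (v • companion i), rt v i ⊙ ih = κ.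
  by apply: (cart_unique Cκ (cart_rt v i)); rewrite ?top_rt ?bot_rt.
have f1 : bot iw = top (cid v) by rewrite !tbE.
have f2 : bot (cid (vid A)) = top ih by rewrite !tbE.
have f3 : bot (ot (companion i) i) = top (cid v) by rewrite !tbE.
have f4 : bot (eta i) = top (rt v i) by rewrite !tbE.
have f5 : bot (ot (companion i) i ⊙ eta i) = top (rt v i) by rewrite !tbE.
have E : vcc κ o e = vcc_iso (i := iso_id v) (j := iw) f1 ⊙ (vcc (cid v) (ot (companion i) i) f3
    ⊙ runi (v • companion i)) ⊙ vcc_iso (i := ih) (j := iso_id (vid A)) f2.
  rewrite /= -(rt_section f4).
  rewrite (vccR (χ := rt v i) (χ' := ot (companion i) i ⊙ eta i) f5) ?ccomp_idl //.
  have f6 : bot (iw ⊙ (ot (companion i) i ⊙ eta i)) = top (rt v i) by rewrite hw e -hh !tbE.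
  rewrite (vccR (χ := rt v i) (χ' := iw ⊙ (ot (companion i) i ⊙ eta i)) f6) ?ccomp_idl //.
  have f7 : bot (iw ⊙ (ot (companion i) i ⊙ eta i) ⊙ cid _) = top (rt v i ⊙ ih).
    by rewrite hw hh ccomp_idr.
  by rewrite -(vcc_ccomp f7); apply: vcc_eq; rewrite ?hh ?hw ?ccomp_idr.
rewrite E; split=> [|Fi].
  apply: opcart_comp; last exact: opcart_iso.
  apply: opcart_comp; first exact: opcart_iso.
  apply: opcart_comp; last exact: opcart_iso.
  by apply: opcart_cid_vcc; [exact: opcart_ot | rewrite !tbE].
apply: cart_comp; last exact: cart_iso.
apply: cart_comp; first exact: cart_iso.
apply: cart_comp; last exact: cart_iso.
by apply: cart_cid_vcc; [exact: cart_ot_full | rewrite !tbE].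
Qed.

Variable GT : glue_theory D.

(** Pushing [C] away to the copy [ĉ] of the collage of [j^*] splits [v] off its extension
    from [A]. *)
Lemma void_extension (A C B N X : D) (y : Ver A C) (uy : Cell y (vid N)) (v : Ver N B)
    (uv : Cell v (vid X)) (h : Ver A B) (κ : Cell h v) (k : Ver C B) (κC : Cell k v) :
  glue uy -> glue uv -> cart κ -> top κ = top uy -> bot κ = idm B ->
  cart κC -> top κC = bot uy -> bot κC = idm B -> void k ->
  forall (Y : D) (f : Hom N Y) (φ : Cell h (vid Y)), top φ = f ∘ top uy ->
    exists! ψ : Cell v (vid Y), top ψ = f /\ ψ ⊙ κ = φ.
Proof.
move=> Uy Uv Cκ κt κb CκC κCt κCb Vk.
set i := top uy in κt *; set j := bot uy in κCt *.
set ι := top uv; set b := bot uv.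
have [N2 [ug Ug]] := gt_glue GT (conjoint j).
set e1 := top ug; set cc := bot ug; pose γ := ug ⊙ alpha j.
have [e [π [ei ej he [hπ πe] HS]]] := collage_conjoint_split GT Uy Ug.
rewrite -/i -/j -/e1 -/cc in ei ej he hπ HS.
have γt : top γ = e1 ∘ j by rewrite !tbE.
have γb : bot γ = cc by rewrite !tbE.
have πe1 : π ∘ e1 = idm N by rewrite (idc_top hπ) !tbE.
have πγ : idc π ⊙ γ = idc j by rewrite /γ ccomp_assoc hπ cjt_hor.
(* [M] is [N2] with [B] attached along the copy [e1] of [N]. It serves to construct a section [δ] of
   the canonical cell [can : v • w -> v], where [w] is the extension of [vid A] to [N]. *)
have [M [um Um]] := gt_glue GT (v • conjoint e1).
set λ := top um; set β := bot um.
have [mX hmX] := glue_ex (um ⊙ ot v e1) Uv.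
have mXι : mX ∘ ι = λ ∘ e1 by rewrite (idc_top hmX) !tbE.
have mXb : mX ∘ b = β by rewrite (idc_bot hmX) !tbE.
have f1 : bot (idc (ι ∘ π) ⊙ beta e1) = top uv by rewrite !tbE -comp_assoc πe1 comp_idr.
pose χ := ract uv (idc (ι ∘ π) ⊙ beta e1) f1.
have χo : χ ⊙ ot v e1 = uv.
  have f2 : bot (idc (ι ∘ π) ⊙ beta e1 ⊙ alpha e1) = top (uv ⊙ cid v).
    by rewrite !tbE -comp_assoc πe1 comp_idr.
  rewrite /ot ccomp_assoc (ract_comp _ _ f2) /ract.
  have f3 : bot (idc ι) = top uv by rewrite !tbE.
  apply: (iso_cancelR (i := runi v)); rewrite -ccomp_assoc iso_K ccomp_idr -(runiE f3).
  congr (_ ⊙ _); apply: vcc_eq; first by rewrite ccomp_idr.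
  by rewrite -ccomp_assoc cjt_hor -idc_comp -comp_assoc πe1 comp_idr.
have [ϖ hϖ] := glue_ex χ Um.
have ϖλ : ϖ ∘ λ = ι ∘ π by rewrite (idc_top hϖ) !tbE.
have ϖβ : ϖ ∘ β = b by rewrite (idc_bot hϖ) !tbE.
have ϖmX : ϖ ∘ mX = idm X.
  by apply: (glue_uq Uv); rewrite idc_comp -ccomp_assoc hmX ccomp_assoc hϖ χo idc_id ccomp_idl.
have [S [n [un [x [ux [Un Ux [tx xC xB]]]]]]] := regroup_right GT Uy Uv.
rewrite -/i -/j -/ι -/b in tx xC xB; set ν := bot ux in xC xB *.
have Vn : void n.
  have [c [ct cb _]] : exists c : Cell n v, [/\ top c = j, bot c = idm B & uv ⊙ c = idc ν ⊙ un].
    by apply: (cart_ex (gt_cart GT Uv)); rewrite !tbE.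
  have [c' _] : exists c' : Cell n k, [/\ top c' = idm C, bot c' = idm B & κC ⊙ c' = c].
    by apply: (cart_ex CκC); rewrite ?tbE ?κCt ?κCb ?comp_idr.
  exact: void_of_cell GT _ _ _ _ _ _ c' Vk.
(* This is where [void k] enters: [S] is the coproduct of [C] and [B], so [C] can be moved to [ĉ]
   while [B] stays. The resulting [ξ : X -> M] restricts to [λ ∘ e] on [N]. *)
have [ξS [ξSC ξSB]] := void_glue_ex (λ ∘ cc) β Vn Un.
have f4 : bot (idc (mX ∘ ν) ⊙ un) = top (idc β) by rewrite !tbE -comp_assoc xB.
have f5 : bot (idc λ ⊙ γ) = top (idc ξS ⊙ un) by rewrite [RHS]tbE !tbE.
have [|||τ [τt τb τC τB]] := two_ex GT (h := mX ∘ ν) (h' := ξS) (e1 := f4) (e2 := f5) Un.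
- by rewrite tbE γt -comp_assoc xC !comp_assoc mXι !tbE.
- by rewrite !tbE.
- by apply: (void_uq Vn); rewrite !tbE // -?comp_assoc ?xC ?xB ?comp_assoc ?mXι ?ξSB.
have f6 : bot (idc mX ⊙ ux) = top τ by rewrite !tbE.
have [ξ hξ] := glue_ex (under _ _ f6) Ux.
have ξν : ξ ∘ ν = ξS by rewrite (idc_bot hξ) !tbE.
have [c [ct cb ce]] : exists c : Cell y x, [/\ top c = idm A, bot c = top un & ux ⊙ c = idc ι ⊙ uy].
  by apply: (cart_ex (gt_cart GT Ux)); rewrite !tbE ?tx.
have ξι : ξ ∘ ι = λ ∘ e.
  apply: (glue_uq Uy); rewrite !idc_comp -!ccomp_assoc -ce ccomp_assoc hξ.
  have f7 : bot (idc mX ⊙ ux ⊙ c) = top (τ ⊙ idc (bot c)) by rewrite [RHS]tbE τt !tbE.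
  have f8 : bot (idc e1 ⊙ uy) = top γ by rewrite γt !tbE.
  have f9 : bot (idc λ ⊙ (idc e1 ⊙ uy)) = top (idc (bot (idc λ)) ⊙ γ) by rewrite bot_ccomp f8 !tbE.
  rewrite (under_comp _ f7) (he f8) (comp_under _ f9); apply: under_eq.
    by rewrite cb τC bot_idc.
  by rewrite -ccomp_assoc ce !ccomp_assoc -!idc_comp mXι.
have ϖτ : idc ϖ ⊙ τ = idc ν.
  apply: (two_ext GT Un); rewrite ?tbE ?τt ?τb ?comp_assoc ?ϖmX ?comp_idl //.
  - apply: (void_glue_uq Vn Un); rewrite -comp_assoc ?ξSC ?ξSB ?ϖβ ?xB //.
    by rewrite comp_assoc ϖλ -comp_assoc (idc_bot hπ) tbE xC.
  - rewrite -ccomp_assoc τC ccomp_assoc -idc_comp ϖλ idc_comp -ccomp_assoc πγ -!idc_comp.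
    by rewrite xC.
  - by rewrite -ccomp_assoc τB -!idc_comp ϖβ xB.
have ϖξ : ϖ ∘ ξ = idm X.
  apply: (glue_uq Ux); rewrite idc_comp -ccomp_assoc hξ.
  have f7 : bot (idc ϖ ⊙ (idc mX ⊙ ux)) = top (idc (bot (idc ϖ)) ⊙ τ).
    by rewrite tbE f6 [RHS]tbE !tbE.
  rewrite (comp_under _ f7) idc_id ccomp_idl.
  have f8 : bot ux = top (idc ν) by rewrite !tbE.
  apply: (etrans _ (under_idc f8)); apply: under_eq; first by rewrite bot_idc.
  by rewrite ccomp_assoc -idc_comp ϖmX idc_id ccomp_idl.
(* Read in the collage of [v • conjoint e1], the map [ξ] is a cell out of [v] with top [e], hence a
   cell into [v • (conjoint e1 • companion e)]. [HS] maps the second factor, the cells from [e] to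
   [e1], into [w]. *)
have [σ1 [σ1t σ1b σ1e]] : exists σ1 : Cell v (v • conjoint e1),
    [/\ top σ1 = e, bot σ1 = idm B & um ⊙ σ1 = idc ξ ⊙ uv].
  apply: (cart_ex (gt_cart GT Um)); rewrite !tbE //.
  by rewrite -/b -xB comp_assoc ξν.
have f10 : bot (rt (conjoint e1) e) = top (cid v) by rewrite !tbE.
have [σ2 [σ2t σ2b σ2e]] : exists σ2 : Cell v (v • (conjoint e1 • companion e)),
    [/\ top σ2 = idm N, bot σ2 = idm B & vcc (cid v) (rt (conjoint e1) e) f10 ⊙ σ2 = σ1].
  by apply: (cart_ex (cart_cid_vcc f10 (cart_rt _ _) (bot_rt _ _))); rewrite !tbE.
have [w [o [Oo ot_ ob_]]] := extension_exists (vid A) i i.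
have [ε [εt εb εo]] : exists ε : Cell w (vid N), [/\ top ε = idm N, bot ε = idm N & ε ⊙ o = idc i].
  by apply: (opcart_ex Oo); rewrite !tbE ?ot_ ?ob_.
have [η [ηt ηb ηe]] : exists η : Cell (conjoint e1 • companion e) w, [/\ top η = idm N, bot η = idm N &
    ε ⊙ η = idc π ⊙ (beta e1 ⊙ rt (conjoint e1) e)].
  by apply: (HS w _ o) => //; rewrite !tbE.
have f11 : bot η = top (cid v) by rewrite !tbE.
pose δ := vcc (cid v) η f11 ⊙ σ2.
have f12 : bot ε = top (cid v) by rewrite !tbE.
pose can := ract (cid v) ε f12.
have canδ : can ⊙ δ = cid v.
  apply: (cart_uq (gt_cart GT Uv)); rewrite ?tbE ?εt ?ηt ?σ2t ?σ2b ?comp_idl //.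
  rewrite ccomp_idr /δ /can 2!ccomp_assoc.
  have f13 : bot (idc (top uv) ⊙ ε) = top (uv ⊙ cid v) by rewrite !tbE εb comp_idr.
  have f14 : bot (idc (top uv) ⊙ ε ⊙ η) = top (uv ⊙ cid v ⊙ cid v).
    by rewrite !tbE εb ηb !comp_idr.
  have f15 : bot (idc (ι ∘ π) ⊙ beta e1 ⊙ rt (conjoint e1) e) = top (uv ⊙ cid v).
    by rewrite !tbE -comp_assoc πe1 comp_idr.
  rewrite (comp_ract _ f13) (ract_comp _ _ f14).
  transitivity (χ ⊙ vcc (cid v) (rt (conjoint e1) e) f10 ⊙ σ2).
    congr (_ ⊙ _); rewrite (ract_comp _ _ f15); apply: ract_eq; rewrite ?ccomp_idr //.
    by rewrite -ccomp_assoc ηe !ccomp_assoc -idc_comp.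
  by rewrite -ccomp_assoc σ2e -hϖ -ccomp_assoc σ1e ccomp_assoc -idc_comp ϖξ idc_id ccomp_idl.
move=> Y f φ φt.
have f16 : bot o = top κ by rewrite ob_ κt.
have [O2 C2] := restrict_extend f16 Cκ κt κb Oo ot_ ob_.
have {}C2 := C2 (full_top GT Uy).
have [φ' [φt' φb' φe']] : exists φ' : Cell (v • w) (vid Y),
    [/\ top φ' = f, bot φ' = bot φ & φ' ⊙ vcc κ o f16 = φ ⊙ runi h].
  by apply: (opcart_ex O2); rewrite !tbE ?ot_ ?κb ?comp_idr.
have cκ : can ⊙ vcc κ o f16 = κ ⊙ runi h.
  have f17 : bot (ε ⊙ o) = top (cid v ⊙ κ) by rewrite εo !tbE κt.
  have f18 : bot (idc i) = top κ by rewrite !tbE.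
  rewrite (ract_comp _ _ f17) -(runiE f18) /ract; congr (_ ⊙ _).
  by apply: vcc_eq; rewrite ?ccomp_idl.
exists (φ' ⊙ δ); split.
  split; first by rewrite !tbE φt' ηt σ2t !comp_idr.
  have [ε' [εt' εb' εe']] : exists ε' : Cell h (h • vid A), [/\ top ε' = idm A, bot ε' = idm B &
     vcc κ o f16 ⊙ ε' = δ ⊙ κ].
    by apply: (cart_ex C2); rewrite ?tbE ?ot_ ?κt ?κb ?ηt ?σ2t ?σ2b ?comp_idl ?comp_idr.
  have rε : runi h ⊙ ε' = cid h.
    apply: (cart_uq Cκ); rewrite ?tbE // ccomp_idr ccomp_assoc -cκ -ccomp_assoc εe'.
    by rewrite ccomp_assoc canδ ccomp_idl.
  by rewrite -ccomp_assoc -εe' ccomp_assoc φe' -ccomp_assoc rε ccomp_idr.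
move=> ψ [ψt ψκ].
rewrite -[ψ]ccomp_idr -canδ ccomp_assoc; congr (_ ⊙ _).
apply: (opcart_uq O2).
- by rewrite !tbE φt' ψt εt comp_idr.
- by rewrite !tbE φb' -ψκ !tbE κb comp_idr.
by rewrite φe' -ccomp_assoc cκ ccomp_assoc ψκ.
Qed.

End VoidExtension.

(** * Cells over a zigzag of cylinders *)

Section Zigzag.
Variable D : FramedBicategory.
Local Notation eps f := (cpn_eps (fb_cpn f)).
Local Notation eta f := (cpn_eta (fb_cpn f)).
Local Notation alpha f := (cjt_alpha (fb_cjt f)).
Local Notation beta f := (cjt_beta (fb_cjt f)).
Variable GT : glue_theory D.

(** Evaluation form of [reflection_desc]: the bottom of [ψ] factors through [t] and does not see
    [σ], so [d] may first be pushed along [σ] into the restriction. *)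
Lemma reflection_eval (A A' V N N' Y : D) (t : Hom V N) (σ : Cell (vid V) (vid V)) (w : Ver A V)
    (w1 : Ver A N) (κ : Cell w1 w) (w' : Ver A' N') (d : Cell w' w) (d' : Cell w' w1)
    (ψ : Cell w (vid Y)) (g : Hom N Y) e :
  top σ = idm V -> idc t ⊙ σ = idc t -> bot ψ = g ∘ t ->
  κ ⊙ d' = under (σ ⊙ idc (bot d)) d e -> ψ ⊙ d = ψ ⊙ κ ⊙ d'.
Proof.
move=> σt tσ ψb h; rewrite -ccomp_assoc h.
have e1 : bot (ψ ⊙ d) = top (idc (bot ψ) ⊙ (σ ⊙ idc (bot d))) by rewrite !tbE σt comp_idl.
rewrite (comp_under _ e1).
have e2 : bot (ψ ⊙ d) = top (idc (g ∘ t ∘ bot d)) by rewrite !tbE ψb.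
apply: (etrans (esym (under_idc e2))); apply: under_eq => //.
by rewrite ψb 2!idc_comp -!ccomp_assoc; congr (_ ⊙ _); rewrite ccomp_assoc tσ.
Qed.

Variables (B N Vk V : D) (l : Hom B N) (uk : Cell (companion l) (vid Vk)).
Variables (uV : Cell (conjoint (top uk)) (vid V)) (t : Hom V N).
(** [V] consists of [N], of [B], and of a second copy [B0] of [B] with arrows to both. Regrouping
    the collage of [w] as [Q1 -> B], with [Q1] over [Vk], separates the two ends. [Q1] is governed
    by the reflection of [Vk] onto [N]. By [void_extension], the morphism [Q1 -> B] is governed by
    its restriction to the part [Q2] of [Q1] over [B0], where a second reflection applies. *)
Lemma zigzag_desc (A Y : D) (w : Ver A V) (wN : Ver A N) (wl w0 : Ver A B)
    (κN : Cell wN w) (κl : Cell wl w) (κ0 : Cell w0 w) (x1 : Cell w0 wN) (x2 : Cell w0 wl)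
    (g : Hom N Y) (ψN : Cell wN (vid Y)) (ψl : Cell wl (vid Y)) e1 e2 :
  glue uk -> glue uV -> idc (t ∘ top uV) ⊙ uk = eps l -> idc t ⊙ (uV ⊙ alpha (top uk)) = idc l ->
  cart κN -> top κN = idm A -> bot κN = top uV ∘ bot uk ->
  cart κl -> top κl = idm A -> bot κl = bot uV ->
  cart κ0 -> top κ0 = idm A -> bot κ0 = top uV ∘ top uk ->
  top x1 = idm A -> bot x1 = l -> top x2 = idm A -> bot x2 = idm B ->
  κN ⊙ x1 = under (idc (top uV) ⊙ uk ⊙ eta l) κ0 e1 ->
  κl ⊙ x2 = under (uV ⊙ alpha (top uk)) κ0 e2 ->
  bot ψN = g -> bot ψl = g ∘ l -> ψN ⊙ x1 = ψl ⊙ x2 ->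
  exists! ζ : Cell w (vid Y), [/\ bot ζ = g ∘ t, ζ ⊙ κN = ψN & ζ ⊙ κl = ψl].
Proof.
move=> Uk UV tk tδ CN Nt Nb Cl lt lb C0 zt zb x1t x1b x2t x2b hx1 hx2 ψNb ψlb Hc.
have [Q [uw Uw]] := gt_glue GT w.
set δ := uV ⊙ alpha (top uk) in e2 hx2 tδ.
set μ := idc (top uV) ⊙ uk ⊙ eta l in e1 hx1.
set b0 := top uk in zb tδ *; set sN := bot uk in Nb *; set p := top uV in Nb zb tk *.
set bl := bot uV in lb *; set a := top uw; set ι := bot uw.
have tpb : t ∘ p ∘ b0 = l by rewrite (idc_top tk) !tbE.
have tps : t ∘ p ∘ sN = idm N by rewrite (idc_bot tk) !tbE.
have tbl : t ∘ bl = l.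
  by have := f_equal (fun x => bot x) tδ; rewrite !tbE.
have [tk' [σ [tkb tks tke [σt σb tσ σs σb0]]]] := cylinder GT Uk (opcart_eta l) (top_eta _) (bot_eta _).
have Etk : tk' = t ∘ p.
  apply: (glue_uq Uk); rewrite tk; apply: (opcart_uq (opcart_eta l)).
  - by rewrite !tbE.
  - by rewrite !tbE.
  - by rewrite tke cpn_hor.
subst tk'; clear tkb tks.
have [Q1 [w1 [u1 [v1 [uv1 [U1 Uv1 [h1a h1p h1b]]]]]]] := regroup_left GT UV Uw.
have [Q2 [w2 [u2 [v2 [uv2 [U2 Uv2 [h2a h2b h2s]]]]]]] := regroup_left GT Uk U1.
rewrite -/a -/ι -/p -/bl in h1a h1p h1b; rewrite -/b0 -/sN in h2b h2s.
set q1 := top uv1 in h1a h1p *; set q2 := top uv2 in h2a h2b *.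
set a2 := top u2 in h2a *; set b2 := bot u2 in h2b *.
have Fι := full_bot GT Uw; rewrite -/ι in Fι.
have Fb0 := full_top GT Uk; rewrite -/b0 in Fb0.
have Fq1 := full_top GT Uv1; rewrite -/q1 in Fq1.
have [h [κh [Ch ht hb]]] := restriction_exists v1 q2 (idm B).
have [k [κC [CC Ct Cb]]] := restriction_exists v1 (bot uv2) (idm B).
(* On the copy of [N], the morphism [Q1 -> B] consists of cells into the restriction of
   [conjoint b0], that is of cells of [Vk] from [N] to [B0], against the direction of
   [companion l]. *)
have Vk0 : void k.
  have [c [ct cb ce]] : exists c : Cell k (vid V), [/\ top c = p ∘ sN, bot c = bl & idc ι ⊙ c = uv1 ⊙ κC].
    apply: (cart_ex Fι); rewrite !tbE ?Ct ?Cb ?comp_idr ?h1b //.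
    by rewrite -/q1 h2s !comp_assoc h1p.
  have [c' [ct' cb' ce']] : exists c' : Cell k (conjoint b0), [/\ top c' = sN, bot c' = idm B & uV ⊙ c' = c].
    by apply: (cart_ex (gt_cart GT UV)); rewrite ?comp_idr.
  by apply: (void_of_disjoint GT (w := beta b0 ⊙ c') (f := idm N) (g := idm B) Uk); rewrite !tbE ?ct' ?cb' ?comp_idr.
have [ω1 [ω1t ω1b ω1e]] : exists ω1 : Cell w1 w, [/\ top ω1 = idm A, bot ω1 = p & uw ⊙ ω1 = idc q1 ⊙ u1].
  by apply: (cart_ex (gt_cart GT Uw)); rewrite !tbE ?h1a.
have Cω1 : cart ω1.
  by apply: (cart_cancel (gt_cart GT Uw)); rewrite ω1e; apply: cart_comp => //; exact: gt_cart U1.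
have [κ1 [κ1t κ1b κ1e]] : exists κ1 : Cell wN w1, [/\ top κ1 = idm A, bot κ1 = sN & ω1 ⊙ κ1 = κN].
  by apply: (cart_ex Cω1); rewrite ?ω1t ?ω1b ?Nt ?comp_idr.
have Cκ1 : cart κ1 by apply: (cart_cancel Cω1); rewrite κ1e.
have [ψ1 [ψ1b ψ1κ ψ1u]] := reflection_desc ψN tps σt σb tσ σs Cκ1 κ1t κ1b.
rewrite ψNb in ψ1b.
have [f' hf'] := glue_ex ψ1 U1.
have [R [uh Uh]] := gt_glue GT h.
have [r hr] := glue_ex (uv1 ⊙ κh) Uh.
have rt_ : r ∘ top uh = q1 ∘ q2 by rewrite (idc_top hr) tbE ht.
have rb_ : r ∘ bot uh = ι ∘ bl by rewrite (idc_bot hr) tbE hb comp_idr h1b.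
have Cuk : cart (uv1 ⊙ κh) by apply: cart_comp Ch; exact: gt_cart Uv1.
have [R1 [n2 [un2 [x [ux [Un2 Ux [hxa hxb hxl]]]]]]] := regroup_right GT U2 Uh.
set ν := bot ux in hxb hxl *.
have CnR : cart (idc r ⊙ (idc ν ⊙ un2)).
  have [c [ct cb ce]] : exists c : Cell n2 h, [/\ top c = b2, bot c = idm B & uh ⊙ c = idc ν ⊙ un2].
    by apply: (cart_ex (gt_cart GT Uh)); rewrite !tbE.
  have Cc : cart c.
    apply: (cart_cancel (gt_cart GT Uh)); rewrite ce.
    by apply: cart_comp (gt_cart GT Un2); exact: (full_bot GT Ux).
  by rewrite -ce ccomp_assoc hr; exact: cart_comp.
have [q [qt qb qe]] : exists q : Cell n2 (vid V), [/\ top q = p ∘ b0, bot q = bl &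
    idc ι ⊙ q = idc r ⊙ (idc ν ⊙ un2)].
  apply: (cart_ex Fι); rewrite !tbE ?hxb ?hxl ?rb_ //.
  by rewrite comp_assoc rt_ -comp_assoc h2b !comp_assoc h1p.
have [q' [qt' qb' qe']] : exists q' : Cell n2 (conjoint b0), [/\ top q' = b0, bot q' = idm B & uV ⊙ q' = q].
  by apply: (cart_ex (gt_cart GT UV)); rewrite ?comp_idr.
have [q3 [qt3 qb3 qe3]] : exists q3 : Cell n2 (vid B), [/\ top q3 = idm B, bot q3 = idm B & idc b0 ⊙ q3 = beta b0 ⊙ q'].
  by apply: (cart_ex Fb0); rewrite !tbE ?qt' ?qb' ?comp_idr.
have Cq3 : cart q3.
  apply: (cart_cancel Fb0); rewrite qe3; apply: cart_comp (cart_beta _) _.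
  apply: (cart_cancel (gt_cart GT UV)); rewrite qe'.
  by apply: (cart_cancel Fι); rewrite qe.
(* What follows [A] in [R] is thus the collage of a morphism isomorphic to an identity: again a
   cylinder, reflecting onto its second end. *)
have [j hj] : exists j : SpecialIso (vid B) n2, q3 ⊙ j = cid (vid B).
  by apply: (cart_unique (cart_iso (iso_id (vid B))) Cq3); rewrite /= tbE ?qt3 ?qb3.
have qj : q ⊙ j = δ.
  rewrite -qe' -ccomp_assoc; congr (_ ⊙ _).
  apply: (cart_uq (cart_beta b0)); rewrite ?tbE ?qt' ?qb' ?tbE //.
  by rewrite ccomp_assoc -qe3 -ccomp_assoc hj ccomp_idr cjt_hor.
have nj : idc r ⊙ (idc ν ⊙ un2) ⊙ j = idc ι ⊙ δ by rewrite -qe -ccomp_assoc qj.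
have [t2 [σ2 [t2a t2b t2e [σ2t σ2b tσ2 σ2s σ2a]]]] := cylinder GT Un2 (opcart_iso j) (top_iso _) (bot_iso _).
have [κh' [kt' kb' ke']] : exists κh' : Cell wl h, [/\ top κh' = a2, bot κh' = idm B & uv1 ⊙ κh ⊙ κh' = uw ⊙ κl].
  apply: (cart_ex Cuk); rewrite !tbE ?ht ?hb ?lt ?lb ?comp_idr -?h1b //.
  by rewrite -/q1 -/a -comp_assoc h2a h1a.
have Ckh' : cart κh'.
  by apply: (cart_cancel Cuk); rewrite ke'; apply: cart_comp => //; exact: gt_cart Uw.
have [κ2 [κ2t κ2b κ2e]] : exists κ2 : Cell wl x, [/\ top κ2 = idm A, bot κ2 = bot un2 & ux ⊙ κ2 = uh ⊙ κh'].
  by apply: (cart_ex (gt_cart GT Ux)); rewrite !tbE ?kt' ?kb' ?comp_idr // hxl.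
have Cκ2 : cart κ2.
  apply: (cart_cancel (gt_cart GT Ux)); rewrite κ2e; apply: cart_comp Ckh'; exact: gt_cart Uh.
have [ψ2 [ψ2b ψ2κ ψ2u]] := reflection_desc ψl t2b σ2t σ2b tσ2 σ2s Cκ2 κ2t κ2b.
rewrite ψlb in ψ2b.
have [F2 hF2] := glue_ex ψ2 Ux.
have F2ν : F2 ∘ ν = g ∘ l ∘ t2 by rewrite (idc_bot hF2).
have [d1 [d1t d1b d1e]] : exists d1 : Cell w2 w1, [/\ top d1 = idm A, bot d1 = b0 & u1 ⊙ d1 = idc q2 ⊙ u2].
  by apply: (cart_ex (gt_cart GT U1)); rewrite !tbE ?h2a.
have [d2 [d2t d2b d2e]] : exists d2 : Cell w2 x, [/\ top d2 = idm A, bot d2 = top un2 & ux ⊙ d2 = idc (top uh) ⊙ u2].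
  by apply: (cart_ex (gt_cart GT Ux)); rewrite !tbE ?hxa.
have Cd1 : cart d1.
  apply: (cart_cancel (gt_cart GT U1)); rewrite d1e.
  by apply: cart_comp (gt_cart GT U2); exact: (full_top GT Uv2).
have Cωd : cart (ω1 ⊙ d1) by exact: cart_comp.
have [i0 hi0] : exists i0 : SpecialIso w0 w2, ω1 ⊙ d1 ⊙ i0 = κ0.
  by apply: (cart_unique C0 Cωd); rewrite !tbE ?ω1t ?d1t ?ω1b ?d1b ?comp_idl.
have Ed1 : ψ1 ⊙ (d1 ⊙ i0) = ψN ⊙ x1.
  rewrite -ψ1κ.
  have f1 : bot (d1 ⊙ i0) = top (σ ⊙ idc (bot (d1 ⊙ i0))) by rewrite [RHS]tbE σt !tbE.
  apply: (reflection_eval (e := f1) σt tσ ψ1b).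
  apply: (cart_uq Cω1); rewrite ?tbE ?κ1t ?d1t ?κ1b ?d1b ?x1t ?x1b ?comp_idl ?σb //.
    by rewrite -(comp_assoc _ _ b0) tpb.
  have f2 : bot (ω1 ⊙ (d1 ⊙ i0)) = top (idc (bot ω1) ⊙ (σ ⊙ idc (bot (d1 ⊙ i0)))).
    by rewrite [RHS]tbE [top (_ ⊙ idc _)]tbE σt !tbE.
  rewrite ccomp_assoc κ1e hx1 (comp_under _ f2); apply: under_eq.
    by rewrite ω1b !tbE d1b σb0 /μ ccomp_assoc.
  by rewrite ccomp_assoc hi0.
have Ed2 : ψ2 ⊙ (d2 ⊙ i0) = ψl ⊙ x2.
  rewrite -ψ2κ.
  have f1 : bot (d2 ⊙ i0) = top (σ2 ⊙ idc (bot (d2 ⊙ i0))) by rewrite [RHS]tbE σ2t !tbE.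
  apply: (reflection_eval (e := f1) σ2t tσ2 ψ2b).
  apply: (cart_uq (gt_cart GT Ux)); rewrite ?tbE ?κ2t ?d2t ?κ2b ?d2b ?x2t ?x2b ?comp_idl ?comp_idr ?σ2b //.
    by rewrite -comp_assoc t2a comp_idr.
  have f2 : bot (ux ⊙ (d2 ⊙ i0)) = top (idc (bot ux) ⊙ (σ2 ⊙ idc (bot (d2 ⊙ i0)))).
    by rewrite [RHS]tbE [top (_ ⊙ idc _)]tbE σ2t !tbE.
  apply: (collapse_faithful (a := a2) (b := idm B) GT Uh Cuk hr).
  - by rewrite !tbE κ2t x2t !comp_idr hxa.
  - by rewrite !tbE κ2b x2b !comp_idr hxl.
  - by rewrite !tbE d2t comp_idr hxa.
  - by rewrite !tbE σ2b d2b -(comp_assoc _ _ (top un2)) t2a !comp_idr hxl.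
  rewrite [ux ⊙ (κ2 ⊙ x2)]ccomp_assoc κ2e -ccomp_assoc ccomp_assoc hr ccomp_assoc ke'.
  rewrite -ccomp_assoc hx2 (comp_under _ f2).
  have f3 : bot (uw ⊙ κ0) = top (idc (bot uw) ⊙ δ) by rewrite tbE e2 [RHS]tbE !tbE.
  have f4 : bot (idc r ⊙ (ux ⊙ (d2 ⊙ i0))) = top (idc (bot (idc r)) ⊙ (idc (bot ux) ⊙ (σ2 ⊙ idc (bot (d2 ⊙ i0))))).
    by rewrite tbE f2 [RHS]tbE !tbE.
  rewrite (comp_under _ f3) (comp_under _ f4); apply: under_eq.
    rewrite bot_idc -/ν -/ι -nj -!ccomp_assoc; congr (_ ⊙ (_ ⊙ _)).
    by rewrite -σ2a !tbE d2b.
  rewrite (ccomp_assoc ux) d2e -hi0 -!ccomp_assoc [in RHS]ccomp_assoc -idc_comp rt_ idc_comp.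
  by rewrite -!ccomp_assoc (ccomp_assoc (idc q2)) -d1e -!ccomp_assoc (ccomp_assoc (idc q1)) -ω1e -!ccomp_assoc.
pose φ := idc F2 ⊙ uh.
(* The agreement of [ψN] and [ψl] over [B0] enters here, by way of [Ed1] and [Ed2]. *)
have φt : top φ = f' ∘ q2.
  rewrite !tbE; apply: (glue_uq U2); rewrite !idc_comp -!ccomp_assoc -d1e -d2e !ccomp_assoc hF2 hf'.
  by apply: (iso_cancelR (i := i0)); rewrite -!ccomp_assoc Ed1 Ed2.
have φb : bot φ = g ∘ l.
  by rewrite !tbE -hxl comp_assoc F2ν -comp_assoc t2b comp_idr.
have VE Y' f0 φ0 := void_extension GT Uv2 Uv1 Ch ht hb CC Ct Cb Vk0 (Y := Y') (f := f0) (φ := φ0).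
have [ψv [[ψvt ψvκ] ψvu]] := VE Y f' φ φt.
have ψvb : bot ψv = g ∘ l by rewrite -φb -ψvκ tbE hb comp_idr.
have [F hF] := glue_ex ψv Uv1.
have Fq : F ∘ q1 = f' by rewrite (idc_top hF).
have Fbl : F ∘ (ι ∘ bl) = g ∘ l by rewrite -h1b (idc_bot hF).
have Fr : F ∘ r = F2.
  by apply: (glue_uq Uh); rewrite idc_comp -ccomp_assoc hr ccomp_assoc hF ψvκ.
have Fι_eq : F ∘ ι = g ∘ t.
  apply: (glue_uq UV); apply: (opcart_uq (opcart_alpha b0)).
  - rewrite !tbE -[top uV]/p -!comp_assoc -h1p !comp_assoc Fq.
    by rewrite (idc_bot hf') ψ1b comp_assoc.
  - by rewrite !tbE -[bot uV]/bl -!comp_assoc Fbl tbl.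
  rewrite -!ccomp_assoc -/δ [idc (g ∘ t)]idc_comp -(ccomp_assoc (idc g)) tδ [idc (F ∘ ι)]idc_comp -(ccomp_assoc (idc F)) -nj.
  rewrite !ccomp_assoc -!idc_comp Fr F2ν.
  by rewrite [idc (g ∘ l ∘ t2)]idc_comp -!ccomp_assoc (ccomp_assoc (idc t2)) t2e idc_id ccomp_idr.
exists (idc F ⊙ uw); split.
  split; first by rewrite !tbE Fι_eq.
  - by rewrite -ccomp_assoc -κ1e (ccomp_assoc uw) ω1e !ccomp_assoc -idc_comp Fq hf'.
  - by rewrite -ccomp_assoc -ke' !ccomp_assoc hF ψvκ /φ -ccomp_assoc -κ2e ccomp_assoc hF2.
move=> ζ [ζb ζN ζl]; have [Fz hFz] := glue_ex ζ Uw.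
have Fzι : Fz ∘ ι = g ∘ t by rewrite (idc_bot hFz).
suff -> : F = Fz by [].
apply: (glue_uq Uv1); rewrite hF; apply: ψvu.
have fz : Fz ∘ q1 = f'.
  apply: (glue_uq U1); rewrite hf' idc_comp -ccomp_assoc -ω1e ccomp_assoc hFz.
  apply: (ψ1u _ g); first by rewrite !tbE ζb ω1b comp_assoc.
  by rewrite -ccomp_assoc κ1e.
split; first by rewrite !tbE.
rewrite -ccomp_assoc -hr ccomp_assoc -idc_comp; congr (idc _ ⊙ _).
apply: (glue_uq Ux); rewrite hF2; apply: (ψ2u _ (g ∘ l)); last first.
  by rewrite -ccomp_assoc κ2e ccomp_assoc idc_comp -(ccomp_assoc _ _ uh) hr -!ccomp_assoc (ccomp_assoc uv1) ke' ccomp_assoc hFz.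
rewrite !tbE; apply: (glue_uq Un2); apply: (iso_cancelR (i := j)).
have nj' : idc r ⊙ (idc ν ⊙ (un2 ⊙ j)) = idc ι ⊙ δ by rewrite -nj !ccomp_assoc.
rewrite !idc_comp -!ccomp_assoc nj' (ccomp_assoc (idc t2)) t2e idc_id ccomp_idr.
by rewrite ccomp_assoc -idc_comp Fzι [idc (g ∘ t)]idc_comp -ccomp_assoc tδ.
Qed.

End Zigzag.

(** * Vertical morphisms into a collage *)

Section Restriction.
Variable D : FramedBicategory.
Local Notation eps f := (cpn_eps (fb_cpn f)).
Local Notation eta f := (cpn_eta (fb_cpn f)).
Local Notation alpha f := (cjt_alpha (fb_cjt f)).
Local Notation beta f := (cjt_beta (fb_cjt f)).

Lemma under_vcc (X X' X'' Y Y' Y'' : D) (m : Ver X X') (m' : Ver X' X'') (n : Ver Y Y')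
    (n' : Ver Y' Y'') (b : Cell (vid X'') (vid Y'')) (φ : Cell m' n') (ψ : Cell m n) e e1 e2 e3 :
  vcc (under b φ e) ψ e1 = under b (vcc φ ψ e2) e3.
Proof.
have f1 : bot (cid m) = top (luni m') by rewrite !tbE.
have f2 : bot (cid n) = top (luni n') by rewrite !tbE.
have f3 : bot ψ = top (vcc b φ e) by rewrite !tbE.
apply: (iso_cancelR (i := luni (m' • m))); apply: (iso_cancelR (i := assoc _ m' m)).
rewrite underE -[RHS]ccomp_assoc -(assoc_nat e f3) [RHS]ccomp_assoc (luni_assoc f2).
rewrite -ccomp_assoc (luni_assoc f1).
have f4 : bot (ψ ⊙ cid m) = top (under b φ e ⊙ luni m') by rewrite !tbE e1 !tbE.
rewrite (vccR f4) //; apply/esym; apply: vccR; rewrite ?underE //.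
by rewrite ccomp_idl ccomp_idr.
Qed.

Lemma rbE (X Y Y' : D) (n : Ver X Y) (g : Hom Y' Y) e : rb n g = lact (beta g) (cid n) e.
Proof. by rewrite /rb /lact; congr (_ ⊙ _); exact: vcc_eq. Qed.

Lemma lact_idc (X Y V W : D) (m : Ver X Y) (w : Ver V W) (φ : Cell m w) f e :
  lact (idc f) φ e = φ ⊙ luni m.
Proof. exact: luniE. Qed.

Lemma ract_idc (X Y V W : D) (m : Ver X Y) (w : Ver V W) (φ : Cell m w) f e :
  ract φ (idc f) e = φ ⊙ runi m.
Proof. exact: runiE. Qed.

Variable GT : glue_theory D.

(** The idea is to write [id_N] as a retract
    of [t_* • z], where [V] is the zigzag [{C -> B <- B0 -> B'}] over [N] and the piece of [z]
    over each part of [V] only sees [C] (resp. [B]). *)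
Lemma restriction_desc (A B C N : D) (n : Ver C B) (un : Cell n (vid N)) (y : Ver A N)
    (c : Cell (n • (conjoint (top un) • y)) (conjoint (bot un) • y)) ec :
  glue un -> top c = idm A -> bot c = idm B ->
  rb y (bot un) ⊙ c = lact un (rb y (top un)) ec ->
  forall (Y : D) (g : Hom N Y) (ψ1 : Cell (conjoint (top un) • y) (vid Y))
    (ψ2 : Cell (conjoint (bot un) • y) (vid Y)) e,
  bot ψ1 = g ∘ top un -> bot ψ2 = g ∘ bot un ->
  ψ2 ⊙ c = lact (idc g ⊙ un) ψ1 e ->
  exists! ψ : Cell y (vid Y), [/\ bot ψ = g, ψ ⊙ rb y (top un) = ψ1 & ψ ⊙ rb y (bot un) = ψ2].
Proof.
move=> Un ct cb hc Y g ψ1 ψ2 ecompat b1 b2 Hcompat.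
set k := top un in c ec ct cb hc ψ1 ecompat b1 Hcompat *.
set l := bot un in c ct cb hc ψ2 b2 Hcompat *.
(* [W] is [N] followed by a new copy [cc] of [B]. It contains two copies of [N]: [e1], made of [C]
   and [B], and [e], made of [C] and [cc]. *)
have [W [ug Ug]] := gt_glue GT (conjoint l).
have [e [π [ek el he [hπ πe] HS]]] := collage_conjoint_split GT Un Ug.
rewrite -/k -/l in ek el he hπ HS.
set e1 := top ug in ek he HS; set cc := bot ug in el.
pose γ := ug ⊙ alpha l.
have γt : top γ = e1 ∘ l by rewrite !tbE.
have γb : bot γ = cc by rewrite !tbE.
have πe1 : π ∘ e1 = idm N by rewrite (idc_top hπ) !tbE.
have πcc : π ∘ cc = l by rewrite (idc_bot hπ) !tbE.
have πγ : idc π ⊙ γ = idc l by rewrite /γ ccomp_assoc hπ cjt_hor.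
have [Vk [uk Uk]] := gt_glue GT (companion l).
set b0 := top uk; set sN := bot uk.
have [V [uV UV]] := gt_glue GT (conjoint b0).
set p := top uV; set bl := bot uV.
pose δ := uV ⊙ alpha b0.
pose μ := idc p ⊙ uk ⊙ eta l.
have [tk htk] := glue_ex (eps l) Uk.
have tkb : tk ∘ b0 = l by rewrite (idc_top htk) !tbE.
have tks : tk ∘ sN = idm N by rewrite (idc_bot htk) !tbE.
have [φt [φtt φtb φte]] : exists φt, [/\ top φt = tk, bot φt = l & φt ⊙ alpha b0 = idc l].
  by apply: (opcart_ex (opcart_alpha b0)); rewrite !tbE.
have [t ht] := glue_ex φt UV.
have tp : t ∘ p = tk by rewrite (idc_top ht).
have tbl : t ∘ bl = l by rewrite (idc_bot ht).
have tδ : idc t ⊙ δ = idc l by rewrite /δ ccomp_assoc ht.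
(* [v : V -> W] sends the part [N] to [e1], the part [B0] to [B] inside [e1], and the end [B'] to
   [cc]. *)
have [vk hvk] := glue_ex (idc e1 ⊙ eps l) Uk.
have vkb : vk ∘ b0 = e1 ∘ l by rewrite (idc_top hvk) !tbE.
have vks : vk ∘ sN = e1 by rewrite (idc_bot hvk) !tbE.
have [φv [φvt φvb φve]] : exists φv, [/\ top φv = vk, bot φv = cc & φv ⊙ alpha b0 = γ].
  by apply: (opcart_ex (opcart_alpha b0)); rewrite !tbE.
have [v hv] := glue_ex φv UV.
have vp : v ∘ p = vk by rewrite (idc_top hv).
have vbl : v ∘ bl = cc by rewrite (idc_bot hv).
have vδ : idc v ⊙ δ = γ by rewrite /δ ccomp_assoc hv.
have vμ : idc v ⊙ μ = idc (e1 ∘ l).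
  by rewrite /μ !ccomp_assoc -idc_comp vp hvk -ccomp_assoc cpn_hor idc_comp.
have πv : π ∘ v = t.
  apply: (glue_uq UV); apply: (opcart_uq (opcart_alpha b0)).
  - rewrite !tbE -!comp_assoc -/p vp tp; apply: (glue_uq Uk).
    by rewrite htk idc_comp -ccomp_assoc hvk ccomp_assoc -idc_comp πe1 idc_id ccomp_idl.
  - by rewrite !tbE -!comp_assoc -/bl vbl tbl.
  by rewrite idc_comp -!ccomp_assoc -/δ vδ πγ tδ.
have tμ : idc t ⊙ μ = idc l.
  by rewrite -πv idc_comp -ccomp_assoc vμ -idc_comp comp_assoc πe1 comp_idl.
have μt : top μ = p ∘ b0 by rewrite !tbE.
have μb : bot μ = p ∘ sN ∘ l by rewrite !tbE.
have δt : top δ = p ∘ b0 by rewrite !tbE.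
have δb : bot δ = bl by rewrite !tbE.
(* The cells of [z] start at [e]. Over the part [N] of [V] they end at [e1], so by [HS] they factor
   through [C]; over the end [bl] they end at [cc], which is [B] in [e]. Therefore the pieces of
   [z • y] at the two ends can be mapped by [ψ1] and by [ψ2] respectively. *)
have [z [cz [Cz czt czb]]] := restriction_exists (vid W) e v.
pose ρ := idc π ⊙ cz.
have ρt : top ρ = idm N by rewrite !tbE czt.
have ρb : bot ρ = t by rewrite !tbE czb.
set sV := p ∘ sN; set b0V := p ∘ b0.
have vs : v ∘ sV = e1 by rewrite comp_assoc vp vks.
have vb0 : v ∘ b0V = e1 ∘ l by rewrite comp_assoc vp vkb.
have tsV : t ∘ sV = idm N by rewrite comp_assoc tp tks.
pose κN := rb z sV; pose κl := rb z bl; pose κ0 := rb z b0V.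
have NB : bot κN = sV by exact: bot_rb.
have NT : top κN = idm N by exact: top_rb.
have lB : bot κl = bl by exact: bot_rb.
have lT : top κl = idm N by exact: top_rb.
have zB : bot κ0 = b0V by exact: bot_rb.
have zT : top κ0 = idm N by exact: top_rb.
have CN : cart κN by exact: cart_rb.
have Cl : cart κl by exact: cart_rb.
have C0 : cart κ0 by exact: cart_rb.
clearbody κN κl κ0.
have eμ : bot κ0 = top μ by rewrite zB μt.
have eδ : bot κ0 = top δ by rewrite zB δt.
have [x1 [x1t x1b x1e]] : exists x1, [/\ top x1 = idm N, bot x1 = l & κN ⊙ x1 = under μ κ0 eμ].
  by apply: (cart_ex CN); rewrite ?NT ?NB !tbE.
have [x2 [x2t x2b x2e]] : exists x2, [/\ top x2 = idm N, bot x2 = idm B & κl ⊙ x2 = under δ κ0 eδ].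
  by apply: (cart_ex Cl); rewrite ?lT ?lB !tbE.
have [εC [εCt εCb εCe]] : exists εC : Cell (vid C) (conjoint sV • z), [/\ top εC = k, bot εC = k &
    cz ⊙ (κN ⊙ εC) = idc (e ∘ k)].
  have [a [at_ ab ae]] : exists a : Cell (vid C) z, [/\ top a = k, bot a = sV ∘ k & cz ⊙ a = idc (e ∘ k)].
    by apply: (cart_ex Cz); rewrite !tbE ?czt ?czb // ek comp_assoc vs.
  have [a' [at' ab' ae']] : exists a' : Cell (vid C) (conjoint sV • z), [/\ top a' = k, bot a' = k & κN ⊙ a' = a].
    by apply: (cart_ex CN); rewrite ?NT ?NB ?comp_idl.
  by exists a'; rewrite ae'.
have [εB [εBt εBb εBe]] : exists εB : Cell (vid B) (conjoint bl • z), [/\ top εB = l, bot εB = idm B &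
    cz ⊙ (κl ⊙ εB) = idc (e ∘ l)].
  have [a [at_ ab ae]] : exists a : Cell (vid B) z, [/\ top a = l, bot a = bl & cz ⊙ a = idc (e ∘ l)].
    by apply: (cart_ex Cz); rewrite !tbE ?czt ?czb // vbl el.
  have [a' [at' ab' ae']] : exists a' : Cell (vid B) (conjoint bl • z), [/\ top a' = l, bot a' = idm B & κl ⊙ a' = a].
    by apply: (cart_ex Cl); rewrite ?lT ?lB ?comp_idl ?comp_idr.
  by exists a'; rewrite ae'.
have ρC : ρ ⊙ (κN ⊙ εC) = idc k by rewrite /ρ -ccomp_assoc εCe -idc_comp comp_assoc πe comp_idl.
have ρB : ρ ⊙ (κl ⊙ εB) = idc l by rewrite /ρ -ccomp_assoc εBe -idc_comp comp_assoc πe comp_idl.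
have hρ : ρ = idc π ⊙ cz by [].
clearbody ρ.
pose o := ot (companion k) k ⊙ eta k.
have fε : bot (beta k) = top (eps k) by rewrite !tbE.
pose ε := lact (eps k) (beta k) fε.
have εo : ε ⊙ o = idc k.
  have f1 : bot (beta k ⊙ alpha k) = top (eps k ⊙ cid _) by rewrite !tbE.
  have f2 : bot (idc k) = top (eps k) by rewrite !tbE.
  rewrite /ε /o /ot !ccomp_assoc (lact_comp _ _ f1) lact_ract.
  have -> : ract (eps k ⊙ cid _) (beta k ⊙ alpha k) f1 = ract (eps k) (idc k) f2.
    by apply: ract_eq; rewrite ?ccomp_idr ?cjt_hor.
  by rewrite ract_idc -(ccomp_assoc _ (runi _)) iso_VK ccomp_idr cpn_hor.
have Ck : cart (idc k) by exact: (full_top GT Un).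
have Oo : opcart o by exact: opcart_comp (opcart_ot _ _) (opcart_eta _).
have Co : cart o.
  apply: cart_comp (cart_ot_full _ Ck) _.
  by apply: (cart_cancel (cart_eps k)); rewrite cpn_hor.
have [η [ηt ηb ηe]] : exists η : Cell (conjoint sV • z) (companion k • conjoint k),
    [/\ top η = idm N, bot η = idm N & ε ⊙ η = idc π ⊙ (cz ⊙ κN)].
  by apply: (HS _ _ o) => //; rewrite !tbE ?czt ?czb ?NT ?NB ?comp_idr.
have ηεC : η ⊙ εC = o.
  have [x [xt xb xe]] : exists x : Cell (vid C) (vid C), [/\ top x = idm C, bot x = idm C & o ⊙ x = η ⊙ εC].
    by apply: (cart_ex Co); rewrite !tbE ?ηt ?ηb ?εCt ?εCb ?comp_idl.
  rewrite -xe; suff -> : x = cid (vid C) by rewrite ccomp_idr.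
  apply: (cart_uq Ck); rewrite ?tbE // ccomp_idr -{1}εo -ccomp_assoc xe ccomp_assoc ηe.
  by rewrite -2!ccomp_assoc εCe -idc_comp comp_assoc πe comp_idl.
(* [ψ1'] and [ψl] extend the data to the two ends of the zigzag. *)
have fψ1 : bot ψ1 = top (idc g ⊙ eps k) by rewrite b1 !tbE.
pose ψ1' := lact (idc g ⊙ eps k) ψ1 fψ1 ⊙ assoc (companion k) (conjoint k) y.
have fη : bot (cid y) = top η by rewrite !tbE.
pose ψN := ψ1' ⊙ vcc η (cid y) fη.
have fl : bot (cid y) = top (ρ ⊙ κl) by rewrite !tbE ρt lT ?comp_idl.
have [sl [slt slb sle]] : exists sl : Cell ((conjoint bl • z) • y) (conjoint l • y),
    [/\ top sl = idm A, bot sl = idm B & rb y l ⊙ sl = lact (ρ ⊙ κl) (cid y) fl].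
  apply: (cart_ex (cart_rb y l)); rewrite ?top_rb ?bot_rb ?top_lact ?bot_lact ?tbE //.
  by rewrite lB ρb tbl ?comp_idr.
pose ψl := ψ2 ⊙ sl.
have fN : bot (cid y) = top κN by rewrite NT !tbE.
have fl' : bot (cid y) = top κl by rewrite lT !tbE.
have f0 : bot (cid y) = top κ0 by rewrite zT !tbE.
have fx1 : bot (cid y) = top x1 by rewrite x1t !tbE.
have fx2 : bot (cid y) = top x2 by rewrite x2t !tbE.
have fe1 : bot (vcc κ0 (cid y) f0) = top μ by rewrite bot_vcc.
have fe2 : bot (vcc κ0 (cid y) f0) = top δ by rewrite bot_vcc.
have hx1 : vcc κN (cid y) fN ⊙ vcc x1 (cid y) fx1 = under μ (vcc κ0 (cid y) f0) fe1.
  have f1 : bot (cid y) = top (under μ κ0 eμ) by rewrite top_under.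
  by rewrite -(under_vcc (e := eμ) f1); apply: vccR; rewrite ?x1e ?ccomp_idl.
have hx2 : vcc κl (cid y) fl' ⊙ vcc x2 (cid y) fx2 = under δ (vcc κ0 (cid y) f0) fe2.
  have f1 : bot (cid y) = top (under δ κ0 eδ) by rewrite top_under.
  by rewrite -(under_vcc (e := eδ) f1); apply: vccR; rewrite ?x2e ?ccomp_idl.
have fy1 : bot (cid y) = top (beta k) by rewrite !tbE.
have fun_ : bot (beta k) = top un by rewrite tbE.
have ρ0 : ρ ⊙ κN ⊙ x1 = ρ ⊙ κ0.
  have f1 : bot (ρ ⊙ κ0) = top (idc (bot ρ) ⊙ μ) by rewrite tbE eμ [RHS]tbE !tbE.
  rewrite -ccomp_assoc x1e (comp_under _ f1).
  have f2 : bot (ρ ⊙ κ0) = top (idc l) by rewrite f1 ρb tμ.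
  by apply: (etrans _ (under_idc f2)); apply: under_eq; rewrite ?ρb.
have ρ0' : ρ ⊙ κl ⊙ x2 = ρ ⊙ κ0.
  have f1 : bot (ρ ⊙ κ0) = top (idc (bot ρ) ⊙ δ) by rewrite tbE eδ [RHS]tbE !tbE.
  rewrite -ccomp_assoc x2e (comp_under _ f1).
  have f2 : bot (ρ ⊙ κ0) = top (idc l) by rewrite f1 ρb tδ.
  by apply: (etrans _ (under_idc f2)); apply: under_eq; rewrite ?ρb.
(* Over [B0] the cell [η ⊙ x1] ends in [B] and lifts to [η0], with values in [n • conjoint k]. There
   the compatibility of [ψ1] and [ψ2] with [c] applies, and the rest is compared in the restriction
   of [y] along [l]. *)
have Hz : ψN ⊙ vcc x1 (cid y) fx1 = ψl ⊙ vcc x2 (cid y) fx2.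
  have [ut [utt utb ute]] : exists ut : Cell n (companion k), [/\ top ut = idm C, bot ut = l & eps k ⊙ ut = un].
    by apply: (cart_ex (cart_eps k)); rewrite !tbE.
  have Cut : cart ut by apply: (cart_cancel (cart_eps k)); rewrite ute; exact: gt_cart Un.
  have g1 : bot (cid (conjoint k)) = top ut by rewrite utt !tbE.
  pose xl := vcc ut (cid (conjoint k)) g1.
  have Cxl : cart xl by exact: cart_vcc_cid.
  have [η0 [η0t η0b η0e]] : exists η0 : Cell (conjoint b0V • z) (n • conjoint k),
      [/\ top η0 = idm N, bot η0 = idm B & xl ⊙ η0 = η ⊙ x1].
    by apply: (cart_ex Cxl); rewrite !tbE ?ηt ?ηb ?x1t ?x1b ?comp_idl ?comp_idr ?utb.
  have g2 : bot (cid y) = top η0 by rewrite η0t !tbE.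
  have g3 : bot (cid y) = top xl by rewrite !tbE.
  have g4 : bot (cid y) = top (η ⊙ x1) by rewrite !tbE ηt x1t comp_idl.
  have g5 : bot (cid (conjoint k • y)) = top ut by rewrite utt !tbE.
  have g6 : bot ψ1 = top (idc g ⊙ eps k ⊙ ut) by rewrite tbE -fψ1 utt comp_idr.
  have -> : ψN ⊙ vcc x1 (cid y) fx1 = ψ2 ⊙ (c ⊙ assoc n (conjoint k) y ⊙ vcc η0 (cid y) g2).
    rewrite /ψN -ccomp_assoc (vccR (χ := η ⊙ x1) (χ' := cid y) g4) ?ccomp_idl //.
    have -> : vcc (η ⊙ x1) (cid y) g4 = vcc xl (cid y) g3 ⊙ vcc η0 (cid y) g2.
      by apply/esym/vccR; rewrite ?η0e ?ccomp_idl.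
    rewrite [LHS]ccomp_assoc [RHS]ccomp_assoc; congr (_ ⊙ _); rewrite [RHS]ccomp_assoc Hcompat /ψ1'.
    have g7 : bot (cid y) = top (cid (conjoint k)) by rewrite !tbE.
    have g8 : bot (vcc (cid (conjoint k)) (cid y) g7) = top ut by rewrite vcc_cid.
    rewrite -ccomp_assoc (assoc_nat g1 g3 g7 g8) ccomp_assoc; congr (_ ⊙ _).
    have g9 : bot (ψ1 ⊙ vcc (cid (conjoint k)) (cid y) g7) = top (idc g ⊙ eps k ⊙ ut).
      by rewrite vcc_cid ccomp_idr.
    rewrite (lact_comp _ _ g9); apply: lact_eq; last by rewrite vcc_cid ccomp_idr.
    by rewrite -ccomp_assoc ute.
  rewrite /ψl -[RHS]ccomp_assoc; congr (_ ⊙ _).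
  apply: (cart_uq (cart_rb y l)); rewrite ?tbE ?η0t ?η0b ?ct ?cb ?slt ?slb ?x2t ?x2b ?comp_idl //.
  rewrite !ccomp_assoc hc sle.
  have g7 : bot (cid y) = top (lact un (beta k) fun_) by rewrite !tbE.
  have g8 : bot (rb y k) = top un by rewrite bot_rb.
  have g9 : bot (cid y ⊙ cid y) = top (lact un (beta k) fun_ ⊙ η0) by rewrite tbE !tbE η0t.
  have g10 : bot (cid y ⊙ cid y) = top (ρ ⊙ κl ⊙ x2) by rewrite [RHS]tbE -fl x2t !tbE.
  have g11 : bot (lact (beta k) (cid y) fy1) = top un by rewrite bot_lact tbE.
  have -> : lact un (rb y k) ec = lact un (lact (beta k) (cid y) fy1) g11.
    by apply: lact_eq => //; exact: rbE.
  rewrite (lact_lact g11 g7) (lact_comp _ _ g9) (lact_comp _ _ g10).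
  apply: lact_eq => //; rewrite ρ0' -ρ0.
  have -> : lact un (beta k) fun_ = ε ⊙ xl.
    have g12 : bot (beta k ⊙ cid _) = top (eps k ⊙ ut) by rewrite ute ccomp_idr.
    by rewrite /ε /xl (lact_comp _ _ g12); apply: lact_eq; rewrite ?ccomp_idr.
  by rewrite -(ccomp_assoc ε) η0e ccomp_assoc ηe hρ !ccomp_assoc.
have ZD := zigzag_desc GT (w := z • y) (wN := conjoint sV • z • y) (wl := conjoint bl • z • y)
  (w0 := conjoint b0V • z • y) (κN := vcc κN (cid y) fN) (κl := vcc κl (cid y) fl')
  (κ0 := vcc κ0 (cid y) f0) (x1 := vcc x1 (cid y) fx1) (x2 := vcc x2 (cid y) fx2) (t := t)
  (g := g) (e1 := fe1) (e2 := fe2) (ψN := ψN) (ψl := ψl) Uk UV.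
have [ζ [[ζb ζN ζl] ζu]] : exists! ζ : Cell (z • y) (vid Y),
    [/\ bot ζ = g ∘ t, ζ ⊙ vcc κN (cid y) fN = ψN & ζ ⊙ vcc κl (cid y) fl' = ψl].
  apply: ZD; rewrite ?top_vcc ?bot_vcc ?top_cid -/p -/bl -/b0 -/sN ?tp //.
  - exact: cart_vcc_cid.
  - exact: cart_vcc_cid.
  - exact: cart_vcc_cid.
  - by rewrite /ψN /ψ1' !tbE ηb ?tbE.
  - by rewrite /ψl tbE slb comp_idr.
have fC : bot (rb y k) = top εC by rewrite εCt bot_rb.
have fB : bot (rb y l) = top εB by rewrite εBt bot_rb.
(* [εC] and [εB] mark the identities of [C] and of [B] inside the end pieces of [z]. Evaluating
   there gives back [ψ1] and, in [HB], [ψ2]. *)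
have HC : ψN ⊙ vcc εC (rb y k) fC = ψ1 ⊙ luni (conjoint k • y).
  have g1 : bot (rb y k) = top (η ⊙ εC) by rewrite tbE -fC ηt comp_idl.
  rewrite /ψN -ccomp_assoc (vccR (χ := η ⊙ εC) (χ' := rb y k) g1) ?ccomp_idl //.
  have g2 : bot (alpha k) = top (eta k) by rewrite !tbE.
  have o_eq : o ⊙ runi (vid C) = vcc (eta k) (alpha k) g2.
    have g3 : bot (idc (idm C)) = top (eta k) by rewrite !tbE.
    have g4 : bot (alpha k) = top (cid (companion k)) by rewrite !tbE.
    rewrite /o -[LHS]ccomp_assoc -(runiE g3) ccomp_assoc /ot -(ccomp_assoc _ (iso_inv _)) iso_K ccomp_idr.
    by apply: vccR; rewrite ?ccomp_idl // idc_id ccomp_idr.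
  have g5 : bot (cid (conjoint k • y)) = top (runi (vid C)) by rewrite !tbE.
  have g6 : bot (cid (conjoint k • y)) = top (luni (vid C)) by rewrite !tbE.
  apply: (iso_cancelR (i := vcc_iso (i := runi (vid C)) (j := iso_id (conjoint k • y)) g5)) => /=.
  have -> : vcc (runi (vid C)) (cid (conjoint k • y)) g5 = vcc (luni (vid C)) (cid (conjoint k • y)) g6.
    by apply: vcc_eq; rewrite ?luni_runi.
  have g7 : bot (rb y k) = top (vcc (eta k) (alpha k) g2) by rewrite bot_rb !tbE.
  have g8 : bot (rb y k) = top (alpha k) by rewrite bot_rb !tbE.
  have g9 : bot (vcc (alpha k) (rb y k) g8) = top (eta k) by rewrite !tbE.
  rewrite -[LHS]ccomp_assoc (vccR (χ := vcc (eta k) (alpha k) g2) (χ' := rb y k) g7) ?ccomp_idr //; last first.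
    by rewrite ηεC luni_runi.
  rewrite /ψ1' -[LHS]ccomp_assoc (assoc_nat g2 g7 g8 g9) ccomp_assoc.
  have g10 : bot (ψ1 ⊙ luni (conjoint k • y)) = top (idc (g ∘ k)) by rewrite tbE b1 !tbE.
  have g11 : bot (luni (conjoint k • y)) = top (eta k) by rewrite !tbE.
  have -> : vcc (eta k) (vcc (alpha k) (rb y k) g8) g9 = vcc (eta k) (luni (conjoint k • y)) g11.
    by apply: vcc_eq => //; exact: rb_section.
  have g12 : bot (ψ1 ⊙ luni (conjoint k • y)) = top (idc g ⊙ eps k ⊙ eta k) by rewrite tbE b1 !tbE.
  rewrite (lact_comp _ _ g12).
  have -> : lact (idc g ⊙ eps k ⊙ eta k) (ψ1 ⊙ luni (conjoint k • y)) g12 = lact (idc (g ∘ k)) (ψ1 ⊙ luni (conjoint k • y)) g10.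
    by apply: lact_eq => //; rewrite -ccomp_assoc cpn_hor idc_comp.
  by rewrite lact_idc -!ccomp_assoc luni_assoc.
have HB : ψl ⊙ vcc εB (rb y l) fB = ψ2 ⊙ luni (conjoint l • y).
  rewrite /ψl -ccomp_assoc; congr (_ ⊙ _); apply: (cart_uq (cart_rb y l)); rewrite ?tbE ?slt ?slb ?top_rb ?εBb ?comp_idl //.
  rewrite ccomp_assoc sle.
  have g1 : bot (cid y ⊙ rb y l) = top (ρ ⊙ κl ⊙ εB) by rewrite !tbE ρt lT εBt !comp_idl ?bot_rb.
  have g2 : bot (rb y l) = top (idc l) by rewrite ?bot_rb !tbE.
  rewrite (lact_comp _ _ g1).
  have -> : lact (ρ ⊙ κl ⊙ εB) (cid y ⊙ rb y l) g1 = lact (idc l) (rb y l) g2.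
    by apply: lact_eq; rewrite ?ccomp_idl // -ccomp_assoc.
  by rewrite lact_idc.
(* A solution [ψ], acted on by [ρ], solves the problem posed on [z • y]; so it becomes [ζ] there,
   and uniqueness will follow from the retraction. *)
have HU (ψ : Cell y (vid Y)) fψ : bot ψ = g -> ψ ⊙ rb y k = ψ1 -> ψ ⊙ rb y l = ψ2 ->
    lact (idc g ⊙ ρ) ψ fψ = ζ.
  move=> ψb ψk ψl_; apply/esym/ζu; split; first by rewrite bot_lact !tbE ρb.
  - have g1 : bot (ψ ⊙ cid y) = top (idc g ⊙ ρ ⊙ κN) by rewrite !tbE ρt NT ψb !comp_idr.
    rewrite (lact_comp _ _ g1) /ψN.
    have g2 : bot ψ = top (idc g ⊙ beta k) by rewrite ψb !tbE.
    have g3 : bot (lact (idc g ⊙ beta k) ψ g2) = top (idc g ⊙ eps k) by rewrite bot_lact !tbE.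
    have g4 : bot (idc g ⊙ beta k) = top (idc g ⊙ eps k) by rewrite !tbE.
    have g5 : bot ψ = top (lact (idc g ⊙ eps k) (idc g ⊙ beta k) g4) by rewrite top_lact.
    have E1 : lact (idc g ⊙ beta k) ψ g2 = ψ1.
      have g6 : bot (ψ ⊙ cid y) = top (idc (bot ψ) ⊙ beta k) by rewrite ψb !tbE.
      by rewrite -ψk (rbE fy1) (comp_lact _ g6); apply: lact_eq; rewrite ?ψb ?ccomp_idr.
    have -> : ψ1' = lact (lact (idc g ⊙ eps k) (idc g ⊙ beta k) g4) ψ g5.
      by rewrite -(lact_lact g3) /ψ1'; congr (_ ⊙ _); apply: lact_eq.
    have g7 : bot (ψ ⊙ cid y) = top (lact (idc g ⊙ eps k) (idc g ⊙ beta k) g4 ⊙ η).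
      by rewrite !tbE ηt ψb ?top_lact ?tbE.
    rewrite (lact_comp _ _ g7); apply: lact_eq => //.
    have g8 : bot (idc g ⊙ beta k) = top (idc (bot (idc g)) ⊙ eps k) by rewrite !tbE.
    have -> : lact (idc g ⊙ eps k) (idc g ⊙ beta k) g4 = idc g ⊙ ε.
      by rewrite /ε (comp_lact _ g8); apply: lact_eq; rewrite ?bot_idc.
    by rewrite -(ccomp_assoc _ ε η) ηe hρ !ccomp_assoc.
  - have g1 : bot (ψ ⊙ cid y) = top (idc g ⊙ ρ ⊙ κl) by rewrite !tbE ρt lT ψb !comp_idr.
    rewrite (lact_comp _ _ g1) /ψl -ψl_ -[RHS]ccomp_assoc sle.
    have g2 : bot (ψ ⊙ cid y) = top (idc (bot ψ) ⊙ (ρ ⊙ κl)) by rewrite !tbE ρt lT !comp_idr.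
    by rewrite (comp_lact _ g2); apply: lact_eq; rewrite ?ψb // -ccomp_assoc.
(* The section [θ] of the collapse of [t_* • z]. *)
pose T := companion t • z.
have [QT [uT UT]] := gt_glue GT T.
pose ω := uT ⊙ ob z t.
have ωt : top ω = top uT by rewrite tbE top_ob comp_idr.
have ωb : bot ω = bot uT ∘ t by rewrite tbE bot_ob.
set q0 := top uT in ωt; set q1 := bot uT in ωb.
pose a1 := κN ⊙ εC; pose a2 := κl ⊙ εB.
have a1t : top a1 = k by rewrite tbE NT comp_idl.
have a1b : bot a1 = sV ∘ k by rewrite tbE NB εCb.
have a2t : top a2 = l by rewrite tbE lT comp_idl.
have a2b : bot a2 = bl by rewrite tbE lB εBb comp_idr.
have tb0V : t ∘ b0V = l by rewrite /b0V comp_assoc tp tkb.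
have μbV : bot μ = sV ∘ l by exact: μb.
have μtV : top μ = b0V by exact: μt.
have δtV : top δ = b0V by exact: δt.
clearbody sV b0V.
have a1E : κN ⊙ εC = a1 by [].
have a2E : κl ⊙ εB = a2 by [].
have ωE : ω = uT ⊙ ob z t by [].
clearbody a1 a2 ω.
rewrite a1E in εCe ρC; rewrite a2E in εBe ρB.
have [αB [αBt αBb αBe]] : exists α : Cell n z, [/\ top α = k, bot α = bl & cz ⊙ α = idc e ⊙ un].
  by apply: (cart_ex Cz); rewrite !tbE ?czt ?czb // -/l el vbl.
have [αC [αCt αCb αCe]] : exists α : Cell n z, [/\ top α = k, bot α = sV ∘ l & cz ⊙ α = idc e1 ⊙ un].
  by apply: (cart_ex Cz); rewrite !tbE ?czt ?czb ?ek // comp_assoc vs.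
have [α0 [α0t α0b α0e]] : exists α : Cell n z, [/\ top α = k, bot α = b0V & cz ⊙ α = idc e1 ⊙ un].
  by apply: (cart_ex Cz); rewrite !tbE ?czt ?czb ?ek ?vb0.
have fμ : bot α0 = top μ by rewrite α0b μtV.
have fδ : bot α0 = top δ by rewrite α0b δtV.
have EC : under μ α0 fμ = αC.
  apply: (cart_uq Cz); rewrite ?top_under ?bot_under ?α0t ?αCt ?αCb ?μbV //.
  have g1 : bot (cz ⊙ α0) = top (idc (bot cz) ⊙ μ) by rewrite tbE fμ [RHS]tbE !tbE.
  rewrite (comp_under _ g1) αCe.
  have g2 : bot (idc e1 ⊙ un) = top (idc (e1 ∘ l)) by rewrite !tbE.
  by apply: (etrans _ (under_idc g2)); apply: under_eq; rewrite ?czb ?vμ.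
have EB : under δ α0 fδ = αB.
  apply: (cart_uq Cz); rewrite ?top_under ?bot_under ?α0t ?αBt ?αBb ?δb //.
  have g1 : bot (cz ⊙ α0) = top (idc (bot cz) ⊙ δ) by rewrite tbE fδ [RHS]tbE !tbE.
  rewrite (comp_under _ g1) αBe.
  have g2 : bot (idc e1 ⊙ un) = top γ by rewrite γt !tbE.
  by rewrite (he g2); apply: under_eq; rewrite ?czb ?vδ.
have ωαC : ω ⊙ αC = ω ⊙ α0.
  have g1 : bot (ω ⊙ α0) = top (idc (bot ω) ⊙ μ) by rewrite tbE fμ [RHS]tbE !tbE.
  rewrite -EC (comp_under _ g1).
  have g2 : bot (ω ⊙ α0) = top (idc (q1 ∘ l)) by rewrite tbE α0b ωb -(comp_assoc q1) tb0V !tbE.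
  by apply: (etrans _ (under_idc g2)); apply: under_eq; rewrite ?ωb // [idc (q1 ∘ t)]idc_comp -ccomp_assoc tμ idc_comp.
have ωαB : ω ⊙ αB = ω ⊙ α0.
  have g1 : bot (ω ⊙ α0) = top (idc (bot ω) ⊙ δ) by rewrite tbE fδ [RHS]tbE !tbE.
  rewrite -EB (comp_under _ g1).
  have g2 : bot (ω ⊙ α0) = top (idc (q1 ∘ l)) by rewrite tbE α0b ωb -(comp_assoc q1) tb0V !tbE.
  by apply: (etrans _ (under_idc g2)); apply: under_eq; rewrite ?ωb // [idc (q1 ∘ t)]idc_comp -ccomp_assoc tδ idc_comp.
have h1 : bot (idc q0 ⊙ un) = top (ω ⊙ a2) by rewrite !tbE ωt a2t.
have h2 : bot (ω ⊙ a1) = top (idc q1 ⊙ un).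
  by rewrite !tbE ωb a1b -comp_assoc (comp_assoc t) tsV comp_idl.
(* [θ0] has value [a1] on [C] and [a2] on [B]. The two values live at different ends of the zigzag
   and are compared over [B0]: the bottom of [ω] factors through [t], so [ω] takes the same value on
   [αC], [α0] and [αB]. *)
have Nat : under (ω ⊙ a2) (idc q0 ⊙ un) h1 = over (idc q1 ⊙ un) (ω ⊙ a1) h2.
  transitivity (ω ⊙ αB); last rewrite ωαB -ωαC.
    apply: (iso_cancelR (i := luni n)); rewrite underL.
    have g1 : bot un = top a2 by rewrite a2t.
    have -> : ω ⊙ αB ⊙ luni n = ω ⊙ ract a2 un g1.
      rewrite -ccomp_assoc; congr (_ ⊙ _); apply: (cart_uq Cz); rewrite ?tbE ?top_ract ?bot_ract ?αBt ?αBb ?a2b //.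
      have g2 : bot (idc (top cz) ⊙ un) = top (cz ⊙ a2) by rewrite !tbE g1.
      rewrite (comp_ract _ g2) ccomp_assoc αBe -lact_ract.
      have g3 : bot (idc e ⊙ un) = top (idc (e ∘ l)) by rewrite !tbE.
      by rewrite -(lact_idc g3); apply: lact_eq; rewrite ?czt.
    have g4 : bot (idc (top ω) ⊙ un) = top (ω ⊙ a2) by rewrite ωt h1.
    by rewrite (comp_ract _ g4) -lact_ract; apply: lact_eq; rewrite ?ωt.
  apply: (iso_cancelR (i := runi n)); rewrite overR.
  have g1 : bot a1 = top (idc sV ⊙ un) by rewrite a1b !tbE.
  have -> : ω ⊙ αC ⊙ runi n = ω ⊙ lact (idc sV ⊙ un) a1 g1.
    rewrite -ccomp_assoc; congr (_ ⊙ _); apply: (cart_uq Cz); rewrite ?tbE ?top_lact ?bot_lact ?αCt ?αCb ?a1t ?tbE //.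
    have g2 : bot (cz ⊙ a1) = top (idc (bot cz) ⊙ (idc sV ⊙ un)) by rewrite !tbE a1b.
    rewrite (comp_lact _ g2) ccomp_assoc αCe lact_ract.
    have g3 : bot (idc (e ∘ k)) = top (idc e1 ⊙ un) by rewrite !tbE ek.
    by rewrite -(ract_idc g3); apply: ract_eq; rewrite ?εCe // czb ccomp_assoc -idc_comp vs.
  have g4 : bot (ω ⊙ a1) = top (idc (bot ω) ⊙ (idc sV ⊙ un)) by rewrite !tbE a1b.
  rewrite (comp_lact _ g4) lact_ract; apply: ract_eq => //.
  by rewrite ccomp_assoc -idc_comp ωb -comp_assoc tsV comp_idr.
have [|||θ0 [θ0t θ0b θ0C θ0B]] := two_ex GT (h := q0) (h' := q1) (e1 := h1) (e2 := h2) Un.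
- by rewrite !tbE ωt a1t.
- by rewrite !tbE ωb a2b -comp_assoc tbl.
- exact: Nat.
have CT := gt_cart GT UT.
have [θ [θt θb θe]] : exists θ : Cell (vid N) T, [/\ top θ = idm N, bot θ = idm N & uT ⊙ θ = θ0].
  by apply: (cart_ex CT); rewrite ?comp_idr.
have θC : θ ⊙ idc k = ob z t ⊙ a1.
  apply: (cart_uq CT); rewrite ?tbE ?θt ?θb ?top_ob ?bot_ob ?a1t ?a1b ?comp_idl ?comp_idr //.
    by rewrite comp_assoc tsV comp_idl.
  by rewrite [LHS]ccomp_assoc θe [RHS]ccomp_assoc -ωE.
have θB : θ ⊙ idc l = ob z t ⊙ a2.
  apply: (cart_uq CT); rewrite ?tbE ?θt ?θb ?top_ob ?bot_ob ?a2t ?a2b ?comp_idl ?comp_idr //.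
  by rewrite [LHS]ccomp_assoc θe [RHS]ccomp_assoc -ωE.
have [ρ' [ρt' ρb' ρe']] : exists ρ' : Cell T (vid N), [/\ top ρ' = idm N, bot ρ' = idm N & ρ' ⊙ ob z t = ρ].
  by apply: (opcart_ex (opcart_ob z t)); rewrite ?top_ob ?bot_ob ?comp_idl.
have ρθ : ρ' ⊙ θ = idc (idm N).
  apply: (two_ext GT Un); rewrite ?tbE ?ρt' ?ρb' ?θt ?θb ?comp_idl //.
    by rewrite -ccomp_assoc θC ccomp_assoc ρe' ρC -idc_comp comp_idl.
  by rewrite -ccomp_assoc θB ccomp_assoc ρe' ρB -idc_comp comp_idl.
have fo : bot (cid y) = top (ob z t) by rewrite top_ob tbE.
have fθ : bot (cid y) = top θ by rewrite θt tbE.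
have Oy := opcart_vcc_cid fo (opcart_ob z t) (top_ob z t).
have [ζ' [ζt' ζb' ζe']] : exists ζ' : Cell (T • y) (vid Y), [/\ top ζ' = top ζ, bot ζ' = g &
    ζ' ⊙ vcc (ob z t) (cid y) fo = ζ].
  by apply: (opcart_ex Oy); rewrite !tbE ?bot_ob ?comp_idr.
exists (ζ' ⊙ vcc θ (cid y) fθ ⊙ iso_inv (luni y)); split.
  have S (Z : D) (f : Hom Z N) (κ : Cell (conjoint f • y) y) (a : Cell (vid Z) z) fκ :
      bot κ = f -> θ ⊙ idc f = ob z t ⊙ a ->
      ζ' ⊙ vcc θ (cid y) fθ ⊙ iso_inv (luni y) ⊙ κ ⊙ luni (conjoint f • y) = ζ ⊙ vcc a κ fκ.
    move=> κb hf.
    have g1 : bot κ = top (idc f) by rewrite κb tbE.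
    have g2 : bot κ = top (θ ⊙ idc f) by rewrite tbE θt comp_idl.
    rewrite -ccomp_assoc -(luniE g1) ccomp_assoc -(ccomp_assoc _ (iso_inv _)) iso_K ccomp_idr.
    rewrite -ccomp_assoc (vccR (χ := θ ⊙ idc f) (χ' := κ) g2) ?ccomp_idl //.
    rewrite -ζe' -ccomp_assoc; congr (_ ⊙ _); apply/esym/vccR; rewrite ?ccomp_idl //.
  split; first by rewrite !tbE ζb' θb comp_idr.
  - have g1 : bot (rb y k) = top a1 by rewrite a1t bot_rb.
    apply: (iso_cancelR (i := luni (conjoint k • y))); rewrite (S _ _ _ a1 g1) ?bot_rb //.
    rewrite -HC -ζN -ccomp_assoc; congr (_ ⊙ _); apply/esym/vccR; rewrite ?ccomp_idl //.
  - have g1 : bot (rb y l) = top a2 by rewrite a2t bot_rb.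
    apply: (iso_cancelR (i := luni (conjoint l • y))); rewrite (S _ _ _ a2 g1) ?bot_rb //.
    rewrite -HB -ζl -ccomp_assoc; congr (_ ⊙ _); apply/esym/vccR; rewrite ?ccomp_idl //.
move=> ψ [ψb ψk ψl'].
have h3 : bot ψ = top (idc g ⊙ ρ) by rewrite !tbE ρt ψb ?comp_idr.
have h4 : bot ψ = top (idc g ⊙ ρ') by rewrite !tbE ρt' ψb ?comp_idr.
have Eζ : ζ' = lact (idc g ⊙ ρ') ψ h4.
  apply: (opcart_uq Oy).
  - rewrite ζt' -(HU _ h3) //; by rewrite !top_lact.
  - by rewrite ζb' bot_lact !tbE ρb' ?comp_idr.
  rewrite ζe' -(HU _ h3) //.
  have h5 : bot (ψ ⊙ cid y) = top (idc g ⊙ ρ' ⊙ ob z t) by rewrite ccomp_idr [RHS]tbE -h4 top_ob comp_idr.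
  by rewrite (lact_comp _ _ h5); apply: lact_eq; rewrite ?ccomp_idr // -ccomp_assoc ρe'.
apply: (iso_cancelR (i := luni y)); rewrite -(ccomp_assoc _ (iso_inv _)) iso_K ccomp_idr Eζ.
have h5 : bot (ψ ⊙ cid y) = top (idc g ⊙ ρ' ⊙ θ) by rewrite ccomp_idr [RHS]tbE -h4 θt comp_idr.
have h6 : bot ψ = top (idc g) by rewrite ψb !tbE.
rewrite (lact_comp _ _ h5) -(lact_idc h6); apply: lact_eq; rewrite ?ccomp_idr //.
by rewrite -ccomp_assoc ρθ -idc_comp comp_idr.
Qed.

End Restriction.

(** * Constructing a vertical morphism into a collage from its restrictions *)

Section Modules.
Variable D : FramedBicategory.
Local Notation eps f := (cpn_eps (fb_cpn f)).
Local Notation eta f := (cpn_eta (fb_cpn f)).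
Local Notation alpha f := (cjt_alpha (fb_cjt f)).
Local Notation beta f := (cjt_beta (fb_cjt f)).

Lemma cart_ob_full (A N Z : D) (m : Ver Z A) (i : Hom A N) :
  cart (idc i) -> cart (ob m i).
Proof.
move=> Ci; have Ca : cart (eta i) by apply: (cart_cancel (cart_eps i)); rewrite cpn_hor.
by apply: cart_comp; [apply: cart_vcc_cid Ca _; rewrite !tbE | exact: (cart_iso (iso_sym _))].
Qed.

(** The Yoneda lemma for [conjoint g]: [θ] is determined by its sides and [θ ⊙ alpha g], and this is
    its value at [x]. *)
Lemma cjt_eval (A B C L Q : D) (g : Hom B Q) (θ : Cell (conjoint g) (vid L)) (y : Ver A C)
    (x : Cell y (conjoint g)) e :
  θ ⊙ x = under (θ ⊙ alpha g ⊙ idc (bot x)) (idc (top θ) ⊙ (beta g ⊙ x)) e.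
Proof.
have e1 : bot (beta g ⊙ x) = top (alpha g ⊙ idc (bot x)) by rewrite !tbE.
have E : x ⊙ luni y = runi (conjoint g) ⊙ vcc (alpha g ⊙ idc (bot x)) (beta g ⊙ x) e1.
  have e2 : bot (beta g) = top (alpha g) by rewrite !tbE.
  have e3 : bot x = top (idc (bot x)) by rewrite !tbE.
  by rewrite (vcc_ccomp e1 e2 e3) ccomp_assoc (cjt_ver e2) luniE.
apply: (iso_cancelR (i := luni y)); rewrite -ccomp_assoc E underL lact_ract ccomp_assoc.
have e4 : bot (idc (top θ)) = top θ by rewrite !tbE.
have e5 : bot (idc (top θ) ⊙ (beta g ⊙ x)) = top (θ ⊙ (alpha g ⊙ idc (bot x))) by rewrite !tbE.
rewrite -(runiE e4) -ccomp_assoc /ract -(vcc_ccomp e5); congr (_ ⊙ _).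
by apply: vcc_eq; rewrite ?ccomp_assoc.
Qed.

Lemma cpn_eval (A B C L P : D) (f : Hom B P) (θ : Cell (companion f) (vid L)) (y : Ver A C)
    (x : Cell y (companion f)) e :
  θ ⊙ x = over (idc (bot θ) ⊙ (eps f ⊙ x)) (θ ⊙ eta f ⊙ idc (top x)) e.
Proof.
have e1 : bot (eta f ⊙ idc (top x)) = top (eps f ⊙ x) by rewrite !tbE.
have E : x ⊙ runi y = luni (companion f) ⊙ vcc (eps f ⊙ x) (eta f ⊙ idc (top x)) e1.
  have e2 : bot (eta f) = top (eps f) by rewrite !tbE.
  have e3 : bot (idc (top x)) = top x by rewrite !tbE.
  by rewrite (vcc_ccomp e1 e2 e3) ccomp_assoc (cpn_ver e2) runiE.
apply: (iso_cancelR (i := runi y)); rewrite -ccomp_assoc E overR -lact_ract ccomp_assoc.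
have e4 : bot θ = top (idc (bot θ)) by rewrite !tbE.
have e5 : bot (θ ⊙ (eta f ⊙ idc (top x))) = top (idc (bot θ) ⊙ (eps f ⊙ x)) by rewrite !tbE.
rewrite -(luniE e4) -ccomp_assoc /lact -(vcc_ccomp e5); congr (_ ⊙ _).
by apply: vcc_eq; rewrite ?ccomp_assoc.
Qed.

Variable GT : glue_theory D.

(** The cell of the collage of [w] is cartesian, so cells into [w] are those cells into an identity
    whose sides factor through the legs. *)
Lemma opcart_of_vid (X X' Y Y' : D) (m : Ver X X') (n : Ver Y Y') (o : Cell m n) :
  (forall (Z : D) (φ : Cell m (vid Z)) f g, top φ = f ∘ top o -> bot φ = g ∘ bot o ->
    exists ψ : Cell n (vid Z), [/\ top ψ = f, bot ψ = g & ψ ⊙ o = φ]) ->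
  (forall (Z : D) (ψ ψ' : Cell n (vid Z)),
    top ψ = top ψ' -> bot ψ = bot ψ' -> ψ ⊙ o = ψ' ⊙ o -> ψ = ψ') -> opcart o.
Proof.
move=> ex uq; split.
  move=> Z Z' w φ f g ht hb; have [W [uw Uw]] := gt_glue GT w.
  have [ψ [h1 h2 h3]] : exists ψ : Cell n (vid W), [/\ top ψ = top uw ∘ f, bot ψ = bot uw ∘ g & ψ ⊙ o = uw ⊙ φ].
    by apply: ex; rewrite tbE ?ht ?hb comp_assoc.
  have [ψ' [k1 k2 k3]] := cart_ex (gt_cart GT Uw) h1 h2.
  exists ψ'; split=> //; apply: (cart_uq (gt_cart GT Uw)); rewrite ?tbE ?k1 ?k2 //.
  by rewrite ccomp_assoc k3.
move=> Z Z' w ψ ψ' ht hb e; have [W [uw Uw]] := gt_glue GT w.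
apply: (cart_uq (gt_cart GT Uw)) => //; apply: uq; rewrite ?tbE ?ht ?hb //.
by rewrite -!ccomp_assoc e.
Qed.

(** Cells from [R] to its second leg may be computed in [P]. They form the restriction [h] of the
    identity of [P] along [r] and [ν ∘ l]. The collage of [h] regroups as [A] followed by a cylinder
    on [B], whose reflection gives a retraction [F] onto [R]; this provides the inverse [s'] of the
    comparison [s] from [conjoint j] to [h]. *)
Lemma leg_conjoint_cart (A B N P R : D) (x : Ver A N) (ux : Cell x (vid P)) (l : Hom B N)
    (x0 : Ver A B) (κ : Cell x0 x) (uR : Cell x0 (vid R)) (r : Hom R P) :
  glue ux -> glue uR -> cart (idc l) -> cart κ -> top κ = idm A -> bot κ = l ->
  idc r ⊙ uR = ux ⊙ κ -> cart (idc r ⊙ beta (bot uR)).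
Proof.
move=> Ux UR Fl Cκ κt κb hr.
set i := top uR; set j := bot uR; set ν := bot ux.
have ri : r ∘ i = top ux by rewrite (idc_top hr) tbE κt comp_idr.
have rj : r ∘ j = ν ∘ l by rewrite (idc_bot hr) tbE κb.
have Fν : cart (idc (ν ∘ l)) by rewrite idc_comp; apply: cart_comp Fl; exact: (full_bot GT Ux).
have [h [κh [Ch ht hb]]] := restriction_exists (vid P) r (ν ∘ l).
have [E [uh Uh]] := gt_glue GT h.
have [rE hrE] := glue_ex κh Uh.
have rEt : rE ∘ top uh = r by rewrite (idc_top hrE).
have rEb : rE ∘ bot uh = ν ∘ l by rewrite (idc_bot hrE).
have [R1 [n2 [un2 [x2 [u2 [Un2 U2 [h2a h2b h2l]]]]]]] := regroup_right GT UR Uh.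
rewrite -/i -/j in h2a h2b; set ν2 := bot u2 in h2b h2l *.
have CnR : cart (idc rE ⊙ (idc ν2 ⊙ un2)).
  have [c [ct cb ce]] : exists c : Cell n2 h, [/\ top c = j, bot c = idm B & uh ⊙ c = idc ν2 ⊙ un2].
    by apply: (cart_ex (gt_cart GT Uh)); rewrite !tbE.
  have Cc : cart c.
    apply: (cart_cancel (gt_cart GT Uh)); rewrite ce.
    by apply: cart_comp (gt_cart GT Un2); exact: (full_bot GT U2).
  by rewrite -ce ccomp_assoc hrE; exact: cart_comp.
have [jj hjj] : exists jj : SpecialIso (vid B) n2, idc rE ⊙ (idc ν2 ⊙ un2) ⊙ jj = idc (ν ∘ l).
  apply: (cart_unique Fν CnR); rewrite !tbE ?h2b ?h2l //.
  by rewrite comp_assoc rEt rj.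
have [t2 [σ2 [t2a t2b t2e [σ2t σ2b tσ2 σ2s σ2a]]]] := cylinder GT Un2 (opcart_iso jj) (top_iso _) (bot_iso _).
have [κh' [kt' kb' ke']] : exists κh' : Cell x0 h, [/\ top κh' = i, bot κh' = idm B & κh ⊙ κh' = idc r ⊙ uR].
  by apply: (cart_ex Ch); rewrite !tbE ?ht ?hb ?comp_idr.
have Ckh' : cart κh'.
  by apply: (cart_cancel Ch); rewrite ke' hr; apply: cart_comp => //; exact: gt_cart Ux.
have [κ2 [κ2t κ2b κ2e]] : exists κ2 : Cell x0 x2, [/\ top κ2 = idm A, bot κ2 = bot un2 & u2 ⊙ κ2 = uh ⊙ κh'].
  by apply: (cart_ex (gt_cart GT U2)); rewrite !tbE ?kt' ?kb' ?comp_idr // h2l.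
have Cκ2 : cart κ2.
  apply: (cart_cancel (gt_cart GT U2)); rewrite κ2e; apply: cart_comp Ckh'; exact: gt_cart Uh.
have RD Y φ := reflection_desc (Y := Y) φ t2b σ2t σ2b tσ2 σ2s Cκ2 κ2t κ2b.
have [ψ2 [ψ2b ψ2κ _]] := RD _ uR.
have [F hF] := glue_ex ψ2 U2.
have Fν2 : F ∘ ν2 = j ∘ t2 by rewrite (idc_bot hF) ψ2b.
have [d [dt db de]] : exists d : Cell x0 x2, [/\ top d = idm A, bot d = top un2 & u2 ⊙ d = idc (top uh) ⊙ uR].
  by apply: (cart_ex (gt_cart GT U2)); rewrite !tbE ?h2a.
have CF V W (v : Ver V W) a b ψ ψ' := @collapse_faithful _ GT _ _ _ _ V W _ κh uh rE v a b ψ ψ' Uh Ch hrE.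
have Ftop : F ∘ top uh = idm R.
  apply: (glue_uq UR); rewrite idc_comp -ccomp_assoc -de ccomp_assoc hF idc_id ccomp_idl.
  have f1 : bot d = top (σ2 ⊙ idc (bot d)) by rewrite [RHS]tbE σ2t !tbE.
  rewrite (reflection_eval (κ := κ2) (d' := cid x0) (g := j) (e := f1) σ2t tσ2) ?ψ2κ ?ccomp_idr //.
  apply: (cart_uq (gt_cart GT U2)); rewrite ?tbE ?κ2t ?dt ?κ2b ?db ?σ2b //.
    by rewrite -comp_assoc t2a comp_idr.
  have f2 : bot (u2 ⊙ d) = top (idc (bot u2) ⊙ (σ2 ⊙ idc (bot d))).
    by rewrite [RHS]tbE [top (σ2 ⊙ _)]tbE σ2t !tbE.
  rewrite (comp_under _ f2).
  apply: (CF _ _ _ i (idm B)).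
  - by rewrite tbE κ2t comp_idr h2a.
  - by rewrite tbE κ2b h2l comp_idr.
  - by rewrite !tbE dt comp_idr h2a.
  - by rewrite !tbE σ2b db -(comp_assoc _ _ (top un2)) t2a comp_idr h2l.
  rewrite κ2e ccomp_assoc hrE ke'.
  have f3 : bot (idc rE ⊙ (u2 ⊙ d)) = top (idc (bot (idc rE)) ⊙ (idc (bot u2) ⊙ (σ2 ⊙ idc (bot d)))).
    by rewrite tbE f2 [RHS]tbE !tbE.
  rewrite (comp_under _ f3).
  have f4 : bot (idc r ⊙ uR) = top (idc (ν ∘ l)) by rewrite !tbE.
  apply: (etrans (esym (under_idc f4))); apply: under_eq.
    by rewrite bot_idc db σ2a -hjj -!ccomp_assoc.
  by rewrite de ccomp_assoc -idc_comp rEt.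
have Fbot : F ∘ bot uh = j by rewrite -h2l comp_assoc Fν2 -comp_assoc t2b comp_idr.
have [s [st sb se]] : exists s : Cell (conjoint j) h, [/\ top s = idm R, bot s = idm B & κh ⊙ s = idc r ⊙ beta j].
  by apply: (cart_ex Ch); rewrite !tbE ?ht ?hb ?rj.
have [s' [st' sb' se']] : exists s' : Cell h (conjoint j), [/\ top s' = idm R, bot s' = idm B & beta j ⊙ s' = idc F ⊙ uh].
  by apply: (cart_ex (cart_beta j)); rewrite !tbE.
have us : uh ⊙ (s ⊙ alpha j) = idc ν2 ⊙ (un2 ⊙ jj).
  apply: (CF _ _ _ j (idm B)); rewrite ?tbE ?st ?sb ?comp_idl ?comp_idr //.
  rewrite ccomp_assoc hrE ccomp_assoc se -ccomp_assoc cjt_hor -idc_comp rj -hjj.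
  by rewrite -!ccomp_assoc.
have s's : s' ⊙ s = cid (conjoint j).
  apply: (opcart_uq (opcart_alpha j)); rewrite ?tbE ?st ?sb ?st' ?sb' ?comp_idl //.
  apply: (cart_uq (cart_beta j)); rewrite ?tbE ?st ?sb ?st' ?sb' ?comp_idl //.
  rewrite ccomp_idl cjt_hor !ccomp_assoc se' -!ccomp_assoc us !ccomp_assoc -idc_comp Fν2.
  by rewrite idc_comp -!ccomp_assoc (ccomp_assoc (idc t2)) t2e idc_id ccomp_idr.
have rF : r ∘ F = rE.
  apply: (glue_uq U2); have [ψ3 [ψ3b ψ3κ ψ3u]] := RD _ (idc r ⊙ uR).
  rewrite [LHS](ψ3u _ (ν ∘ l)).
  - apply/esym/(ψ3u _ (ν ∘ l)); last by rewrite -ccomp_assoc κ2e ccomp_assoc hrE.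
    rewrite !tbE; apply: (glue_uq Un2); apply: (iso_cancelR (i := jj)).
    have hjj' : idc rE ⊙ (idc ν2 ⊙ (un2 ⊙ jj)) = idc (ν ∘ l) by rewrite -hjj !ccomp_assoc.
    rewrite [idc (rE ∘ bot u2)]idc_comp [idc (ν ∘ l ∘ t2)]idc_comp -!ccomp_assoc hjj'.
    by rewrite (ccomp_assoc (idc t2)) t2e idc_id ccomp_idr.
  - by rewrite !tbE -comp_assoc Fν2 comp_assoc rj.
  - by rewrite idc_comp -!ccomp_assoc (ccomp_assoc (idc F)) hF ψ2κ.
have ss' : s ⊙ s' = cid h.
  apply: (cart_uq Ch); rewrite ?tbE ?st ?sb ?st' ?sb' ?comp_idl //.
  by rewrite ccomp_assoc se -ccomp_assoc se' ccomp_assoc -idc_comp rF hrE ccomp_idr.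
by rewrite -se; apply: cart_comp Ch (cart_iso (MkSpecialIso st sb st' sb' s's ss')).
Qed.

Lemma ot_nat (X Y Y' X2 : D) (m : Ver X Y) (m' : Ver X Y') (h : Hom X X2) (χ : Cell m m') e :
  top χ = idm X -> vcc χ (cid (conjoint h)) e ⊙ ot m h = ot m' h ⊙ χ.
Proof.
move=> χt.
have e1 : bot (alpha h) = top χ by rewrite χt !tbE.
have e2 : bot (idc (idm X)) = top χ by rewrite χt !tbE.
rewrite /ot ccomp_assoc (vccR (χ := χ) (χ' := alpha h) e1) ?ccomp_idl ?ccomp_idr //.
apply: (iso_cancelR (i := runi m)); rewrite -ccomp_assoc iso_K ccomp_idr.
rewrite -[RHS]ccomp_assoc -(runiE e2) ccomp_assoc -(ccomp_assoc _ (iso_inv _)) iso_K ccomp_idr.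
by apply/esym/vccR; rewrite ?ccomp_idl // idc_id ccomp_idr.
Qed.

Lemma lact_over (X Y Z V W : D) (m : Ver X Y) (n : Ver Y Z) (w : Ver V W)
    (u : Cell n (vid W)) (φ : Cell m w) (a : Cell (vid X) (vid V)) e1 e2 e3 e4 :
  lact u (over φ a e1) e2 = over (lact u φ e3) a e4.
Proof.
apply: (iso_cancelR (i := runi (n • m))); rewrite overR.
have f1 : bot (runi m) = top (cid n) by rewrite !tbE.
rewrite -(runi_assoc f1) ccomp_assoc.
have f2 : bot (ract φ a e1) = top u by rewrite bot_ract.
have f3 : bot (over φ a e1 ⊙ runi m) = top (u ⊙ cid n) by rewrite overR ccomp_idr.
rewrite (lact_comp _ _ f3).
have -> : lact (u ⊙ cid n) (over φ a e1 ⊙ runi m) f3 = lact u (ract φ a e1) f2.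
  by apply: lact_eq; rewrite ?ccomp_idr ?overR.
exact: lact_ract_assoc.
Qed.

(** The collage [L] of [r_* • q^*], where [R] is the collage of [n • y1], contains [y2] and
    the free extension of [y1] along [k] glued along [n • y1]. *)
Lemma module_exists (A B C N : D) (n : Ver C B) (un : Cell n (vid N)) (y1 : Ver A C)
    (y2 : Ver A B) (φ : Cell (n • y1) y2) :
  glue un -> top φ = idm A -> bot φ = idm B ->
  exists (y : Ver A N) (κ1 : Cell y1 y) (κ2 : Cell y2 y),
    [/\ cart κ1, top κ1 = idm A & bot κ1 = top un] /\
    [/\ cart κ2, top κ2 = idm A, bot κ2 = bot un & forall e, κ2 ⊙ φ = lact un κ1 e].
Proof.
move=> Un φt φb; set k := top un; set l := bot un.
have Fk : cart (idc k) by exact: (full_top GT Un).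
have Fl : cart (idc l) by exact: (full_bot GT Un).
pose o1 := ob y1 k.
have Co1 : cart o1 by exact: cart_ob_full.
have o1t : top o1 = idm A by exact: top_ob.
have o1b : bot o1 = k by exact: bot_ob.
have [P [uP UP]] := gt_glue GT (companion k • y1).
set aP := top uP; set ν := bot uP.
pose x1 := uP ⊙ o1.
have x1t : top x1 = aP by rewrite tbE o1t comp_idr.
have x1b : bot x1 = ν ∘ k by rewrite tbE o1b.
have Cx1 : cart x1 by apply: cart_comp Co1; exact: gt_cart UP.
have [ut [utt utb ute]] : exists ut : Cell n (companion k), [/\ top ut = idm C, bot ut = l & eps k ⊙ ut = un].
  by apply: (cart_ex (cart_eps k)); rewrite !tbE.
have Cut : cart ut by apply: (cart_cancel (cart_eps k)); rewrite ute; exact: gt_cart Un.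
have fR : bot (cid y1) = top ut by rewrite utt !tbE.
pose κR := vcc ut (cid y1) fR.
have CκR : cart κR by exact: cart_vcc_cid.
have κRt : top κR = idm A by rewrite !tbE.
have κRb : bot κR = l by rewrite tbE.
have κRE e : κR = lact un o1 e.
  have f1 : bot o1 = top (eps k) by rewrite o1b !tbE.
  have f2 : bot (o1 ⊙ cid y1) = top (eps k ⊙ ut) by rewrite ccomp_idr ute.
  have -> : lact un o1 e = lact (eps k ⊙ ut) (o1 ⊙ cid y1) f2.
    by apply: lact_eq; rewrite ?ccomp_idr.
  rewrite -(lact_comp f1 fR) /lact ob_section /=.
  by rewrite ccomp_idl.
have x1E : x1 = uP ⊙ o1 by [].
clearbody x1 o1 κR.
have [R [uR UR]] := gt_glue GT (n • y1); set i := top uR; set j := bot uR.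
have [r hr] := glue_ex (uP ⊙ κR) UR.
have ri : r ∘ i = aP by rewrite (idc_top hr) tbE κRt comp_idr.
have rj : r ∘ j = ν ∘ l by rewrite (idc_bot hr) tbE κRb.
have Cβ := leg_conjoint_cart UP UR Fl CκR κRt κRb hr; rewrite -/j in Cβ.
have [Q [uQ UQ]] := gt_glue GT y2; set aQ := top uQ; set bQ := bot uQ.
have [q hq] := glue_ex (uQ ⊙ φ) UR.
have qi : q ∘ i = aQ by rewrite (idc_top hq) tbE φt comp_idr.
have qj : q ∘ j = bQ by rewrite (idc_bot hq) tbE φb comp_idr.
(* [L] is the lax pushout of [q] and [r], with [δ] as its 2-cell from [QL ∘ q] to [PL ∘ r]. The
   morphism [y] will consist of the cells of [L] from [A] inside [Q] to [N] inside [P]. *)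
have [L [uL UL]] := gt_glue GT (companion r • conjoint q).
set QL := top uL; set PL := bot uL.
pose θ := uL ⊙ ot (companion r) q.
have θt : top θ = QL ∘ q by rewrite tbE top_ot.
have θb : bot θ = PL by rewrite tbE bot_ot comp_idr.
have θE : θ = uL ⊙ ot (companion r) q by [].
clearbody θ.
pose δ := θ ⊙ eta r.
have δE : δ = θ ⊙ eta r by [].
have δt : top δ = QL ∘ q by rewrite !tbE θt.
have δb : bot δ = PL ∘ r by rewrite !tbE θb.
clearbody δ.
have e1 : bot (δ ⊙ idc i) = top (idc PL ⊙ x1) by rewrite !tbE δb x1t -comp_assoc ri.
pose c1 := over (idc PL ⊙ x1) (δ ⊙ idc i) e1.
have e2 : bot (idc QL ⊙ uQ) = top (δ ⊙ idc j) by rewrite !tbE δt -comp_assoc qj.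
pose c2 := under (δ ⊙ idc j) (idc QL ⊙ uQ) e2.
(* For cells ending in [B]: by [leg_conjoint_cart] the restriction of [companion r] there is
   [conjoint j], which extended along [q] becomes [conjoint bQ]; restricted to [A] this is [y2]. *)
have Cc2 : cart c2.
  have [x [xt xb xe]] : exists x : Cell (conjoint j) (companion r), [/\ top x = idm R, bot x = ν ∘ l & eps r ⊙ x = idc r ⊙ beta j].
    by apply: (cart_ex (cart_eps r)); rewrite !tbE.
  have Cx : cart x by apply: (cart_cancel (cart_eps r)); rewrite xe.
  have xα : x ⊙ alpha j = eta r ⊙ idc j.
    apply: (cart_uq (cart_eps r)); rewrite ?tbE ?xt ?xb ?comp_idl //.
    by rewrite !ccomp_assoc xe cpn_hor -ccomp_assoc cjt_hor.
  have Oo := opcart_comp (opcart_ot (conjoint j) q) (opcart_alpha j).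
  have [i0 hi0] : exists i0 : SpecialIso (conjoint bQ) (conjoint j • conjoint q), i0 ⊙ alpha bQ = ot (conjoint j) q ⊙ alpha j.
    by apply: (opcart_unique (opcart_alpha bQ) Oo); rewrite !tbE ?qj.
  have f1 : bot (cid (conjoint q)) = top x by rewrite xt !tbE.
  pose e0 := uL ⊙ vcc x (cid (conjoint q)) f1 ⊙ i0.
  have Ce : cart e0.
    apply: cart_comp (cart_iso i0); apply: cart_comp; first exact: gt_cart UL.
    exact: cart_vcc_cid.
  have [z [zt zb ze]] : exists z : Cell y2 (conjoint bQ), [/\ top z = aQ, bot z = idm B & beta bQ ⊙ z = uQ].
    by apply: (cart_ex (cart_beta bQ)); rewrite !tbE.
  have Cz : cart z by apply: (cart_cancel (cart_beta bQ)); rewrite ze; exact: gt_cart UQ.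
  have e0t : top e0 = QL by rewrite !tbE.
  have e0α : e0 ⊙ alpha bQ = δ ⊙ idc j.
    rewrite /e0 -(ccomp_assoc _ i0) hi0 ccomp_assoc -(ccomp_assoc uL) ot_nat //.
    by rewrite ccomp_assoc -θE -ccomp_assoc xα ccomp_assoc δE.
  clearbody e0.
  have f2 : bot (idc (top e0) ⊙ (beta bQ ⊙ z)) = top (e0 ⊙ alpha bQ ⊙ idc (bot z)).
    by rewrite !tbE ?comp_assoc.
  have -> : c2 = e0 ⊙ z.
    rewrite (cjt_eval f2); apply: under_eq; last by rewrite ze e0t.
    by rewrite e0α zb idc_id ccomp_idr.
  exact: cart_comp.
(* For cells ending in [C]: the restriction [h] of [companion r] is void on the leg [j], since cells
   from [B] to [C] run backwards in [N]. By [void_extension] it is the extension of [y1] along the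
   leg [i], and extending further along [q] changes nothing on [A], as the leg of [Q] is full. *)
have Cc1 : cart c1.
  have [h [κh [Ch ht hb]]] := restriction_exists (vid P) r (ν ∘ k).
  have [κ' [κt' κb' κe']] : exists κ' : Cell y1 h, [/\ top κ' = i, bot κ' = idm C & κh ⊙ κ' = x1].
    by apply: (cart_ex Ch); rewrite ?x1t ?x1b ?ht ?hb ?ri ?comp_idr.
  have Cκ' : cart κ' by apply: (cart_cancel Ch); rewrite κe'.
  have [v [κC [CC Ct Cb]]] := restriction_exists h j (idm C).
  have Vv : void v.
    have [w [wt wb _]] : exists w : Cell v (vid N), [/\ top w = l, bot w = k & idc ν ⊙ w = κh ⊙ κC].
      by apply: (cart_ex (full_bot GT UP)); rewrite !tbE ?ht ?hb ?Ct ?Cb ?comp_idr.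
    by apply: (void_of_disjoint GT (w := w) (f := idm B) (g := idm C) Un); rewrite ?wt ?wb comp_idr.
  have [H [uh Uh]] := gt_glue GT h.
  have VE Y f φ' := void_extension GT UR Uh Cκ' κt' κb' CC Ct Cb Vv (Y := Y) (f := f) (φ := φ').
  have Oκ' : opcart κ'.
    apply: opcart_of_vid.
      move=> Z φ' f g hf hg; rewrite κt' in hf; rewrite κb' comp_idr in hg.
      have [ψ [[h1 h2] _]] := VE Z f φ' hf; exists ψ; split=> //.
      by rewrite -hg -h2 tbE κb' comp_idr.
    move=> Z ψ ψ' h1 h2 h3.
    have hf : top (ψ ⊙ κ') = top ψ ∘ top uR by rewrite tbE κt'.
    have [ψ0 [_ K]] := VE Z (top ψ) (ψ ⊙ κ') hf.
    by rewrite -(K ψ (conj erefl erefl)); apply: K.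
  have [xh [xt xb xe]] : exists x : Cell h (companion r), [/\ top x = idm R, bot x = ν ∘ k & eps r ⊙ x = κh].
    by apply: (cart_ex (cart_eps r)); rewrite !tbE ?ht ?hb.
  have Cxh : cart xh by apply: (cart_cancel (cart_eps r)); rewrite xe.
  have f1 : bot (cid (conjoint q)) = top xh by rewrite xt !tbE.
  have Eg : c1 = uL ⊙ vcc xh (cid (conjoint q)) f1 ⊙ (ot h q ⊙ κ').
    have f2 : bot (θ ⊙ eta r ⊙ idc (top (xh ⊙ κ'))) = top (idc (bot θ) ⊙ (eps r ⊙ (xh ⊙ κ'))).
      by rewrite !tbE ?comp_assoc.
    rewrite ccomp_assoc -(ccomp_assoc uL) ot_nat // ccomp_assoc -θE -ccomp_assoc (cpn_eval f2).
    apply: over_eq; first by rewrite (ccomp_assoc (eps r)) xe κe' θb.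
    by rewrite -δE tbE xt κt' comp_idl.
  rewrite Eg; apply: cart_comp.
    by apply: cart_comp (gt_cart GT UL) _; exact: cart_vcc_cid.
  have Oc := opcart_comp (opcart_ot h q) Oκ'.
  have [i0 hi0] : exists i0 : SpecialIso (y1 • conjoint aQ) (h • conjoint q), i0 ⊙ ot y1 aQ = ot h q ⊙ κ'.
    apply: (opcart_unique (opcart_ot y1 aQ) Oc); rewrite !tbE ?top_ot ?bot_ot ?κt' ?κb' ?qi //.
  rewrite -hi0; apply: cart_comp (cart_iso i0) _; apply: cart_ot_full; exact: (full_top GT UQ).
have [y [cy [Cy cyt cyb]]] := restriction_exists (vid L) (QL ∘ aQ) (PL ∘ ν).
have [κ1 [k1t k1b k1e]] : exists κ1 : Cell y1 y, [/\ top κ1 = idm A, bot κ1 = k & cy ⊙ κ1 = c1].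
  apply: (cart_ex Cy); rewrite /c1 !tbE ?cyt ?cyb ?x1b ?comp_assoc //.
  by rewrite δt -comp_assoc qi.
have [κ2 [k2t k2b k2e]] : exists κ2 : Cell y2 y, [/\ top κ2 = idm A, bot κ2 = l & cy ⊙ κ2 = c2].
  apply: (cart_ex Cy); rewrite /c2 !tbE ?cyt ?cyb //.
  by rewrite δb -comp_assoc rj comp_assoc.
have Cκ1 : cart κ1 by apply: (cart_cancel Cy); rewrite k1e.
have Cκ2 : cart κ2 by apply: (cart_cancel Cy); rewrite k2e.
exists y, κ1, κ2; split; split=> // e.
apply: (cart_uq Cy); rewrite ?tbE ?top_lact ?bot_lact ?k1t ?k2t ?k2b ?φt ?φb ?comp_idl ?comp_idr //.
rewrite ccomp_assoc k2e.
have g1 : bot (idc (top δ) ⊙ uR) = top (δ ⊙ idc (bot uR)) by rewrite !tbE.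
have g2 : bot (δ ⊙ idc (top uR)) = top (idc (bot δ) ⊙ uR) by rewrite !tbE.
have g3 : bot (idc QL ⊙ uQ ⊙ φ) = top (δ ⊙ idc j ⊙ idc (bot φ)) by rewrite tbE e2 φb !tbE.
transitivity (δ ⊙ uR).
  rewrite /c2 (under_comp _ g3) -(two_under g1); apply: under_eq.
    by rewrite φb idc_id ccomp_idr.
  by rewrite -ccomp_assoc -hq ccomp_assoc -idc_comp δt.
have g4 : bot (cy ⊙ κ1) = top (idc (bot cy) ⊙ un) by rewrite !tbE k1b.
rewrite (comp_lact _ g4) -(two_over g2).
have g5 : bot c1 = top (idc (PL ∘ ν) ⊙ un) by rewrite -k1e g4 cyb.
have g6 : bot (idc PL ⊙ x1) = top (idc (PL ∘ ν) ⊙ un) by rewrite !tbE x1b comp_assoc.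
have g7 : bot (δ ⊙ idc i) = top (lact (idc (PL ∘ ν) ⊙ un) (idc PL ⊙ x1) g6) by rewrite top_lact e1.
have -> : lact (idc (bot cy) ⊙ un) (cy ⊙ κ1) g4 = over (lact (idc (PL ∘ ν) ⊙ un) (idc PL ⊙ x1) g6) (δ ⊙ idc i) g7.
  by rewrite -(lact_over (e1 := e1) g5); apply: lact_eq; rewrite ?cyb.
apply: over_eq => //.
have g8 : bot o1 = top un by rewrite o1b.
have g9 : bot (uP ⊙ o1) = top (idc (bot uP) ⊙ un) by rewrite !tbE o1b.
have g10 : bot (idc PL ⊙ (uP ⊙ o1)) = top (idc (bot (idc PL)) ⊙ (idc (bot uP) ⊙ un)).
  by rewrite !tbE o1b !comp_assoc.
rewrite δb idc_comp -ccomp_assoc hr (κRE g8) (comp_lact _ g9) (comp_lact _ g10).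
by apply: lact_eq; rewrite ?x1E // bot_idc ccomp_assoc -idc_comp.
Qed.

End Modules.

(** * Pasting of pullbacks, composites with void morphisms, arbitrary restrictions *)

Section Complements.
Variable D : FramedBicategory.
Local Notation eps f := (cpn_eps (fb_cpn f)).
Local Notation eta f := (cpn_eta (fb_cpn f)).
Local Notation alpha f := (cjt_alpha (fb_cjt f)).
Local Notation beta f := (cjt_beta (fb_cjt f)).

Lemma pb_paste (X' X T' T P Q : D) (p : Hom X T) (q : Hom T' T) (u : Hom X' X) (p' : Hom X' T')
    (r : Hom Q T') (v : Hom P X') (w : Hom P Q) :
  is_pullback (K := HD D) p q u p' -> is_pullback (K := HD D) p' r v w ->
  is_pullback (K := HD D) p (q ∘ r : @Hom (HD D) Q T) (u ∘ v : @Hom (HD D) P X) w.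
Proof.
move=> H1 H2; have /= c1 := pb_comm H1; have /= c2 := pb_comm H2; split.
- by rewrite /= comp_assoc c1 -!comp_assoc c2.
- move=> Z a b /= e.
  have [x [[x1 x2] xu]] := pb_hom H1 (etrans e (esym (comp_assoc _ _ _))).
  have [y [[y1 y2] yu]] := pb_hom H2 x2.
  exists y; split; first by rewrite /= -comp_assoc y1.
  move=> y' [h1 h2]; apply: yu; split=> //; apply/esym/xu; split; first by rewrite /= comp_assoc.
  by rewrite /= comp_assoc c2 -comp_assoc h2.
move=> Z a b /= e.
have e' : idc p ⊙ a = idc q ⊙ (idc r ⊙ b) by rewrite ccomp_assoc -idc_comp.
have [x [[/= x1 x2] xu]] := pb_two H1 e'.
have [y [[y1 y2] yu]] := pb_two H2 x2.
exists y; split; first by rewrite /= idc_comp -ccomp_assoc [idc v ⊙ y]y1.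
move=> y' [h1 h2]; apply: yu; split=> //; apply/esym/xu; split => /=.
  by rewrite ccomp_assoc -idc_comp.
by rewrite ccomp_assoc -idc_comp c2 idc_comp -ccomp_assoc [idc w ⊙ y']h2.
Qed.

Lemma pb_cancel (X' X T' T P Q : D) (p : Hom X T) (q : Hom T' T) (u : Hom X' X) (p' : Hom X' T')
    (r : Hom Q T') (v : Hom P X') (w : Hom P Q) :
  is_pullback (K := HD D) p q u p' ->
  is_pullback (K := HD D) p (q ∘ r : @Hom (HD D) Q T) (u ∘ v : @Hom (HD D) P X) w ->
  p' ∘ v = r ∘ w -> is_pullback (K := HD D) p' r v w.
Proof.
move=> H1 H2 c2; have /= c1 := pb_comm H1; split=> //.
- move=> Z a b /= e.
  have e' : p ∘ (u ∘ a) = q ∘ r ∘ b by rewrite comp_assoc c1 -!comp_assoc e.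
  have [x [[/= x1 x2] xu]] := pb_hom H2 e'.
  exists x; split.
    split=> //; apply: (pb_uniq H1); first by rewrite comp_assoc.
    by rewrite comp_assoc c2 -comp_assoc x2 e.
  move=> x' [h1 h2]; apply: xu; split=> //; by rewrite /= -comp_assoc h1.
move=> Z a b /= e.
have e' : idc p ⊙ (idc u ⊙ a) = idc (q ∘ r) ⊙ b.
  by rewrite ccomp_assoc -idc_comp c1 !idc_comp -!ccomp_assoc e.
have [x [[/= x1 x2] xu]] := pb_two H2 e'.
have e'' : idc p ⊙ (idc u ⊙ a) = idc q ⊙ (idc p' ⊙ a) by rewrite !ccomp_assoc -!idc_comp c1.
have [k [_ ku]] := pb_two H1 e''.
exists x; split.
  split=> //=; rewrite -(ku a (conj erefl erefl)); apply/esym/ku; split=> /=.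
    by rewrite ccomp_assoc -idc_comp.
  by rewrite ccomp_assoc -idc_comp c2 idc_comp -ccomp_assoc x2 e.
move=> x' [/= h1 h2]; apply: xu; split=> //=.
by rewrite idc_comp -ccomp_assoc h1.
Qed.

Lemma pb_iso (A B C P P' : D) (p : Hom A C) (q : Hom B C) (u : Hom P A) (v : Hom P B)
    (u' : Hom P' A) (v' : Hom P' B) :
  is_pullback (K := HD D) p q u v -> is_pullback (K := HD D) p q u' v' ->
  exists r : Hom P' P, [/\ is_iso r, u ∘ r = u' & v ∘ r = v'].
Proof.
move=> H H'.
have [r [r1 r2]] := pb_lift H (pb_comm H'); have [s [s1 s2]] := pb_lift H' (pb_comm H).
exists r; split=> //; exists s; split.
  by apply: (pb_uniq H'); rewrite comp_assoc ?s1 ?s2 ?r1 ?r2 comp_idr.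
by apply: (pb_uniq H); rewrite comp_assoc ?r1 ?r2 ?s1 ?s2 comp_idr.
Qed.

Variable GT : glue_theory D.

Lemma void_opcart (A B A' B' : D) (x : Ver A B) (v : Ver A' B') (o : Cell x v) :
  opcart o -> void x -> void v.
Proof.
move=> O V Y f g.
have [φ [h1 h2]] := void_ex (f ∘ top o) (g ∘ bot o) V.
have [ψ [k1 k2 _]] := opcart_ex O h1 h2.
exists ψ; split=> // ψ' [l1 l2]; apply: (opcart_uq O); rewrite ?k1 ?k2 //.
by apply: (void_uq V); rewrite !tbE ?k1 ?k2 ?l1 ?l2.
Qed.

Lemma void_special (A B A' B' : D) (v : Ver A B) (w : Ver A' B') (f : Hom A A') (g : Hom B B') :
  void v -> exists c : Cell v w, top c = f /\ bot c = g.
Proof.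
move=> V; have [W [u U]] := gt_glue GT w.
have [φ [h1 h2]] := void_ex (top u ∘ f) (bot u ∘ g) V.
by have [c [ct cb _]] := cart_ex (gt_cart GT U) h1 h2; exists c.
Qed.

Lemma void_cell_uq (A B A' B' : D) (v : Ver A B) (w : Ver A' B') (c c' : Cell v w) :
  void v -> top c = top c' -> bot c = bot c' -> c = c'.
Proof.
move=> V ht hb; have [W [u U]] := gt_glue GT w.
by apply: (cart_uq (gt_cart GT U)) => //; apply: (void_uq V); rewrite !tbE ?ht ?hb.
Qed.

(** A void morphism has a cell to one through the initial object, [companion b • conjoint a]. After
    composition with [n] this is the extension along [a] of a morphism out of the initial object,
    hence void. *)
Lemma void_comp (A B E : D) (v : Ver A B) (n : Ver B E) : void v -> void (n • v).
Proof.
move=> V; have [O Oz] := gt_zero GT.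
have [a _] := zero_hom A Oz; have [b _] := zero_hom B Oz.
have V1 : void (companion b • conjoint a).
  by apply: (void_opcart (opcart_ot (companion b) a)); exact: void_zero_top.
have [c [ct cb]] := void_special (companion b • conjoint a) (idm A) (idm B) V.
have V2 : void (n • companion b • conjoint a).
  by apply: (void_opcart (opcart_ot (n • companion b) a)); exact: void_zero_top.
have f1 : bot c = top (cid n) by rewrite cb tbE.
exact: (void_of_cell GT (iso_inv (assoc n (companion b) (conjoint a)) ⊙ vcc (cid n) c f1) V2).
Qed.

Lemma lact_vcc (W0 X Y Z V W V0 : D) (l : Ver W0 X) (m : Ver X Y) (n : Ver Y Z)
    (w : Ver V W) (w0 : Ver V0 V) (u : Cell n (vid W)) (φ : Cell m w) (χ : Cell l w0) e1 e2 e3 e4 :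
  lact u (vcc φ χ e1) e2 ⊙ assoc n m l = vcc (lact u φ e3) χ e4.
Proof.
have f1 : bot χ = top (vcc u φ e3) by rewrite !tbE.
have f2 : bot (cid w0) = top (luni w) by rewrite !tbE.
rewrite /lact -ccomp_assoc -(assoc_nat e3 f1) ccomp_assoc (luni_assoc f2).
by apply: vccR; rewrite ?ccomp_idl.
Qed.

Lemma void_zero_bot (A B : D) (v : Ver A B) : zero B -> void v.
Proof.
move=> Bz Y f g; have [M [u U]] := gt_glue GT v.
have [k [ki k1 k2]] := iso_inverse (zero_bot_iso GT Bz U).
exists (idc (f ∘ k) ⊙ u); split.
  by split; rewrite !tbE; [rewrite -comp_assoc k1 comp_idr | exact: zero_uq].
move=> φ [h1 h2]; have [F hF] := glue_ex φ U; rewrite -hF.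
by have := idc_top hF; rewrite h1 => <-; rewrite -comp_assoc k2 comp_idr.
Qed.

Lemma void_comp_l (A B E : D) (y : Ver A B) (v : Ver B E) : void v -> void (v • y).
Proof.
move=> V; have [O Oz] := gt_zero GT.
have [a _] := zero_hom B Oz; have [b _] := zero_hom E Oz.
have V1 : void (companion b • conjoint a).
  by apply: (void_opcart (opcart_ot (companion b) a)); exact: void_zero_top.
have [c [ct cb]] := void_special (companion b • conjoint a) (idm B) (idm E) V.
have V2 : void (companion b • (conjoint a • y)).
  by apply: (void_opcart (opcart_ob (conjoint a • y) b)); exact: void_zero_bot.
have f1 : bot (cid y) = top c by rewrite ct tbE.
exact: (void_of_cell GT (assoc (companion b) (conjoint a) y ⊙ vcc c (cid y) f1) V2).
Qed.

(** [restriction_desc] transported from composites with conjoints to arbitrary cartesian cells, as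
    restrictions along several legs of a cocone do not come in the chosen form. *)
Lemma restriction_desc_gen (A B C N : D) (n : Ver C B) (un : Cell n (vid N)) (y : Ver A N)
    (y1 : Ver A C) (y2 : Ver A B) (κ1 : Cell y1 y) (κ2 : Cell y2 y) (c : Cell (n • y1) y2) ec :
  glue un -> cart κ1 -> top κ1 = idm A -> bot κ1 = top un ->
  cart κ2 -> top κ2 = idm A -> bot κ2 = bot un ->
  top c = idm A -> bot c = idm B -> κ2 ⊙ c = lact un κ1 ec ->
  forall (Y : D) (g : Hom N Y) (ψ1 : Cell y1 (vid Y)) (ψ2 : Cell y2 (vid Y)) e,
  bot ψ1 = g ∘ top un -> bot ψ2 = g ∘ bot un -> ψ2 ⊙ c = lact (idc g ⊙ un) ψ1 e ->
  exists! ψ : Cell y (vid Y), [/\ bot ψ = g, ψ ⊙ κ1 = ψ1 & ψ ⊙ κ2 = ψ2].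
Proof.
move=> Un C1 t1 b1 C2 t2 b2 ct cb hc Y g ψ1 ψ2 e hb1 hb2 compat.
have [i1 hi1] : exists i : SpecialIso (conjoint (top un) • y) y1, κ1 ⊙ i = rb y (top un).
  by apply: (cart_unique (cart_rb _ _) C1); rewrite ?top_rb ?bot_rb ?t1 ?b1.
have [i2 hi2] : exists i : SpecialIso y2 (conjoint (bot un) • y), rb y (bot un) ⊙ i = κ2.
  by apply: (cart_unique C2 (cart_rb _ _)); rewrite ?top_rb ?bot_rb ?t2 ?b2.
have f1 : bot i1 = top (cid n) by rewrite !tbE.
pose c' := i2 ⊙ c ⊙ vcc (cid n) i1 f1.
have f2 : bot (rb y (top un)) = top un by rewrite bot_rb.
have hc' : rb y (bot un) ⊙ c' = lact un (rb y (top un)) f2.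
  have f3 : bot (κ1 ⊙ i1) = top (un ⊙ cid n) by rewrite hi1 bot_rb ccomp_idr.
  rewrite /c' !ccomp_assoc hi2 hc (lact_comp _ _ f3).
  by apply: lact_eq; rewrite ?ccomp_idr.
have f4 : bot (ψ1 ⊙ i1) = top (idc g ⊙ un) by rewrite tbE hb1 !tbE.
have c't : top c' = idm A by rewrite !tbE ct.
have c'b : bot c' = idm B by rewrite !tbE cb.
have [||  |ψ [[hb hk1 hk2] hu]] := restriction_desc GT Un c't c'b hc' (g := g) (ψ1 := ψ1 ⊙ i1) (ψ2 := ψ2 ⊙ iso_inv i2) (e := f4).
- by rewrite !tbE.
- by rewrite !tbE.
- have f5 : bot (ψ1 ⊙ i1) = top (idc g ⊙ un ⊙ cid n) by rewrite f4 ccomp_idr.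
  rewrite /c' -ccomp_assoc !(ccomp_assoc (iso_inv i2)) iso_K ccomp_idl ccomp_assoc compat (lact_comp _ _ f5).
  by apply: lact_eq; rewrite ?ccomp_idr.
exists ψ; split.
  split=> //; first by apply: (iso_cancelR (i := i1)); rewrite -ccomp_assoc hi1.
  by rewrite -hi2 ccomp_assoc hk2 -ccomp_assoc iso_K ccomp_idr.
move=> ψ' [k1 k2 k3]; apply: hu; split=> //; first by rewrite -hi1 ccomp_assoc k2.
by rewrite -k3 -hi2 -!ccomp_assoc iso_VK ccomp_idr.
Qed.

End Complements.

(** * Universal cocones over finite posets *)

Lemma dependent_choice (I : Type) (T : I -> Type) (R : forall i, T i -> Prop) :
  (forall i, exists t, R i t) -> exists f : forall i, T i, forall i, R i (f i).
Proof.
move=> H; exists (fun i => proj1_sig (constructive_indefinite_description _ (H i))) => i.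
exact: proj2_sig.
Qed.

Definition subcat (C : Cat) (Q : C -> Prop) : Cat :=
  @MkCat {x | Q x} (fun x y => Hom (proj1_sig x) (proj1_sig y)) (fun x => idm (proj1_sig x))
    (fun x y z g f => g ∘ f) (fun x y f => comp_idl f) (fun x y f => comp_idr f)
    (fun x y z w h g f => comp_assoc h g f).

Definition thin (C : Cat) : Prop := forall (x y : C) (f g : Hom x y), f = g.

(** * Families defined by cases on a distinguished object *)

Section Families.
Variables (C : Cat) (b : C).
Local Notation C' := (subcat (fun x => x <> b)).

(** Matching on a view replaces the object by [b] or by the projection of an object of [C'], so no
    transport along an equality of objects is needed. *)
Inductive view : C -> Type :=
| view_b : view b
| view_s (x : C') : view (proj1_sig x).

Lemma view_exists (c : C) : inhabited (view c).
Proof.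
case: (classic (c = b)) => [-> | h]; first exact: (inhabits view_b).
exact: (inhabits (view_s (exist _ c h))).
Qed.

Lemma view_bE (v : view b) : v = view_b.
Proof.
have gen c (w : view c) (e : b = c) : w = eq_rect b view view_b c e.
  case: w e => [|x] e; first by rewrite (proof_irrelevance _ e erefl).
  by case: (proj2_sig x (esym e)).
exact: (gen b v erefl).
Qed.

Lemma view_sE (x : C') (v : view (proj1_sig x)) : v = view_s x.
Proof.
have gen c (w : view c) (e : proj1_sig x = c) : w = eq_rect _ view (view_s x) c e.
  case: w e => [|y] e; first by case: (proj2_sig x e).
  have exy : x = y by exact: sig_eq.
  by subst y; rewrite (proof_irrelevance _ e erefl).
exact: (gen _ v erefl).
Qed.

(** A view of each object is only chosen, but the family takes the prescribed values because an
    object has just one view. *)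
Lemma family_exists (P : C -> Type) (pb : P b) (ps : forall x : C', P (proj1_sig x)) :
  exists p : forall c, P c, p b = pb /\ forall x : C', p (proj1_sig x) = ps x.
Proof.
pose f c (v : view c) : P c := match v with view_b => pb | view_s x => ps x end.
exists (fun c => f c (proj1_sig (constructive_indefinite_description (fun v : view c => True)
  (match view_exists c with inhabits v => ex_intro _ v I end)))).
split; first by rewrite (view_bE (proj1_sig _)).
by move=> x; rewrite (view_sE (proj1_sig _)).
Qed.

Lemma family2_exists (P : C -> C -> Type) (pbb : P b b) (pbs : forall x : C', P b (proj1_sig x))
    (psb : forall x : C', P (proj1_sig x) b)
    (pss : forall x y : C', P (proj1_sig x) (proj1_sig y)) :
  exists p : forall c c', P c c', [/\ p b b = pbb, forall x : C', p b (proj1_sig x) = pbs x &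
    forall x y : C', p (proj1_sig x) (proj1_sig y) = pss x y].
Proof.
have [p1 [h1 h2]] := family_exists pbb pbs.
have [p2 hp2] : exists p : forall (x : C') c, P (proj1_sig x) c,
    forall x, forall y : C', p x (proj1_sig y) = pss x y.
  apply: (dependent_choice (T := fun x : C' => forall c, P (proj1_sig x) c)
    (R := fun x q => forall y : C', q (proj1_sig y) = pss x y)) => x.
  by have [q [_ hq]] := family_exists (P := P (proj1_sig x)) (psb x) (pss x); exists q.
have [p [k1 k2]] := family_exists (P := fun c => forall c', P c c') p1 p2.
by exists p; split=> [|x|x y]; rewrite ?k1 ?k2.
Qed.

End Families.
Arguments view {C} b c.

(** * Cocones over lax functors on thin categories *)

Section Cocones.
Variables (D : FramedBicategory).

(** The component of a cocone with its target displayed as [vid T], so that [idc], [lact] and [glue]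
    apply to it directly. *)
Definition ccell (C : Cat) (F : NLax C D) (T : D) (i : Transf F (constL C T)) (c c' : C)
  (β : Hom c c') : Cell (lver F β) (vid T) := tcell i β.

Lemma top_ccell (C : Cat) (F : NLax C D) (T : D) (i : Transf F (constL C T)) (c c' : C)
  (β : Hom c c') : top (ccell i β) = i c.
Proof. exact: (top_tcell i β). Qed.
Lemma bot_ccell (C : Cat) (F : NLax C D) (T : D) (i : Transf F (constL C T)) (c c' : C)
  (β : Hom c c') : bot (ccell i β) = i c'.
Proof. exact: (bot_tcell i β). Qed.

Lemma ccell_comp (C : Cat) (F : NLax C D) (T : D) (i : Transf F (constL C T)) (c c' c'' : C)
    (β' : Hom c' c'') (β : Hom c c') e :
  ccell i (β' ∘ β) ⊙ lcomp F β' β = lact (ccell i β') (ccell i β) e.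
Proof. exact: (tcell_comp (t := i) e). Qed.

Lemma ccell_const (C : Cat) (F : NLax C D) (T Y : D) (i : Transf F (constL C T)) (h : Hom T Y)
  (c c' : C) (β : Hom c c') : ccell (compT (constT C h) i) β = idc h ⊙ ccell i β.
Proof. by []. Qed.

Definition vcast_iso (A B : D) (m n : Ver A B) (e : m = n) : SpecialIso m n :=
  match e in _ = k return SpecialIso m k with erefl => iso_id m end.

Lemma vcast_isoE (A B : D) (m n : Ver A B) (e : m = n) : iso_cell (vcast_iso e) = vcast e.
Proof. by subst. Qed.

Variables (C : Cat) (thinC : thin C).

(** In a thin category [β] is an identity, so normality makes [lver F β] equal to [vid (F c)]; this
    is the cast along that equality, as an isomorphism. *)
Definition nid (F : NLax C D) (c : C) (β : Hom c c) : SpecialIso (lver F β) (vid (F c)) :=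
  vcast_iso (etrans (f_equal (@lver C D F c c) (thinC β (idm c))) (lver_id F c)).

Lemma ccell_nid (F : NLax C D) (T : D) (i : Transf F (constL C T)) (c : C) (β : Hom c c) :
  ccell i β = idc (i c) ⊙ nid F β.
Proof.
have e := thinC β (idm c); subst β; rewrite /nid vcast_isoE.
have -> : etrans (f_equal (@lver C D F c c) (thinC (idm c) (idm c))) (lver_id F c) = lver_id F c.
  exact: proof_irrelevance.
have := tcell_id i c; rewrite /ccell => <-.
by rewrite /= ccomp_idl.
Qed.

(** The unit law of [F]. A family [Φ] over all arrows from [c] to [c'] absorbs the cast between
    [γ ∘ β] and [γ]. *)
Lemma lcomp_nid_r (F : NLax C D) (S : D) (c c' : C)
    (Φ : forall δ : Hom c c', Cell (lver F δ) (vid S)) (γ : Hom c c') (β : Hom c c) h e :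
  (forall δ, top (Φ δ) = h) ->
  Φ (γ ∘ β) ⊙ lcomp F γ β = lact (Φ γ) (idc h ⊙ nid F β) e.
Proof.
move=> Φt; have e0 := thinC β (idm c); subst β.
have E (δ δ' : Hom c c') (q : δ = δ') : Φ δ = Φ δ' ⊙ vcast (f_equal (@lver C D F c c') q).
  by subst; rewrite ccomp_idr.
rewrite (E _ _ (comp_idr γ)) -ccomp_assoc.
have f1 : bot (vcast (lver_id F c)) = top (cid (lver F γ)) by rewrite bot_vcast tbE.
rewrite (lcomp_idr (β := γ) f1) ccomp_assoc lact_ract.
have f2 : bot (idc h) = top (Φ γ) by rewrite tbE Φt.
rewrite -(runiE f2) -ccomp_assoc /ract; congr (_ ⊙ _); apply: vccR; rewrite ?ccomp_idr //.
rewrite /nid vcast_isoE; congr (_ ⊙ vcast _); exact: proof_irrelevance.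
Qed.

Lemma lcomp_nid_l (F : NLax C D) (S : D) (c c' : C)
    (Φ : forall δ : Hom c c', Cell (lver F δ) (vid S)) (γ : Hom c c') (β : Hom c' c') h e :
  (forall δ, bot (Φ δ) = h) ->
  Φ (β ∘ γ) ⊙ lcomp F β γ = lact (idc h ⊙ nid F β) (Φ γ) e.
Proof.
move=> Φb; have e0 := thinC β (idm c'); subst β.
have E (δ δ' : Hom c c') (q : δ = δ') : Φ δ = Φ δ' ⊙ vcast (f_equal (@lver C D F c c') q).
  by subst; rewrite ccomp_idr.
rewrite (E _ _ (comp_idl γ)) -ccomp_assoc.
have f1 : bot (cid (lver F γ)) = top (vcast (lver_id F c')) by rewrite top_vcast tbE.
rewrite (lcomp_idl (β := γ) f1) ccomp_assoc.
have f2 : bot (Φ γ) = top (idc h) by rewrite tbE Φb.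
rewrite -(luniE f2) -ccomp_assoc /lact; congr (_ ⊙ _); apply: vccR; rewrite ?ccomp_idr //.
rewrite /nid vcast_isoE; congr (_ ⊙ vcast _); exact: proof_irrelevance.
Qed.

Lemma cocone_eq (F : NLax C D) (T : D) (i j : Transf F (constL C T)) :
  (forall c, i c = j c) ->
  (forall c c' (β : Hom c c'), c <> c' -> ccell i β = ccell j β) -> i = j.
Proof.
move=> h1 h2; apply: Transf_eq => // c c' β.
case: (classic (c = c')) => [e | ne]; last exact: h2.
by subst c'; have := ccell_nid i β; have := ccell_nid j β; rewrite /ccell h1 => -> ->.
Qed.

Definition universal (F : NLax C D) (T : D) (i : Transf F (constL C T)) : Prop :=
  forall (Y : D) (s : Transf F (constL C Y)), exists! h : Hom T Y, compT (constT C h) i = s.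

Lemma universal_ex (F : NLax C D) (T Y : D) (i : Transf F (constL C T)) (s : Transf F (constL C Y)) :
  universal i -> exists h : Hom T Y, compT (constT C h) i = s.
Proof. by move=> /(_ Y s) [h [hh _]]; exists h. Qed.

Lemma universal_uq (F : NLax C D) (T Y : D) (i : Transf F (constL C T)) (h h' : Hom T Y) :
  universal i -> compT (constT C h) i = compT (constT C h') i -> h = h'.
Proof.
move=> /(_ Y (compT (constT C h) i)) [k [_ K]] e.
by rewrite -(K h erefl); apply: K.
Qed.

Lemma cocone_leg (F : NLax C D) (T Y : D) (i : Transf F (constL C T)) (h : Hom T Y)
    (s : Transf F (constL C Y)) c : compT (constT C h) i = s -> h ∘ i c = s c.
Proof. by move=> <-. Qed.
Lemma cocone_cell (F : NLax C D) (T Y : D) (i : Transf F (constL C T)) (h : Hom T Y)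
    (s : Transf F (constL C Y)) c c' (β : Hom c c') :
  compT (constT C h) i = s -> idc h ⊙ ccell i β = ccell s β.
Proof. by move=> <-. Qed.

Lemma universal_iso (F : NLax C D) (T T' : D) (i : Transf F (constL C T)) (i' : Transf F (constL C T')) :
  universal i -> universal i' -> exists h : Hom T T', is_iso h /\ compT (constT C h) i = i'.
Proof.
move=> U U'; have [h hh] := universal_ex i' U; have [k hk] := universal_ex i U'.
have comp (X Y Z : D) (f : Hom X Y) (g : Hom Y Z) (s : Transf F (constL C X)) :
    compT (constT C (g ∘ f)) s = compT (constT C g) (compT (constT C f) s).
  by apply: Transf_eq => * /=; rewrite ?comp_assoc ?idc_comp ?ccomp_assoc.
have one (X : D) (s : Transf F (constL C X)) : compT (constT C (idm X)) s = s.
  by apply: Transf_eq => * /=; rewrite ?comp_idl ?idc_id ?ccomp_idl.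
exists h; split=> //; exists k; split.
  by apply: (universal_uq U); rewrite comp hh hk one.
by apply: (universal_uq U'); rewrite comp hk hh one.
Qed.

End Cocones.
Arguments nid {D C} thinC F {c} β.

Section Sub.
Variables (D : FramedBicategory) (C : Cat) (Q : C -> Prop).

Lemma thin_sub : thin C -> thin (subcat Q).
Proof. by move=> H x y f g; exact: H. Qed.

Definition res (F : NLax C D) : NLax (subcat Q) D :=
  @MkNLax (subcat Q) D (fun x => F (proj1_sig x))
    (fun x y (β : Hom (proj1_sig x) (proj1_sig y)) => lver F β) (fun x => lver_id F (proj1_sig x))
    (fun x y z (β' : Hom (proj1_sig y) (proj1_sig z)) (β : Hom (proj1_sig x) (proj1_sig y)) => lcomp F β' β)
    (fun _ _ _ _ _ => top_lcomp _ _ _) (fun _ _ _ _ _ => bot_lcomp _ _ _)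
    (fun x y (β : Hom (proj1_sig x) (proj1_sig y)) e => @lcomp_idl C D F _ _ β e)
    (fun x y (β : Hom (proj1_sig x) (proj1_sig y)) e => @lcomp_idr C D F _ _ β e)
    (fun x y z w (β'' : Hom (proj1_sig z) (proj1_sig w)) (β' : Hom (proj1_sig y) (proj1_sig z))
      (β : Hom (proj1_sig x) (proj1_sig y)) e1 e2 => @lcomp_assoc C D F _ _ _ _ β'' β' β e1 e2).

Definition resT (F : NLax C D) (T : D) (i : Transf F (constL C T)) :
    Transf (res F) (constL (subcat Q) T) :=
  @MkTransf (subcat Q) D (res F) (constL (subcat Q) T) (fun x => i (proj1_sig x))
    (fun x y (β : Hom (proj1_sig x) (proj1_sig y)) => tcell i β)
    (fun x y (β : Hom (proj1_sig x) (proj1_sig y)) => top_tcell i β)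
    (fun x y (β : Hom (proj1_sig x) (proj1_sig y)) => bot_tcell i β)
    (fun x => tcell_id i (proj1_sig x)) (fun x y z (β' : Hom (proj1_sig y) (proj1_sig z))
       (β : Hom (proj1_sig x) (proj1_sig y)) e => tcell_comp (t := i) e).

End Sub.

(** * Removing a minimal object: universality, cells and modules *)

Section Strata.
Variables (D : FramedBicategory) (GT : glue_theory D).

Definition restrictions (C : Cat) (F : NLax C D) (T : D) (i : Transf F (constL C T)) (A : D)
    (y : Ver A T) (yc : forall c, Ver A (F c)) (κ : forall c, Cell (yc c) y) : Prop :=
  forall c, [/\ cart (κ c), top (κ c) = idm A & bot (κ c) = i c].

(** This and [modules_extend] say that a vertical morphism [A -> T] amounts to a family of
    vertical morphisms [A -> F c] on which the [F β] act. *)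
Definition cells_extend (C : Cat) (F : NLax C D) (T : D) (i : Transf F (constL C T)) : Prop :=
  forall (A : D) (y : Ver A T) (yc : forall c, Ver A (F c)) (κ : forall c, Cell (yc c) y),
  restrictions i κ ->
  forall (Y : D) (f : Hom A Y) (g : Hom T Y) (ψ : forall c, Cell (yc c) (vid Y)),
  (forall c, top (ψ c) = f /\ bot (ψ c) = g ∘ i c) ->
  (forall (c c' : C) (β : Hom c c') (a : Cell (lver F β • yc c) (yc c')) e e',
    top a = idm A -> bot a = idm _ -> κ c' ⊙ a = lact (ccell i β) (κ c) e ->
    ψ c' ⊙ a = lact (idc g ⊙ ccell i β) (ψ c) e') ->
  exists! φ : Cell y (vid Y), [/\ top φ = f, bot φ = g & forall c, φ ⊙ κ c = ψ c].

Lemma cells_extend_uq (C : Cat) (F : NLax C D) (T : D) (i : Transf F (constL C T)) (A : D)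
    (y : Ver A T) (yc : forall c, Ver A (F c)) (κ : forall c, Cell (yc c) y) (Y : D)
    (φ φ' : Cell y (vid Y)) :
  cells_extend i -> restrictions i κ -> top φ = top φ' -> bot φ = bot φ' ->
  (forall c, φ ⊙ κ c = φ' ⊙ κ c) -> φ = φ'.
Proof.
move=> K R ht hb h.
have [||ψ [_ u]] := K A y yc κ R Y (top φ) (bot φ) (fun c => φ ⊙ κ c).
- by move=> c; have [_ t b] := R c; rewrite !tbE t b comp_idr.
- move=> c c' β a e e' _ _ ha; rewrite -ccomp_assoc ha.
  have f1 : bot (φ ⊙ κ c) = top (idc (bot φ) ⊙ ccell i β) by rewrite e'.
  by rewrite (comp_lact _ f1); exact: lact_eq.
rewrite -(u φ) //; apply/esym; rewrite -(u φ') //.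
by split=> // c; rewrite h.
Qed.

Definition modules_extend (C : Cat) (thinC : thin C) (F : NLax C D) (T : D)
    (i : Transf F (constL C T)) : Prop :=
  forall (A : D) (yc : forall c, Ver A (F c))
    (act : forall c c' (β : Hom c c'), Cell (lver F β • yc c) (yc c')),
  (forall c c' (β : Hom c c'), top (act c c' β) = idm A /\ bot (act c c' β) = idm _) ->
  (forall c (β : Hom c c) e, act c c β = luni (yc c) ⊙ vcc (nid thinC F β) (cid (yc c)) e) ->
  (forall c c' c'' (β' : Hom c' c'') (β : Hom c c') e1 e2,
    act c' c'' β' ⊙ vcc (cid (lver F β')) (act c c' β) e1 ⊙ assoc (lver F β') (lver F β) (yc c) =
    act c c'' (β' ∘ β) ⊙ vcc (lcomp F β' β) (cid (yc c)) e2) ->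
  exists (y : Ver A T) (κ : forall c, Cell (yc c) y), restrictions i κ /\
    forall c c' (β : Hom c c') e, κ c' ⊙ act c c' β = lact (ccell i β) (κ c) e.

Section Step.
Variables (C : Cat) (thinC : thin C) (b : C).
Local Notation C' := (subcat (fun x => x <> b)).
Hypothesis bmin : forall x : C', Hom (proj1_sig x) b -> False.

(** [T] is the collage of [n], where [T'] is the colimit of [F] away from the minimal element [b]. *)
Record splitting (F : NLax C D) (T : D) (i : Transf F (constL C T)) (T' : D)
    (i' : Transf (res _ F) (constL C' T')) (n : Ver (F b) T') (u : Cell n (vid T)) : Prop :=
  MkSplitting {
  sp_glue : glue u;
  sp_univ : universal i';
  sp_b : i b = top u;
  sp_s : forall x : C', i (proj1_sig x) = bot u ∘ i' x;
  sp_cell : forall (x y : C') (β : Hom (proj1_sig x) (proj1_sig y)),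
    ccell i β = idc (bot u) ⊙ @ccell D C' (res _ F) T' i' x y β;
  sp_hom : forall (x : C') (β : Hom b (proj1_sig x)), exists κ : Cell (lver F β) n,
    [/\ cart κ, top κ = idm (F b), bot κ = i' x & u ⊙ κ = ccell i β];
  sp_void : forall x : C', (Hom b (proj1_sig x) -> False) ->
    exists (k : Ver (F b) (F (proj1_sig x))) (κ : Cell k n),
    [/\ cart κ, top κ = idm (F b), bot κ = i' x & void k] }.

Section Given.
Variables (F : NLax C D) (T T' : D) (i : Transf F (constL C T)).
Variables (i' : Transf (res (fun x => x <> b) F) (constL C' T')) (n : Ver (F b) T') (u : Cell n (vid T)).
Hypothesis Sp : splitting i i' u.
Hypothesis K' : cells_extend i'.

Lemma sub_top (x y : C') (β : Hom (proj1_sig x) (proj1_sig y)) :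
  top (@ccell D C' (res _ F) T' i' x y β) = i' x.
Proof. exact: top_ccell. Qed.
Lemma sub_bot (x y : C') (β : Hom (proj1_sig x) (proj1_sig y)) :
  bot (@ccell D C' (res _ F) T' i' x y β) = i' y.
Proof. exact: bot_ccell. Qed.

(** Merges [sp_hom] and [sp_void] into a single family of restrictions of [n], the form in which
    [cells_extend] applies to [n]. *)
Lemma splitting_restr : exists (m : forall x : C', Ver (F b) (F (proj1_sig x)))
    (κ : forall x, Cell (m x) n),
  [/\ restrictions i' κ,
    forall (x : C') (β : Hom b (proj1_sig x)), exists ξ : SpecialIso (lver F β) (m x),
      u ⊙ κ x ⊙ ξ = ccell i β &
    forall x : C', (Hom b (proj1_sig x) -> False) -> void (m x)].
Proof.
pose R (x : C') (t : {m : Ver (F b) (F (proj1_sig x)) & Cell m n}) :=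
  [/\ [/\ cart (projT2 t), top (projT2 t) = idm (F b) & bot (projT2 t) = i' x],
    forall (β : Hom b (proj1_sig x)), exists ξ : SpecialIso (lver F β) (projT1 t),
      u ⊙ projT2 t ⊙ ξ = ccell i β & (Hom b (proj1_sig x) -> False) -> void (projT1 t)].
suff : forall x, exists t, R x t.
  move=> /dependent_choice [t ht].
  by exists (fun x => projT1 (t x)), (fun x => projT2 (t x)); split=> x; case: (ht x).
move=> x; case: (classic (inhabited (Hom b (proj1_sig x)))) => [[β]|nh].
  have [κ [Cκ κt κb κe]] := sp_hom Sp β; exists (existT _ (lver F β) κ); split=> //=.
  - by move=> β'; have e := thinC β' β; subst β'; exists (iso_id _); rewrite /= ccomp_idr.
have nh' : Hom b (proj1_sig x) -> False by move=> β; apply: nh.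
have [k [κ [Ck kt kb Vk]]] := sp_void Sp nh'; exists (existT _ k κ); split=> //=.
Qed.

(** The action of [F] on the restrictions of [n] is composition in [F]: after the cartesian cell
    [u ⊙ κ y] both sides become the composition law of the cocone [i]. *)
Lemma splitting_act (m : forall x : C', Ver (F b) (F (proj1_sig x))) (κ : forall x, Cell (m x) n)
    (R : restrictions i' κ) (x y : C') (β : Hom x y) (β0 : Hom b (proj1_sig x))
    (ξ : SpecialIso (lver F β0) (m x))
    (ξ' : SpecialIso (lver F ((β : Hom (proj1_sig x) (proj1_sig y)) ∘ β0)) (m y))
    (a : Cell (lver F (β : Hom (proj1_sig x) (proj1_sig y)) • m x) (m y)) e e1 :
  u ⊙ κ x ⊙ ξ = ccell i β0 -> u ⊙ κ y ⊙ ξ' = ccell i ((β : Hom (proj1_sig x) (proj1_sig y)) ∘ β0) ->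
  top a = idm _ -> bot a = idm _ -> κ y ⊙ a = lact (@ccell D C' (res _ F) T' i' x y β) (κ x) e ->
  a ⊙ vcc (cid (lver F (β : Hom (proj1_sig x) (proj1_sig y)))) ξ e1
  = ξ' ⊙ lcomp F (β : Hom (proj1_sig x) (proj1_sig y)) β0.
Proof.
move=> h1 h1' at_ ab ha; have U := sp_glue Sp.
have [Cx xt xb] := R x; have [Cy yt yb] := R y.
apply: (cart_uq (cart_comp (gt_cart GT U) Cy)).
- by rewrite !tbE at_ top_lcomp.
- by rewrite !tbE ab bot_lcomp.
rewrite [RHS]ccomp_assoc h1'.
have f2 : bot (ccell i β0) = top (ccell i (β : Hom (proj1_sig x) (proj1_sig y))).
  by rewrite bot_ccell top_ccell.
rewrite (ccell_comp f2) ccomp_assoc -(ccomp_assoc u) ha.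
have f3 : bot (u ⊙ κ x) = top (idc (bot u) ⊙ @ccell D C' (res _ F) T' i' x y β).
  by rewrite !tbE xb sub_top.
rewrite (comp_lact _ f3).
have f4 : bot (u ⊙ κ x ⊙ ξ) = top (idc (bot u) ⊙ @ccell D C' (res _ F) T' i' x y β ⊙ cid _).
  by rewrite h1 ccomp_idr -(sp_cell Sp) f2.
rewrite (lact_comp _ _ f4); apply: lact_eq => //.
by rewrite ccomp_idr (sp_cell Sp).
Qed.

(** A map out of [T] is a cell out of [n], which by [cells_extend] is a compatible family of cells
    out of its restrictions. Those are the cells of a cocone at the arrows out of [b]; the void
    restrictions add no data. *)
Lemma splitting_universal : universal i.
Proof.
have [m [κ [R mh mv]]] := splitting_restr.
have U := sp_glue Sp.
move=> Y s.
have [h' hh'] := universal_ex (resT _ s) (sp_univ Sp).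
have hx x : h' ∘ i' x = s (proj1_sig x) by exact: (cocone_leg x hh').
have hc (x y : C') (β : Hom (proj1_sig x) (proj1_sig y)) :
    idc h' ⊙ @ccell D C' (res _ F) T' i' x y β = ccell s β.
  exact: (@cocone_cell D C' (res _ F) T' Y i' h' _ x y β hh').
have [ψ hψ] : exists ψ : forall x : C', Cell (m x) (vid Y), forall x,
    [/\ top (ψ x) = s b, bot (ψ x) = h' ∘ i' x &
     forall β : Hom b (proj1_sig x), exists ξ : SpecialIso (lver F β) (m x),
      u ⊙ κ x ⊙ ξ = ccell i β /\ ψ x ⊙ ξ = ccell s β].
  apply: (dependent_choice (I := C') (T := fun x => Cell (m x) (vid Y)) (R := fun x ψ =>
    [/\ top ψ = s b, bot ψ = h' ∘ i' x &
     forall β : Hom b (proj1_sig x), exists ξ : SpecialIso (lver F β) (m x),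
      u ⊙ κ x ⊙ ξ = ccell i β /\ ψ ⊙ ξ = ccell s β])) => x.
  case: (classic (inhabited (Hom b (proj1_sig x)))) => [[β]|nh].
    have [ξ hξ] := mh x β; exists (ccell s β ⊙ iso_inv ξ); split.
    - by rewrite !tbE top_ccell.
    - by rewrite !tbE bot_ccell hx.
    move=> β'; have e := thinC β' β; subst β'; exists ξ; split=> //.
    by rewrite -ccomp_assoc iso_K ccomp_idr.
  have nh' : Hom b (proj1_sig x) -> False by move=> β; apply: nh.
  have [φ [h1 h2]] := void_ex (s b) (h' ∘ i' x) (mv x nh').
  by exists φ; split=> // β; case: (nh' β).
have Ex : exists! φ : Cell n (vid Y), [/\ top φ = s b, bot φ = h' & forall x, φ ⊙ κ x = ψ x].
  apply: (K' R); first by move=> x; have [h1 h2 _] := hψ x.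
  move=> x y β a e e' at_ ab ha.
  case: (classic (inhabited (Hom b (proj1_sig x)))) => [[β0]|nh]; last first.
    have nh' : Hom b (proj1_sig x) -> False by move=> β0; apply: nh.
    apply: (void_uq (void_comp GT (lver F β) (mv x nh'))).
      by rewrite top_lact tbE at_ comp_idr; case: (hψ y) => -> _ _; case: (hψ x) => ->.
    by rewrite bot_lact !tbE ab comp_idr sub_bot; case: (hψ y) => _ -> _.
  have [ξ [h1 h2]] : exists ξ : SpecialIso (lver F β0) (m x), u ⊙ κ x ⊙ ξ = ccell i β0 /\ ψ x ⊙ ξ = ccell s β0.
    by case: (hψ x) => _ _; apply.
  have [ξ' [h1' h2']] : exists ξ : SpecialIso (lver F ((β : Hom (proj1_sig x) (proj1_sig y)) ∘ β0)) (m y),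
      u ⊙ κ y ⊙ ξ = ccell i ((β : Hom (proj1_sig x) (proj1_sig y)) ∘ β0) /\
      ψ y ⊙ ξ = ccell s ((β : Hom (proj1_sig x) (proj1_sig y)) ∘ β0).
    by case: (hψ y) => _ _; apply.
  have [Cx xt xb] := R x; have [Cy yt yb] := R y.
  have f1 : bot ξ = top (cid (lver F (β : Hom (proj1_sig x) (proj1_sig y)))) by rewrite !tbE.
  have E := splitting_act R f1 h1 h1' at_ ab ha.
  apply: (iso_cancelR (i := vcc_iso (i := iso_id (lver F (β : Hom (proj1_sig x) (proj1_sig y)))) (j := ξ) f1)) => /=.
  rewrite -ccomp_assoc E ccomp_assoc h2'.
  have f2 : bot (ccell s β0) = top (ccell s (β : Hom (proj1_sig x) (proj1_sig y))).
    by rewrite bot_ccell top_ccell.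
  rewrite (ccell_comp f2).
  have f4 : bot (ψ x ⊙ ξ) = top (idc h' ⊙ @ccell D C' (res _ F) T' i' x y β ⊙ cid _).
    by rewrite h2 ccomp_idr hc f2.
  by rewrite (lact_comp _ _ f4); apply: lact_eq; rewrite ?hc ?h2 ?ccomp_idr.
have [φ [[φt φb φκ] _]] := Ex.
have [h hh] := glue_ex φ U.
have vw c : inhabited (view b c) by exact: view_exists.
exists h; split.
  apply: (cocone_eq thinC).
    move=> c; case: (vw c) => -[|x] /=; first by rewrite (sp_b Sp) (idc_top hh).
    by rewrite (sp_s Sp) comp_assoc (idc_bot hh) φb hx.
  move=> c c' β; case: (vw c) β => -[|x] β; case: (vw c') β => -[|y] β ne; rewrite ccell_const.
  - by [].
  - have [_ _ /(_ β) [ξ [h1 h2]]] := hψ y.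
    by rewrite -h1 -h2 -φκ -hh !ccomp_assoc.
  - by case: (bmin β).
  - by rewrite (sp_cell Sp) ccomp_assoc -idc_comp (idc_bot hh) φb hc.
move=> k hk; apply: (glue_uq U); rewrite hh.
have kb : k ∘ bot u = h'.
  apply: (universal_uq (sp_univ Sp)); rewrite hh'; apply: Transf_eq.
    by move=> x /=; rewrite -comp_assoc -(sp_s Sp) (cocone_leg _ hk).
  move=> x y β; rewrite -/(ccell _ _) ccell_const idc_comp -ccomp_assoc.
  by rewrite -(sp_cell Sp); exact: (@cocone_cell D C F T Y i k s _ _ β hk).
apply: (cells_extend_uq K' R).
- by rewrite tbE φt tbE -(sp_b Sp) (cocone_leg _ hk).
- by rewrite tbE φb tbE kb.
move=> x; rewrite φκ.
case: (classic (inhabited (Hom b (proj1_sig x)))) => [[β]|nh].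
  have [_ _ /(_ β) [ξ [h1 h2]]] := hψ x.
  by apply: (iso_cancelR (i := ξ)); rewrite h2 -!ccomp_assoc (ccomp_assoc u) h1 (cocone_cell β hk).
have nh' : Hom b (proj1_sig x) -> False by move=> β; apply: nh.
have [t1 t2 _] := hψ x; have [_ xt xb] := R x.
apply: (void_uq (mv x nh')); rewrite !tbE ?t1 ?t2 ?xt ?xb ?comp_idr.
  by rewrite -(sp_b Sp) (cocone_leg _ hk).
by rewrite kb.
Qed.

(** [restriction_desc_gen] reduces [y] to its restrictions to [F b] and to [T'], and the latter is
    covered by the hypothesis on [i']. *)
Lemma splitting_cells : cells_extend i.
Proof.
have [m [κm [Rm mh mv]]] := splitting_restr.
have U := sp_glue Sp.
move=> A y yc κ R Y f g ψ hψ comp.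
have [y' [λ [Cλ λt λb]]] := restriction_exists y (idm A) (bot u).
have [κ' hκ'] : exists κ' : forall x : C', Cell (yc (proj1_sig x)) y',
    forall x, [/\ top (κ' x) = idm A, bot (κ' x) = i' x & λ ⊙ κ' x = κ (proj1_sig x)].
  apply: (dependent_choice (I := C') (T := fun x => Cell (yc (proj1_sig x)) y')
    (R := fun x k => [/\ top k = idm A, bot k = i' x & λ ⊙ k = κ (proj1_sig x)])) => x.
  have [_ t b0] := R (proj1_sig x); apply: (cart_ex Cλ); rewrite ?t ?b0 ?λt ?λb ?comp_idr //.
  exact: (sp_s Sp).
have R' : restrictions i' κ'.
  move=> x; have [t b0 e] := hκ' x; split=> //; apply: (cart_cancel Cλ); rewrite e.
  by case: (R (proj1_sig x)).
have [ψ2 [[ψ2t ψ2b ψ2e] ψ2u]] : exists! φ : Cell y' (vid Y),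
    [/\ top φ = f, bot φ = g ∘ bot u & forall x, φ ⊙ κ' x = ψ (proj1_sig x)].
  apply: (K' R').
  - by move=> x; have [h1 h2] := hψ (proj1_sig x); rewrite h1 h2 (sp_s Sp) comp_assoc.
  - move=> x z β a e e' at_ ab ha.
    have [_ κ'b κ'e] := hκ' x; have [_ _ κ'e2] := hκ' z; have [_ κt κb] := R (proj1_sig x).
    have f1 : bot (κ (proj1_sig x)) = top (@ccell D C F T i _ _ β) by rewrite κb top_ccell.
    have f2 : bot (ψ (proj1_sig x)) = top (idc g ⊙ @ccell D C F T i _ _ β).
      by case: (hψ (proj1_sig x)) => _ ->; rewrite !tbE top_ccell.
    have ha' : κ (proj1_sig z) ⊙ a = lact (@ccell D C F T i _ _ β) (κ (proj1_sig x)) f1.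
      have f3 : bot (λ ⊙ κ' x) = top (idc (bot λ) ⊙ @ccell D C' (res _ F) T' i' x z β).
        by rewrite !tbE κ'b sub_top.
      rewrite -κ'e2 -ccomp_assoc ha (comp_lact _ f3); apply: lact_eq => //.
      by rewrite λb (sp_cell Sp).
    rewrite (comp _ _ _ _ _ f2 at_ ab ha'); apply: lact_eq => //.
    by rewrite (sp_cell Sp) ccomp_assoc -idc_comp.
have [_ κbt κbb] := R b; rewrite (sp_b Sp) in κbb.
have ec : bot (κ b) = top u by rewrite κbb.
have [c [ct cb ce]] : exists c : Cell (n • yc b) y', [/\ top c = idm A, bot c = idm T' & λ ⊙ c = lact u (κ b) ec].
  by apply: (cart_ex Cλ); rewrite ?top_lact ?bot_lact ?κbt ?λt ?λb ?comp_idr.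
have [ψbt ψbb] := hψ b; rewrite (sp_b Sp) in ψbb.
have ee : bot (ψ b) = top (idc g ⊙ u) by rewrite ψbb !tbE.
have [Cκb _ _] := R b.
(* An equation of cells out of [n • yc b]. This too is a vertical morphism into [T'], with
   restrictions [m x • yc b], so [cells_extend_uq] reduces it to the given compatibility at each
   arrow out of [b]. *)
have compat : ψ2 ⊙ c = lact (idc g ⊙ u) (ψ b) ee.
  have fm x : bot (cid (yc b)) = top (κm x) by case: (Rm x) => _ -> _; rewrite tbE.
  have R2 : restrictions i' (fun x => vcc (κm x) (cid (yc b)) (fm x)).
    by move=> x; have [Cm mt mb] := Rm x; split; rewrite ?top_vcc ?bot_vcc ?tbE //; exact: cart_vcc_cid.
  apply: (cells_extend_uq K' R2).
  - by rewrite tbE ct top_lact ψ2t ψbt comp_idr.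
  - by rewrite tbE cb bot_lact ψ2b !tbE.
  move=> x; have [Cm mt mb] := Rm x.
  case: (classic (inhabited (Hom b (proj1_sig x)))) => [[β]|nh]; last first.
    have nh' : Hom b (proj1_sig x) -> False by move=> β; apply: nh.
    apply: (void_uq (void_comp_l GT (yc b) (mv x nh'))); rewrite !tbE ?top_lact ?bot_lact ?ct ?cb ?comp_idr ?ψ2t ?ψ2b ?tbE //.
  have [ξ hξ] := mh x β.
  have [Cκ κt κb] := R (proj1_sig x); have [κ't κ'b κ'e] := hκ' x.
  have f1 : bot (κ b) = top (ccell i β) by rewrite top_ccell (sp_b Sp).
  have [a [at_ ab ae]] : exists a : Cell (lver F β • yc b) (yc (proj1_sig x)),
      [/\ top a = idm A, bot a = idm _ & κ (proj1_sig x) ⊙ a = lact (ccell i β) (κ b) f1].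
    by apply: (cart_ex Cκ); rewrite ?top_lact ?bot_lact ?bot_ccell ?κt ?κb ?κbt ?comp_idr.
  have f2 : bot (cid (yc b)) = top ξ by rewrite !tbE.
  have f3 : bot (cid (yc b)) = top (κm x ⊙ ξ) by rewrite !tbE mt.
  have E : c ⊙ vcc (κm x ⊙ ξ) (cid (yc b)) f3 = κ' x ⊙ a.
    apply: (cart_uq Cλ).
    - by rewrite !tbE ct at_ κ't !comp_idl.
    - by rewrite !tbE cb ab mb κ'b !comp_idl comp_idr.
    have f4 : bot (κ b ⊙ cid (yc b)) = top (u ⊙ (κm x ⊙ ξ)).
      by rewrite ccomp_idr ccomp_assoc hξ.
    rewrite !ccomp_assoc ce κ'e ae (lact_comp _ _ f4); apply: lact_eq; rewrite ?ccomp_idr //.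
    by rewrite ccomp_assoc.
  apply: (iso_cancelR (i := vcc_iso (i := ξ) (j := iso_id (yc b)) f2)) => /=.
  rewrite -!ccomp_assoc (vccR (χ := κm x ⊙ ξ) (χ' := cid (yc b)) f3) ?ccomp_idl // E ccomp_assoc ψ2e.
  have f5 : bot (ψ b) = top (idc g ⊙ ccell i β) by rewrite ψbb !tbE top_ccell (sp_b Sp).
  rewrite (comp _ _ _ _ f1 f5 at_ ab ae).
  have f6 : bot (ψ b ⊙ cid (yc b)) = top (idc g ⊙ u ⊙ (κm x ⊙ ξ)).
    by rewrite ccomp_idr -(ccomp_assoc (idc g)) (ccomp_assoc u) hξ.
  rewrite (ccomp_assoc (luni _)) -/(lact (idc g ⊙ u) (ψ b) ee) (lact_comp _ _ f6); apply: lact_eq; rewrite ?ccomp_idr //.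
  by rewrite -(ccomp_assoc (idc g)) (ccomp_assoc u) hξ.
have [φ [[φb φ1 φ2] φu]] := restriction_desc_gen GT U Cκb κbt κbb Cλ λt λb ct cb ce (g := g) (ψ1 := ψ b) (ψ2 := ψ2) (e := ee) ψbb ψ2b compat.
exists φ; split.
  split=> //.
    by rewrite -ψbt -φ1 tbE κbt comp_idr.
  move=> c0; case: (view_exists b c0) => -[|x] //.
  by have [_ _ <-] := hκ' x; rewrite ccomp_assoc φ2 ψ2e.
move=> φ' [φ't φ'b φ'e]; apply: φu; split=> //.
apply/esym/ψ2u; split; rewrite ?tbE ?λt ?λb ?φ't ?φ'b ?comp_idr //.
by move=> x; have [_ _ h] := hκ' x; rewrite -ccomp_assoc h.
Qed.

Lemma nid_res (x : C') (β : Hom x x) :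
  iso_cell (nid (thin_sub thinC) (res _ F) β) = nid thinC F (β : Hom (proj1_sig x) (proj1_sig x)).
Proof. by rewrite /nid !vcast_isoE; congr (vcast _); exact: proof_irrelevance. Qed.

(** The members of the family away from [b] form some [y' : A -> T']. The actions of the arrows out
    of [b] assemble into one cell [φ : n • yc b -> y'], along which [module_exists] joins [yc b] to
    [y']. *)
Lemma splitting_modules : modules_extend (thin_sub thinC) i' -> modules_extend thinC i.
Proof.
move=> E'.
have [m [κm [Rm mh mv]]] := splitting_restr.
have U := sp_glue Sp.
move=> A yc act actI act_id act_comp.
have [y' [κ' [R' law']]] : exists (y : Ver A T') (κ : forall x : C', Cell (yc (proj1_sig x)) y),
    restrictions i' κ /\
    forall (x y0 : C') (β : Hom x y0) e,
      κ y0 ⊙ act _ _ (β : Hom (proj1_sig x) (proj1_sig y0)) = lact (@ccell D C' (res _ F) T' i' x y0 β) (κ x) e.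
  apply: (E' A (fun x => yc (proj1_sig x)) (fun x y0 (β : Hom (proj1_sig x) (proj1_sig y0)) => act _ _ β)).
  - by move=> x y0 β; exact: actI.
  - move=> x β e; have f : bot (cid (yc (proj1_sig x))) = top (nid thinC F (β : Hom (proj1_sig x) (proj1_sig x))) by rewrite -nid_res.
    by rewrite (act_id _ _ f); congr (_ ⊙ _); apply: vcc_eq => //; rewrite nid_res.
  - by move=> x y0 z β' β e1 e2; exact: (act_comp _ _ _ (β' : Hom (proj1_sig y0) (proj1_sig z)) (β : Hom (proj1_sig x) (proj1_sig y0)) e1 e2).
(* [cells_extend] produces cells into identities; through the cartesian cell [uZ] it produces cells
   into [y'] as well. *)
have [Z [uZ UZ]] := gt_glue GT y'.
have CZ := gt_cart GT UZ.
pose Ψ (x : C') (ψ : Cell (m x • yc b) (vid Z)) :=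
  [/\ top ψ = top uZ, bot ψ = bot uZ ∘ i' x &
   forall β : Hom b (proj1_sig x), exists (ξ : SpecialIso (lver F β) (m x)) f,
      u ⊙ κm x ⊙ ξ = ccell i β /\ ψ ⊙ vcc ξ (cid (yc b)) f = uZ ⊙ κ' x ⊙ act _ _ β].
have [ψ hψ] : exists ψ : forall x, Cell (m x • yc b) (vid Z), forall x, Ψ x (ψ x).
  apply: (dependent_choice (T := fun x : C' => Cell (m x • yc b) (vid Z)) (R := Ψ)) => x.
  have [_ xt xb] := R' x.
  case: (classic (inhabited (Hom b (proj1_sig x)))) => [[β]|nh].
    have [ξ hξ] := mh x β; have [a1 a2] := actI _ _ β.
    have f : bot (cid (yc b)) = top ξ by rewrite !tbE.
    exists (uZ ⊙ κ' x ⊙ act _ _ β ⊙ iso_inv (vcc_iso (i := ξ) (j := iso_id (yc b)) f)); split.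
    - by rewrite !tbE a1 xt !comp_idr.
    - by rewrite !tbE a2 xb !comp_idr.
    move=> β'; have e := thinC β' β; subst β'; exists ξ, f; split=> //.
    have K := iso_K (vcc_iso (i := ξ) (j := iso_id (yc b)) f).
    by rewrite -(ccomp_assoc (uZ ⊙ κ' x ⊙ act _ _ β)) [X in _ ⊙ X]K ccomp_idr.
  have nh' : Hom b (proj1_sig x) -> False by move=> β; apply: nh.
  have [φ [h1 h2]] := void_ex (top uZ) (bot uZ ∘ i' x) (void_comp_l GT (yc b) (mv x nh')).
  by exists φ; split=> // β; case: (nh' β).
have fm x : bot (cid (yc b)) = top (κm x) by case: (Rm x) => _ -> _; rewrite tbE.
have R2 : restrictions i' (fun x => vcc (κm x) (cid (yc b)) (fm x)).
  by move=> x; have [Cm mt mb] := Rm x; split; rewrite ?top_vcc ?bot_vcc ?tbE //; exact: cart_vcc_cid.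
have [Φ [[Φt Φb Φe] _]] : exists! Φ : Cell (n • yc b) (vid Z),
    [/\ top Φ = top uZ, bot Φ = bot uZ & forall x, Φ ⊙ vcc (κm x) (cid (yc b)) (fm x) = ψ x].
  apply: (K' R2); first by move=> x; case: (hψ x).
  move=> x z β a e e' at_ ab ha.
  case: (classic (inhabited (Hom b (proj1_sig x)))) => [[β0]|nh]; last first.
    have nh' : Hom b (proj1_sig x) -> False by move=> β0; apply: nh.
    have [h1 h2 _] := hψ x; have [h1' h2' _] := hψ z.
    apply: (void_uq (void_comp GT (lver F (β : Hom (proj1_sig x) (proj1_sig z))) (void_comp_l GT (yc b) (mv x nh')))).
      by rewrite top_lact tbE at_ h1 h1' comp_idr.
    by rewrite bot_lact !tbE ab h2' comp_idr sub_bot.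
  pose β1 : Hom (proj1_sig x) (proj1_sig z) := β.
  have [ht hb /(_ β0) [ξ [f [h1 h2]]]] := hψ x.
  have [ht' hb' /(_ (β1 ∘ β0)) [ξ' [f' [h1' h2']]]] := hψ z.
  have [Cz zt zb] := Rm z; have [Cx xt xb] := Rm x.
  have g1 : bot (κm x) = top (@ccell D C' (res _ F) T' i' x z β) by rewrite xb sub_top.
  have [a0 [a0t a0b a0e]] : exists a0 : Cell (lver F β1 • m x) (m z),
      [/\ top a0 = idm _, bot a0 = idm _ & κm z ⊙ a0 = lact (@ccell D C' (res _ F) T' i' x z β) (κm x) g1].
    by apply: (cart_ex Cz); rewrite ?top_lact ?bot_lact ?xt ?zt ?zb ?comp_idr // sub_bot.
  have g2 : bot ξ = top (cid (lver F β1)) by rewrite !tbE.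
  have E0 := splitting_act Rm g2 h1 h1' a0t a0b a0e.
  have g3 : bot (cid (yc b)) = top a0 by rewrite a0t tbE.
  have Ea : a ⊙ assoc (lver F β1) (m x) (yc b) = vcc a0 (cid (yc b)) g3.
    apply: (cart_uq (cart_vcc_cid (fm z) Cz zt)).
    - by rewrite !tbE at_ ?comp_idr ?comp_idl.
    - by rewrite !tbE ab a0b ?comp_idr ?comp_idl.
    have g4 : bot (cid (yc b)) = top (lact (@ccell D C' (res _ F) T' i' x z β) (κm x) g1).
      by rewrite top_lact xt tbE.
    rewrite ccomp_assoc ha (lact_vcc (e3 := g1) _ g4).
    by apply/esym/vccR; rewrite ?a0e ?ccomp_idl.
  have q1 : bot (vcc ξ (cid (yc b)) f) = top (cid (lver F β1)) by rewrite !tbE.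
  pose J := vcc_iso (i := iso_id (lver F β1)) (j := vcc_iso (i := ξ) (j := iso_id (yc b)) f) q1.
  apply: (iso_cancelR (i := J)); apply: (iso_cancelR (i := assoc (lver F β1) (lver F β0) (yc b))).
  rewrite /J /=.
  have q2 : bot (cid (yc b)) = top (vcc (cid (lver F β1)) ξ g2) by rewrite !tbE.
  have q3 : bot (act _ _ β0) = top (cid (lver F β1)) by have [_ ->] := actI _ _ β0; rewrite tbE.
  have q4 : bot (cid (yc b)) = top (lcomp F β1 β0) by rewrite top_lcomp tbE.
  have q5 : bot (uZ ⊙ κ' x) = top (idc (bot uZ) ⊙ @ccell D C' (res _ F) T' i' x z β).
    by have [_ _ k] := R' x; rewrite !tbE k sub_top.
  transitivity (lact (idc (bot uZ) ⊙ @ccell D C' (res _ F) T' i' x z β) (uZ ⊙ κ' x) q5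
     ⊙ vcc (cid (lver F β1)) (act _ _ β0) q3 ⊙ assoc (lver F β1) (lver F β0) (yc b)).
    rewrite -!ccomp_assoc -(assoc_nat g2 q2) (ccomp_assoc a) Ea.
    have q6 : bot (cid (yc b)) = top (ξ' ⊙ lcomp F β1 β0) by rewrite !tbE top_lcomp ?comp_idr ?comp_idl.
    rewrite (vccR (χ := ξ' ⊙ lcomp F β1 β0) (χ' := cid (yc b)) q6) ?ccomp_idl //.
    have V : vcc ξ' (cid (yc b)) f' ⊙ vcc (lcomp F β1 β0) (cid (yc b)) q4 = vcc (ξ' ⊙ lcomp F β1 β0) (cid (yc b)) q6.
      by apply: vccR; rewrite ?ccomp_idl.
    rewrite -V (ccomp_assoc (ψ z)) h2' -ccomp_assoc -(act_comp _ _ _ β1 β0 q3) !ccomp_assoc.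
    have q7 : bot (κ' x) = top (@ccell D C' (res _ F) T' i' x z β) by have [_ _ ->] := R' x; rewrite sub_top.
    by rewrite -(ccomp_assoc uZ) (law' x z β q7) (comp_lact _ q5).
  have q8 : bot (ψ x ⊙ vcc ξ (cid (yc b)) f) = top (idc (bot uZ) ⊙ @ccell D C' (res _ F) T' i' x z β ⊙ cid (lver F β1)).
    by rewrite !tbE hb ?comp_idr ?comp_idl sub_top.
  have q9 : bot (uZ ⊙ κ' x ⊙ act _ _ β0) = top (idc (bot uZ) ⊙ @ccell D C' (res _ F) T' i' x z β ⊙ cid (lver F β1)).
    by rewrite -h2.
  rewrite (lact_comp _ _ q8) (lact_comp _ _ q9); congr (_ ⊙ _); exact: lact_eq.
have [φ [φt φb φe]] : exists φ : Cell (n • yc b) y', [/\ top φ = idm A, bot φ = idm T' & uZ ⊙ φ = Φ].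
  by apply: (cart_ex CZ); rewrite ?comp_idr.
have φact (x : C') (β : Hom b (proj1_sig x)) : exists (ξ : SpecialIso (lver F β) (m x)) f,
    u ⊙ κm x ⊙ ξ = ccell i β /\ φ ⊙ vcc (κm x ⊙ ξ) (cid (yc b)) f = κ' x ⊙ act _ _ β.
  have [_ _ /(_ β) [ξ [f [h1 h2]]]] := hψ x; have [_ mt mb] := Rm x; have [a1 a2] := actI _ _ β.
  have [_ xt xb] := R' x.
  have f' : bot (cid (yc b)) = top (κm x ⊙ ξ) by rewrite !tbE mt ?comp_idr ?comp_idl.
  exists ξ, f'; split=> //; apply: (cart_uq CZ).
  - by rewrite !tbE φt a1 xt ?comp_idr ?comp_idl.
  - by rewrite !tbE φb a2 xb mb ?comp_idr ?comp_idl.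
  have V : vcc (κm x) (cid (yc b)) (fm x) ⊙ vcc ξ (cid (yc b)) f = vcc (κm x ⊙ ξ) (cid (yc b)) f'.
    by apply: vccR; rewrite ?ccomp_idl.
  by rewrite ccomp_assoc φe -V ccomp_assoc Φe h2 !ccomp_assoc.
have [y [κ1 [κ2 [[Cκ1 κ1t κ1b] [Cκ2 κ2t κ2b κ2e]]]]] := module_exists GT U φt φb.
have [κ [κ_b κ_s]] := family_exists (P := fun c => Cell (yc c) y) κ1 (fun x => κ2 ⊙ κ' x).
exists y, κ; split.
  move=> c; case: (view_exists b c) => -[|x].
    by rewrite κ_b (sp_b Sp).
  have [Cx xt xb] := R' x; rewrite κ_s (sp_s Sp); split.
  - exact: cart_comp.
  - by rewrite tbE κ2t xt comp_idr.
  - by rewrite tbE κ2b xb.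
move=> c c' β; case: (view_exists b c) β => -[|x] β; case: (view_exists b c') β => -[|z] β e.
- have f : bot (cid (yc b)) = top (nid thinC F β) by rewrite !tbE.
  have f0 : bot κ1 = top (ccell i β) by rewrite top_ccell κ1b (sp_b Sp).
  have -> : lact (ccell i β) (κ b) e = lact (ccell i β) κ1 f0 by exact: lact_eq.
  rewrite (act_id _ _ f) κ_b ccomp_assoc.
  have f1 : bot κ1 = top (idc (i b)) by rewrite tbE κ1b (sp_b Sp).
  by rewrite -(luniE f1) -ccomp_assoc /lact; congr (_ ⊙ _); apply: vccR; rewrite ?ccell_nid ?ccomp_idr.
- have [ξ [f [h1 h2]]] := φact z β.
  have f1 : bot κ1 = top u by rewrite κ1b.
  have f2 : bot (κ1 ⊙ cid (yc b)) = top (u ⊙ (κm z ⊙ ξ)) by rewrite ccomp_idr ccomp_assoc h1 top_ccell (sp_b Sp).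
  have f0 : bot κ1 = top (ccell i β) by rewrite top_ccell κ1b (sp_b Sp).
  have -> : lact (ccell i β) (κ b) e = lact (ccell i β) κ1 f0 by exact: lact_eq.
  rewrite κ_s -ccomp_assoc -h2 ccomp_assoc (κ2e f1) (lact_comp _ _ f2); apply: lact_eq.
    by rewrite ccomp_assoc.
  by rewrite ccomp_idr.
- by case: (bmin β).
have f1 : bot (κ' x) = top (@ccell D C' (res _ F) T' i' x z β) by have [_ _ ->] := R' x; rewrite sub_top.
have f2 : bot (κ2 ⊙ κ' x) = top (idc (bot κ2) ⊙ @ccell D C' (res _ F) T' i' x z β).
  by rewrite !tbE f1.
have f0 : bot (κ2 ⊙ κ' x) = top (@ccell D C F T i _ _ β) by rewrite -κ_s.
have -> : lact (ccell i β) (κ (proj1_sig x)) e = lact (@ccell D C F T i _ _ β) (κ2 ⊙ κ' x) f0 by exact: lact_eq.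
rewrite κ_s -ccomp_assoc (law' x z β f1) (comp_lact _ f2); apply: lact_eq => //.
by rewrite κ2b (sp_cell Sp).
Qed.

End Given.
End Step.
End Strata.

(** * Cartesian cells, monic legs, pullbacks and stability for split cocones *)

Section Properties.
Variables (D : FramedBicategory) (GT : glue_theory D).

Section Predicates.
Variables (C : Cat) (F : NLax C D) (T : D) (i : Transf F (constL C T)).

Definition cells_cart : Prop := forall (c c' : C) (β : Hom c c'), cart (ccell i β).

(** The sides of the cell may lie over [F c] and [F c'] instead of being the legs themselves; this
    makes the property applicable to cocones over the restriction along a map into [T]. *)
Definition cells_void : Prop := forall c c' : C, (Hom c c' -> False) ->
  forall (A B : D) (w : Ver A B) (φ : Cell w (vid T)) (f : Hom A (F c)) (g : Hom B (F c')),
  top φ = i c ∘ f -> bot φ = i c' ∘ g -> void w.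

Definition legs_mono : Prop := forall c : C, mono (i c).

Definition legs_pullback : Prop := forall (c : C) (X : D) (p : Hom X T),
  exists (P : D) (u : Hom P X) (v : Hom P (F c)), is_pullback (K := HD D) p (i c) u v.

End Predicates.

Definition stable (C : Cat) (F : NLax C D) (T : D) (i : Transf F (constL C T)) : Prop := forall (X : D) (p : Hom X T) (G : NLax C D) (t : Transf G F)
  (j : Transf G (constL C X)), compT (constT C p) j = compT i t -> cells_cart j ->
  (forall c, is_pullback (K := HD D) p (i c) (j c) (t c)) -> universal j.

Lemma cocone_exists (C : Cat) (thinC : thin C) (F : NLax C D) (S : D) (l : forall c, Hom (F c) S)
    (φ : forall c c' (β : Hom c c'), Cell (lver F β) (vid S)) :
  (forall c c' (β : Hom c c'), top (φ c c' β) = l c /\ bot (φ c c' β) = l c') ->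
  (forall c (β : Hom c c), φ c c β = idc (l c) ⊙ nid thinC F β) ->
  (forall c c' c'' (β' : Hom c' c'') (β : Hom c c') e,
    φ c c'' (β' ∘ β) ⊙ lcomp F β' β = lact (φ c' c'' β') (φ c c' β) e) ->
  exists i : Transf F (constL C S), (forall c, i c = l c) /\
    forall c c' (β : Hom c c'), ccell i β = φ c c' β.
Proof.
move=> h1 h2 h3.
have k1 c c' (β : Hom c c') : top (φ c c' β) = l c by case: (h1 c c' β).
have k2 c c' (β : Hom c c') : bot (φ c c' β) = l c' by case: (h1 c c' β).
have k3 c : vcast (lver_id (constL C S) c) ⊙ φ c c (idm c) = idc (l c) ⊙ vcast (lver_id F c).
  rewrite h2 /= ccomp_idl /nid vcast_isoE; congr (_ ⊙ vcast _); exact: proof_irrelevance.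
by exists (@MkTransf C D F (constL C S) l φ k1 k2 k3 (fun c c' c'' β' β e => h3 c c' c'' β' β e)).
Qed.

(** Cells with sides through the full morphism [m] lift uniquely, and the cocone laws are checked
    after [m]. *)
Lemma cocone_lift (C : Cat) (thinC : thin C) (F : NLax C D) (S T : D) (m : Hom S T)
    (i : Transf F (constL C T)) (l : forall c, Hom (F c) S) :
  cart (idc m) -> (forall c, i c = m ∘ l c) ->
  exists j : Transf F (constL C S), (forall c, j c = l c) /\ compT (constT C m) j = i.
Proof.
move=> Cm hl.
pose R c c' (φ : forall β : Hom c c', Cell (lver F β) (vid S)) := forall β : Hom c c',
  [/\ top (φ β) = l c, bot (φ β) = l c' & idc m ⊙ φ β = ccell i β].
have [φ hφ] : exists φ : forall c c' (β : Hom c c'), Cell (lver F β) (vid S), forall c c', R c c' (φ c c').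
  apply: (dependent_choice (T := fun c => forall c' (β : Hom c c'), Cell (lver F β) (vid S))
     (R := fun c φ => forall c', R c c' (φ c'))) => c.
  apply: (dependent_choice (T := fun c' => forall (β : Hom c c'), Cell (lver F β) (vid S))
     (R := R c)) => c'.
  apply: (dependent_choice (T := fun β : Hom c c' => Cell (lver F β) (vid S))
     (R := fun β φ => [/\ top φ = l c, bot φ = l c' & idc m ⊙ φ = ccell i β])) => β.
  by apply: (cart_ex Cm); rewrite tbE ?top_ccell ?bot_ccell.
have [j [j1 j2]] : exists j : Transf F (constL C S), (forall c, j c = l c) /\
    forall c c' (β : Hom c c'), ccell j β = φ c c' β.
  apply: (cocone_exists (thinC := thinC)).
  - by move=> c c' β; case: (hφ c c' β).
  - move=> c β; have [t b e] := hφ c c β; apply: (cart_uq Cm); rewrite ?tbE //.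
    by rewrite e ccell_nid hl idc_comp ccomp_assoc.
  move=> c c' c'' β' β e; have [t1 b1 e1] := hφ _ _ (β' ∘ β).
  have [t2 b2 e2] := hφ _ _ β'; have [t3 b3 e3] := hφ _ _ β.
  apply: (cart_uq Cm).
  - by rewrite top_lact tbE top_lcomp t1 t3 comp_idr.
  - by rewrite bot_lact tbE bot_lcomp b1 b2 comp_idr.
  have f1 : bot (ccell i β) = top (ccell i β') by rewrite top_ccell bot_ccell.
  have f2 : bot (idc m ⊙ φ c c' β) = top (idc (bot (idc m)) ⊙ φ c' c'' β') by rewrite !tbE e.
  rewrite ccomp_assoc e1 (ccell_comp f1) (comp_lact _ f2); apply: lact_eq => //.
  by rewrite tbE e2.
exists j; split=> //; apply: (cocone_eq thinC) => [c|c c' β ne]; first by rewrite /= j1 hl.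
by rewrite ccell_const j2; case: (hφ c c' β).
Qed.

Section StepProperties.
Variables (C : Cat) (thinC : thin C) (b : C).
Local Notation C' := (subcat (fun x => x <> b)).
Hypothesis bmin : forall x : C', Hom (proj1_sig x) b -> False.

Section GivenProperties.
Variables (F : NLax C D) (T T' : D) (i : Transf F (constL C T)).
Variables (i' : Transf (res (fun x => x <> b) F) (constL C' T')) (n : Ver (F b) T') (u : Cell n (vid T)).
Hypothesis Sp : splitting i i' u.

Lemma splitting_cart : cells_cart i' -> cells_cart i.
Proof.
move=> K c c'; have U := sp_glue Sp.
case: (view_exists b c) => -[|x]; case: (view_exists b c') => -[|y] β.
- rewrite (ccell_nid thinC) (sp_b Sp); apply: cart_comp; first exact: (full_top GT U).
  exact: cart_iso.
- by have [κ [Cκ _ _ <-]] := sp_hom Sp β; apply: cart_comp Cκ; exact: gt_cart U.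
- by case: (bmin β).
rewrite (sp_cell Sp); apply: cart_comp; first exact: (full_bot GT U).
exact: K.
Qed.

Lemma splitting_cells_void : cells_void i' -> cells_void i.
Proof.
move=> K c c'; have U := sp_glue Sp.
case: (view_exists b c) => -[|x]; case: (view_exists b c') => -[|y] nh A B w φ f g φt φb.
- by case: nh; exact: idm.
- have [k [κ [Cκ κt κb Vk]]] := sp_void Sp nh.
  have [ξ [ξt ξb _]] : exists ξ, [/\ top ξ = f, bot ξ = i' y ∘ g & u ⊙ ξ = φ].
    by apply: (cart_ex (gt_cart GT U)); rewrite ?φt ?φb ?(sp_b Sp) ?(sp_s Sp) ?comp_assoc.
  have [ζ _] : exists ζ, [/\ top ζ = f, bot ζ = g & κ ⊙ ζ = ξ].
    by apply: (cart_ex Cκ); rewrite ?κt ?κb ?comp_idl.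
  exact: (void_of_cell GT ζ Vk).
- rewrite (sp_s Sp) -comp_assoc in φt; rewrite (sp_b Sp) in φb.
  exact: (void_of_disjoint GT U φt φb).
rewrite (sp_s Sp) -comp_assoc in φt; rewrite (sp_s Sp) -comp_assoc in φb.
have [ξ [ξt ξb _]] : exists ξ, [/\ top ξ = i' x ∘ f, bot ξ = i' y ∘ g & idc (bot u) ⊙ ξ = φ].
  by apply: (cart_ex (full_bot GT U)); rewrite tbE.
exact: (K x y nh _ _ _ ξ f g).
Qed.

Lemma splitting_mono : legs_mono i' -> legs_mono i.
Proof.
move=> K c; have U := sp_glue Sp.
case: (view_exists b c) => -[|x]; first by rewrite (sp_b Sp); exact: (top_mono GT U).
by rewrite (sp_s Sp); apply: mono_comp; [exact: K | exact: (bot_mono GT U)].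
Qed.

Lemma splitting_pullback : legs_pullback i' -> legs_pullback i.
Proof.
move=> K c X p; have U := sp_glue Sp.
have [A' [B' [n' [u' [c0 [_ _ P1 P2]]]]]] := split GT p U.
case: (view_exists b c) => -[|x]; first by rewrite (sp_b Sp); exists A', (top u'), (top c0).
have [P [q [r Q]]] := K x B' (bot c0).
rewrite (sp_s Sp); exists P, (bot u' ∘ q), r; exact: (pb_paste P2 Q).
Qed.

End GivenProperties.

Definition res_hom (F G : NLax C D) (t : Transf G F) :
    Transf (res (fun x => x <> b) G) (res (fun x => x <> b) F) :=
  @MkTransf C' D (res _ G) (res _ F) (fun x => t (proj1_sig x))
    (fun x y (β : Hom (proj1_sig x) (proj1_sig y)) => tcell t β)
    (fun x y (β : Hom (proj1_sig x) (proj1_sig y)) => top_tcell t β)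
    (fun x y (β : Hom (proj1_sig x) (proj1_sig y)) => bot_tcell t β)
    (fun x => tcell_id t (proj1_sig x)) (fun x y z (β' : Hom (proj1_sig y) (proj1_sig z))
       (β : Hom (proj1_sig x) (proj1_sig y)) e => tcell_comp (t := t) e).

(** The collage structure of [T] pulls back along [p] to one on [X], whose first leg can be taken to
    be [j b]. Induction handles the part over [T']. The remaining splitting conditions for [j] hold
    because its cells are cartesian and, where there is no arrow, because [p] maps into cells of [T]
    that are void. *)
Lemma splitting_stable (F : NLax C D) (T T' : D) (i : Transf F (constL C T))
    (i' : Transf (res (fun x => x <> b) F) (constL C' T')) (n : Ver (F b) T') (u : Cell n (vid T)) :
  splitting i i' u -> cells_void i' -> stable i' ->
  (forall (G : NLax C' D) (S : D) (j : Transf G (constL C' S)), universal j -> cells_extend j) ->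
  stable i.
Proof.
move=> Sp V St K X p G t j ej Cj pbs; have U := sp_glue Sp.
have el c : p ∘ j c = i c ∘ t c by have := f_equal (fun s : Transf G (constL C T) => s c) ej.
have [A' [B' [n0 [u0 [c0 [U0 e0 P1 P2]]]]]] := split GT p U.
have := pbs b; rewrite (sp_b Sp) => Pb.
have [r [ri r1 r2]] := pb_iso P1 Pb.
have [n' [u' [U' u't u'b]]] := glue_releg U0 ri (is_iso_id B').
rewrite r1 in u't; rewrite comp_idr in u'b.
have [j' hj'] : exists j' : forall x : C', Hom (G (proj1_sig x)) B', forall x,
    bot u' ∘ j' x = j (proj1_sig x) /\ bot c0 ∘ j' x = i' x ∘ t (proj1_sig x).
  apply: (dependent_choice (I := C') (T := fun x => Hom (G (proj1_sig x)) B')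
    (R := fun x k => bot u' ∘ k = j (proj1_sig x) /\ bot c0 ∘ k = i' x ∘ t (proj1_sig x))) => x.
  rewrite u'b; apply: (pb_lift P2).
  by rewrite el (sp_s Sp) comp_assoc.
have [J [J1 J2]] := cocone_lift (thin_sub thinC) (i := resT _ j) (full_bot GT U')
  (fun x : C' => esym (proj1 (hj' x))).
have Jc (x y : C') (β : Hom (proj1_sig x) (proj1_sig y)) :
    idc (bot u') ⊙ @ccell D C' (res _ G) B' J x y β = ccell j β.
  exact: (@cocone_cell D C' (res _ G) B' X J (bot u') _ x y β J2).
have JU : universal J.
  apply: (St B' (bot c0) _ (res_hom t)).
  - apply: (cocone_eq (thin_sub thinC)) => [x|x y β ne].
      by rewrite /= J1; case: (hj' x).
    apply: (cart_uq (full_bot GT U)).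
    - rewrite !top_ccell /= J1 /=; by case: (hj' x).
    - rewrite !bot_ccell /= J1 /=; by case: (hj' y).
    rewrite ccell_const ccomp_assoc -idc_comp.
    have ce : idc p ⊙ @ccell D C G X j _ _ β = @ccell D C F T i _ _ β ⊙ tcell t (β : Hom (proj1_sig x) (proj1_sig y)).
      by have := f_equal (fun s : Transf G (constL C T) => @ccell D C G T s _ _ β) ej.
    have e1 : bot u ∘ bot c0 = p ∘ bot u' by rewrite u'b; apply/esym; exact: (pb_comm P2).
    rewrite e1 idc_comp -ccomp_assoc Jc ce (sp_cell Sp) -ccomp_assoc; congr (_ ⊙ _).
  - move=> x y β; apply: (cart_cancel (full_bot GT U')); rewrite Jc; exact: Cj.
  move=> x; rewrite J1; have [h1 h2] := hj' x; rewrite u'b in h1.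
  apply: (pb_cancel P2) => //; rewrite h1 -(sp_s Sp); exact: pbs.
have Spj : splitting j J u'.
  split=> //.
  - by move=> x; rewrite J1; case: (hj' x).
  - by move=> x y β; rewrite Jc.
  - move=> x β.
    have [κ [κt κb κe]] : exists κ, [/\ top κ = idm _, bot κ = J x & u' ⊙ κ = ccell j β].
      apply: (cart_ex (gt_cart GT U')); rewrite ?top_ccell ?bot_ccell ?comp_idr // J1.
      by case: (hj' x).
    exists κ; split=> //; apply: (cart_cancel (gt_cart GT U')); rewrite κe; exact: Cj.
  move=> x nh; have [k [κ [Cκ κt κb]]] := restriction_exists n' (idm (G b)) (J x).
  exists k, κ; split=> //.
  apply: (splitting_cells_void Sp V nh (φ := idc p ⊙ (u' ⊙ κ)) (f := t b) (g := t (proj1_sig x))).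
    by rewrite !tbE κt comp_idr u't el.
  rewrite !tbE κb J1 -el; congr (_ ∘ _); by case: (hj' x).
exact: (splitting_universal GT thinC bmin Spj (K _ _ _ JU)).
Qed.

End StepProperties.
End Properties.

Section ThinLaws.
Variables (D : FramedBicategory) (C : Cat) (thinC : thin C) (F : NLax C D).

Lemma thin_cast (A B : D) (w : Ver A B) (c c' : C) (Φ : forall δ : Hom c c', Cell (lver F δ) w)
    (δ δ' : Hom c c') (q : δ = δ') : Φ δ' ⊙ vcast (f_equal (@lver C D F c c') q) = Φ δ.
Proof. by subst; rewrite /= ccomp_idr. Qed.

Lemma lcomp_nid (A B : D) (w : Ver A B) (c c' : C) (Φ : forall δ : Hom c c', Cell (lver F δ) w)
    (β : Hom c' c') (γ : Hom c c') e :
  Φ (β ∘ γ) ⊙ lcomp F β γ = Φ γ ⊙ luni (lver F γ) ⊙ vcc (nid thinC F β) (cid (lver F γ)) e.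
Proof.
have e0 := thinC β (idm c'); subst β.
have f1 : bot (cid (lver F γ)) = top (vcast (lver_id F c')) by rewrite top_vcast tbE.
rewrite -(thin_cast Φ (comp_idl γ)) -!ccomp_assoc (lcomp_idl f1); congr (_ ⊙ (_ ⊙ _)).
by apply: vcc_eq => //; rewrite /nid vcast_isoE; congr (vcast _); exact: proof_irrelevance.
Qed.

Lemma lcomp_assoc_thin (A B : D) (w : Ver A B) (c0 c1 c2 c3 : C)
    (Φ : forall δ : Hom c0 c3, Cell (lver F δ) w) (β'' : Hom c2 c3) (β' : Hom c1 c2) (β : Hom c0 c1) e1 e2 :
  Φ (β'' ∘ (β' ∘ β)) ⊙ lcomp F β'' (β' ∘ β) ⊙ vcc (cid (lver F β'')) (lcomp F β' β) e1
    ⊙ assoc (lver F β'') (lver F β') (lver F β)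
  = Φ (β'' ∘ β' ∘ β) ⊙ lcomp F (β'' ∘ β') β ⊙ vcc (lcomp F β'' β') (cid (lver F β)) e2.
Proof.
by rewrite -(thin_cast Φ (comp_assoc β'' β' β)) -[RHS]ccomp_assoc -(lcomp_assoc e1) -!ccomp_assoc.
Qed.

End ThinLaws.

(** * The column of a minimal object, and existence of splittings *)

Section Existence.
Variables (D : FramedBicategory) (GT : glue_theory D) (C : Cat) (thinC : thin C) (b : C).
Local Notation C' := (subcat (fun x => x <> b)).
Hypothesis bmin : forall x : C', Hom (proj1_sig x) b -> False.

(** The column of [F] at [b], filled up with void morphisms, with composition in [F] as action. Each
    law is checked after the isomorphisms [ξ] where there is an arrow from [b]; elsewhere both sides
    are cells out of a void composite. *)
Lemma column_module (F : NLax C D) :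
  exists (v : forall x : C', Ver (F b) (F (proj1_sig x)))
    (ξ : forall (x : C') (β : Hom b (proj1_sig x)), SpecialIso (lver F β) (v x))
    (act : forall (x y : C') (β : Hom (proj1_sig x) (proj1_sig y)), Cell (lver F β • v x) (v y)),
  [/\ forall x : C', (Hom b (proj1_sig x) -> False) -> void (v x),
    forall x y β, top (act x y β) = idm _ /\ bot (act x y β) = idm _,
    forall x y β β0 f, act x y β ⊙ vcc (cid (lver F β)) (ξ x β0) f = ξ y (β ∘ β0) ⊙ lcomp F β β0,
    forall x (β : Hom (proj1_sig x) (proj1_sig x)) e,
      act x x β = luni (v x) ⊙ vcc (nid thinC F β) (cid (v x)) e &
    forall x y z (β' : Hom (proj1_sig y) (proj1_sig z)) (β : Hom (proj1_sig x) (proj1_sig y)) e1 e2,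
    act y z β' ⊙ vcc (cid (lver F β')) (act x y β) e1 ⊙ assoc (lver F β') (lver F β) (v x) =
    act x z (β' ∘ β) ⊙ vcc (lcomp F β' β) (cid (v x)) e2].
Proof.
have [v hv] : exists v : forall x : C', Ver (F b) (F (proj1_sig x)), forall x,
    (forall β : Hom b (proj1_sig x), exists ξ : SpecialIso (lver F β) (v x), True) /\
    ((Hom b (proj1_sig x) -> False) -> void (v x)).
  apply: (dependent_choice (I := C') (T := fun x => Ver (F b) (F (proj1_sig x))) (R := fun x v =>
    (forall β : Hom b (proj1_sig x), exists ξ : SpecialIso (lver F β) v, True) /\
    ((Hom b (proj1_sig x) -> False) -> void v))) => x.
  case: (classic (inhabited (Hom b (proj1_sig x)))) => [[β]|nh].
    exists (lver F β); split=> [β'|//]; have e := thinC β' β; subst β'; by exists (iso_id _).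
  have [w Vw] := void_exists GT (F b) (F (proj1_sig x)).
  by exists w; split=> // β; case: nh.
have [ξ _] : exists ξ : forall (x : C') (β : Hom b (proj1_sig x)), SpecialIso (lver F β) (v x),
    forall x : C', True.
  apply: (dependent_choice (I := C') (T := fun x => forall β : Hom b (proj1_sig x), SpecialIso (lver F β) (v x))
    (R := fun _ _ => True)) => x.
  have [ξ _] := dependent_choice (proj1 (hv x)); by exists ξ.
pose R (x y : C') (a : forall β : Hom (proj1_sig x) (proj1_sig y), Cell (lver F β • v x) (v y)) :=
  forall β, [/\ top (a β) = idm _, bot (a β) = idm _ & forall β0 f,
    a β ⊙ vcc (cid (lver F β)) (ξ x β0) f = ξ y (β ∘ β0) ⊙ lcomp F β β0].
have fξ (x y : C') (β : Hom (proj1_sig x) (proj1_sig y)) β0 : bot (ξ x β0) = top (cid (lver F β)) by rewrite !tbE.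
have [act ha] : exists act : forall (x y : C') β, Cell (lver F β • v x) (v y), forall x y, R x y (act x y).
  apply: (dependent_choice (I := C') (T := fun x => forall (y : C') (β : Hom (proj1_sig x) (proj1_sig y)), Cell (lver F β • v x) (v y))
    (R := fun x a => forall y, R x y (a y))) => x.
  apply: (dependent_choice (I := C') (R := R x)) => y.
  apply: (dependent_choice (T := fun β : Hom (proj1_sig x) (proj1_sig y) => Cell (lver F β • v x) (v y))
    (R := fun β a => [/\ top a = idm _, bot a = idm _ & forall β0 f,
    a ⊙ vcc (cid (lver F β)) (ξ x β0) f = ξ y (β ∘ β0) ⊙ lcomp F β β0])) => β.
  case: (classic (inhabited (Hom b (proj1_sig x)))) => [[β0]|nh].
    pose J := vcc_iso (i := iso_id (lver F β)) (j := ξ x β0) (fξ x y β β0).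
    exists (ξ y (β ∘ β0) ⊙ lcomp F β β0 ⊙ iso_inv J); split.
    - by rewrite !tbE top_lcomp ?comp_idr.
    - by rewrite !tbE bot_lcomp ?comp_idr.
    move=> β0' f; have e := thinC β0' β0; subst β0'; rewrite (proof_irrelevance _ f (fξ x y β β0)).
    by have K := iso_K J; rewrite -ccomp_assoc [X in _ ⊙ X]K ccomp_idr.
  have nh' : Hom b (proj1_sig x) -> False by move=> β0; apply: nh.
  have [a [at_ ab]] := void_special GT (v y) (idm _) (idm _) (void_comp GT (lver F β) (proj2 (hv x) nh')).
  by exists a; split=> // β0; case: (nh' β0).
have at_ x y β : top (act x y β) = idm _ by case: (ha x y β).
have ab x y β : bot (act x y β) = idm _ by case: (ha x y β).
have aξ x y β β0 f : act x y β ⊙ vcc (cid (lver F β)) (ξ x β0) f = ξ y (β ∘ β0) ⊙ lcomp F β β0.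
  by case: (ha x y β).
exists v, ξ, act; split=> //; first by move=> x; case: (hv x).
- move=> x β e; case: (classic (inhabited (Hom b (proj1_sig x)))) => [[β0]|nh]; last first.
    have nh' : Hom b (proj1_sig x) -> False by move=> β0; apply: nh.
    apply: (void_cell_uq GT (void_comp GT _ (proj2 (hv x) nh'))); rewrite !tbE ?at_ ?ab //.
  apply: (iso_cancelR (i := vcc_iso (i := iso_id (lver F β)) (j := ξ x β0) (fξ x x β β0))) => /=.
  rewrite aξ.
  have f1 : bot (cid (lver F β0)) = top (nid thinC F β) by rewrite !tbE.
  rewrite (lcomp_nid (thinC := thinC) (fun δ => iso_cell (ξ x δ)) f1).
  have f2 : bot (ξ x β0) = top (idc (idm (F (proj1_sig x)))) by rewrite !tbE.
  rewrite -(luniE f2) -!ccomp_assoc; congr (_ ⊙ _).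
  have f3 : bot (ξ x β0) = top (nid thinC F β) by rewrite !tbE.
  by rewrite (vccR f3) ?ccomp_idr ?idc_id ?ccomp_idl //; apply/esym/vccR; rewrite ?ccomp_idr ?ccomp_idl.
move=> x y z β' β e1 e2; case: (classic (inhabited (Hom b (proj1_sig x)))) => [[β0]|nh]; last first.
  have nh' : Hom b (proj1_sig x) -> False by move=> β0; apply: nh.
  by apply: (void_cell_uq GT (void_comp GT _ (proj2 (hv x) nh'))); rewrite !tbE ?at_ ?ab ?top_lcomp ?bot_lcomp ?comp_idl ?comp_idr.
have f0 : bot (ξ x β0) = top (cid (lver F β' • lver F β)) by rewrite !tbE.
apply: (iso_cancelR (i := vcc_iso (i := iso_id (lver F β' • lver F β)) (j := ξ x β0) f0)) => /=.
have f1 : bot (cid (lver F β)) = top (cid (lver F β')) by rewrite !tbE.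
have f2 : bot (ξ x β0) = top (vcc (cid (lver F β')) (cid (lver F β)) f1) by rewrite !tbE.
have f3 : bot (vcc (cid (lver F β)) (ξ x β0) (fξ _ _ β β0)) = top (cid (lver F β')) by rewrite !tbE.
have -> : vcc (cid (lver F β' • lver F β)) (ξ x β0) f0 = vcc (vcc (cid (lver F β')) (cid (lver F β)) f1) (ξ x β0) f2.
  by apply: vcc_eq => //; rewrite vcc_cid.
rewrite -ccomp_assoc (assoc_nat f1 f2 (fξ _ _ β β0) f3) ccomp_assoc -(ccomp_assoc (act y z β')).
have f4 : bot (ξ y (β ∘ β0)) = top (cid (lver F β')) by rewrite !tbE.
have f5 : bot (lcomp F β β0) = top (cid (lver F β')) by rewrite bot_lcomp tbE.
have -> : vcc (cid (lver F β')) (act x y β) e1 ⊙ vcc (cid (lver F β')) (vcc (cid (lver F β)) (ξ x β0) (fξ _ _ β β0)) f3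
    = vcc (cid (lver F β')) (ξ y (β ∘ β0)) f4 ⊙ vcc (cid (lver F β')) (lcomp F β β0) f5.
  have f6 : bot (ξ y (β ∘ β0) ⊙ lcomp F β β0) = top (cid (lver F β')) by rewrite !tbE bot_lcomp ?comp_idl.
  by rewrite (vccR (χ := cid (lver F β')) (χ' := ξ y (β ∘ β0) ⊙ lcomp F β β0) f6) ?aξ ?ccomp_idl //;
    apply/esym/vccR; rewrite ?ccomp_idl.
have f7 : bot (cid (lver F β0)) = top (lcomp F β' β) by rewrite top_lcomp tbE.
rewrite (ccomp_assoc (act y z β')) aξ (lcomp_assoc_thin (fun δ => iso_cell (ξ z δ)) f5 f7) -(aξ _ _ (β' ∘ β) β0 (fξ _ _ _ _)).
rewrite -!ccomp_assoc; congr (_ ⊙ _).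
have f8 : bot (ξ x β0) = top (lcomp F β' β) by rewrite top_lcomp tbE.
rewrite (vccR f8) ?ccomp_idl ?ccomp_idr //; apply/esym.
have -> : vcc (vcc (cid (lver F β')) (cid (lver F β)) f1) (ξ x β0) f2 = vcc (cid (lver F β' • lver F β)) (ξ x β0) f0.
  by apply: vcc_eq => //; rewrite vcc_cid.
by apply: vccR; rewrite ?ccomp_idl ?ccomp_idr.
Qed.

(** [modules_extend] assembles the column into [n]. On the collage of [n] the cocone has the cells
    of [i'], the restrictions of [u] and unit cells; arrows into [b] from elsewhere are excluded by
    minimality. *)
Lemma splitting_exists (F : NLax C D) (T' : D) (i' : Transf (res (fun x => x <> b) F) (constL C' T')) :
  universal i' -> modules_extend (thin_sub thinC) i' ->
  exists (T : D) (i : Transf F (constL C T)) (n : Ver (F b) T') (u : Cell n (vid T)), splitting i i' u.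
Proof.
move=> U' E'; have [v [ξ [act [Vv actI actξ act_id act_comp]]]] := column_module F.
have [n [κ [R law]]] : exists (n : Ver (F b) T') (κ : forall x : C', Cell (v x) n),
    restrictions i' κ /\
    forall (x y0 : C') (β : Hom x y0) e,
      κ y0 ⊙ act x y0 β = lact (@ccell D C' (res _ F) T' i' x y0 β) (κ x) e.
  apply: (E' (F b) v act).
  - by move=> x y0 β; exact: actI.
  - move=> x β e; have f : bot (cid (v x)) = top (nid thinC F (β : Hom (proj1_sig x) (proj1_sig x))) by rewrite -nid_res.
    by rewrite (act_id _ _ f); congr (_ ⊙ _); apply: vcc_eq => //; rewrite nid_res.
  - by move=> x y0 z β' β e1 e2; exact: act_comp.
have [S [u U]] := gt_glue GT n.
have [l [l_b l_s]] := family_exists (P := fun c => Hom (F c) S) (top u : Hom (F b) S)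
   (fun x : C' => bot u ∘ i' x).
have [φ [φbb φbs φss]] := family2_exists (P := fun c c' => forall β : Hom c c', Cell (lver F β) (vid S))
   (fun β : Hom b b => idc (top u) ⊙ nid thinC F β)
   (fun (x : C') (β : Hom b (proj1_sig x)) => u ⊙ κ x ⊙ ξ x β)
   (fun (x : C') (β : Hom (proj1_sig x) b) => False_rect _ (bmin β))
   (fun (x y : C') (β : Hom (proj1_sig x) (proj1_sig y)) => idc (bot u) ⊙ @ccell D C' (res _ F) T' i' x y β).
have φt c c' (β : Hom c c') : top (φ c c' β) = l c.
  case: (view_exists b c) β => -[|x]; case: (view_exists b c') => -[|y] β.
  - by rewrite φbb !tbE l_b.
  - by have [_ t _] := R y; rewrite φbs !tbE t comp_idr l_b.
  - by case: (bmin β).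
  - by rewrite φss !tbE sub_top l_s.
have φb c c' (β : Hom c c') : bot (φ c c' β) = l c'.
  case: (view_exists b c) β => -[|x]; case: (view_exists b c') => -[|y] β.
  - by rewrite φbb !tbE l_b.
  - by have [_ _ t] := R y; rewrite φbs !tbE t ?comp_idr l_s.
  - by case: (bmin β).
  - by rewrite φss !tbE sub_bot l_s.
have φid c (β : Hom c c) : φ c c β = idc (l c) ⊙ nid thinC F β.
  case: (view_exists b c) β => -[|x] β; first by rewrite φbb l_b.
  by rewrite φss l_s (ccell_nid (thin_sub thinC)) idc_comp -ccomp_assoc; congr (_ ⊙ (_ ⊙ _)); rewrite nid_res.
have [i [i1 i2]] : exists i : Transf F (constL C S), (forall c, i c = l c) /\
    forall c c' (β : Hom c c'), ccell i β = φ c c' β.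
  apply: (cocone_exists (thinC := thinC) (l := l) (φ := φ)) => //.
  move=> c c' c'' β' β.
  case: (view_exists b c') β' β => -[|y] β' β.
    case: (view_exists b c) β => -[|x] β; last by case: (bmin β).
    rewrite (φid b) l_b => e; apply: (@lcomp_nid_r D C thinC F S b c'' (φ b c'')) => δ.
    by rewrite φt l_b.
  case: (view_exists b c'') β' => -[|z] β'; first by case: (bmin β').
  case: (view_exists b c) β => -[|x] β.
    rewrite !φbs φss => e.
    have [_ _ yb] := R y.
    have f1 : bot (ξ y β) = top (cid (lver F β')) by rewrite !tbE.
    rewrite -[LHS]ccomp_assoc -(actξ _ _ β' β f1) ccomp_assoc -(ccomp_assoc u).
    have f2 : bot (κ y) = top (@ccell D C' (res _ F) T' i' y z β') by rewrite yb sub_top.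
    have f3 : bot (u ⊙ κ y) = top (idc (bot u) ⊙ @ccell D C' (res _ F) T' i' y z β').
      by rewrite !tbE f2.
    rewrite (law y z β' f2) (comp_lact _ f3).
    have f4 : bot (u ⊙ κ y ⊙ ξ y β) = top (idc (bot u) ⊙ @ccell D C' (res _ F) T' i' y z β' ⊙ cid _).
      by rewrite ccomp_idr e.
    by rewrite (lact_comp _ _ f4); apply: lact_eq; rewrite ?ccomp_idr.
  rewrite !φss => e.
  have f1 : bot (@ccell D C' (res _ F) T' i' x y β) = top (@ccell D C' (res _ F) T' i' y z β').
    by rewrite sub_top sub_bot.
  rewrite -ccomp_assoc (@ccell_comp D C' (res _ F) T' i' x y z β' β f1).
  have f2 : bot (idc (bot u) ⊙ @ccell D C' (res _ F) T' i' x y β)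
     = top (idc (bot (idc (bot u))) ⊙ @ccell D C' (res _ F) T' i' y z β').
    by rewrite !tbE sub_top sub_bot.
  by rewrite (comp_lact _ f2); apply: lact_eq; rewrite ?tbE.
exists S, i, n, u; split=> //.
- by rewrite i1 l_b.
- by move=> x; rewrite i1 l_s.
- by move=> x y β; rewrite i2 φss.
- move=> x β; have [Cκ κt κb] := R x; exists (κ x ⊙ ξ x β); split.
  + by apply: cart_comp => //; exact: cart_iso.
  + by rewrite !tbE.
  + by rewrite !tbE.
  + by rewrite ccomp_assoc i2 φbs.
move=> x nh; have [Cκ κt κb] := R x; exists (v x), (κ x); split=> //; exact: Vv.
Qed.

Lemma splitting_transport (F : NLax C D) (S T T' : D) (s : Transf F (constL C S)) (i : Transf F (constL C T))
    (i' : Transf (res (fun x => x <> b) F) (constL C' T')) (n : Ver (F b) T') (u : Cell n (vid S)) (θ : Hom S T) :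
  is_iso θ -> compT (constT C θ) s = i -> splitting s i' u -> splitting i i' (idc θ ⊙ u).
Proof.
move=> /iso_inverse [θ' [_ h1 h2]] <- Sp; split.
- move=> Y φ; have [h hh] := glue_ex φ (sp_glue Sp).
  exists (h ∘ θ'); split; first by rewrite ccomp_assoc -idc_comp -comp_assoc h1 comp_idr.
  move=> k hk; have -> : h = k ∘ θ.
    by apply: (glue_uq (sp_glue Sp)); rewrite hh idc_comp -ccomp_assoc.
  by rewrite -comp_assoc h2 comp_idr.
- exact: sp_univ Sp.
- by rewrite tbE /= (sp_b Sp) tbE.
- by move=> x; rewrite tbE /= (sp_s Sp) comp_assoc tbE.
- by move=> x y β; rewrite ccell_const (sp_cell Sp) ccomp_assoc -idc_comp tbE tbE.
- move=> x β; have [κ [Cκ t t' e]] := sp_hom Sp β; exists κ; split=> //.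
  by rewrite ccell_const -e ccomp_assoc.
- exact: sp_void Sp.
Qed.

(** [p] is induced by a cell [c] between the two collages, so its squares over their legs are
    pullbacks. Pasting with the inductive squares for [p'] gives the legs away from [b]. *)
Lemma splitting_squares (F G : NLax C D) (T T' S S' : D) (i : Transf F (constL C T)) (k : Transf G (constL C S))
    (i' : Transf (res (fun x => x <> b) F) (constL C' T')) (k' : Transf (res (fun x => x <> b) G) (constL C' S'))
    (n : Ver (F b) T') (u : Cell n (vid T)) (m : Ver (G b) S') (w : Cell m (vid S))
    (t : Transf G F) (p : Hom S T) :
  splitting i i' u -> splitting k k' w -> compT (constT C p) k = compT i t ->
  (forall p' : Hom S' T', compT (constT C' p') k' = compT i' (res_hom b t) ->
    forall x : C', is_pullback (K := HD D) p' (i' x) (k' x) (t (proj1_sig x))) ->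
  forall c, is_pullback (K := HD D) p (i c) (k c) (t c).
Proof.
move=> Sp Sq e IH.
have el c : p ∘ k c = i c ∘ t c by have := f_equal (fun s : Transf G (constL C T) => s c) e.
have ec c c' (β : Hom c c') : idc p ⊙ ccell k β = ccell i β ⊙ tcell t β.
  by have := f_equal (fun s : Transf G (constL C T) => @ccell D C G T s _ _ β) e.
have [p' hp'] := universal_ex (compT i' (res_hom b t)) (sp_univ Sq).
have ep : p ∘ bot w = bot u ∘ p'.
  apply: (universal_uq (sp_univ Sq)); apply: (cocone_eq (thin_sub thinC)) => [x|x y β _].
    rewrite /= -!comp_assoc -(sp_s Sq) el (sp_s Sp) -comp_assoc; congr (_ ∘ _).
    exact: (esym (cocone_leg x hp')).
  rewrite !ccell_const !idc_comp -!ccomp_assoc -(sp_cell Sq) ec (sp_cell Sp) -ccomp_assoc; congr (_ ⊙ _).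
  exact: (esym (@cocone_cell D C' (res _ G) S' T' k' p' _ x y β hp')).
have [c [ct cb ce]] : exists c, [/\ top c = t b, bot c = p' & u ⊙ c = idc p ⊙ w].
  by apply: (cart_ex (gt_cart GT (sp_glue Sp))); rewrite !tbE // -(sp_b Sq) el (sp_b Sp).
have := gt_pbt GT (sp_glue Sp) (sp_glue Sq) (esym ce).
have := gt_pbb GT (sp_glue Sp) (sp_glue Sq) (esym ce).
rewrite ct cb => P2 P1 c0; case: (view_exists b c0) => -[|x].
  by rewrite (sp_b Sp) (sp_b Sq).
rewrite (sp_s Sp) (sp_s Sq); exact: (pb_paste P2 (IH p' hp' x)).
Qed.

End Existence.

Definition antisym (C : Cat) : Prop := forall x y : C, Hom x y -> Hom y x -> x = y.

(** * Induction over finite posets *)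

Section Induction.
Variables (D : FramedBicategory) (GT : glue_theory D).

(** The induction hypothesis. Existence, cells and modules serve to build the colimit at the next
    stage, [good_void] its stability; the remaining fields are what glueing over [B] is deduced
    from. *)
Record good (C : Cat) (thinC : thin C) : Prop := MkGood {
  good_ex : forall F : NLax C D, exists (T : D) (i : Transf F (constL C T)), universal i;
  good_cells : forall (F : NLax C D) (T : D) (i : Transf F (constL C T)), universal i -> cells_extend i;
  good_modules : forall (F : NLax C D) (T : D) (i : Transf F (constL C T)), universal i ->
    modules_extend thinC i;
  good_cart : forall (F : NLax C D) (T : D) (i : Transf F (constL C T)), universal i -> cells_cart i;
  good_void : forall (F : NLax C D) (T : D) (i : Transf F (constL C T)), universal i -> cells_void i;
  good_mono : forall (F : NLax C D) (T : D) (i : Transf F (constL C T)), universal i -> legs_mono i;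
  good_pullback : forall (F : NLax C D) (T : D) (i : Transf F (constL C T)), universal i -> legs_pullback i;
  good_stable : forall (F : NLax C D) (T : D) (i : Transf F (constL C T)), universal i -> stable i;
  good_squares : forall (F G : NLax C D) (T S : D) (i : Transf F (constL C T)) (k : Transf G (constL C S))
    (t : Transf G F) (p : Hom S T), universal i -> universal k -> compT (constT C p) k = compT i t ->
    forall c, is_pullback (K := HD D) p (i c) (k c) (t c) }.

(** One universal cocone comes with a splitting by construction. Splittings are transported along
    isomorphisms, so every universal cocone has one, and each field follows from its lemma on
    splittings. *)
Lemma good_step (C : Cat) (thinC : thin C) (b : C) :
  (forall x : subcat (fun x => x <> b), Hom (proj1_sig x) b -> False) ->
  good (thin_sub (Q := fun x => x <> b) thinC) -> good thinC.
Proof.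
move=> bmin G.
have ex (F : NLax C D) : exists T' (i' : Transf (res (fun x => x <> b) F) (constL _ T')) (T : D)
    (i : Transf F (constL C T)) (n : Ver (F b) T') (u : Cell n (vid T)), splitting i i' u.
  have [T' [i' U']] := good_ex G (res (fun x => x <> b) F); exists T', i'.
  exact: (splitting_exists GT bmin U' (good_modules G U')).
have sp (F : NLax C D) (T : D) (i : Transf F (constL C T)) : universal i ->
    exists T' (i' : Transf (res (fun x => x <> b) F) (constL _ T')) (n : Ver (F b) T') (u : Cell n (vid T)),
      universal i' /\ splitting i i' u.
  move=> U; have [T' [i' [S [s [n [u Sp]]]]]] := ex F.
  have Us : universal s by exact: (splitting_universal GT thinC bmin Sp (good_cells G (sp_univ Sp))).
  have [θ [θi eθ]] := universal_iso Us U.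
  by exists T', i', n, (idc θ ⊙ u); split; [exact: sp_univ Sp | exact: splitting_transport Sp].
split=> [F|F T i U|F T i U|F T i U|F T i U|F T i U|F T i U|F T i U|F H T S i k t p U Uk e].
- have [T' [i' [S [s [n [u Sp]]]]]] := ex F.
  by exists S, s; exact: (splitting_universal GT thinC bmin Sp (good_cells G (sp_univ Sp))).
all: have [T' [i' [n [u [U' Sp]]]]] := sp F T i U.
- exact: (splitting_cells GT thinC Sp (good_cells G U')).
- exact: (splitting_modules GT bmin Sp (good_cells G U') (good_modules G U')).
- exact: (splitting_cart GT thinC bmin Sp (good_cart G U')).
- exact: (splitting_cells_void GT Sp (good_void G U')).
- exact: (splitting_mono GT Sp (good_mono G U')).
- exact: (splitting_pullback GT Sp (good_pullback G U')).
- apply: (splitting_stable GT thinC bmin Sp (good_void G U') (good_stable G U')).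
  by move=> H S j; exact: (good_cells G).
- have [S' [k' [m [w [Uk' Sq]]]]] := sp H S k Uk.
  apply: (splitting_squares GT thinC Sp Sq e) => p' e'; exact: (good_squares G U' Uk' e').
Qed.

(** A colimit over the empty category is a zero object, and by strictness so is everything that maps
    to it, which gives stability. *)
Lemma good_empty (C : Cat) (thinC : thin C) : (C -> False) -> good thinC.
Proof.
move=> no; have [O Oz] := gt_zero GT.
have cz (F : NLax C D) (Y : D) : exists s : Transf F (constL C Y), True.
  have [s _] := @cocone_exists D C thinC F Y (fun c => False_rect _ (no c)) (fun c => False_rect _ (no c))
    (fun c => False_rect _ (no c)) (fun c => False_rect _ (no c)) (fun c => False_rect _ (no c)).
  by exists s.
have u (F : NLax C D) (Z : D) (s : Transf F (constL C Z)) : zero Z -> universal s.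
  move=> Zz Y s'; have [h _] := zero_hom Y Zz; exists h; split; last by move=> k _; exact: zero_uq.
  by apply: Transf_eq => c; case: (no c).
have z (F : NLax C D) (T : D) (i : Transf F (constL C T)) : universal i -> zero T.
  move=> U; have [s _] := cz F O.
  have [θ [θi _]] := universal_iso U (u F O s Oz); exact: (zero_iso Oz θi).
split=> [F|F T i /z Tz|F T i /z Tz|F T i U|F T i U|F T i U|F T i U|F T i /z Tz|F H T S i k t p _ _ _].
- by have [s _] := cz F O; exists O, s; exact: u.
- move=> A y yc κ _ Y f g ψ _ _.
  have V : void y by exact: (void_zero_bot GT).
  have [φ [h1 h2]] := void_ex f g V; exists φ; split; first by split=> // c; case: (no c).
  by move=> φ' [k1 k2 _]; apply: (void_uq V); rewrite ?h1 ?h2.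
- move=> A yc act _ _ _; have [f _] := zero_hom A Tz.
  by exists (conjoint f), (fun c => False_rect _ (no c)); split=> c; case: (no c).
- by move=> c; case: (no c).
- by move=> c; case: (no c).
- by move=> c; case: (no c).
- by move=> c; case: (no c).
- by move=> X p G t j _ _ _; apply: u; exact: (zero_of_hom GT Tz p).
- by move=> c; case: (no c).
Qed.

Lemma minimal_exists (C : Cat) (l : seq C) : antisym C -> l <> [::] ->
  exists2 b, List.In b l & forall x, List.In x l -> Hom x b -> x = b.
Proof.
move=> anti; elim: l => [//|a l IH] _.
case: (classic (l = [::])) => [->|/IH [b hb bmin]].
  by exists a; [left | move=> x [->|[]]].
case: (classic (inhabited (Hom a b))) => [[ab]|nh].
  exists a; first by left.
  move=> x [-> //|xl] xa; have xb := bmin x xl (ab ∘ xa); subst x; exact: anti.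
exists b; first by right.
by move=> x [<-|xl] xb; [case: nh | exact: bmin].
Qed.

Lemma remove_list (C : Cat) (b : C) (l : seq C) : exists l' : seq (subcat (fun x : C => x <> b)),
  [/\ forall x, List.In (proj1_sig x) l -> List.In x l', size l' <= size l
    & List.In b l -> size l' < size l].
Proof.
elim: l => [|a l [l' [h1 h2 h3]]]; first by exists [::].
case: (view_exists b a) => -[|x].
  exists l'; split=> [x [e|]| |] /=; [by case: (proj2_sig x) | exact: h1 | exact: leqW | by []].
exists (x :: l'); split=> [y [e|hy]|//|] /=.
- by left; apply: sig_eq.
- by right; exact: h1.
- by case=> [e|/h3 //]; case: (proj2_sig x).
Qed.

Lemma good_finite (k : nat) (C : Cat) (thinC : thin C) (l : seq C) :
  antisym C -> (forall x, List.In x l) -> size l <= k -> good thinC.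
Proof.
elim: k C thinC l => [|k IH] C thinC l anti full hk.
  by apply: good_empty => c; have := full c; case: l hk {full}.
case: (classic (l = [::])) => [e|/(minimal_exists anti) [b hb bmin]].
  by subst l; apply: good_empty => c; exact: full c.
have [l' [h1 h2 h3]] := remove_list b l.
apply: (good_step (b := b)).
  by move=> x xb; apply: (proj2_sig x); exact: bmin.
apply: (IH _ _ l').
- by move=> x y xy yx; apply: sig_eq; exact: anti.
- by move=> x; apply: h1.
by rewrite -ltnS; apply: leq_trans hk; exact: h3.
Qed.

End Induction.

(** * Glueing over [2] *)

Section Adjunction.
Variables (C K : TwoCat) (R : TwoFunctor C K) (L : LeftAdjoint R).

Lemma adj_transpose (F : K) (Y : C) (s : Hom F (R Y)) : fhom R (counit L Y ∘ fhom L s) ∘ unit L F = s.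
Proof.
rewrite fhom_comp -comp_assoc.
have N := nat_hom (unit L) s; rewrite /= in N.
by rewrite -N comp_assoc triangle_r comp_idl.
Qed.

Lemma adj_uq (F : K) (Y : C) (h h' : Hom (L F) Y) :
  fhom R h ∘ unit L F = fhom R h' ∘ unit L F -> h = h'.
Proof.
have E (k : Hom (L F) Y) : k = counit L Y ∘ fhom L (fhom R k ∘ unit L F).
  rewrite fhom_comp comp_assoc; have N := nat_hom (counit L) k; rewrite /= in N.
  by rewrite N -comp_assoc triangle_l comp_idr.
by move=> e; rewrite (E h) e -E.
Qed.

Lemma adj2_ex (F : K) (Y : C) (s : Two F (R Y)) :
  exists h : Two (L F) Y, hc (ftwo R h) (id2 (unit L F)) = s.
Proof.
exists (hc (id2 (counit L Y)) (ftwo L s)); rewrite ftwo_hc -hc_assoc.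
have N := nat_two (unit L) s; rewrite /= in N.
by rewrite -N hc_assoc ftwo_id2 hc_id2 triangle_r hc_idl.
Qed.

Lemma adj2_uq (F : K) (Y : C) (h h' : Two (L F) Y) :
  hc (ftwo R h) (id2 (unit L F)) = hc (ftwo R h') (id2 (unit L F)) -> h = h'.
Proof.
have E (k : Two (L F) Y) : k = hc (id2 (counit L Y)) (ftwo L (hc (ftwo R k) (id2 (unit L F)))).
  rewrite ftwo_hc hc_assoc; have N := nat_two (counit L) k; rewrite /= in N.
  by rewrite N -hc_assoc ftwo_id2 hc_id2 triangle_l hc_idr.
by move=> e; rewrite (E h) e -E.
Qed.

End Adjunction.

Section LaxColim.
Variables (B : Cat) (D : FramedBicategory) (Γ : LaxColimits B D).

Lemma colim_universal (F : NLax B D) : universal (cocone Γ F).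
Proof.
move=> Y s; exists (counit Γ Y ∘ fhom Γ s); split; first exact: (adj_transpose Γ s).
by move=> k hk; apply: (@adj_uq _ _ _ Γ F Y); exact: etrans (adj_transpose Γ s) (esym hk).
Qed.

Lemma colim_nat (F G : NLax B D) (t : Transf G F) :
  compT (constT B (fhom Γ t)) (cocone Γ G) = compT (cocone Γ F) t.
Proof. by have N := nat_hom (unit Γ) t. Qed.

Lemma colim2_uq (F : NLax B D) (Y : D) (θ θ' : Cell (vid (Γ F)) (vid Y)) :
  top θ = top θ' -> bot θ = bot θ' -> (forall b, θ ⊙ idc (cocone Γ F b) = θ' ⊙ idc (cocone Γ F b)) -> θ = θ'.
Proof.
move=> h1 h2 h; apply: (@adj2_uq _ _ _ Γ F Y θ θ'); apply: Modif_eq => //=.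
  by rewrite h1.
by rewrite h2.
Qed.

Lemma colim2_ex (F : NLax B D) (Y : D) (h h' : Hom (Γ F) Y) (θ : forall b, Cell (vid (F b)) (vid Y)) :
  (forall b, top (θ b) = h ∘ cocone Γ F b) -> (forall b, bot (θ b) = h' ∘ cocone Γ F b) ->
  (forall b b' (β : Hom b b') e1 e2, under (θ b') (idc h ⊙ ccell (cocone Γ F) β) e1
     = over (idc h' ⊙ ccell (cocone Γ F) β) (θ b) e2) ->
  exists ω : Cell (vid (Γ F)) (vid Y), [/\ top ω = h, bot ω = h' &
    forall b, ω ⊙ idc (cocone Γ F b) = θ b].
Proof.
move=> h1 h2 hn.
pose M := @MkModif B D F (constL B Y) (compT (constT B h) (cocone Γ F)) (compT (constT B h') (cocone Γ F))
  θ h1 h2 hn.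
have [ω hω] := adj2_ex Γ (M : @Two (Lax B D) F (Delta B D Y)).
exists ω; split.
- by apply: (universal_uq (colim_universal (F := F))); have := f_equal (@msrc _ _ _ _) hω.
- by apply: (universal_uq (colim_universal (F := F))); have := f_equal (@mtgt _ _ _ _) hω.
by move=> b; have := f_equal (fun m : Modif F (constL B Y) => m b) hω.
Qed.

End LaxColim.

Lemma empty_colim_zero (D : FramedBicategory) (B : Cat) (Γ : LaxColimits B D) :
  (B -> False) -> exists Z : D, zero Z.
Proof.
move=> no.
have [F _] : exists F : NLax B D, True.
  by exists (@MkNLax B D (fun b => False_rect _ (no b)) (fun b => False_rect _ (no b)) (fun b => False_rect _ (no b))
   (fun b => False_rect _ (no b)) (fun b => False_rect _ (no b)) (fun b => False_rect _ (no b))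
   (fun b => False_rect _ (no b)) (fun b => False_rect _ (no b)) (fun b => False_rect _ (no b))).
have [s [_ _]] : exists s : forall Y, Transf F (constL B Y), True /\ True.
  by exists (fun Y => @MkTransf B D F (constL B Y) (fun b => False_rect _ (no b)) (fun b => False_rect _ (no b))
   (fun b => False_rect _ (no b)) (fun b => False_rect _ (no b)) (fun b => False_rect _ (no b))
   (fun b => False_rect _ (no b))).
have te Y (t t' : Transf F (constL B Y)) : t = t' by apply: Transf_eq => b; case: (no b).
exists (Γ F) => Y; split.
  have [h _] := universal_ex (s Y) (colim_universal Γ (F := F)).
  exists h; split=> // k _; apply: (universal_uq (colim_universal Γ (F := F))); exact: te.
move=> θ θ'; apply: colim2_uq; last by move=> b; case: (no b).
  by apply: (universal_uq (colim_universal Γ (F := F))); exact: te.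
by apply: (universal_uq (colim_universal Γ (F := F))); exact: te.
Qed.

Section Isos.
Variables (D : FramedBicategory).

Lemma iso_idc (X Y : D) (f : Hom X Y) : is_iso f -> exists2 d : Cell (vid Y) (vid X), d ⊙ idc f = cid _ & idc f ⊙ d = cid _.
Proof. by move=> [g [h1 h2]]; exists (idc g); rewrite -idc_comp ?h1 ?h2 idc_id. Qed.

Lemma cart_inverse (A B A' B' : D) (m : Ver A B) (m' : Ver A' B') (c : Cell m m') (d : Cell m' m) :
  d ⊙ c = cid m -> c ⊙ d = cid m' -> cart c.
Proof.
move=> h1 h2; have t1 : top d ∘ top c = idm A by rewrite -top_ccomp h1 tbE.
have b1 : bot d ∘ bot c = idm B by rewrite -bot_ccomp h1 tbE.
split=> [Z Z' w φ a b ha hb|Z Z' w ψ ψ' _ _ e].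
  exists (d ⊙ φ); rewrite !tbE ha hb !comp_assoc t1 b1 !comp_idl; split=> //.
  by rewrite ccomp_assoc h2 ccomp_idl.
by rewrite -[LHS]ccomp_idl -[RHS]ccomp_idl -h1 -!ccomp_assoc e.
Qed.

Lemma cart_idc (X Y : D) (f : Hom X Y) : is_iso f -> cart (idc f).
Proof. by move=> /iso_idc [d h1 h2]; exact: (cart_inverse h1 h2). Qed.

Lemma pb_transport (A B C P A' C' P' : D) (p : Hom A C) (q : Hom B C) (u : Hom P A) (v : Hom P B)
    (p' : Hom A' C') (q' : Hom B C') (u' : Hom P' A') (v' : Hom P' B)
    (w : Hom C C') (a : Hom A A') (r : Hom P' P) :
  is_iso w -> is_iso a -> is_iso r ->
  p' ∘ a = w ∘ p -> q' = w ∘ q -> u' = a ∘ u ∘ r -> v' = v ∘ r ->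
  is_pullback (K := HD D) p q u v -> is_pullback (K := HD D) p' q' u' v'.
Proof.
move=> [w' [w1 w2]] [a' [a1 a2]] [r' [r1 r2]] ep -> -> -> [c H1 H2].
have ep' : w' ∘ p' = p ∘ a'.
  by rewrite -[LHS]comp_idr -a2 comp_assoc -(comp_assoc w') ep !comp_assoc w1 comp_idl.
split.
- rewrite /= in c *; rewrite !comp_assoc ep -(comp_assoc w p) c; by rewrite !comp_assoc.
- move=> Z x y e.
  have [|k [[k1 k2] ku]] := H1 Z (a' ∘ x) y.
    by rewrite /= in e *; rewrite comp_assoc -ep' -comp_assoc e !comp_assoc w1 comp_idl.
  rewrite /= in k k1 k2 ku *.
  exists (r' ∘ k); split.
    rewrite !comp_assoc -(comp_assoc _ r) r2 comp_idr -comp_assoc k1 comp_assoc a2 comp_idl.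
    by rewrite -(comp_assoc _ r) r2 comp_idr.
  move=> l [l1 l2].
  have -> : k = r ∘ l.
    apply: ku; rewrite -l1 -l2; split; last by rewrite comp_assoc.
    by rewrite !comp_assoc a1 comp_idl.
  by rewrite comp_assoc r1 comp_idl.
move=> Z x y e; rewrite /= in e *.
have [|k [[k1 k2] ku]] := H2 Z (idc a' ⊙ x) y.
  rewrite /= ccomp_assoc -idc_comp -ep' idc_comp -ccomp_assoc e.
  by rewrite ccomp_assoc -idc_comp comp_assoc w1 comp_idl.
rewrite /= in k k1 k2 ku *.
exists (idc r' ⊙ k); split.
  rewrite !idc_comp -!ccomp_assoc (ccomp_assoc (idc r)) -idc_comp r2 idc_id ccomp_idl k1.
  by rewrite ccomp_assoc -idc_comp a2 idc_id ccomp_idl.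
move=> l [l1 l2].
have -> : k = idc r ⊙ l.
  apply: ku; rewrite -l1 -l2; split; last by rewrite idc_comp ccomp_assoc.
  by rewrite !ccomp_assoc -!idc_comp !comp_assoc a1 comp_idl.
by rewrite ccomp_assoc -idc_comp r1 idc_id ccomp_idl.
Qed.

Lemma glue_unique (A B X X' : D) (m : Ver A B) (u : Cell m (vid X)) (u' : Cell m (vid X')) :
  glue u -> glue u' -> exists θ : Hom X X', is_iso θ /\ idc θ ⊙ u = u'.
Proof.
move=> U U'; have [θ hθ] := glue_ex u' U; have [θ' hθ'] := glue_ex u U'.
exists θ; split=> //; exists θ'; split.
  by apply: (glue_uq U); rewrite idc_comp -ccomp_assoc hθ hθ' idc_id ccomp_idl.
by apply: (glue_uq U'); rewrite idc_comp -ccomp_assoc hθ' hθ idc_id ccomp_idl.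
Qed.

Lemma glue_post (A B X X' : D) (m : Ver A B) (u : Cell m (vid X)) (θ : Hom X X') :
  glue u -> is_iso θ -> glue (idc θ ⊙ u).
Proof.
move=> U [θ' [h1 h2]] Y φ; have [h hh] := glue_ex φ U.
exists (h ∘ θ'); split; first by rewrite ccomp_assoc -idc_comp -comp_assoc h1 comp_idr.
move=> k hk; have -> : h = k ∘ θ by apply: (glue_uq U); rewrite hh idc_comp -ccomp_assoc.
by rewrite -comp_assoc h2 comp_idr.
Qed.

End Isos.

Section Unpack.
Variables (B : Cat) (D : FramedBicategory) (Γ : LaxColimits B D) (Γ2 : LaxColimits cat2 D) (F : NLax B D).
Hypothesis H : has_glueing_over Γ Γ2 F.

Lemma glueing_ess (X : D) (p : Hom X (Γ F)) : exists (G : NLax B D) (t : Transf G F) (k : Hom (Γ G) X),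
  [/\ is_iso k, p ∘ k = fhom Γ t & restricts_to Γ2 p t (compT (constT B k) (cocone Γ G))].
Proof.
have [Ψ HΨ] := H; have R := HΨ X p.
pose P : slice (Γ F) := existT _ X p.
exists (projT1 (Ψ P)), (projT2 (Ψ P)), (proj1_sig (pi_counit Ψ P)); split.
- have [g [g1 g2]] := pi_counit_iso Ψ P; exists (proj1_sig g); split.
    exact: (f_equal (@proj1_sig _ _) g1).
  exact: (f_equal (@proj1_sig _ _) g2).
- exact: (proj2_sig (pi_counit Ψ P)).
exact: R.
Qed.

(** The unit of the equivalence identifies [(G0, t0)] with the value of the pseudo-inverse at its
    own image, so the pullbacks and canonical cells prescribed for that value become available for a
    given transformation. *)
Lemma glueing_full (G0 : NLax B D) (t0 : Transf G0 F) :
  exists (G : NLax B D) (t : Transf G F) (k : Hom (Γ G) (Γ G0)) (η : Transf G0 G) (ζ : Transf G G0),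
  [/\ is_iso k, fhom Γ t0 ∘ k = fhom Γ t &
    restricts_to Γ2 (fhom Γ t0) t (compT (constT B k) (cocone Γ G))] /\
  [/\ compT t η = t0, compT ζ η = idT G0 & compT η ζ = idT G].
Proof.
have [Ψ HΨ] := H; have R := HΨ (Γ G0) (fhom Γ t0).
pose P : slice (Γ F) := existT _ (Γ G0) (fhom Γ t0).
pose x : slice (C := Lax B D) F := existT _ G0 t0.
have [g [g1 g2]] := pi_unit_iso Ψ x.
exists (projT1 (Ψ P)), (projT2 (Ψ P)), (proj1_sig (pi_counit Ψ P)), (proj1_sig (pi_unit Ψ x)), (proj1_sig g).
split; first split.
- have [h [h1 h2]] := pi_counit_iso Ψ P; exists (proj1_sig h); split.
    exact: (f_equal (@proj1_sig _ _) h1).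
  exact: (f_equal (@proj1_sig _ _) h2).
- exact: (proj2_sig (pi_counit Ψ P)).
- exact: R.
split; first exact: (proj2_sig (pi_unit Ψ x)).
  exact: (f_equal (@proj1_sig _ _) g1).
exact: (f_equal (@proj1_sig _ _) g2).
Qed.

End Unpack.

(** * From [2]-glueing to the properties of collages *)

Section GlueingTwo.
Variables (D : FramedBicategory) (Γ : LaxColimits cat2 D).

Lemma thin_poset (d : Order.disp_t) (P : porderType d) : thin (poset_cat P).
Proof. move=> x y f g; exact: bool_irrelevance. Qed.
Local Notation thin2 := (@thin_poset _ bool : thin cat2).

Lemma arr_false (h : @Hom cat2 true false) : False.
Proof. by []. Qed.

(** On [2] the cells at identities are forced by the legs. An arbitrary lax functor is treated
    because the pseudo-inverse does not return one of the form [arrow m]. *)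
Lemma cocone2_exists (G : NLax cat2 D) (Y : D) (φ : Cell (lver G arr2) (vid Y)) :
  exists s : Transf G (constL cat2 Y), ccell s arr2 = φ.
Proof.
pose l (b : bool) : Hom (G b) Y := match b with false => top φ | true => bot φ end.
pose Φ (b b' : bool) : forall β : @Hom cat2 b b', Cell (lver G β) (vid Y) :=
  match b, b' return forall β : @Hom cat2 b b', Cell (lver G β) (vid Y) with
  | false, false => fun β => idc (l false) ⊙ nid thin2 G β
  | true, true => fun β => idc (l true) ⊙ nid thin2 G β
  | false, true => fun β => φ ⊙ vcast (f_equal (@lver cat2 D G false true) (thin2 _ _ β arr2))
  | true, false => fun β => False_rect _ (arr_false β)
  end.
have Φt (b b' : bool) (β : @Hom cat2 b b') : top (Φ b b' β) = l b.
  by case: b b' β => [] [] β; rewrite /= ?tbE ?top_vcast ?comp_idr //; case: (arr_false β).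
have Φb (b b' : bool) (β : @Hom cat2 b b') : bot (Φ b b' β) = l b'.
  by case: b b' β => [] [] β; rewrite /= ?tbE ?bot_vcast ?comp_idr //; case: (arr_false β).
have Φi (b : bool) (β : @Hom cat2 b b) : Φ b b β = idc (l b) ⊙ nid thin2 G β by case: b β.
have [s [_ hs]] : exists s : Transf G (constL cat2 Y), (forall c, s c = l c) /\
    forall c c' (β : Hom c c'), ccell s β = Φ c c' β.
  apply: (cocone_exists (thinC := thin2)) => //.
  move=> b b' b'' β' β.
  case: (b =P b') => [e|ne].
    subst b'; rewrite Φi => e; apply: (@lcomp_nid_r D cat2 thin2 G Y b b'' (Φ b b'')) => δ; exact: Φt.
  case: (b' =P b'') => [e|ne'].
    subst b''; rewrite Φi => e; apply: (@lcomp_nid_l D cat2 thin2 G Y b b' (Φ b b')) => δ; exact: Φb.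
  by case: b b' b'' β β' ne ne' => [] [] [].
exists s; rewrite hs /=; rewrite (proof_irrelevance _ (thin2 _ _ arr2 arr2) erefl); exact: ccomp_idr.
Qed.

Lemma cocone2_eq (G : NLax cat2 D) (Y : D) (s s' : Transf G (constL cat2 Y)) :
  ccell s arr2 = ccell s' arr2 -> s = s'.
Proof.
move=> e; apply: (cocone_eq thin2).
  by case; [rewrite -(bot_ccell s arr2) e bot_ccell | rewrite -(top_ccell s arr2) e top_ccell].
by case=> [] [] β //= _; rewrite (thin2 _ _ β arr2).
Qed.

Lemma universal_glue (G : NLax cat2 D) (T : D) (i : Transf G (constL cat2 T)) :
  universal i -> glue (ccell i arr2).
Proof.
move=> U Y φ; have [s hs] := cocone2_exists φ; have [h hh] := universal_ex s U.
exists h; split; first by rewrite (cocone_cell _ hh).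
by move=> k hk; apply: (universal_uq U); rewrite hh; apply: cocone2_eq; rewrite hs ccell_const hk.
Qed.

Definition gl (A B : D) (m : Ver A B) : Cell m (vid (Γ (arrow m))) := @ccell D cat2 (arrow m) _ (cocone Γ (arrow m)) _ _ arr2.

Lemma gl_top (A B : D) (m : Ver A B) : top (gl m) = cocone Γ (arrow m) false.
Proof. exact: (@top_tcell cat2 D (arrow m) (constL cat2 (Γ (arrow m))) (cocone Γ (arrow m)) false true arr2). Qed.
Lemma gl_bot (A B : D) (m : Ver A B) : bot (gl m) = cocone Γ (arrow m) true.
Proof. exact: (@bot_tcell cat2 D (arrow m) (constL cat2 (Γ (arrow m))) (cocone Γ (arrow m)) false true arr2). Qed.

Lemma gl_glue (A B : D) (m : Ver A B) : glue (gl m).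
Proof. exact: (universal_glue (colim_universal Γ (F := arrow m))). Qed.

Lemma arrow_transf (A B A' B' : D) (m : Ver A B) (n : Ver A' B') (c : Cell n m) :
  exists t : Transf (arrow n) (arrow m), [/\ t false = top c, t true = bot c & tcell t arr2 = c].
Proof.
pose l (b : bool) : Hom (arrow_ob A' B' b) (arrow_ob A B b) := match b with false => top c | true => bot c end.
pose Φ (b b' : bool) : forall β : @Hom cat2 b b', Cell (arrow_ver n β) (arrow_ver m β) :=
  match b, b' return forall β : @Hom cat2 b b', Cell (arrow_ver n β) (arrow_ver m β) with
  | false, false => fun β => idc (top c)
  | true, true => fun β => idc (bot c)
  | false, true => fun β => c
  | true, false => fun β => False_rect _ (arr_false β)
  end.
unshelve eexists (@MkTransf cat2 D (arrow n) (arrow m) l Φ _ _ _ _) => //.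
- by case=> [] [] β //=; rewrite tbE.
- by case=> [] [] β //=; rewrite tbE.
- by case=> /=; rewrite ccomp_idl ccomp_idr.
by case=> [] [] [] β' β e //=; rewrite ?luniE ?runiE // luni_runi runiE.
Qed.

Hypothesis H : has_glueing Γ Γ.

(** Glueing is applied to the identity of [arrow m]. Its [X_β] is a pullback of an identity, so [v]
    is invertible, and the prescribed form of the cells shows [gl m] to be a [frame_cell] up to
    isomorphism. *)
Lemma gt_cart_of : forall (A B X : D) (m : Ver A B) (u : Cell m (vid X)), glue u -> cart u.
Proof.
move=> A B X m u U; have [θ [θi <-]] := glue_unique (@gl_glue _ _ m) U.
apply: cart_comp; first exact: cart_idc.
have [G [t [k [η [ζ [[_ _ [_ Rr]] [e1 e2 e3]]]]]]] := glueing_full (H (arrow m)) (idT (arrow m)).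
have [Xβ [a [v [s [s' [σ [pb [_ [_ [_ e]]]]]]]]]] := Rr false true arr2.
have f1 : tcell t arr2 ⊙ tcell η arr2 = cid m.
  by have := f_equal (fun k : Transf (arrow m) (arrow m) => tcell k arr2) e1.
have f2 : tcell η arr2 ⊙ tcell t arr2 = cid (lver G arr2).
  have -> : t = ζ.
    transitivity (compT t (compT η ζ)); first by rewrite e3; apply/esym; exact: (@comp_idr (lax_cat cat2 D)).
    transitivity (compT (compT t η) ζ); first exact: (@comp_assoc (lax_cat cat2 D) _ _ _ _ t η ζ).
    by rewrite e1; exact: (@comp_idl (lax_cat cat2 D)).
  by have := f_equal (fun k : Transf G G => tcell k arr2) e3.
rewrite -[gl m]ccomp_idr -f1 ccomp_assoc; apply: cart_comp; last exact: cart_inverse f1 f2.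
rewrite -e; apply: cart_comp; last first.
  by apply: cart_comp; [exact: cart_frame | exact: cart_iso].
apply: cart_idc.
have ei : fhom Γ (idT (arrow m)) = idm (Γ (arrow m)) by exact: (fhom_id Γ).
rewrite ei in pb.
have [|r [[r' [r1 r2]] _ hr]] := pb_mono_iso pb _ (comp_idl _).
  by move=> Z f g; rewrite !comp_idl.
have -> : v = r' by rewrite -[v]comp_idr -r2 comp_assoc hr comp_idl.
by exists r.
Qed.

Lemma gt_dec_of : forall (A B M X : D) (m : Ver A B) (u : Cell m (vid M)) (p : Hom X M), glue u ->
    exists (A' B' : D) (n : Ver A' B') (u' : Cell n (vid X)) (c : Cell n m),
      glue u' /\ idc p ⊙ u' = u ⊙ c.
Proof.
move=> A B M X m u p U; have [θ [[θ' [h1 h2]] <-]] := glue_unique (@gl_glue _ _ m) U.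
have [G [t [k [ki kt _]]]] := glueing_ess (H (arrow m)) (θ' ∘ p).
exists (G false), (G true), (lver G arr2), (idc k ⊙ ccell (cocone Γ G) arr2), (tcell t arr2); split.
  apply: glue_post => //; exact: (universal_glue (colim_universal Γ (F := G))).
have -> : p = θ ∘ (θ' ∘ p) by rewrite comp_assoc h2 comp_idl.
rewrite idc_comp -!ccomp_assoc (ccomp_assoc (idc (θ' ∘ p))) -idc_comp kt; congr (_ ⊙ _).
exact: (f_equal (fun s : Transf G (constL cat2 (Γ (arrow m))) => tcell s arr2) (colim_nat Γ t)).
Qed.

Lemma gt_pb_of : forall (A B A' B' M N : D) (m : Ver A B) (u : Cell m (vid M)) (n : Ver A' B')
      (u' : Cell n (vid N)) (c : Cell n m) (p : Hom N M), glue u -> glue u' ->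
    idc p ⊙ u' = u ⊙ c -> is_pullback (K := HD D) p (top u) (top u') (top c) /\
    is_pullback (K := HD D) p (bot u) (bot u') (bot c).
Proof.
move=> A B A' B' M N m u n u' c p U U'.
have [w [wi <-]] := glue_unique (@gl_glue _ _ m) U.
have [w' [wi' <-]] := glue_unique (@gl_glue _ _ n) U' => {U U'} e.
have [t [tt tb ta]] := arrow_transf c.
have [G [t' [k [η [ζ [[ki kt [pbs _]] [e1 e2 e3]]]]]]] := glueing_full (H (arrow m)) t.
(* An automorphism over [fhom Γ t]: it measures the difference between the cocone with vertex
   [Γ (arrow n)] supplied by glueing and the colimit cocone. *)
pose σ := k ∘ fhom Γ η.
have fc (F1 F2 F3 : NLax cat2 D) (s2 : Transf F2 F3) (s1 : Transf F1 F2) :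
    fhom Γ s2 ∘ fhom Γ s1 = fhom Γ (compT s2 s1) by exact: (esym (fhom_comp Γ s2 s1)).
have fi : is_iso (fhom Γ η).
  exists (fhom Γ ζ); rewrite !fc e2 e3; split; exact: (fhom_id Γ).
have [σ' [σi s1 s2]] := iso_inverse (is_iso_comp fi ki).
have qσ : fhom Γ t ∘ σ = fhom Γ t by rewrite /σ comp_assoc kt fc e1.
have ηb b : is_iso (η b).
  by exists (ζ b); split; [have := f_equal (fun s : Transf (arrow n) (arrow n) => s b) e2
    | have := f_equal (fun s : Transf G G => s b) e3].
have ep : p ∘ w' = w ∘ fhom Γ t.
  apply: (glue_uq (@gl_glue _ _ n)); rewrite !idc_comp -!ccomp_assoc e -ccomp_assoc; congr (_ ⊙ _).
  have := f_equal (fun s : Transf (arrow n) (constL cat2 (Γ (arrow m))) => tcell s arr2) (colim_nat Γ t).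
  by rewrite /= ta.
have key b : is_pullback (K := HD D) p (w ∘ cocone Γ (arrow m) b) (w' ∘ cocone Γ (arrow n) b) (t b).
  apply: (pb_transport (w := w) (a := w' ∘ σ') (r := η b) _ _ _ _ _ _ _ (pbs b)) => //.
  - exact: is_iso_comp.
  - rewrite comp_assoc ep -comp_assoc; congr (_ ∘ _).
    by rewrite -{1}qσ -comp_assoc s2 comp_idr.
  - have := f_equal (fun s : Transf (arrow n) (constL cat2 (Γ G)) => s b) (colim_nat Γ η) => /= hη.
    rewrite -!comp_assoc -hη (comp_assoc k) -/σ (comp_assoc σ') s1 comp_idl //.
  - by have := f_equal (fun s : Transf (arrow n) (arrow m) => s b) e1.
rewrite -tt -tb; split.
  by have := key false; rewrite !top_ccomp !top_idc !gl_top.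
by have := key true; rewrite !bot_ccomp !bot_idc !gl_bot.
Qed.

Lemma gt_two_of : forall (A B X : D) (m : Ver A B) (u : Cell m (vid X)), glue u ->
    forall (Y : D) (h h' : Hom X Y) (θA : Cell (vid A) (vid Y)) (θB : Cell (vid B) (vid Y))
      e1 e2,
    top θA = h ∘ top u -> bot θB = h' ∘ bot u ->
    under θB (idc h ⊙ u) e1 = over (idc h' ⊙ u) θA e2 ->
    exists! θ : Cell (vid X) (vid Y), [/\ top θ = h, bot θ = h',
      θ ⊙ idc (top u) = θA & θ ⊙ idc (bot u) = θB].
Proof.
move=> A B X m u U Y h h' θA θB e1 e2 ht hb e.
have [w [[w' [w1 w2]] hw]] := glue_unique (@gl_glue _ _ m) U.
have ut : top u = w ∘ cocone Γ (arrow m) false by rewrite -hw !tbE gl_top.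
have ub : bot u = w ∘ cocone Γ (arrow m) true by rewrite -hw !tbE gl_bot.
pose θ (b : bool) : Cell (vid (arrow_ob A B b)) (vid Y) := match b with false => θA | true => θB end.
have θbA : bot θA = h' ∘ top u by rewrite e2 !tbE.
have θtB : top θB = h ∘ bot u by rewrite -e1 !tbE.
have [ω [ωt ωb ωe]] : exists ω : Cell (vid (Γ (arrow m))) (vid Y), [/\ top ω = h ∘ w, bot ω = h' ∘ w &
    forall b, ω ⊙ idc (cocone Γ (arrow m) b) = θ b].
  apply: colim2_ex.
  - by case; rewrite /= -comp_assoc -?ut -?ub.
  - by case; rewrite /= -comp_assoc -?ut -?ub.
  have same Z (a : Cell (vid Z) (vid Y)) f f' e3 e4 : under a (idc f) e3 = over (idc f') a e4.
    rewrite under_over over_idc; have := under_idc (f := f') e4.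
    by rewrite under_over.
  have cA (β : @Hom cat2 false false) : @ccell D cat2 (arrow m) _ (cocone Γ (arrow m)) false false β
      = idc (cocone Γ (arrow m) false).
    rewrite (ccell_nid thin2) /nid vcast_isoE (proof_irrelevance _ (etrans _ _) erefl); exact: ccomp_idr.
  have cB (β : @Hom cat2 true true) : @ccell D cat2 (arrow m) _ (cocone Γ (arrow m)) true true β
      = idc (cocone Γ (arrow m) true).
    rewrite (ccell_nid thin2) /nid vcast_isoE (proof_irrelevance _ (etrans _ _) erefl); exact: ccomp_idr.
  case=> [] [] β f1 f2 /=.
  - move: f1 f2; rewrite cB -!idc_comp; exact: same.
  - by case: (arr_false β).
  - move: f1 f2; rewrite (thin2 _ _ β arr2) !idc_comp -!ccomp_assoc -/(gl m) hw => f1 f2.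
    by rewrite (proof_irrelevance _ f1 e1) (proof_irrelevance _ f2 e2).
  move: f1 f2; rewrite cA -!idc_comp; exact: same.
exists (ω ⊙ idc w'); split.
  split.
  - by rewrite !tbE ωt -comp_assoc w2 comp_idr.
  - by rewrite !tbE ωb -comp_assoc w2 comp_idr.
  - by rewrite -ccomp_assoc -idc_comp ut comp_assoc w1 comp_idl; exact: (ωe false).
  - by rewrite -ccomp_assoc -idc_comp ub comp_assoc w1 comp_idl; exact: (ωe true).
move=> θ' [h1 h2 h3 h4].
suff -> : ω = θ' ⊙ idc w by rewrite -ccomp_assoc -idc_comp w2 idc_id ccomp_idr.
apply: colim2_uq; rewrite ?tbE ?ωt ?ωb ?h1 ?h2 //.
by case; rewrite ωe -ccomp_assoc -idc_comp -?ut -?ub ?h3 ?h4.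
Qed.

Lemma glue_theory_of_glueing : (exists Z : D, zero Z) -> glue_theory D.
Proof.
move=> Z; split=> //.
- by move=> A B m; exists (Γ (arrow m)), (gl m); exact: gl_glue.
- exact: gt_cart_of.
- exact: gt_two_of.
- exact: gt_dec_of.
- by move=> A B A' B' M N m u n u' c p U U' e; have [] := gt_pb_of U U' e.
by move=> A B A' B' M N m u n u' c p U U' e; have [] := gt_pb_of U U' e.
Qed.

End GlueingTwo.

(** * Glueing over a finite poset *)

Section Pseudo.
Variables (C K : TwoCat) (E : TwoFunctor C K).
Variable R : forall (y : K) (x : C), Hom (E x) y -> Prop.
Hypothesis ess : forall y : K, exists (x : C) (e : Hom (E x) y), is_iso e /\ R e.
Hypothesis full : forall (x y : C) (f : Hom (E x) (E y)), exists g : Hom x y, fhom E g = f.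
Hypothesis faithful : forall (x y : C) (g g' : Hom x y), fhom E g = fhom E g' -> g = g'.
Hypothesis full2 : forall (x y : C) (f : Two (E x) (E y)), exists g : Two x y, ftwo E g = f.
Hypothesis faithful2 : forall (x y : C) (g g' : Two x y), ftwo E g = ftwo E g' -> g = g'.

(** Strict functoriality of the inverse follows from faithfulness on morphisms and 2-cells. [R] is a
    condition on the chosen isomorphisms, which become the counit; it allows [restricts_to] to be
    imposed on the result. *)
Lemma pseudo_inverse_exists : exists Ψ : PseudoInverse E, forall y, R (pi_counit Ψ y).
Proof.
have [G hG] : exists G : forall y : K, {x : C & Hom (E x) y}, forall y, is_iso (projT2 (G y)) /\ R (projT2 (G y)).
  apply: (dependent_choice (T := fun y : K => {x : C & Hom (E x) y})
    (R := fun y s => is_iso (projT2 s) /\ R (projT2 s))) => y.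
  by have [x [e h]] := ess y; exists (existT _ x e).
pose g y := projT1 (G y); pose ε y : Hom (E (g y)) y := projT2 (G y).
have [ν hν] : exists ν : forall y, Hom y (E (g y)), forall y, ν y ∘ ε y = idm _ /\ ε y ∘ ν y = idm _.
  apply: (dependent_choice (T := fun y : K => Hom y (E (g y)))
    (R := fun y s => s ∘ ε y = idm _ /\ ε y ∘ s = idm _)) => y.
  by have [[k hk] _] := hG y; exists k.
have νε y : ν y ∘ ε y = idm _ by case: (hν y).
have εν y : ε y ∘ ν y = idm _ by case: (hν y).
have [gh hgh] : exists gh : forall y z, Hom y z -> Hom (g y) (g z),
    forall y z f, fhom E (gh y z f) = ν z ∘ f ∘ ε y.
  have [gh hgh] := dependent_choice (fun s : {y : K & {z : K & Hom y z}} =>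
     full (ν (projT1 (projT2 s)) ∘ projT2 (projT2 s) ∘ ε (projT1 s))).
  by exists (fun y z f => gh (existT _ y (existT _ z f))) => y z f; exact: (hgh (existT _ y (existT _ z f))).
have [gt hgt] : exists gt : forall y z, Two y z -> Two (g y) (g z),
    forall y z f, ftwo E (gt y z f) = hc (hc (id2 (ν z)) f) (id2 (ε y)).
  have [gt hgt] := dependent_choice (fun s : {y : K & {z : K & Two y z}} =>
     full2 (hc (hc (id2 (ν (projT1 (projT2 s)))) (projT2 (projT2 s))) (id2 (ε (projT1 s))))).
  by exists (fun y z f => gt (existT _ y (existT _ z f))) => y z f; exact: (hgt (existT _ y (existT _ z f))).
have f1 y : gh y y (idm y) = idm (g y).
  by apply: faithful; rewrite hgh fhom_id comp_idr νε.
have f2 x y z (f' : Hom y z) (f : Hom x y) : gh x z (f' ∘ f) = gh y z f' ∘ gh x y f.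
  apply: faithful; rewrite fhom_comp !hgh.
  by rewrite -!comp_assoc (comp_assoc (ε y)) εν comp_idl.
have f3 y z (a : Two y z) : dom2 (gt y z a) = gh y z (dom2 a).
  by apply: faithful; rewrite -dom2_ftwo hgt !dom2_hc !dom2_id2 hgh.
have f4 y z (a : Two y z) : cod2 (gt y z a) = gh y z (cod2 a).
  by apply: faithful; rewrite -cod2_ftwo hgt !cod2_hc !cod2_id2 hgh.
have f5 y z (f : Hom y z) : gt y z (id2 f) = id2 (gh y z f).
  by apply: faithful2; rewrite ftwo_id2 hgt hgh !hc_id2.
have f6 y z (b a : Two y z) e e' : gt y z (vc b a e) = vc (gt y z b) (gt y z a) e'.
  apply: faithful2.
  have e1 : cod2 (ftwo E (gt y z a)) = dom2 (ftwo E (gt y z b)) by rewrite cod2_ftwo dom2_ftwo e'.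
  rewrite (ftwo_vc e' e1) hgt.
  have e2 : cod2 (hc (id2 (ν z)) a) = dom2 (hc (id2 (ν z)) b) by rewrite cod2_hc dom2_hc cod2_id2 dom2_id2 e.
  have e3 : cod2 (id2 (ν z)) = dom2 (id2 (ν z)) by rewrite cod2_id2 dom2_id2.
  have e4 : cod2 (id2 (ε y)) = dom2 (id2 (ε y)) by rewrite cod2_id2 dom2_id2.
  have i1 (x x' : K) (f : Hom x x') h : vc (id2 f) (id2 f) h = id2 f.
    have h' : cod2 (id2 f) = dom2 (id2 (cod2 (id2 f))) by rewrite !cod2_id2 dom2_id2.
    rewrite -[RHS](vc_idl h'); apply: vc_congr => //; by rewrite cod2_id2.
  have e5 : cod2 (hc (hc (id2 (ν z)) a) (id2 (ε y))) = dom2 (hc (hc (id2 (ν z)) b) (id2 (ε y))).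
    by rewrite -!hgt.
  transitivity (vc (hc (hc (id2 (ν z)) b) (id2 (ε y))) (hc (hc (id2 (ν z)) a) (id2 (ε y))) e5).
    rewrite -(hc_vc e2 e4 e5) i1; congr (hc _ _).
    by rewrite -(hc_vc e3 e e2) i1.
  by apply: vc_congr; rewrite hgt.
have f7 x y z (b : Two y z) (a : Two x y) : gt x z (hc b a) = hc (gt y z b) (gt x y a).
  apply: faithful2; rewrite ftwo_hc !hgt.
  by rewrite -!hc_assoc (hc_assoc K (id2 (ε y)) (id2 (ν y))) hc_id2 εν hc_idl.
pose Φ := @MkTwoFunctor K C g gh gt f1 f2 f3 f4 f5 f6 f7.
have [η hη] := dependent_choice (fun x : C => full (ν (E x))).
have u1 x y (f : Hom x y) : η y ∘ fhom (idF C) f = fhom (compF Φ E) f ∘ η x.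
  apply: faithful; rewrite /= !fhom_comp !hη hgh.
  by rewrite -!comp_assoc εν comp_idr.
have u2 x y (a : Two x y) : hc (id2 (η y)) (ftwo (idF C) a) = hc (ftwo (compF Φ E) a) (id2 (η x)).
  apply: faithful2; rewrite /= !ftwo_hc !ftwo_id2 !hη hgt.
  by rewrite -!hc_assoc hc_id2 εν hc_idr.
have c1 x y (f : Hom x y) : ε y ∘ fhom (compF E Φ) f = fhom (idF K) f ∘ ε x.
  by rewrite /= hgh !comp_assoc εν comp_idl.
have c2 x y (a : Two x y) : hc (id2 (ε y)) (ftwo (compF E Φ) a) = hc (ftwo (idF K) a) (id2 (ε x)).
  by rewrite /= hgt !hc_assoc hc_id2 εν hc_idl.
have i1 x : is_iso (η x).
  have [κ hκ] := full (ε (E x)); exists κ; split; apply: faithful; rewrite fhom_comp hκ hη fhom_id //.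
have i2 y : is_iso (ε y) by case: (hG y).
exists (@MkPseudoInverse C K E Φ (@MkTwoNat C C (idF C) (compF Φ E) η u1 u2)
  (@MkTwoNat K K (compF E Φ) (idF K) ε c1 c2) i1 i2) => y /=.
by case: (hG y).
Qed.

End Pseudo.

Lemma pb_of_hom (D : FramedBicategory) (GT : glue_theory D) (A B C P : D) (p : Hom A C) (q : Hom B C)
    (u : Hom P A) (v : Hom P B) : p ∘ u = q ∘ v ->
  (forall (Z : D) (a : Hom Z A) (b : Hom Z B), p ∘ a = q ∘ b ->
    exists w : Hom Z P, u ∘ w = a /\ v ∘ w = b) ->
  (forall (Z : D) (w w' : Hom Z P), u ∘ w = u ∘ w' -> v ∘ w = v ∘ w' -> w = w') ->
  is_pullback (K := HD D) p q u v.
Proof.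
move=> c ex uq; split=> //.
  move=> Z a b e; have [w [h1 h2]] := ex Z a b e; exists w; split=> // w' [k1 k2].
  by apply: uq; rewrite ?h1 ?h2 ?k1 ?k2.
move=> Z a b e; rewrite /= in e *; have [I [uI UI]] := gt_glue GT (vid Z).
have [a' ha] := glue_ex a UI; have [b' hb] := glue_ex b UI.
have [|w [h1 h2]] := ex I a' b'.
  by apply: (glue_uq UI); rewrite !idc_comp -!ccomp_assoc ha hb.
exists (idc w ⊙ uI); split; first by rewrite !ccomp_assoc -!idc_comp h1 h2 ha hb.
move=> w2 [k1 k2]; have [w' hw'] := glue_ex w2 UI; rewrite -hw'; congr (idc _ ⊙ _).
apply: uq; apply: (glue_uq UI); rewrite !idc_comp -!ccomp_assoc hw' ?k1 ?k2.
  by rewrite ccomp_assoc -idc_comp h1.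
by rewrite ccomp_assoc -idc_comp h2.
Qed.

Lemma vcast_cid (D : DoubleBase) (A B : D) (m : Ver A B) (e : m = m) : vcast e = cid m.
Proof. by rewrite (proof_irrelevance _ e erefl). Qed.

(** * Lax functors on full families of objects *)

Section Restrict.
Variables (D : FramedBicategory) (GT : glue_theory D).

(** A cell is a map out of the collage [W]; its lift is the map to the pullback induced by it and by
    the lift of its image in [T] to [I]. *)
Lemma pb_full (X T I P : D) (p : Hom X T) (i : Hom I T) (j : Hom P X) (q : Hom P I) :
  is_pullback (K := HD D) p i j q -> cart (idc i) -> mono i -> cart (idc j).
Proof.
move=> pb Ci Mi.
have comm : p ∘ j = i ∘ q by exact: pb_comm pb.
have Mj : mono j.
  move=> Z a b e; apply: (pb_uniq pb) => //; apply: Mi.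
  by rewrite !comp_assoc -comm -!comp_assoc e.
split=> [Z Z' w φ a b|Z Z' w ψ ψ' _ _ e].
  rewrite !tbE => φt φb; have [W [u U]] := gt_glue GT w.
  have [h hh] := glue_ex φ U.
  have [ψ0 [_ _ ψe]] : exists ψ, [/\ top ψ = q ∘ a, bot ψ = q ∘ b & idc i ⊙ ψ = idc p ⊙ φ].
    by apply: (cart_ex Ci); rewrite !tbE ?φt ?φb !comp_assoc comm.
  have [h0 hh0] := glue_ex ψ0 U.
  have [|h1 [k1 k2]] := pb_lift pb (a := h) (b := h0).
    by apply: (glue_uq U); rewrite !idc_comp -!ccomp_assoc hh hh0 ψe.
  exists (idc h1 ⊙ u); split; last by rewrite ccomp_assoc -idc_comp k1 hh.
    by apply: Mj; rewrite !tbE comp_assoc k1 (idc_top hh) φt.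
  by apply: Mj; rewrite !tbE comp_assoc k1 (idc_bot hh) φb.
have [W [u U]] := gt_glue GT w.
have [h hh] := glue_ex ψ U; have [h' hh'] := glue_ex ψ' U.
rewrite -hh -hh'; congr (idc _ ⊙ _); apply: Mj; apply: (glue_uq U).
by rewrite !idc_comp -!ccomp_assoc hh hh' e.
Qed.

(** A normal lax functor sends identities to vertical identities on the nose, so restrictions of
    [vid X] cannot be chosen freely: on the diagonal the identity is taken, which is such a
    restriction by fullness. *)
Lemma full_family (B : Cat) (X : D) (P : B -> D) (j : forall c, Hom (P c) X) :
  (forall c, cart (idc (j c))) ->
  exists (m : forall c c', Ver (P c) (P c')) (γ : forall c c', Cell (m c c') (vid X)),
  [/\ forall c c', cart (γ c c'), forall c c', top (γ c c') = j c, forall c c', bot (γ c c') = j c' &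
    exists e : forall c, m c c = vid (P c), forall c, γ c c = idc (j c) ⊙ vcast (e c)].
Proof.
move=> Cj; pose S c c' := {m : Ver (P c) (P c') & Cell m (vid X)}.
have [s hs] : exists s : forall c c', S c c', forall c c',
    [/\ cart (projT2 (s c c')), top (projT2 (s c c')) = j c, bot (projT2 (s c c')) = j c' &
      forall e : c = c', s c c' = eq_rect c (S c) (existT _ (vid (P c)) (idc (j c))) c' e].
  apply: (dependent_choice (T := fun c => forall c', S c c') (R := fun c s => forall c',
     [/\ cart (projT2 (s c')), top (projT2 (s c')) = j c, bot (projT2 (s c')) = j c' &
      forall e : c = c', s c' = eq_rect c (S c) (existT _ (vid (P c)) (idc (j c))) c' e])) => c.
  apply: (dependent_choice (T := S c) (R := fun c' s =>
     [/\ cart (projT2 s), top (projT2 s) = j c, bot (projT2 s) = j c' &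
      forall e : c = c', s = eq_rect c (S c) (existT _ (vid (P c)) (idc (j c))) c' e])) => c'.
  case: (classic (c = c')) => [e|ne].
    subst c'; exists (existT _ (vid (P c)) (idc (j c))); rewrite /= !tbE; split=> // e.
    by rewrite (proof_irrelevance _ e erefl).
  have [m [γ [C t b]]] := restriction_exists (vid X) (j c) (j c').
  by exists (existT _ m γ); split=> // e; case: ne.
exists (fun c c' => projT1 (s c c')), (fun c c' => projT2 (s c c')).
split; try by move=> c c'; case: (hs c c').
have E c : s c c = existT _ (vid (P c)) (idc (j c)) by case: (hs c c) => _ _ _ /(_ erefl).
exists (fun c => f_equal (@projT1 _ _) (E c)) => c.
have gen (x y : S c c) (e : x = y) : projT2 x = projT2 y ⊙ vcast (f_equal (@projT1 _ _) e).
  by subst; rewrite ccomp_idr.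
exact: (gen _ _ (E c)).
Qed.

(** All comparison cells are induced by composition in [X], and coherence is checked after the
    cartesian cells [γ]. The equality of pairs records that [G] has the objects [P] with the legs
    [j]. *)
Lemma full_lax (B : Cat) (X : D) (P : B -> D) (j : forall c, Hom (P c) X) :
  (forall c, cart (idc (j c))) ->
  exists (G : NLax B D) (h : forall c, Hom (G c) X) (i : Transf G (constL B X)),
    [/\ existT (fun P : B -> D => forall c, Hom (P c) X) P j = existT _ (lob G) h,
      forall c, i c = h c & cells_cart i].
Proof.
move=> Cj; have [m [γ [Cγ γt γb [e0 γ0]]]] := full_family Cj.
have fγ c c' c'' : bot (γ c c') = top (γ c' c'') by rewrite γt γb.
have [κ hκ] : exists κ : forall c c' c'', Cell (m c' c'' • m c c') (m c c''), forall c c' c'',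
    [/\ top (κ c c' c'') = idm _, bot (κ c c' c'') = idm _ &
     γ c c'' ⊙ κ c c' c'' = lact (γ c' c'') (γ c c') (fγ c c' c'')].
  have [κ hκ] := dependent_choice (I := B * B * B)
    (T := fun x => Cell (m x.1.2 x.2 • m x.1.1 x.1.2) (m x.1.1 x.2))
    (R := fun x κ => [/\ top κ = idm _, bot κ = idm _ &
     γ x.1.1 x.2 ⊙ κ = lact (γ x.1.2 x.2) (γ x.1.1 x.1.2) (fγ x.1.1 x.1.2 x.2)])
    (fun x => cart_ex (Cγ x.1.1 x.2)
       (etrans (top_lact _) (etrans (γt _ _) (etrans (esym (comp_idr _)) (f_equal (fun h => h ∘ idm _) (esym (γt _ _))))))
       (etrans (bot_lact _) (etrans (γb _ _) (etrans (esym (comp_idr _)) (f_equal (fun h => h ∘ idm _) (esym (γb _ _))))))).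
  by exists (fun c c' c'' => κ (c, c', c'')) => c c' c''; exact: (hκ (c, c', c'')).
have κt c c' c'' : top (κ c c' c'') = idm _ by case: (hκ c c' c'').
have κb c c' c'' : bot (κ c c' c'') = idm _ by case: (hκ c c' c'').
have κe c c' c'' e : γ c c'' ⊙ κ c c' c'' = lact (γ c' c'') (γ c c') e.
  by case: (hκ c c' c'') => _ _ ->; apply: lact_eq.
have L1 b b' (β : Hom b b') e : vcast (f_equal (fun _ : Hom b b' => m b b') (comp_idl β)) ⊙ κ b b' b'
    = luni (m b b') ⊙ vcc (vcast (e0 b')) (cid (m b b')) e.
  rewrite vcast_cid ccomp_idl.
  apply: (cart_uq (Cγ b b')).
  - by rewrite !tbE κt.
  - by rewrite !tbE κb bot_vcast.
  have f : bot (γ b b') = top (idc (j b')) by rewrite tbE.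
  rewrite κe // ccomp_assoc -(luniE f) -ccomp_assoc /lact; congr (_ ⊙ _).
  by apply/esym/vccR; rewrite ?γ0 ?ccomp_idr.
have L2 b b' (β : Hom b b') e : vcast (f_equal (fun _ : Hom b b' => m b b') (comp_idr β)) ⊙ κ b b b'
    = runi (m b b') ⊙ vcc (cid (m b b')) (vcast (e0 b)) e.
  rewrite vcast_cid ccomp_idl.
  apply: (cart_uq (Cγ b b')).
  - by rewrite !tbE κt top_vcast.
  - by rewrite !tbE κb.
  have f : bot (idc (j b)) = top (γ b b') by rewrite tbE.
  rewrite κe // lact_ract ccomp_assoc -(runiE f) -ccomp_assoc /ract; congr (_ ⊙ _).
  by apply/esym/vccR; rewrite ?γ0 ?ccomp_idr.
have L3 b b' b'' b3 (β'' : Hom b'' b3) (β' : Hom b' b'') (β : Hom b b') e1 e2 :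
    vcast (f_equal (fun _ : Hom b b3 => m b b3) (comp_assoc β'' β' β)) ⊙ κ b b'' b3
      ⊙ vcc (cid (m b'' b3)) (κ b b' b'') e1 ⊙ assoc (m b'' b3) (m b' b'') (m b b')
    = κ b b' b3 ⊙ vcc (κ b' b'' b3) (cid (m b b')) e2.
  rewrite vcast_cid ccomp_idl.
  apply: (cart_uq (Cγ b b3)).
  - by rewrite !tbE !κt ?tbE.
  - by rewrite !tbE !κb ?tbE.
  have f1 : bot (γ b b'' ⊙ κ b b' b'') = top (γ b'' b3 ⊙ cid _) by rewrite !tbE κb γb γt comp_idr.
  rewrite !ccomp_assoc (κe _ _ _ (fγ _ _ _)) (lact_comp _ _ f1).
  have f2 : bot (γ b b' ⊙ cid _) = top (γ b' b3 ⊙ κ b' b'' b3) by rewrite !tbE κt γb γt comp_idr.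
  rewrite (κe _ _ _ (fγ b b' b3)) (lact_comp _ _ f2).
  have f3 : bot (lact (γ b' b'') (γ b b') (fγ _ _ _)) = top (γ b'' b3) by rewrite bot_lact.
  have f4 : bot (γ b b') = top (lact (γ b'' b3) (γ b' b'') (fγ _ _ _)) by rewrite top_lact.
  transitivity (lact (γ b'' b3) (lact (γ b' b'') (γ b b') (fγ _ _ _)) f3 ⊙ assoc (m b'' b3) (m b' b'') (m b b')).
    by congr (_ ⊙ _); apply: lact_eq; rewrite ?ccomp_idr -?κe.
  by rewrite (lact_lact f3 f4); apply: lact_eq; rewrite ?ccomp_idr // -κe.
pose G := @MkNLax B D P (fun c c' _ => m c c') e0 (fun c c' c'' _ _ => κ c c' c'') (fun c c' c'' _ _ => κt c c' c'')
   (fun c c' c'' _ _ => κb c c' c'') L1 L2 L3.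
have t1 b b' (β : Hom b b') : top (γ b b') = j b by [].
have t2 b b' (β : Hom b b') : bot (γ b b') = j b' by [].
have t3 b : vcast (lver_id (constL B X) b) ⊙ γ b b = idc (j b) ⊙ vcast (lver_id G b) by rewrite /= ccomp_idl γ0.
have t4 b b' b'' (β' : Hom b' b'') (β : Hom b b') e : γ b b'' ⊙ lcomp G β' β
    = lcomp (constL B X) β' β ⊙ vcc (γ b' b'') (γ b b') e by exact: κe.
exists G, j, (@MkTransf B D G (constL B X) j (fun b b' _ => γ b b') t1 t2 t3 t4); split=> //.
Qed.

End Restrict.

(** * Full faithfulness and essential surjectivity of [Γ/F] *)

Section PosetGlueing.
Variables (D : FramedBicategory) (GT : glue_theory D).
Variables (B : Cat) (thinB : thin B) (g : good D thinB).

Lemma cells_cart_leg (F : NLax B D) (T : D) (i : Transf F (constL B T)) c : cells_cart i -> cart (idc (i c)).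
Proof.
move=> /(_ c c (idm c)); rewrite (ccell_nid thinB) => K.
rewrite -[idc (i c)]ccomp_idr -(iso_VK (nid thinB F (idm c))) ccomp_assoc.
by apply: cart_comp K _; exact: (cart_iso (iso_sym (nid thinB F (idm c)))).
Qed.

Lemma transf_lift (F G : NLax B D) (T : D) (i : Transf F (constL B T)) (j : Transf G (constL B T))
    (τ : forall c, Hom (G c) (F c)) :
  cells_cart i -> (forall c, i c ∘ τ c = j c) ->
  exists t : Transf G F, (forall c, t c = τ c) /\ compT i t = j.
Proof.
move=> Ci el.
have [φ hφ] : exists φ : forall c c' (β : Hom c c'), Cell (lver G β) (lver F β), forall c c' (β : Hom c c'),
    [/\ top (φ c c' β) = τ c, bot (φ c c' β) = τ c' & ccell i β ⊙ φ c c' β = ccell j β].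
  apply: (dependent_choice (T := fun c => forall c' (β : Hom c c'), Cell (lver G β) (lver F β)) (R := fun c φ =>
    forall c' (β : Hom c c'), [/\ top (φ c' β) = τ c, bot (φ c' β) = τ c' & ccell i β ⊙ φ c' β = ccell j β])) => c.
  apply: (dependent_choice (T := fun c' => forall (β : Hom c c'), Cell (lver G β) (lver F β)) (R := fun c' φ =>
    forall (β : Hom c c'), [/\ top (φ β) = τ c, bot (φ β) = τ c' & ccell i β ⊙ φ β = ccell j β])) => c'.
  apply: (dependent_choice (T := fun (β : Hom c c') => Cell (lver G β) (lver F β)) (R := fun β φ =>
    [/\ top φ = τ c, bot φ = τ c' & ccell i β ⊙ φ = ccell j β])) => β.
  by apply: (cart_ex (Ci _ _ β)); rewrite ?top_ccell ?bot_ccell.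
have φt c c' (β : Hom c c') : top (φ c c' β) = τ c by case: (hφ _ _ β).
have φb c c' (β : Hom c c') : bot (φ c c' β) = τ c' by case: (hφ _ _ β).
have φe c c' (β : Hom c c') : ccell i β ⊙ φ c c' β = ccell j β by case: (hφ _ _ β).
have φ1 b : vcast (lver_id F b) ⊙ φ b b (idm b) = idc (τ b) ⊙ vcast (lver_id G b).
  apply: (cart_uq (cells_cart_leg b Ci)).
  - by rewrite !tbE φt !top_vcast ?comp_idr ?comp_idl.
  - by rewrite !tbE φb !bot_vcast ?comp_idr ?comp_idl.
  have h1 := tcell_id i b; have h2 := tcell_id j b; rewrite /= !ccomp_idl in h1 h2.
  rewrite !ccomp_assoc -h1 -idc_comp el -h2; exact: φe.
have φ2 b b' b'' (β' : Hom b' b'') (β : Hom b b') e :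
    φ b b'' (β' ∘ β) ⊙ lcomp G β' β = lcomp F β' β ⊙ vcc (φ b' b'' β') (φ b b' β) e.
  apply: (cart_uq (Ci _ _ (β' ∘ β))).
  - by rewrite !tbE !φt !top_lcomp comp_idl comp_idr.
  - by rewrite !tbE !φb !bot_lcomp comp_idl comp_idr.
  have f1 : bot (ccell i β) = top (ccell i β') by rewrite top_ccell bot_ccell.
  have f2 : bot (ccell j β) = top (ccell j β') by rewrite top_ccell bot_ccell.
  rewrite !ccomp_assoc φe (ccell_comp f1) (ccell_comp f2).
  have f4 : bot (ccell i β ⊙ φ b b' β) = top (ccell i β' ⊙ φ b' b'' β') by rewrite !φe.
  by rewrite (lact_comp _ _ f4); apply: lact_eq; rewrite φe.
exists (@MkTransf B D G F τ φ φt φb φ1 φ2); split=> //.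
by apply: Transf_eq => [c|c c' β]; [exact: el | exact: φe].
Qed.

(** The pullbacks of the legs are full in [X], so they carry a lax functor with cartesian cells. The
    projections lift to a transformation because the cells of [i] are cartesian, and stability makes
    the new cocone universal. *)
Lemma restriction_lax (F : NLax B D) (T X : D) (i : Transf F (constL B T)) (p : Hom X T) :
  universal i -> exists (G : NLax B D) (t : Transf G F) (j : Transf G (constL B X)),
    [/\ universal j, compT (constT B p) j = compT i t, cells_cart j &
      forall c, is_pullback (K := HD D) p (i c) (j c) (t c)].
Proof.
move=> U.
have Ci := good_cart g U; have Mi := good_mono g U.
have [P hP] := dependent_choice (fun c => good_pullback g U c p).
have [u hu] := dependent_choice (T := fun c => Hom (P c) X) (R := fun c u => exists v, is_pullback (K := HD D) p (i c) u v) hP.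
have [v hv] := dependent_choice hu.
have [G [h [j [E hj Cj]]]] := full_lax (fun c => pb_full GT (hv c) (cells_cart_leg c Ci) (Mi c)).
have [τ hτ] : exists τ : forall c, Hom (G c) (F c), forall c, is_pullback (K := HD D) p (i c) (j c) (τ c).
  have [τ hτ] : exists τ : forall c, Hom (G c) (F c), forall c, is_pullback (K := HD D) p (i c) (h c) (τ c).
    have gen (x y : {P : B -> D & forall c, Hom (P c) X}) (e : x = y) : (exists v : forall c, Hom (projT1 x c) (F c),
        forall c, is_pullback (K := HD D) p (i c) (projT2 x c) (v c)) ->
      exists v : forall c, Hom (projT1 y c) (F c), forall c, is_pullback (K := HD D) p (i c) (projT2 y c) (v c).
      by subst.
    by apply: (gen _ _ E); exists v.
  by exists τ => c; rewrite hj.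
have [t [ht et]] := transf_lift (i := i) (j := compT (constT B p) j) (τ := τ) Ci
  (fun c => esym (pb_comm (hτ c))).
have pbs c : is_pullback (K := HD D) p (i c) (j c) (t c) by rewrite ht.
by exists G, t, j; split=> //; exact: (good_stable g U (esym et)).
Qed.

Variables (Γ : LaxColimits B D) (F : NLax B D).
Let U (G : NLax B D) : universal (cocone Γ G) := colim_universal Γ (F := G).

Lemma colim_square (G : NLax B D) (t : Transf G F) (c : B) :
  is_pullback (K := HD D) (fhom Γ t) (cocone Γ F c) (cocone Γ G c) (t c).
Proof. exact: (good_squares g (@U F) (@U G) (colim_nat Γ t)). Qed.

Lemma colim_cell (G H : NLax B D) (s : Transf G H) c c' (β : Hom c c') :
  idc (fhom Γ s) ⊙ ccell (cocone Γ G) β = ccell (cocone Γ H) β ⊙ tcell s β.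
Proof. exact: (f_equal (fun x : Transf G (constL B (Γ H)) => @ccell D B G _ x _ _ β) (colim_nat Γ s)). Qed.

Lemma colim_leg (G H : NLax B D) (s : Transf G H) c : fhom Γ s ∘ cocone Γ G c = cocone Γ H c ∘ s c.
Proof. exact: (f_equal (fun x : Transf G (constL B (Γ H)) => x c) (colim_nat Γ s)). Qed.

Lemma colim_faithful (G H : NLax B D) (s s' : Transf G H) : fhom Γ s = fhom Γ s' -> s = s'.
Proof.
move=> e; have el c : s c = s' c.
  by apply: (good_mono g (@U H) (c := c)); rewrite -!colim_leg e.
apply: Transf_eq => // c c' β; apply: (cart_uq (good_cart g (@U H) β)).
- by rewrite !top_tcell.
- by rewrite !bot_tcell.
by rewrite -!colim_cell e.
Qed.

(** The components of [s] come from the pullback squares of [fhom Γ t'] over the legs, and its cells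
    from the cartesian cells of the cocone on [H]. *)
Lemma colim_full (G H : NLax B D) (t : Transf G F) (t' : Transf H F) (h : Hom (Γ G) (Γ H)) :
  fhom Γ t' ∘ h = fhom Γ t -> exists s : Transf G H, compT t' s = t /\ fhom Γ s = h.
Proof.
move=> e.
have [σ hσ] : exists σ : forall c, Hom (G c) (H c), forall c,
    cocone Γ H c ∘ σ c = h ∘ cocone Γ G c /\ t' c ∘ σ c = t c.
  apply: (dependent_choice (T := fun c => Hom (G c) (H c)) (R := fun c σ =>
    cocone Γ H c ∘ σ = h ∘ cocone Γ G c /\ t' c ∘ σ = t c)) => c.
  by apply: (pb_lift (colim_square t' c)); rewrite comp_assoc e colim_leg.
have [s [hs es]] := transf_lift (i := cocone Γ H) (j := compT (constT B h) (cocone Γ G)) (τ := σ)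
  (good_cart g (@U H)) (fun c => proj1 (hσ c)).
have eh : fhom Γ s = h by apply: (universal_uq (@U G)); rewrite colim_nat.
exists s; split=> //; apply: colim_faithful.
by rewrite (fhom_comp Γ t' s) eh.
Qed.

Lemma modif_faithful (G H : NLax B D) (a a' : Modif G H) : ftwo Γ a = ftwo Γ a' -> a = a'.
Proof.
move=> e; have ec b : idc (cocone Γ H b) ⊙ a b = idc (cocone Γ H b) ⊙ a' b.
  have n1 := f_equal (fun x : Modif G (constL B (Γ H)) => x b) (nat_two (unit Γ) a).
  have n2 := f_equal (fun x : Modif G (constL B (Γ H)) => x b) (nat_two (unit Γ) a').
  apply: (etrans n1); apply: etrans (esym n2).
  exact: (f_equal (fun x : Cell (vid (Γ G)) (vid (Γ H)) => x ⊙ idc (cocone Γ G b)) e).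
have es : msrc a = msrc a'.
  by apply: colim_faithful; rewrite -!(dom2_ftwo Γ) e.
have et : mtgt a = mtgt a'.
  by apply: colim_faithful; rewrite -!(cod2_ftwo Γ) e.
apply: Modif_eq => // b; apply: (cart_uq (cells_cart_leg b (good_cart g (@U H)))) => //.
- by rewrite !top_mcell es.
- by rewrite !bot_mcell et.
Qed.

Lemma modif_full (G H : NLax B D) (t : Transf G F) (t' : Transf H F) (ω : Cell (vid (Γ G)) (vid (Γ H))) :
  idc (fhom Γ t') ⊙ ω = idc (fhom Γ t) ->
  exists a : Modif G H, hc (t := Lax B D) (id2 (t := Lax B D) t') a = id2 (t := Lax B D) t /\ ftwo Γ a = ω.
Proof.
move=> e.
have et : fhom Γ t' ∘ top ω = fhom Γ t by have := f_equal top e; rewrite !tbE.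
have eb : fhom Γ t' ∘ bot ω = fhom Γ t by have := f_equal bot e; rewrite !tbE.
have [s [hs es]] := colim_full et; have [s' [hs' es']] := colim_full eb.
have [a ha] : exists a : forall c, Cell (vid (G c)) (vid (H c)), forall c,
    idc (cocone Γ H c) ⊙ a c = ω ⊙ idc (cocone Γ G c) /\ idc (t' c) ⊙ a c = idc (t c).
  apply: (dependent_choice (T := fun c => Cell (vid (G c)) (vid (H c))) (R := fun c a =>
    idc (cocone Γ H c) ⊙ a = ω ⊙ idc (cocone Γ G c) /\ idc (t' c) ⊙ a = idc (t c))) => c.
  have [|w [hw _]] := pb_two (colim_square t' c) (a := ω ⊙ idc (cocone Γ G c)) (b := idc (t c)); last by exists w.
  by rewrite /= ccomp_assoc e -!idc_comp colim_leg.
have MH := good_mono g (@U H).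
have at_ c : top (a c) = s c.
  apply: (MH c); rewrite -colim_leg es; have [h1 _] := ha c.
  by have := f_equal top h1; rewrite !tbE.
have ab c : bot (a c) = s' c.
  apply: (MH c); rewrite -colim_leg es'; have [h1 _] := ha c.
  by have := f_equal bot h1; rewrite !tbE.
have an c c' (β : Hom c c') e1 e2 : under (a c') (tcell s β) e1 = over (tcell s' β) (a c) e2.
  apply: (cart_uq (good_cart g (@U H) β)).
  - by rewrite !tbE top_tcell at_.
  - by rewrite !tbE bot_tcell ab.
  have f1 : bot (ccell (cocone Γ H) β ⊙ tcell s β) = top (idc (bot (ccell (cocone Γ H) β)) ⊙ a c').
    by rewrite !tbE bot_ccell bot_tcell at_.
  have f2 : bot (idc (top (ccell (cocone Γ H) β)) ⊙ a c) = top (ccell (cocone Γ H) β ⊙ tcell s' β).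
    by rewrite !tbE top_ccell top_tcell ab.
  rewrite (comp_under _ f1) (comp_over _ f2).
  have g1 : bot (idc (top ω) ⊙ ccell (cocone Γ G) β) = top (ω ⊙ idc (bot (ccell (cocone Γ G) β))) by rewrite !tbE.
  have g2 : bot (ω ⊙ idc (top (ccell (cocone Γ G) β))) = top (idc (bot ω) ⊙ ccell (cocone Γ G) β) by rewrite !tbE.
  transitivity (ω ⊙ ccell (cocone Γ G) β).
    rewrite -(two_under g1); apply: under_eq; first by rewrite !bot_ccell; case: (ha c').
    by rewrite -colim_cell es.
  rewrite -(two_over g2); apply: over_eq; first by rewrite -colim_cell es'.
  by rewrite !top_ccell; case: (ha c).
pose M := @MkModif B D G H s s' a at_ ab an.
exists M; split.
  by apply: Modif_eq => //= c; case: (ha c).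
apply: colim2_uq.
- by rewrite -es; exact: (dom2_ftwo Γ M).
- by rewrite -es'; exact: (cod2_ftwo Γ M).
move=> c; have := f_equal (fun x : Modif G (constL B (Γ H)) => x c) (nat_two (unit Γ) M).
by rewrite /= => <-; case: (ha c).
Qed.

Variable Γ2 : LaxColimits cat2 D.

Lemma descE (A A' Z : D) (m : Ver A A') (φ : Cell m (vid Z)) : idc (desc φ Γ2) ⊙ gl Γ2 m = φ.
Proof.
exact: (f_equal (fun x : Transf (arrow m) (constL cat2 Z) => tcell x arr2)
  (adj_transpose Γ2 (arrow_cocone φ))).
Qed.

(** [X_β] is taken to be the collage of [lver G β], with its legs as [s] and [s']. The collage cell
    is cartesian, hence isomorphic to [frame_cell s s'], and the equations for the cells hold by
    construction. What needs proof is that this collage is the pullback. *)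
Lemma restricts_to_pullbacks (X : D) (p : Hom X (Γ F)) (G : NLax B D) (t : Transf G F)
    (j : Transf G (constL B X)) :
  compT (constT B p) j = compT (cocone Γ F) t -> cells_cart j ->
  (forall c, is_pullback (K := HD D) p (cocone Γ F c) (j c) (t c)) -> restricts_to Γ2 p t j.
Proof.
move=> e Cj pbs; split=> // b b' β c; set i := cocone Γ F in e pbs *.
pose n := lver F β; pose m := lver G β; pose un := gl Γ2 n; pose um := gl Γ2 m.
pose γ : Cell m (vid X) := ccell j β; pose τ : Cell m n := tcell t β.
have Un : glue un by exact: gl_glue.
have Um : glue um by exact: gl_glue.
have [d [ed hd]] : exists d, d = desc (tcell i β) Γ2 /\ idc d ⊙ un = ccell i β.
  by exists (desc (tcell i β) Γ2); split=> //; exact: descE.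
have ec : idc p ⊙ γ = ccell i β ⊙ τ.
  exact: (f_equal (fun s : Transf G (constL B (Γ F)) => @ccell D B G _ s _ _ β) e).
have Cγ : cart γ by exact: Cj.
have Ci : cart (ccell i β) by exact: (good_cart g (@U F)).
have [u hu] := glue_ex γ Um; have [v hv] := glue_ex (un ⊙ τ) Um.
have γt : top γ = j b by exact: top_ccell.
have γb : bot γ = j b' by exact: bot_ccell.
have τt : top τ = t b by exact: top_tcell.
have τb : bot τ = t b' by exact: bot_tcell.
have dt : d ∘ top un = i b by rewrite (idc_top hd) top_ccell.
have db : d ∘ bot un = i b' by rewrite (idc_bot hd) bot_ccell.
have ut : u ∘ top um = j b by rewrite (idc_top hu).
have ub : u ∘ bot um = j b' by rewrite (idc_bot hu).
have [σ hσ] : exists σ : SpecialIso m (conjoint (bot um) • companion (top um)),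
    frame_cell (top um) (bot um) ⊙ σ = um.
  apply: cart_unique; [exact: (gt_cart GT Um) | exact: cart_frame | by rewrite /frame_cell !tbE | by rewrite /frame_cell !tbE].
exists (Γ2 (arrow m)), u, v, (top um), (bot um), σ; split; last first.
  split; last split; last split.
  - by rewrite ut (idc_top hv) !tbE τt gl_top.
  - by rewrite ub (idc_bot hv) !tbE τb gl_bot.
  - by rewrite hσ.
  - by rewrite hσ.
rewrite -ed; apply: (pb_of_hom GT).
- apply: (glue_uq Um); rewrite !idc_comp -!ccomp_assoc hu hv (ccomp_assoc (idc d)) hd.
  exact: ec.
(* [f] decomposes [Z] over the collage of [lver F β]. On the two parts the lift comes from the
   pullbacks at [b] and [b'], and on the cell between them from cartesianness of [γ]. *)
- move=> Z a f eaf.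
  have [A [A' [nz [uz [k [Uz ek P1 P2]]]]]] := split GT f Un.
  have k1 := idc_top ek; have k2 := idc_bot ek; rewrite !tbE in k1 k2.
  have [|x [x1 x2]] := pb_lift (pbs b) (a := a ∘ top uz) (b := top k).
    by rewrite comp_assoc eaf -comp_assoc k1 comp_assoc dt.
  have [|y [y1 y2]] := pb_lift (pbs b') (a := a ∘ bot uz) (b := bot k).
    by rewrite comp_assoc eaf -comp_assoc k2 comp_assoc db.
  have [χ [χt χb χe]] : exists χ, [/\ top χ = x, bot χ = y & γ ⊙ χ = idc a ⊙ uz].
    by apply: (cart_ex Cγ); rewrite !tbE ?γt ?γb.
  have [w hw] := glue_ex (um ⊙ χ) Uz; exists w; split.
    by apply: (glue_uq Uz); rewrite idc_comp -ccomp_assoc hw ccomp_assoc hu.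
  apply: (glue_uq Uz); rewrite idc_comp -ccomp_assoc hw ccomp_assoc hv ek -ccomp_assoc; congr (_ ⊙ _).
  apply: (cart_uq Ci).
  - by rewrite tbE τt χt.
  - by rewrite tbE τb χb.
  by rewrite ccomp_assoc -ec -ccomp_assoc χe -hd -ccomp_assoc -ek !ccomp_assoc -!idc_comp eaf.
move=> Z w w' h1 h2.
have [A [A' [nz [uz [k [Uz ek _ _]]]]]] := split GT (v ∘ w) Un.
have Pt := gt_pbt GT Un Um hv; have Pb := gt_pbb GT Un Um hv.
have k1 := idc_top ek; have k2 := idc_bot ek; rewrite !tbE in k1 k2.
have lift (q : Hom Z (Γ2 (arrow m))) : u ∘ w = u ∘ q -> v ∘ w = v ∘ q ->
  exists χ : Cell nz m, [/\ t b ∘ top χ = top k, t b' ∘ bot χ = bot k & um ⊙ χ = idc q ⊙ uz].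
  move=> q1 q2.
  have [|x [x1 x2]] := pb_lift Pt (a := q ∘ top uz) (b := top k); first by rewrite comp_assoc -q2.
  have [|y [y1 y2]] := pb_lift Pb (a := q ∘ bot uz) (b := bot k); first by rewrite comp_assoc -q2.
  have [χ [χt χb χe]] : exists χ, [/\ top χ = x, bot χ = y & um ⊙ χ = idc q ⊙ uz].
    by apply: (cart_ex (gt_cart GT Um)); rewrite !tbE.
  by exists χ; rewrite χt χb -τt -τb.
have [χ [c1 c2 c3]] := lift w erefl erefl; have [χ' [c1' c2' c3']] := lift w' h1 h2.
have ee : γ ⊙ χ = γ ⊙ χ'.
  by rewrite -hu -!ccomp_assoc c3 c3' !ccomp_assoc -!idc_comp h1.
apply: (glue_uq Uz); rewrite -c3 -c3'; congr (_ ⊙ _); apply: (cart_uq Cγ) => //.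
- apply: (pb_uniq (pbs b)); last by rewrite c1 c1'.
  by have := f_equal top ee; rewrite !tbE γt.
- apply: (pb_uniq (pbs b')); last by rewrite c2 c2'.
  by have := f_equal bot ee; rewrite !tbE γb.
Qed.

Lemma glueing_over : has_glueing_over Γ Γ2 F.
Proof.
have [|||||Ψ HΨ] := @pseudo_inverse_exists (slice (C := Lax B D) F) (slice (C := HD D) (Γ F)) (slice_functor Γ F)
  (fun y x e => restricts_to Γ2 (projT2 y) (projT2 x) (compT (constT B (proj1_sig e)) (cocone Γ (projT1 x)))).
- case=> X p; have [G [t [j [Uj ej Cj pbs]]]] := restriction_lax p (@U F).
  have [k [[k' [k1 k2]] ek]] := universal_iso (@U G) Uj.
  have kt : p ∘ k = fhom Γ t.
    apply: (universal_uq (@U G)); rewrite colim_nat -ej -ek.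
    by apply: Transf_eq => *; rewrite /= ?comp_assoc ?idc_comp ?ccomp_assoc.
  have kt' : fhom Γ t ∘ k' = p by rewrite -kt -comp_assoc k2 comp_idr.
  exists (existT _ G t), (exist _ k kt); split; last by rewrite /= ek; exact: restricts_to_pullbacks.
  by exists (exist _ k' kt'); split; apply: sig_eq.
- move=> [G t] [H t'] [h hh]; have [s [s1 s2]] := colim_full hh.
  by exists (exist _ s s1); apply: sig_eq.
- move=> [G t] [H t'] [s hs] [s' hs'] /(f_equal (@proj1_sig _ _)) /= e.
  by apply: sig_eq => /=; exact: colim_faithful.
- move=> [G t] [H t'] [ω hω]; have [a [a1 a2]] := modif_full hω.
  by exists (exist _ a a1); apply: sig_eq.
- move=> [G t] [H t'] [a ha] [a' ha'] /(f_equal (@proj1_sig _ _)) /= e.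
  by apply: sig_eq => /=; exact: modif_faithful.
exists Ψ => X p; exact: (HΨ (existT _ X p)).
Qed.

End PosetGlueing.

Theorem theorem7p2 (D : FramedBicategory)
  (Γ : forall (d : Order.disp_t) (P : finPOrderType d),
    LaxColimits (poset_cat P) D)
  (glue2 : has_glueing (Γ _ bool) (Γ _ bool))
  (d : Order.disp_t) (B : finPOrderType d) :
  has_glueing (Γ d B) (Γ _ bool).
Proof.
(* The ordinal ['I_0] is the empty poset, whose colimit supplies the initial object. *)
have Z : exists Z : D, zero Z by apply: (empty_colim_zero (Γ _ 'I_0)); case.
have GT : glue_theory D by exact: (glue_theory_of_glueing glue2 Z).
have anti : antisym (poset_cat B).
  by move=> x y xy yx; apply: Order.POrderTheory.le_anti; apply/andP.
have full (x : poset_cat B) : List.In x (enum B).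
  have : x \in enum B by rewrite mem_enum.
  by elim: (enum B) => [//|a l IH]; rewrite inE => /orP [/eqP ->|/IH ?]; [left | right].
have g := good_finite GT (thin_poset (P := B)) anti full (leqnn _).
by move=> F; exact: (glueing_over GT g).
Qed.
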